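(* Let $x\in\mathbb{C}\setminus\{0\}$. Then $$\lim_{K\to\infty}\frac{\prod_{-K\le k\le K}W_k(x)}{\pi^{2K}(2K)!}=\sqrt{x/2}\;,$$ and more generally, for every $t\in\mathbb{C}$, $$\lim_{K\to\infty}\frac{\prod_{-K\le k\le K}(W_k(x)-t)}{\pi^{2K}(2K)!}=\sqrt{x/2}\,\left(e^{-t/2}-\frac{t}{x}e^{t/2}\right)\;,$$ where $K$ runs through positive integers.
   Context: Lambert branches: $\log$ is the principal determination of the logarithm (imaginary part in $]-\pi,\pi]$), and $\sqrt{x/2}=\exp(\log(x/2)/2)$ is the principal square root. For $z\in\mathbb{C}\setminus\{0\}$ and $k\in\mathbb{Z}$, if $z\notin[-1/e,0[$ or $k\notin\{0,-1\}$, then $W_k(z)$ is the unique complex solution $w$ of $w+\log(w)=\log(z)+2k\pi i$; if $z\in[-1/e,0[$, then $W_{-1}(z)$ and $W_0(z)$ are the real solutions of $we^w=z$ characterized by $W_{-1}(z)\le -1\le W_0(z)$ (equal when $z=-1/e$). *)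

(* Defs.v *)
From Stdlib Require Import Reals ZArith ClassicalEpsilon.
From Coquelicot Require Import Coquelicot.
Open Scope R_scope.

Definition Cexp (z : C) : C := (exp (Re z) * cos (Im z), exp (Re z) * sin (Im z)).

(* Principal argument, with values in ]-PI, PI] for z <> 0; it is PI on the
   negative real axis. *)
Definition Carg (z : C) : R :=
  if Rle_dec 0 (Im z) then acos (Re z / Cmod z) else - acos (Re z / Cmod z).

(* The value at 0 is meaningless (Stdlib's ln is total). *)
Definition Clog (z : C) : C := (ln (Cmod z), Carg z).

Definition Csqrt (z : C) : C := Cexp (Clog z / 2)%C.

(* z belongs to the real interval [-1/e, 0[ *)
Definition on_cut (z : C) : Prop := Im z = 0 /\ - / exp 1 <= Re z < 0.

(* w is the value at z of the k-th branch, for z <> 0.  The condition w <> 0 is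
   implicit in writing log(w); it has to be explicit here as Clog is total. *)
Definition is_LambertW (k : Z) (z w : C) : Prop :=
  (on_cut z /\ k = 0%Z /\ Im w = 0 /\ -1 <= Re w /\ (w * Cexp w)%C = z) \/
  (on_cut z /\ k = (-1)%Z /\ Im w = 0 /\ Re w <= -1 /\ (w * Cexp w)%C = z) \/
  ((~ on_cut z \/ (k <> 0%Z /\ k <> (-1)%Z)) /\
   w <> 0 /\ (w + Clog w)%C = (Clog z + 2 * IZR k * PI * Ci)%C).

(* For z <> 0 there is exactly one w such that is_LambertW k z w, and epsilon
   selects it. *)
Definition LambertW (k : Z) (z : C) : C :=
  epsilon (inhabits (RtoC 0)) (is_LambertW k z).

(* Product of the f k over the integers k with -K <= k <= K; the bounds of
   Iter.iter_nat are both inclusive. *)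
Definition prod_sym (K : nat) (f : Z -> C) : C :=
  Iter.iter_nat Cmult (RtoC 1) (fun i => f (Z.of_nat i - Z.of_nat K)%Z) 0 (2 * K).

(* Main.v *)
Require Import Defs.
From Stdlib Require Import Reals ZArith Lra Lia List ClassicalEpsilon Ranalysis5.
From Coquelicot Require Import Coquelicot.
Open Scope R_scope.

(** The values W_k(x) are exactly the zeros of the entire function
    g(t) = e^(-t/2) - (t/x) e^(t/2), and g(0) = 1.  On suitable circles |s| = r_m the
    logarithmic derivative g'/g is bounded and, off small arcs, is close to 1/2 on the right
    and to -1/2 on the left; being nearly odd, it has a small mean.  Cauchy's formula for the
    logarithmic derivative of the quotient of g by the product of 1 - t/W over the zeros W inside
    the circle shows that this quotient tends to 1, without any exponential factor.  The same
    argument applied to sinh(t)/t gives its product expansion.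

    It remains to find the limit L(x) of the product P_K(x) of the W_k(x), |k| <= K, divided by
    pi^(2K) (2K)!.  For a second point y and large real t, the product of the
    (W_k(x) - t) (W_(-k)(y) + t) is compared, by the asymptotic expansion of W_k, with that of the
    ((pi j)^2 + t^2); the former is known in terms of P_K(x) P_K(y), g_x(t) and g_y(-t), and the
    latter in terms of sinh t.  Letting K and then t tend to infinity yields L(x) L(y).  For
    x = y = 2 the products are positive, which gives L(2) = 1 with its sign, and then y = 2 gives
    L(x). *)

(** * Complex exponential and logarithm *)

(** The normalization [pi^(2K) (2K)!] is the product of the [pi j] for [1 <= j <= 2K], which
    suggests comparing with [sinh]. The obstacle is that [W_n] differs from its linear part by
    [ln (2 pi n)], whose first-order contribution would not stay bounded for large [t]. This
    dictates the pairing of [W_n(x) - t] with [W_(-n)(y) + t]: they have the form [z + a] and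
    [- z + b], with product [- z^2 (1 + (a - b) / z - a b / z^2)]. The logarithms cancel in [a - b],
    which tends to [mu = log x - log y], and the terms [a b / z^2] are summable. Together with the
    pair of conjugate leading part, what remains to first order is [- 2 t mu / |z|^2]; its sum over
    [n] is close to [- mu / 2] for large [t], and this produces the square root. The factor [x / 2]
    is the quotient of the growth of [t sinh t] by that of [g_x(t) g_y(-t)], up to sign. A fixed [t]
    would not do: the accumulated error is then only bounded, and it becomes small, uniformly in
    [K], only as [t] grows. *)

Lemma C_ext (z w : C) : Re z = Re w -> Im z = Im w -> z = w.
Proof. intros; apply injective_projections; assumption. Qed.

Lemma re_minus (z w : C) : Re (z - w) = Re z - Re w.
Proof. reflexivity. Qed.

Lemma im_minus (z w : C) : Im (z - w) = Im z - Im w.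
Proof. reflexivity. Qed.

Lemma re_pair (a b : R) : Re (a, b) = a.
Proof. reflexivity. Qed.

Lemma im_pair (a b : R) : Im (a, b) = b.
Proof. reflexivity. Qed.

Lemma re_Ci : Re Ci = 0.
Proof. reflexivity. Qed.

Lemma im_Ci : Im Ci = 1.
Proof. reflexivity. Qed.

Lemma re_Cexp (z : C) : Re (Cexp z) = exp (Re z) * cos (Im z).
Proof. reflexivity. Qed.

Lemma im_Cexp (z : C) : Im (Cexp z) = exp (Re z) * sin (Im z).
Proof. reflexivity. Qed.

Lemma re_Clog (z : C) : Re (Clog z) = ln (Cmod z).
Proof. reflexivity. Qed.

Lemma im_Clog (z : C) : Im (Clog z) = Carg z.
Proof. reflexivity. Qed.

Create HintDb reim.
#[export] Hint Rewrite re_plus im_plus re_opp im_opp re_minus im_minus re_mult im_mult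
  re_RtoC im_RtoC re_conj im_conj re_pair im_pair re_Ci im_Ci re_Cexp im_Cexp
  re_Clog im_Clog : reim.

Ltac reim := autorewrite with reim.

Lemma Cmod_sqr (z : C) : Cmod z * Cmod z = Re z * Re z + Im z * Im z.
Proof. generalize (Cmod2_alt z); simpl; lra. Qed.

Lemma Cmod_pos (z : C) : z <> 0 -> 0 < Cmod z.
Proof. apply Cmod_gt_0. Qed.

Lemma Cmod_neq (z : C) : 0 < Cmod z -> z <> 0.
Proof. intros H ->. rewrite Cmod_0 in H; lra. Qed.

Lemma Im_le_Cmod (z : C) : Rabs (Im z) <= Cmod z.
Proof.
  apply Rsqr_incr_0_var; [|apply Cmod_ge_0].
  rewrite <- Rsqr_abs. unfold Rsqr. rewrite Cmod_sqr. nra.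
Qed.

Lemma Cmod_le_sum (z : C) : Cmod z <= Rabs (Re z) + Rabs (Im z).
Proof.
  pose proof (Rabs_pos (Re z)); pose proof (Rabs_pos (Im z)).
  pose proof (Cmod_ge_0 z); pose proof (Cmod_sqr z).
  assert (Rabs (Re z) * Rabs (Re z) = Re z * Re z)
    by (rewrite <- Rabs_mult; apply Rabs_pos_eq; nra).
  assert (Rabs (Im z) * Rabs (Im z) = Im z * Im z)
    by (rewrite <- Rabs_mult; apply Rabs_pos_eq; nra).
  nra.
Qed.

Lemma Cmod_triangle_sub (z w : C) : Cmod z - Cmod w <= Cmod (z - w).
Proof.
  pose proof (Cmod_triangle (z - w) w) as H.
  replace (z - w + w)%C with z in H by ring. lra.
Qed.

Lemma Cmod_triangle_minus (z w : C) : Cmod (z - w) <= Cmod z + Cmod w.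
Proof.
  replace (z - w)%C with (z + - w)%C by ring.
  rewrite <- (Cmod_opp w). apply Cmod_triangle.
Qed.

Lemma Cmod_minus_sym (z w : C) : Cmod (z - w) = Cmod (w - z).
Proof. rewrite <- Cmod_opp. f_equal; ring. Qed.

Lemma Cexp_plus (z w : C) : Cexp (z + w) = (Cexp z * Cexp w)%C.
Proof.
  apply C_ext; reim; rewrite exp_plus.
  - rewrite cos_plus; ring.
  - rewrite sin_plus; ring.
Qed.

Lemma Cexp_0 : Cexp 0 = 1.
Proof. apply C_ext; reim; rewrite exp_0, ?cos_0, ?sin_0; ring. Qed.

Lemma Cmod_Cexp (z : C) : Cmod (Cexp z) = exp (Re z).
Proof.
  unfold Cmod; fold (Re (Cexp z)) (Im (Cexp z)); reim.
  replace (_ + _) with (Rsqr (exp (Re z)) * (Rsqr (sin (Im z)) + Rsqr (cos (Im z))))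
    by (unfold Rsqr; ring).
  rewrite sin2_cos2, Rmult_1_r. apply sqrt_Rsqr. left; apply exp_pos.
Qed.

Lemma Cexp_neq_0 (z : C) : Cexp z <> 0.
Proof. apply Cmod_neq. rewrite Cmod_Cexp. apply exp_pos. Qed.

Lemma Cexp_opp (z : C) : Cexp (- z) = (/ Cexp z)%C.
Proof.
  assert (H : (Cexp (- z) * Cexp z)%C = 1).
  { rewrite <- Cexp_plus. rewrite <- Cexp_0. f_equal; ring. }
  pose proof (Cexp_neq_0 z).
  replace (Cexp (- z)) with (Cexp (- z) * Cexp z / Cexp z)%C by (field; assumption).
  rewrite H; field; assumption.
Qed.

Lemma Cexp_RtoC (x : R) : Cexp x = exp x.
Proof. apply C_ext; reim; rewrite ?cos_0, ?sin_0; ring. Qed.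

Lemma cos_Zperiod (x : R) (k : Z) : cos (x + 2 * IZR k * PI) = cos x.
Proof.
  destruct k as [|p|p].
  - f_equal; simpl; ring.
  - replace (IZR (Zpos p)) with (INR (Pos.to_nat p)) by (rewrite INR_IZR_INZ; f_equal; lia).
    apply cos_period.
  - rewrite <- (cos_period _ (Pos.to_nat p)). f_equal.
    rewrite INR_IZR_INZ, positive_nat_Z.
    change (Zneg p) with (- Zpos p)%Z; rewrite opp_IZR; ring.
Qed.

Lemma sin_Zperiod (x : R) (k : Z) : sin (x + 2 * IZR k * PI) = sin x.
Proof.
  rewrite <- !cos_shift.
  replace (PI / 2 - (x + 2 * IZR k * PI)) with (PI / 2 - x + 2 * IZR (- k) * PI)
    by (rewrite opp_IZR; ring).
  apply cos_Zperiod.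
Qed.

Lemma Cexp_Zperiod (z : C) (k : Z) : Cexp (z + 2 * IZR k * PI * Ci) = Cexp z.
Proof.
  unfold Cexp.
  replace (Re (z + 2 * IZR k * PI * Ci)) with (Re z) by (reim; ring).
  replace (Im (z + 2 * IZR k * PI * Ci)) with (Im z + 2 * IZR k * PI) by (reim; ring).
  rewrite cos_Zperiod, sin_Zperiod; reflexivity.
Qed.

Lemma Cexp_eq_1 (z : C) : Cexp z = 1 -> exists k : Z, z = (2 * IZR k * PI * Ci)%C.
Proof.
  intros H.
  assert (Hr : Re z = 0).
  { apply exp_inv. rewrite exp_0, <- Cmod_Cexp, H. apply Cmod_1. }
  assert (Hc : cos (Im z) = 1).
  { apply (f_equal Re) in H. autorewrite with reim in H. rewrite Hr, exp_0 in H. lra. }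
  replace (Im z) with (2 * (Im z / 2)) in Hc by field.
  rewrite cos_2a_sin in Hc.
  destruct (sin_eq_0_0 (Im z / 2)) as [k Hk]; [nra|].
  exists k. apply C_ext; reim; lra.
Qed.

Lemma Cexp_inj_mod (z w : C) :
  Cexp z = Cexp w -> exists k : Z, z = (w + 2 * IZR k * PI * Ci)%C.
Proof.
  intros H. destruct (Cexp_eq_1 (z - w)) as [k Hk].
  - replace (z - w)%C with (z + - w)%C by ring.
    rewrite Cexp_plus, Cexp_opp, H. field. apply Cexp_neq_0.
  - exists k. rewrite <- Hk; ring.
Qed.

Lemma Re_div_Cmod_bound (z : C) : z <> 0 -> -1 <= Re z / Cmod z <= 1.
Proof.
  intros Hz. pose proof (Cmod_pos z Hz).
  pose proof (re_le_Cmod z) as H1. apply Rabs_le_between in H1.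
  split.
  - apply Rmult_le_reg_r with (Cmod z); [lra|].
    replace (Re z / Cmod z * Cmod z) with (Re z) by (field; lra). lra.
  - apply Rmult_le_reg_r with (Cmod z); [lra|].
    replace (Re z / Cmod z * Cmod z) with (Re z) by (field; lra). lra.
Qed.

Lemma Carg_bound (z : C) : z <> 0 -> - PI < Carg z <= PI.
Proof.
  intros Hz. pose proof (Re_div_Cmod_bound z Hz) as Hb.
  pose proof (acos_bound (Re z / Cmod z)) as Ha. pose proof PI_RGT_0.
  unfold Carg. destruct (Rle_dec 0 (Im z)) as [Hi|Hi]; [lra|].
  split; [|lra].
  destruct (Req_dec (acos (Re z / Cmod z)) PI) as [E|E]; [|lra].
  exfalso. apply (f_equal cos) in E.
  rewrite cos_acos, cos_PI in E by assumption.
  pose proof (Cmod_pos z Hz). pose proof (Cmod_sqr z).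
  assert (Re z = - Cmod z).
  { replace (Re z) with (Re z / Cmod z * Cmod z) by (field; lra). rewrite E; ring. }
  assert (Im z * Im z = 0) by nra. nra.
Qed.

Lemma cos_Carg (z : C) : z <> 0 -> Cmod z * cos (Carg z) = Re z.
Proof.
  intros Hz. pose proof (Cmod_pos z Hz). pose proof (Re_div_Cmod_bound z Hz).
  unfold Carg. destruct (Rle_dec 0 (Im z)) as [Hi|Hi]; rewrite ?cos_neg, cos_acos by assumption;
    field; lra.
Qed.

Lemma sin_Carg (z : C) : z <> 0 -> Cmod z * sin (Carg z) = Im z.
Proof.
  intros Hz. pose proof (Cmod_pos z Hz). pose proof (Re_div_Cmod_bound z Hz).
  pose proof (Cmod_sqr z).
  assert (E : Cmod z * sqrt (1 - Rsqr (Re z / Cmod z)) = Rabs (Im z)).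
  { rewrite <- (sqrt_Rsqr (Cmod z)) at 1 by lra.
    rewrite <- sqrt_mult, <- sqrt_Rsqr_abs.
    - f_equal. unfold Rsqr. field_simplify; nra.
    - unfold Rsqr; nra.
    - unfold Rsqr; nra. }
  unfold Carg. destruct (Rle_dec 0 (Im z)) as [Hi|Hi];
    rewrite ?sin_neg, sin_acos by assumption.
  - rewrite E. apply Rabs_pos_eq; assumption.
  - rewrite Rabs_left in E by lra. lra.
Qed.

Lemma Carg_polar (r phi : R) :
  0 < r -> - PI < phi <= PI -> Carg (r * cos phi, r * sin phi) = phi.
Proof.
  intros Hr Hp.
  assert (Hm : Cmod (r * cos phi, r * sin phi) = r).
  { unfold Cmod; simpl.
    replace (_ + _) with (Rsqr r * (Rsqr (sin phi) + Rsqr (cos phi))) by (unfold Rsqr; ring).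
    rewrite sin2_cos2, Rmult_1_r. apply sqrt_Rsqr. lra. }
  unfold Carg. rewrite Hm. simpl.
  replace (r * cos phi / r) with (cos phi) by (field; lra).
  destruct (Rle_dec 0 (r * sin phi)) as [Hi|Hi].
  - apply acos_cos. split; [|lra].
    destruct (Rle_lt_dec 0 phi) as [|Hn]; [assumption|].
    assert (0 < sin (- phi)) by (apply sin_gt_0; lra).
    rewrite sin_neg in *. nra.
  - assert (phi < 0).
    { apply Rnot_le_lt; intros Hn. apply Hi. pose proof (sin_ge_0 phi Hn); nra. }
    rewrite <- (cos_neg phi), acos_cos by lra. ring.
Qed.

Lemma Cexp_Clog (z : C) : z <> 0 -> Cexp (Clog z) = z.
Proof.
  intros Hz. apply C_ext; reim;
    rewrite exp_ln by (apply Cmod_pos; assumption);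
    [apply cos_Carg|apply sin_Carg]; assumption.
Qed.

Lemma Clog_Cexp (u : C) : - PI < Im u <= PI -> Clog (Cexp u) = u.
Proof.
  intros Hu. unfold Clog. rewrite Cmod_Cexp, ln_exp.
  unfold Cexp. rewrite Carg_polar by (try apply exp_pos; assumption).
  symmetry; apply surjective_pairing.
Qed.

Lemma Carg_conj (z : C) : z <> 0 -> Carg z < PI -> Carg (Cconj z) = - Carg z.
Proof.
  intros Hz Ha. pose proof (Carg_bound z Hz).
  rewrite <- (Carg_polar (Cmod z) (- Carg z)) by (try apply Cmod_pos; auto; lra).
  f_equal. rewrite cos_neg, sin_neg.
  apply C_ext; reim.
  - rewrite cos_Carg; auto.
  - rewrite Ropp_mult_distr_r_reverse, sin_Carg; auto.
Qed.

Lemma Clog_conj (z : C) : z <> 0 -> Carg z < PI -> Clog (Cconj z) = Cconj (Clog z).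
Proof.
  intros Hz Ha. unfold Clog. rewrite Carg_conj, Cmod_conj by assumption. reflexivity.
Qed.

Lemma Clog_RtoC (r : R) : 0 < r -> Clog r = ln r.
Proof.
  intros Hr. rewrite <- (exp_ln r) at 1 by assumption. rewrite <- Cexp_RtoC.
  apply Clog_Cexp. pose proof PI_RGT_0; reim; lra.
Qed.

(** * The branches of the Lambert function *)

(** For [w = r e^(i phi)], the equation [w + log w = L + i s] gives [r = (s - phi) / sin phi];
    eliminating [r] leaves [polarF s phi = L], for [phi] between 0 and the smaller of [s] and
    [PI]. *)
Definition polarF (s phi : R) : R :=
  (s - phi) * cos phi / sin phi + ln ((s - phi) / sin phi).

Lemma polarF_derive (s phi : R) :
  0 < phi < PI -> phi < s ->
  is_derive (polarF s) phi
    (- ((s - phi + cos phi * sin phi) ^ 2 + sin phi ^ 4) / (sin phi ^ 2 * (s - phi))).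
Proof.
  intros Hp Hs. assert (Hsin : 0 < sin phi) by (apply sin_gt_0; lra).
  unfold polarF. auto_derive.
  - repeat split; try lra. apply Rmult_lt_0_compat; [lra|apply Rinv_0_lt_compat; lra].
  - pose proof (sin2_cos2 phi) as H; unfold Rsqr in H.
    assert (Hc : cos phi * cos phi = 1 - sin phi * sin phi) by lra.
    field_simplify_eq; [|repeat split; lra].
    simpl. ring_simplify.
    replace (cos phi ^ 2) with (1 - sin phi * sin phi) by (rewrite <- Hc; ring).
    ring.
Qed.

Lemma polarF_decr (s a b : R) :
  0 < a -> a < b -> b < PI -> b < s -> polarF s b < polarF s a.
Proof.
  intros Ha Hab Hb Hs.
  destruct (MVT_gen (polarF s) a b
    (fun phi => - ((s - phi + cos phi * sin phi) ^ 2 + sin phi ^ 4) / (sin phi ^ 2 * (s - phi))))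
    as (c & Hc & E).
  - intros x Hx. rewrite Rmin_left, Rmax_right in Hx by lra.
    apply polarF_derive; lra.
  - intros x Hx. rewrite Rmin_left, Rmax_right in Hx by lra.
    apply continuity_pt_filterlim, (ex_derive_continuous (polarF s) x).
    eexists; apply polarF_derive; lra.
  - rewrite Rmin_left, Rmax_right in Hc by lra.
    assert (Hsin : 0 < sin c) by (apply sin_gt_0; lra).
    assert (0 < (s - c + cos c * sin c) ^ 2 + sin c ^ 4).
    { pose proof (pow_lt (sin c) 4 Hsin). pose proof (pow2_ge_0 (s - c + cos c * sin c)). lra. }
    assert (0 < sin c ^ 2 * (s - c)) by (apply Rmult_lt_0_compat; [apply pow_lt|]; lra).
    assert (0 < ((s - c + cos c * sin c) ^ 2 + sin c ^ 4) / (sin c ^ 2 * (s - c)) * (b - a)).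
    { apply Rmult_lt_0_compat; [apply Rdiv_lt_0_compat|]; lra. }
    unfold Rdiv in *. rewrite Ropp_mult_distr_l_reverse in E. lra.
Qed.

(** As [phi] tends to 0, the modulus [(s - phi) / sin phi] tends to infinity while [cos phi] stays
    positive. *)
Lemma polarF_large (s L b : R) :
  0 < s -> 0 < b -> exists phi, 0 < phi < b /\ L < polarF s phi.
Proof.
  intros Hs Hb. pose proof (exp_pos L) as HL. pose proof (exp_pos (- L)) as HL'.
  assert (HLL : exp (- L) * exp L = 1) by (rewrite <- exp_plus, <- exp_0; f_equal; ring).
  set (phi := Rmin (Rmin (b / 2) (s / 2)) (Rmin 1 (s / 4 * exp (- L)))).
  assert (Hphi : 0 < phi).
  { unfold phi. repeat apply Rmin_glb_lt; try lra. apply Rmult_lt_0_compat; lra. }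
  assert (H1 : phi <= b / 2) by (eapply Rle_trans; [apply Rmin_l|apply Rmin_l]).
  assert (H2 : phi <= s / 2) by (eapply Rle_trans; [apply Rmin_l|apply Rmin_r]).
  assert (H3 : phi <= 1) by (eapply Rle_trans; [apply Rmin_r|apply Rmin_l]).
  assert (H4 : phi <= s / 4 * exp (- L)) by (eapply Rle_trans; [apply Rmin_r|apply Rmin_r]).
  exists phi. split; [lra|].
  pose proof PI2_1. 
  assert (Hsin : 0 < sin phi) by (apply sin_gt_0; lra).
  assert (Hsin' : sin phi < phi) by (apply sin_lt_x; lra).
  assert (Hcos : 0 < cos phi) by (apply cos_gt_0; lra).
  unfold polarF.
  assert (0 < (s - phi) * cos phi / sin phi).
  { apply Rdiv_lt_0_compat; [apply Rmult_lt_0_compat|]; lra. }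
  assert (L < ln ((s - phi) / sin phi)); [|lra].
  rewrite <- (ln_exp L) at 1. apply ln_increasing; [exact HL|].
  apply Rmult_lt_reg_r with (sin phi); [assumption|].
  replace ((s - phi) / sin phi * sin phi) with (s - phi) by (field; lra).
  apply Rle_lt_trans with (exp L * phi); [nra|].
  assert (phi * exp L <= s / 4 * exp (- L) * exp L) by (apply Rmult_le_compat_r; lra).
  nra.
Qed.

Lemma ln_le_sub1 (y : R) : 0 < y -> ln y <= y - 1.
Proof. intros Hy. pose proof (exp_ineq1_le (ln y)). rewrite exp_ln in H by assumption. lra. Qed.

(** At the end [phi = s] of the range the modulus tends to 0, and its logarithm to minus
    infinity. *)
Lemma polarF_small_lt (s L : R) :
  0 < s < PI -> exists phi, 0 < phi < s /\ polarF s phi < L.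
Proof.
  intros Hs. pose proof (exp_pos (L - 2)) as HL.
  (* The sine increases up to [PI / 2] and decreases afterwards, so on [[s / 2, s]] it is at least
     its smaller end value [sg]. *)
  set (sg := Rmin (sin s) (sin (s / 2))).
  assert (Hsg : 0 < sg) by (apply Rmin_glb_lt; apply sin_gt_0; lra).
  set (e := Rmin (s / 2) (Rmin sg (sg * exp (L - 2)))).
  assert (He : 0 < e) by (apply Rmin_glb_lt; [lra|apply Rmin_glb_lt; [lra|apply Rmult_lt_0_compat; lra]]).
  assert (H1 : e <= s / 2) by apply Rmin_l.
  assert (H2 : e <= sg) by (eapply Rle_trans; [apply Rmin_r|apply Rmin_l]).
  assert (H3 : e <= sg * exp (L - 2)) by (eapply Rle_trans; [apply Rmin_r|apply Rmin_r]).
  exists (s - e). split; [lra|].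
  assert (Hsin : sg <= sin (s - e)).
  { destruct (Rle_lt_dec (s - e) (PI / 2)) as [Hc|Hc].
    - eapply Rle_trans; [apply Rmin_r|]. apply sin_incr_1; lra.
    - eapply Rle_trans; [apply Rmin_l|]. left; apply sin_decreasing_1; lra. }
  unfold polarF. replace (s - (s - e)) with e by ring.
  pose proof (COS_bound (s - e)).
  assert (Hd : e / sin (s - e) <= 1).
  { apply Rmult_le_reg_r with (sin (s - e)); [lra|].
    unfold Rdiv; rewrite Rmult_assoc, Rinv_l by lra. lra. }
  assert (Hd0 : 0 < e / sin (s - e)) by (apply Rdiv_lt_0_compat; lra).
  assert (e * cos (s - e) / sin (s - e) <= 1).
  { replace (e * cos (s - e) / sin (s - e)) with (e / sin (s - e) * cos (s - e))
      by (field; lra). nra. }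
  assert (ln (e / sin (s - e)) <= L - 2); [|lra].
  rewrite <- (ln_exp (L - 2)) at 1.
  assert (e / sin (s - e) <= exp (L - 2)).
  { apply Rmult_le_reg_r with (sin (s - e)); [lra|].
    unfold Rdiv; rewrite Rmult_assoc, Rinv_l by lra. nra. }
  destruct (Req_dec (e / sin (s - e)) (exp (L - 2))) as [->|]; [lra|].
  left; apply ln_increasing; lra.
Qed.

(** For [s > PI] the range ends at [PI], where the modulus [y] tends to infinity and [- y cos e],
    with [cos e >= 1 / 2], outweighs [ln y <= y / 4 + 1]. *)
Lemma polarF_small_gt (s L : R) :
  PI < s -> exists phi, 0 < phi < PI /\ polarF s phi < L.
Proof.
  intros Hs. pose proof (Rle_abs (- L)) as HL. rewrite Rabs_Ropp in HL.
  pose proof (Rabs_pos L). pose proof PI2_1.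
  set (d := s - PI). assert (Hd : 0 < d) by (unfold d; lra).
  set (e := Rmin 1 (d / (4 * (2 + Rabs L)))).
  assert (Hq : 0 < d / (4 * (2 + Rabs L))) by (apply Rdiv_lt_0_compat; lra).
  assert (He : 0 < e) by (apply Rmin_glb_lt; lra).
  assert (H1 : e <= 1) by apply Rmin_l.
  assert (H2 : e <= d / (4 * (2 + Rabs L))) by apply Rmin_r.
  exists (PI - e). split; [lra|].
  assert (Hsin : 0 < sin e) by (apply sin_gt_0; lra).
  assert (Hsin' : sin e < e) by (apply sin_lt_x; lra).
  assert (Hcos : / 2 <= cos e).
  { pose proof PI2_3_2. pose proof cos_PI3 as Hc. replace (/ 2) with (1 / 2) by lra. rewrite <- Hc.
    apply cos_decr_1; lra. }
  unfold polarF. rewrite sin_PI_x.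
  replace (cos (PI - e)) with (- cos e) by (rewrite cos_minus, cos_PI, sin_PI; ring).
  set (y := (s - (PI - e)) / sin e).
  assert (Hy : 4 * (2 + Rabs L) < y).
  { apply Rmult_lt_reg_r with (sin e); [assumption|].
    replace (y * sin e) with (s - (PI - e)) by (unfold y; field; lra).
    apply Rle_lt_trans with (4 * (2 + Rabs L) * e); [nra|].
    apply Rle_lt_trans with d; [|unfold d; lra].
    replace d with (4 * (2 + Rabs L) * (d / (4 * (2 + Rabs L)))) at 1 by (field; lra).
    nra. }
  replace ((s - (PI - e)) * - cos e / sin e) with (- y * cos e) by (unfold y; field; lra).
  assert (Hln : ln y <= y / 4 + 1).
  { replace y with (4 * (y / 4)) at 1 by field.
    rewrite ln_mult by lra. pose proof (ln_le_sub1 (y / 4) ltac:(lra)).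
    assert (ln 4 <= 2).
    { replace 4 with (2 * 2) by ring. rewrite ln_mult by lra.
      pose proof (ln_le_sub1 2 ltac:(lra)). lra. }
    lra. }
  nra.
Qed.

(** Borderline case: at [phi = PI] the modulus tends to 1 and [polarF PI] to -1, whence the
    restriction on [L]. For [L <= -1] the solutions are negative reals, which is the origin of the
    cut. *)
Lemma polarF_small_PI (L : R) :
  -1 < L -> exists phi, 0 < phi < PI /\ polarF PI phi < L.
Proof.
  intros HL. pose proof PI2_1.
  set (e := Rmin 1 ((L + 1) / 2)).
  assert (He : 0 < e) by (apply Rmin_glb_lt; lra).
  assert (H1 : e <= 1) by apply Rmin_l.
  assert (H2 : e <= (L + 1) / 2) by apply Rmin_r.
  exists (PI - e). split; [lra|].
  assert (Hsin : 0 < sin e) by (apply sin_gt_0; lra).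
  assert (Hsin' : sin e < e) by (apply sin_lt_x; lra).
  destruct (pre_sin_bound e 0 ltac:(lra) ltac:(lra)) as [Hb _].
  unfold sin_approx, sin_term in Hb. simpl in Hb.
  destruct (pre_cos_bound e 0 ltac:(lra) ltac:(lra)) as [Hc _].
  unfold cos_approx, cos_term in Hc. simpl in Hc.
  assert (Hb' : e - e * e * e / 6 <= sin e) by lra.
  assert (Hc' : 1 - e * e / 2 <= cos e) by lra.
  clear Hb Hc.
  unfold polarF. rewrite sin_PI_x.
  replace (cos (PI - e)) with (- cos e) by (rewrite cos_minus, cos_PI, sin_PI; ring).
  replace (PI - (PI - e)) with e by ring.
  assert (Hy1 : 1 <= e / sin e).
  { apply Rmult_le_reg_r with (sin e); [lra|].
    unfold Rdiv; rewrite Rmult_assoc, Rinv_l by lra. lra. }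
  pose proof (ln_le_sub1 (e / sin e) ltac:(lra)) as Hln.
  assert (Hy2 : e / sin e - 1 <= e * e / 3).
  { apply Rmult_le_reg_r with (sin e); [lra|].
    replace ((e / sin e - 1) * sin e) with (e - sin e) by (field; lra).
    assert (e / 2 <= sin e) by nra. nra. }
  replace (e * - cos e / sin e) with (- (e / sin e) * cos e) by (field; lra).
  nra.
Qed.

Lemma polar_exists (L s : R) :
  0 < s -> (s <> PI \/ -1 < L) ->
  exists r phi, 0 < r /\ 0 < phi < PI /\ r * cos phi + ln r = L /\ r * sin phi + phi = s.
Proof.
  intros Hs HsL.
  assert (H : exists b, 0 < b < PI /\ b < s /\ polarF s b < L).
  { destruct (Rtotal_order s PI) as [Hlt|[Heq|Hgt]].
    - destruct (polarF_small_lt s L) as (b & Hb & Hf); [lra|]. exists b; repeat split; lra.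
    - subst s. destruct (polarF_small_PI L) as (b & Hb & Hf); [tauto|].
      exists b; repeat split; lra.
    - destruct (polarF_small_gt s L) as (b & Hb & Hf); [lra|]. exists b; repeat split; lra. }
  destruct H as (b & Hb & Hbs & Hfb).
  destruct (polarF_large s L b) as (a & Ha & Hfa); [lra|lra|].
  destruct (IVT_interv (fun phi => L - polarF s phi) a b) as (phi & Hphi & E).
  - intros c Hc. apply continuity_pt_minus; [apply continuity_pt_const; intros ? ?; reflexivity|].
    apply continuity_pt_filterlim, (ex_derive_continuous (polarF s) c).
    eexists; apply polarF_derive; lra.
  - lra.
  - lra.
  - lra.
  - assert (Hsin : 0 < sin phi) by (apply sin_gt_0; lra).
    exists ((s - phi) / sin phi), phi. repeat split; try lra.
    + apply Rdiv_lt_0_compat; lra.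
    + unfold polarF in E.
      replace ((s - phi) / sin phi * cos phi) with ((s - phi) * cos phi / sin phi)
        by (field; lra). lra.
    + field; lra.
Qed.

Lemma polar_unique (L s r phi r' phi' : R) :
  0 < r -> 0 < phi < PI -> r * cos phi + ln r = L -> r * sin phi + phi = s ->
  0 < r' -> 0 < phi' < PI -> r' * cos phi' + ln r' = L -> r' * sin phi' + phi' = s ->
  r = r' /\ phi = phi'.
Proof.
  assert (K : forall r phi, 0 < r -> 0 < phi < PI ->
    r * cos phi + ln r = L -> r * sin phi + phi = s ->
    r = (s - phi) / sin phi /\ phi < s /\ polarF s phi = L).
  { clear. intros r phi Hr Hp H1 H2.
    assert (Hsin : 0 < sin phi) by (apply sin_gt_0; lra).
    assert (E : r = (s - phi) / sin phi) by (rewrite <- H2; field; lra).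
    split; [assumption|split; [nra|]].
    unfold polarF. replace ((s - phi) * cos phi / sin phi) with ((s - phi) / sin phi * cos phi)
      by (field; lra). rewrite <- E; assumption. }
  intros Hr Hp H1 H2 Hr' Hp' H1' H2'.
  destruct (K _ _ Hr Hp H1 H2) as (E & Hlt & HF).
  destruct (K _ _ Hr' Hp' H1' H2') as (E' & Hlt' & HF').
  assert (phi = phi').
  { destruct (Rtotal_order phi phi') as [Hc|[Hc|Hc]]; [|assumption|].
    - pose proof (polarF_decr s phi phi' ltac:(lra) Hc ltac:(lra) ltac:(lra)). lra.
    - pose proof (polarF_decr s phi' phi ltac:(lra) Hc ltac:(lra) ltac:(lra)). lra. }
  subst phi'. split; congruence.
Qed.

(** [Im w] and [Carg w] never have opposite signs, so the imaginary part of [w + Clog w] tells in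
    which half-plane [w] lies. *)
Lemma Im_plus_Carg (w : C) :
  w <> 0 ->
  (Carg w < 0 -> Im w + Carg w < 0) /\ (0 < Carg w -> 0 < Im w + Carg w).
Proof.
  intros Hw. pose proof (Carg_bound w Hw). pose proof (sin_Carg w Hw).
  pose proof (Cmod_pos w Hw). split; intros Ha.
  - assert (0 < sin (- Carg w)) by (apply sin_gt_0; lra).
    rewrite sin_neg in *. nra.
  - pose proof (sin_ge_0 (Carg w) ltac:(lra) ltac:(lra)). nra.
Qed.

(** The argument [PI] would force [s = PI] and [L = ln r - r <= -1], which the hypothesis on [L]
    excludes. *)
Lemma wright_polar (L s : R) (w : C) :
  0 < s -> (s = PI -> -1 < L) -> w <> 0 -> (w + Clog w)%C = (L, s) ->
  0 < Carg w < PI /\ Cmod w * cos (Carg w) + ln (Cmod w) = L /\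
  Cmod w * sin (Carg w) + Carg w = s.
Proof.
  intros Hs HL Hw E.
  pose proof (f_equal Re E) as E1. pose proof (f_equal Im E) as E2.
  autorewrite with reim in E1, E2.
  pose proof (cos_Carg w Hw) as Hc. pose proof (sin_Carg w Hw) as Hsn.
  pose proof (Cmod_pos w Hw). pose proof (Carg_bound w Hw).
  destruct (Im_plus_Carg w Hw) as [K1 K2].
  split; [|split; lra].
  destruct (Rtotal_order (Carg w) 0) as [Ha|[Ha|Ha]].
  - specialize (K1 Ha); lra.
  - rewrite Ha, sin_0 in Hsn. lra.
  - split; [assumption|].
    destruct (Req_dec (Carg w) PI) as [Hp|Hp]; [|lra].
    exfalso. rewrite Hp, sin_PI in Hsn. rewrite Hp, cos_PI in Hc.
    pose proof (ln_le_sub1 (Cmod w) H). specialize (HL ltac:(lra)). lra.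
Qed.

Lemma wright_Carg_lt_PI (s : R) (w : C) :
  w <> 0 -> Im w + Carg w = s -> s <> PI -> Carg w < PI.
Proof.
  intros Hw E Hs. pose proof (Carg_bound w Hw).
  destruct (Req_dec (Carg w) PI) as [Hp|Hp]; [|lra].
  pose proof (sin_Carg w Hw) as Hsn. rewrite Hp, sin_PI in Hsn. lra.
Qed.

Lemma wright_conj (L s : R) (w : C) :
  w <> 0 -> s <> PI -> (w + Clog w)%C = (L, s) ->
  Cconj w <> 0 /\ (Cconj w + Clog (Cconj w))%C = (L, - s).
Proof.
  intros Hw Hs E. split.
  - apply Cmod_neq. rewrite Cmod_conj. apply Cmod_pos; assumption.
  - rewrite Clog_conj; [| assumption |].
    + rewrite <- Cplus_conj, E. reflexivity.
    + apply (f_equal Im) in E. autorewrite with reim in E.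
      apply (wright_Carg_lt_PI s); assumption.
Qed.

Lemma real_omega_exists (L : R) : exists r, 0 < r /\ r + ln r = L.
Proof.
  pose proof (exp_pos L).
  destruct (IVT_gen (fun u => exp u + u) (L - exp L) L L) as (u & _ & Hu).
  - intros u. apply continuity_pt_filterlim, (ex_derive_continuous (fun u => exp u + u) u).
    auto_derive; trivial.
  - assert (exp (L - exp L) < exp L) by (apply exp_increasing; lra).
    rewrite Rmin_left, Rmax_right by lra. lra.
  - exists (exp u). rewrite ln_exp. split; [apply exp_pos|assumption].
Qed.

Lemma wright_exists (L s : R) :
  (Rabs s = PI -> -1 < L) -> exists w : C, w <> 0 /\ (w + Clog w)%C = (L, s).
Proof.
  intros HL.
  assert (K : forall s, 0 < s -> (s = PI -> -1 < L) ->
    exists w : C, w <> 0 /\ (w + Clog w)%C = (L, s)).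
  { clear s HL. intros s Hs HL.
    destruct (polar_exists L s Hs) as (r & phi & Hr & Hp & E1 & E2).
    { destruct (Req_dec s PI); tauto. }
    exists (r * Cexp (0, phi))%C.
    assert (Hm : Cmod (r * Cexp (0, phi)) = r).
    { rewrite Cmod_mult, Cmod_Cexp, Cmod_R, Rabs_pos_eq by lra. reim.
      rewrite exp_0; ring. }
    split; [apply Cmod_neq; lra|].
    assert (Ha : Carg (r * Cexp (0, phi)) = phi).
    { rewrite <- (Carg_polar r phi) at 2 by lra. f_equal.
      apply C_ext; reim; rewrite exp_0; ring. }
    apply C_ext; reim; rewrite ?Hm, ?Ha, exp_0; lra. }
  destruct (Rtotal_order s 0) as [Hs|[Hs|Hs]].
  - destruct (Req_dec s (- PI)) as [Hp|Hp].
    (* Here the conjugate equation has imaginary part [PI], where [wright_conj] does not apply; the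
       bound on [L] keeps the argument of the solution below [PI], so that the logarithm still
       commutes with conjugation. *)
    + destruct (K (- s)) as (w & Hw & E); [lra| |].
      { intros _. apply HL. rewrite Hp, Rabs_Ropp, Rabs_pos_eq; [reflexivity|].
        pose proof PI_RGT_0; lra. }
      destruct (wright_polar L (- s) w) as (Ha & E1 & E2); try assumption; try lra.
      { intros _. apply HL. rewrite Hp, Rabs_Ropp, Rabs_pos_eq; [reflexivity|].
        pose proof PI_RGT_0; lra. }
      exists (Cconj w). split.
      * apply Cmod_neq. rewrite Cmod_conj. apply Cmod_pos; assumption.
      * rewrite Clog_conj by (assumption || lra).
        rewrite <- Cplus_conj, E. apply C_ext; reim; ring.
    + destruct (K (- s)) as (w & Hw & E); [lra|lra|].
      exists (Cconj w).
      destruct (wright_conj L (- s) w Hw ltac:(lra) E) as [H1 H2].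
      rewrite Ropp_involutive in H2. auto.
  - destruct (real_omega_exists L) as (r & Hr & E).
    exists (RtoC r). split.
    + intros H; apply RtoC_inj in H; lra.
    + rewrite Clog_RtoC by assumption. subst s. apply C_ext; reim; lra.
  - apply K; [assumption|]. intros Hp. apply HL. rewrite Rabs_pos_eq; lra.
Qed.

Lemma wright_unique (L s : R) (w w' : C) :
  (Rabs s = PI -> -1 < L) ->
  w <> 0 -> (w + Clog w)%C = (L, s) -> w' <> 0 -> (w' + Clog w')%C = (L, s) -> w = w'.
Proof.
  intros HL. pose proof PI_RGT_0 as HPI.
  assert (K : forall s (w w' : C), 0 < s -> (s = PI -> -1 < L) ->
    w <> 0 -> (w + Clog w)%C = (L, s) -> w' <> 0 -> (w' + Clog w')%C = (L, s) -> w = w').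
  { clear s w w' HL. intros s w w' Hs HL Hw E Hw' E'.
    destruct (wright_polar L s w) as (Ha & E1 & E2); try assumption.
    destruct (wright_polar L s w') as (Ha' & E1' & E2'); try assumption.
    destruct (polar_unique L s (Cmod w) (Carg w) (Cmod w') (Carg w')) as [Em Ea];
      try assumption; try (apply Cmod_pos; assumption).
    rewrite <- (Cexp_Clog w), <- (Cexp_Clog w') by assumption. unfold Clog. congruence. }
  intros Hw E Hw' E'.
  destruct (Rtotal_order s 0) as [Hs|[Hs|Hs]].
  - destruct (wright_conj L s w) as [H1 H2]; try assumption; try lra.
    destruct (wright_conj L s w') as [H1' H2']; try assumption; try lra.
    rewrite <- (Cconj_conj w), <- (Cconj_conj w'). f_equal.
    apply (K (- s)); try assumption; try lra.
    intros Hp. apply HL. rewrite Rabs_left; assumption.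
  - assert (R0 : forall w : C, w <> 0 -> (w + Clog w)%C = (L, s) ->
      w = RtoC (Cmod w) /\ Cmod w + ln (Cmod w) = L).
    { clear w w' Hw E Hw' E'. intros w Hw E.
      pose proof (f_equal Re E) as E1. pose proof (f_equal Im E) as E2.
      autorewrite with reim in E1, E2.
      destruct (Im_plus_Carg w Hw) as [K1 K2].
      assert (Ha : Carg w = 0).
      { destruct (Rtotal_order (Carg w) 0) as [Ha|[Ha|Ha]]; [|assumption|].
        - specialize (K1 Ha); lra.
        - specialize (K2 Ha); lra. }
      pose proof (cos_Carg w Hw) as Hc. rewrite Ha, cos_0 in Hc.
      split; [|lra]. apply C_ext; reim; lra. }
    destruct (R0 w Hw E) as [Ew E1]. destruct (R0 w' Hw' E') as [Ew' E1'].
    rewrite Ew, Ew'. apply (f_equal RtoC).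
    pose proof (Cmod_pos w Hw) as P1. pose proof (Cmod_pos w' Hw') as P2.
    destruct (Rtotal_order (Cmod w) (Cmod w')) as [Hc|[Hc|Hc]]; [|assumption|].
    + pose proof (ln_increasing _ _ P1 Hc); lra.
    + pose proof (ln_increasing _ _ P2 Hc); lra.
  - apply (K s); try assumption. intros Hp. apply HL. rewrite Rabs_pos_eq; lra.
Qed.

(** * Existence, injectivity and completeness of the branches *)

Lemma on_cut_bound (x : C) : on_cut x -> x = RtoC (Re x) /\ Carg x = PI /\ x <> 0.
Proof.
  intros [H1 H2].
  assert (E : x = RtoC (Re x)) by (apply C_ext; reim; lra).
  assert (Hx : x <> 0) by (rewrite E; intros K; apply RtoC_inj in K; lra).
  repeat split; try assumption.
  pose proof PI_RGT_0.
  rewrite E. rewrite <- (Carg_polar (- Re x) PI) by lra.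
  f_equal. rewrite cos_PI, sin_PI. apply C_ext; reim; ring.
Qed.

Lemma Carg_PI (x : C) : x <> 0 -> Carg x = PI -> Im x = 0 /\ Re x = - Cmod x.
Proof.
  intros Hx Ha. rewrite <- (cos_Carg x Hx), <- (sin_Carg x Hx), Ha, cos_PI, sin_PI.
  split; ring.
Qed.

(** An imaginary part [PI] or [- PI] occurs only for [k = 0] or [k = -1] with [Carg x = PI]; being
    off the cut then means [Cmod x > 1 / e]. *)
Lemma wright_regular (x : C) (k : Z) :
  x <> 0 -> (~ on_cut x \/ (k <> 0%Z /\ k <> (-1)%Z)) ->
  Rabs (Carg x + 2 * IZR k * PI) = PI -> -1 < ln (Cmod x).
Proof.
  intros Hx Hk Hs. pose proof (Carg_bound x Hx) as Hb. pose proof PI_RGT_0 as HPI.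
  assert (Hkk : (k = 0 \/ k = -1)%Z /\ Carg x = PI).
  { unfold Rabs in Hs. destruct (Rcase_abs (Carg x + 2 * IZR k * PI)) as [Hc|Hc].
    - assert (-2 < IZR k < 0) by (split; nra).
      assert (k = -1)%Z.
      { destruct H as [H1 H2]. apply lt_IZR in H1. apply lt_IZR in H2. lia. }
      subst k. split; [tauto|]. lra.
    - assert (-1 < IZR k < 1) by (split; nra).
      assert (k = 0)%Z.
      { destruct H as [H1 H2]. apply lt_IZR in H1. apply lt_IZR in H2. lia. }
      subst k. split; [tauto|]. lra. }
  destruct Hkk as [Hk0 Ha]. destruct Hk as [Hk|Hk]; [|lia].
  destruct (Carg_PI x Hx Ha) as [Hi Hr]. pose proof (Cmod_pos x Hx).
  assert (/ exp 1 < Cmod x).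
  { apply Rnot_le_lt. intros Hle. apply Hk. split; [assumption|lra]. }
  rewrite <- (ln_exp (-1)). apply ln_increasing; [apply exp_pos|].
  replace (-1) with (- (1)) by ring. rewrite exp_Ropp. assumption.
Qed.

Lemma Clog_shift_pair (x : C) (k : Z) :
  (Clog x + 2 * IZR k * PI * Ci)%C = (ln (Cmod x), Carg x + 2 * IZR k * PI).
Proof. apply C_ext; reim; ring. Qed.

Lemma RtoC_mult_Cexp (a : R) : (RtoC a * Cexp a)%C = RtoC (a * exp a).
Proof. rewrite Cexp_RtoC, RtoC_mult. reflexivity. Qed.

Lemma continuity_xexp (a : R) : continuity_pt (fun u => u * exp u) a.
Proof.
  apply continuity_pt_filterlim, (ex_derive_continuous (fun u => u * exp u) a).
  auto_derive; trivial.
Qed.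

Lemma is_LambertW_exists (k : Z) (x : C) : x <> 0 -> exists w, is_LambertW k x w.
Proof.
  intros Hx.
  destruct (classic (on_cut x /\ (k = 0%Z \/ k = (-1)%Z))) as [[Hc Hk]|Hk].
  - destruct (on_cut_bound x Hc) as (E & Ha & _). destruct (Hc) as [_ Hr].
    set (a := Re x) in *.
    assert (He : -1 * exp (-1) = - / exp 1).
    { replace (-1) with (- (1)) by ring. rewrite exp_Ropp. ring. }
    destruct Hk as [-> | ->].
    + destruct (IVT_gen (fun u => u * exp u) (-1) 0 a) as (u & Hu & Ha').
      * intros u; apply continuity_xexp.
      * rewrite He. rewrite Rmin_left, Rmax_right by lra. lra.
      * rewrite Rmin_left, Rmax_right in Hu by lra.
        exists (RtoC u). left. rewrite RtoC_mult_Cexp, Ha'. reim.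
        repeat (split; [assumption || reflexivity || lra|]). symmetry; assumption.
    (* Chosen so that [M exp (- M) <= - a]: this follows from [exp M >= M^2 / 4] and
       [M * (- a) >= 4]. *)
    + set (M := 4 / - a + 1).
      assert (HM0 : 0 < 4 / - a) by (apply Rdiv_lt_0_compat; lra).
      assert (HM : M * - a = 4 + - a) by (unfold M; field; lra).
      assert (Hexp : M * M / 4 <= exp M).
      { replace (exp M) with (exp (M / 2) * exp (M / 2)) by (rewrite <- exp_plus; f_equal; field).
        pose proof (exp_ineq1_le (M / 2)). assert (0 < M) by (unfold M; lra). nra. }
      assert (Hlow : a <= - M * exp (- M)).
      { rewrite exp_Ropp. pose proof (exp_pos M).
        apply Rmult_le_reg_r with (exp M); [assumption|].
        replace (- M * / exp M * exp M) with (- M) by (field; lra).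
        assert (1 < M) by (unfold M; lra). nra. }
      destruct (IVT_gen (fun u => u * exp u) (- M) (-1) a) as (u & Hu & Ha').
      * intros u; apply continuity_xexp.
      * rewrite He. rewrite Rmin_right, Rmax_left by lra. lra.
      * rewrite Rmin_left, Rmax_right in Hu by (unfold M in *; lra).
        exists (RtoC u). right; left. rewrite RtoC_mult_Cexp, Ha'. reim.
        repeat (split; [assumption || reflexivity || lra|]). symmetry; assumption.
  - assert (Hk' : ~ on_cut x \/ (k <> 0%Z /\ k <> (-1)%Z)).
    { destruct (classic (on_cut x)); [right|left]; tauto. }
    destruct (wright_exists (ln (Cmod x)) (Carg x + 2 * IZR k * PI)) as (w & Hw & E).
    + apply wright_regular; assumption.
    + exists w. right; right. rewrite Clog_shift_pair. auto.
Qed.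

Lemma LambertW_spec (k : Z) (x : C) : x <> 0 -> is_LambertW k x (LambertW k x).
Proof. intros Hx. unfold LambertW. apply epsilon_spec, is_LambertW_exists, Hx. Qed.

Lemma wexp_of_wright (x w : C) (k : Z) :
  x <> 0 -> w <> 0 -> (w + Clog w)%C = (Clog x + 2 * IZR k * PI * Ci)%C ->
  (w * Cexp w)%C = x.
Proof.
  intros Hx Hw E. apply (f_equal Cexp) in E.
  rewrite Cexp_Zperiod, Cexp_plus, !Cexp_Clog in E by assumption.
  rewrite Cmult_comm; assumption.
Qed.

Lemma wright_of_wexp (x w : C) :
  x <> 0 -> (w * Cexp w)%C = x ->
  w <> 0 /\ exists k : Z, (w + Clog w)%C = (Clog x + 2 * IZR k * PI * Ci)%C.
Proof.
  intros Hx E.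
  assert (Hw : w <> 0) by (intros ->; apply Hx; rewrite <- E; ring).
  split; [assumption|]. apply Cexp_inj_mod.
  rewrite Cexp_plus, !Cexp_Clog by assumption. rewrite <- E; ring.
Qed.

(* On the cut, [W_0] and [W_(-1)] are both real and negative, hence both solve the
   logarithmic equation with [k = 0]. *)
Lemma LambertW_log (k : Z) (x : C) : x <> 0 ->
  let w := LambertW k x in
  w <> 0 /\
  ((w + Clog w)%C = (Clog x + 2 * IZR k * PI * Ci)%C /\
     (on_cut x -> k = 0%Z -> Im w = 0 /\ -1 <= Re w) \/
   on_cut x /\ k = (-1)%Z /\ Im w = 0 /\ Re w <= -1 /\ (w + Clog w)%C = Clog x).
Proof.
  intros Hx w. pose proof PI_RGT_0 as HPI.
  assert (K : on_cut x -> Im w = 0 -> (w * Cexp w)%C = x -> w <> 0 /\ (w + Clog w)%C = Clog x).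
  { intros Hc Hi E. destruct (on_cut_bound x Hc) as (Ex & Ha & _).
    destruct (wright_of_wexp x w Hx E) as [Hw [j Hj]]. split; [assumption|].
    rewrite Hj. pose proof (f_equal Im Hj) as Hj'. autorewrite with reim in Hj'.
    pose proof (Carg_bound w Hw) as Hb.
    assert (IZR j > -1) by nra. assert (IZR j < 1) by nra.
    assert (-1 < j)%Z by (apply lt_IZR; lra). assert (j < 1)%Z by (apply lt_IZR; lra).
    assert (j = 0%Z) by lia.
    subst j. ring. }
  destruct (LambertW_spec k x Hx) as [(Hc & -> & Hi & Hr & E)|[(Hc & -> & Hi & Hr & E)|(Hk & Hw & E)]].
  - destruct (K Hc Hi E) as [Hw Ew]. split; [assumption|]. left.
    split; [rewrite Ew; ring|auto].
  - destruct (K Hc Hi E) as [Hw Ew]. split; [assumption|]. right. auto.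
  - split; [assumption|]. left. split; [assumption|]. intros Hc ->. tauto.
Qed.

Lemma LambertW_neq_0 (k : Z) (x : C) : x <> 0 -> LambertW k x <> 0.
Proof. intros Hx. exact (proj1 (LambertW_log k x Hx)). Qed.

Lemma LambertW_exp (k : Z) (x : C) :
  x <> 0 -> (LambertW k x * Cexp (LambertW k x))%C = x.
Proof.
  intros Hx. destruct (LambertW_log k x Hx) as [Hw [[E _]|(_ & _ & _ & _ & E)]].
  - apply (wexp_of_wright _ _ k); assumption.
  - apply (wexp_of_wright _ _ 0); try assumption. rewrite E; ring.
Qed.

Lemma LambertW_Clog (k : Z) (x : C) : x <> 0 -> k <> (-1)%Z ->
  (LambertW k x + Clog (LambertW k x))%C = (Clog x + 2 * IZR k * PI * Ci)%C.
Proof.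
  intros Hx Hk. destruct (LambertW_log k x Hx) as [Hw [[E _]|(_ & E & _)]]; tauto.
Qed.

Lemma IZR_PI_inj (x : C) (j k : Z) :
  (Clog x + 2 * IZR j * PI * Ci)%C = (Clog x + 2 * IZR k * PI * Ci)%C -> j = k.
Proof.
  intros E. apply (f_equal Im) in E. autorewrite with reim in E.
  pose proof PI_RGT_0. apply eq_IZR. nra.
Qed.

(** The index is read off the imaginary part of the logarithmic equation, except that on the cut
    [W_(-1)] satisfies it with index 0, like [W_0]. A common value of these two lies on both sides
    of -1. *)
Lemma LambertW_inj (x : C) (j k : Z) : x <> 0 -> LambertW j x = LambertW k x ->
  j = k \/ LambertW j x = RtoC (-1) /\ ((j = 0 /\ k = -1) \/ (j = -1 /\ k = 0))%Z.
Proof.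
  intros Hx E.
  destruct (LambertW_log j x Hx) as [Hj [[Ej Cj]|(Ccj & Ij & Rj & Lj & Ej)]];
  destruct (LambertW_log k x Hx) as [Hk [[Ek Ck]|(Cck & Ik & Rk & Lk & Ek)]].
  - left. apply (IZR_PI_inj x). rewrite <- Ej, <- Ek, E; reflexivity.
  - right. assert (j = 0%Z).
    { apply (IZR_PI_inj x). rewrite <- Ej, E, Ek; ring. }
    destruct (Cj Cck H) as [H1 H2]. split; [|lia].
    apply C_ext; reim; [|lra]. rewrite E in *. lra.
  - right. assert (k = 0%Z).
    { apply (IZR_PI_inj x). rewrite <- Ek, <- E, Ej; ring. }
    destruct (Ck Ccj H) as [H1 H2]. split; [|lia].
    apply C_ext; reim; [|lra]. rewrite <- E in *. lra.
  - left; congruence.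
Qed.

(** With [d = b - a] the equation reads [a = b exp d]; the strict inequalities [1 + d < exp d] and
    [1 - d < exp (- d)] then place -1 between [a] and [b]. This separates the two real branches. *)
Lemma xexp_eq (a b : R) : a < b -> a * exp a = b * exp b -> a < -1 < b.
Proof.
  intros Hab E. set (d := b - a).
  assert (H1 : 1 + d < exp d) by (apply exp_ineq1; unfold d; lra).
  assert (H2 : 1 + - d < exp (- d)) by (apply exp_ineq1; unfold d; lra).
  assert (Hd : exp d * exp (- d) = 1) by (rewrite <- exp_plus, <- exp_0; f_equal; ring).
  assert (E1 : a = b * exp d).
  { apply Rmult_eq_reg_r with (exp a); [|pose proof (exp_pos a); lra].
    rewrite E, Rmult_assoc, <- exp_plus. do 2 f_equal. unfold d; ring. }
  pose proof (exp_pos (- d)).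
  assert (E2 : a * exp (- d) = b) by (rewrite E1, Rmult_assoc, Hd; ring).
  assert (0 < d) by (unfold d; lra).
  assert (b = a + d) by (unfold d; ring).
  split; nra.
Qed.

Lemma xcos_lt_sin (x : R) : 0 < x < PI -> x * cos x < sin x.
Proof.
  intros Hx.
  destruct (MVT_cor2 (fun u => sin u - u * cos u) (fun u => u * sin u) 0 x) as (c & E & Hc).
  - lra.
  - intros u _. apply is_derive_Reals. auto_derive; [trivial|ring].
  - rewrite sin_0 in E. pose proof (sin_gt_0 c ltac:(lra) ltac:(lra)).
    assert (0 < c * sin c * (x - 0)) by (repeat apply Rmult_lt_0_compat; lra). lra.
Qed.

(** In the regular case this is uniqueness for the logarithmic equation. On the cut with [k = 0] or
    [k = -1], the solution is first shown to be real; its position relative to -1 and [xexp_eq] then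
    decide between the two real branches. *)
Lemma LambertW_surj (x w : C) : x <> 0 -> (w * Cexp w)%C = x -> exists k, w = LambertW k x.
Proof.
  intros Hx E. pose proof PI_RGT_0 as HPI.
  destruct (wright_of_wexp x w Hx E) as [Hw [k Hk]].
  assert (Reg : ~ on_cut x \/ (k <> 0%Z /\ k <> (-1)%Z) -> w = LambertW k x).
  { intros Hr. destruct (LambertW_spec k x Hx) as [(Hc & -> & _)|[(Hc & -> & _)|(_ & Hw' & E')]];
      [tauto|tauto|].
    rewrite Clog_shift_pair in Hk, E'.
    apply (wright_unique (ln (Cmod x)) (Carg x + 2 * IZR k * PI)); try assumption.
    apply wright_regular; assumption. }
  destruct (classic (on_cut x /\ (k = 0%Z \/ k = (-1)%Z))) as [[Hc Hk0]|Hn].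
  2:{ exists k. apply Reg. destruct (classic (on_cut x)); [right|left]; tauto. }
  destruct (on_cut_bound x Hc) as (Ex & Ha & _). destruct (Hc) as [_ Hr].
  assert (HL : ln (Cmod x) <= -1).
  { rewrite Ex, Cmod_R, Rabs_left by lra. rewrite <- (ln_exp (-1)).
    replace (exp (-1)) with (/ exp 1) by (rewrite <- exp_Ropp; f_equal; ring).
    destruct (Req_dec (- Re x) (/ exp 1)) as [->|]; [lra|left; apply ln_increasing; lra]. }
  (* [polarF PI > -1] rules out non-real solutions. *)
  assert (Hreal : Im w = 0).
  { assert (K : forall v : C, v <> 0 -> (v + Clog v)%C = (ln (Cmod x), PI) -> Im v = 0).
    { intros v Hv Ev.
      pose proof (f_equal Re Ev) as E1. pose proof (f_equal Im Ev) as E2.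
      autorewrite with reim in E1, E2.
      pose proof (cos_Carg v Hv) as Hcv. pose proof (sin_Carg v Hv) as Hsn.
      pose proof (Cmod_pos v Hv) as Hm. pose proof (Carg_bound v Hv) as Hb.
      destruct (Req_dec (Carg v) PI) as [Hp|Hp]; [lra|exfalso].
      destruct (Im_plus_Carg v Hv) as [K1 _].
      destruct (Rtotal_order (Carg v) 0) as [Hn|[Hn|Hn]];
        [specialize (K1 Hn); lra|rewrite Hn, sin_0 in Hsn; lra|].
      (* The imaginary part gives [Cmod v = psi / sin psi > 1], and the real part is
         [ln (Cmod v) - psi cos psi / sin psi], which exceeds -1 by [xcos_lt_sin]. *)
      set (psi := PI - Carg v).
      assert (Hpsi : 0 < psi < PI) by (unfold psi; lra).
      assert (Hs : sin psi = sin (Carg v)) by apply sin_PI_x.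
      assert (Hc' : cos psi = - cos (Carg v))
        by (unfold psi; rewrite cos_minus, cos_PI, sin_PI; ring).
      assert (Hs0 : 0 < sin psi) by (apply sin_gt_0; lra).
      assert (Hs1 : sin psi < psi) by (apply sin_lt_x; lra).
      assert (Hmod : Cmod v * sin psi = psi) by (unfold psi at 2; rewrite Hs; lra).
      assert (H1 : 1 < Cmod v) by nra.
      assert (0 < ln (Cmod v)) by (rewrite <- ln_1; apply ln_increasing; lra).
      pose proof (xcos_lt_sin psi Hpsi). nra. }
    destruct Hk0 as [-> | ->].
    - apply K; [assumption|]. rewrite Hk, Clog_shift_pair, Ha. f_equal; ring.
    - destruct (wright_conj (ln (Cmod x)) (- PI) w) as [H1 H2]; [assumption|lra| |].
      + rewrite Hk, Clog_shift_pair, Ha. f_equal; ring.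
      + rewrite Ropp_involutive in H2. specialize (K _ H1 H2).
        autorewrite with reim in K. lra. }
  set (a := Re w). assert (Ew : w = RtoC a) by (apply C_ext; reim; [reflexivity|assumption]).
  assert (Ea : a * exp a = Re x).
  { rewrite Ew, RtoC_mult_Cexp in E. rewrite <- E; reflexivity. }
  assert (Real : forall v : C, Im v = 0 -> (v * Cexp v)%C = x ->
    v = RtoC (Re v) /\ Re v * exp (Re v) = Re x).
  { intros v Hi Ev. assert (Ev' : v = RtoC (Re v)) by (apply C_ext; reim; auto).
    split; [assumption|]. rewrite Ev', RtoC_mult_Cexp in Ev. rewrite <- Ev; reflexivity. }
  rewrite Ew.
  destruct (Rle_lt_dec (-1) a) as [Hge|Hlt].
  - exists 0%Z.
    destruct (LambertW_spec 0 x Hx) as [(_ & _ & Hi & Hr0 & E')|[(_ & ? & _)|([?|?] & _)]];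
      try tauto; try lia.
    destruct (Real _ Hi E') as [Ev Eb]. rewrite Ev. apply (f_equal RtoC).
    set (b := Re (LambertW _ _)) in *.
    destruct (Rtotal_order a b) as [Hab|[Hab|Hab]]; [|assumption|].
    + destruct (xexp_eq a b Hab); lra.
    + destruct (xexp_eq b a Hab); lra.
  - exists (-1)%Z.
    destruct (LambertW_spec (-1) x Hx) as [(_ & ? & _)|[(_ & _ & Hi & Hr0 & E')|([?|?] & _)]];
      try tauto; try lia.
    destruct (Real _ Hi E') as [Ev Eb]. rewrite Ev. apply (f_equal RtoC).
    set (b := Re (LambertW _ _)) in *.
    destruct (Rtotal_order a b) as [Hab|[Hab|Hab]]; [|assumption|].
    + destruct (xexp_eq a b Hab); lra.
    + destruct (xexp_eq b a Hab); lra.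
Qed.

(** For [r > 0] the imaginary part of the logarithmic equation is [2 k PI], never [PI] or [- PI], so
    conjugation is compatible with the principal logarithm and uniqueness applies. *)
Lemma LambertW_conj (r : R) (k : Z) :
  0 < r -> LambertW (- k) r = Cconj (LambertW k r).
Proof.
  intros Hr. pose proof PI_RGT_0 as HPI.
  assert (Hx : RtoC r <> 0) by (intros H; apply RtoC_inj in H; lra).
  assert (Hn : ~ on_cut r) by (intros [_ H]; autorewrite with reim in H; lra).
  assert (E : forall k, LambertW k r <> 0 /\
    (LambertW k r + Clog (LambertW k r))%C = (ln r, 2 * IZR k * PI)).
  { clear k. intros k.
    destruct (LambertW_log k r Hx) as [Hw [[E _]|[Hc _]]]; [|tauto].
    split; [assumption|]. rewrite E, Clog_RtoC by assumption. apply C_ext; reim; ring. }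
  destruct (E k) as [Hk Ek]. destruct (E (- k)%Z) as [Hk' Ek'].
  assert (Hs : forall j : Z, Rabs (2 * IZR j * PI) = PI -> -1 < ln r).
  { intros j Hj. exfalso.
    assert (IZR (2 * Z.abs j) = 1).
    { rewrite mult_IZR, abs_IZR. rewrite !Rabs_mult, (Rabs_pos_eq PI), (Rabs_pos_eq 2) in Hj by lra.
      nra. }
    apply eq_IZR in H. lia. }
  destruct (wright_conj (ln r) (2 * IZR k * PI) _ Hk) as [H1 H2]; [|assumption|].
  - intros H. assert (IZR (2 * k) = 1) by (rewrite mult_IZR; nra).
    apply eq_IZR in H0. lia.
  - apply (wright_unique (ln r) (2 * IZR (- k) * PI)); try assumption.
    + apply Hs.
    + rewrite H2. f_equal. rewrite opp_IZR; ring.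
Qed.

Lemma LambertW_0_pos (r : R) : 0 < r -> exists a, 0 < a /\ LambertW 0 r = RtoC a.
Proof.
  intros Hr. pose proof PI_RGT_0 as HPI.
  assert (Hx : RtoC r <> RtoC 0) by (intros H; apply RtoC_inj in H; lra).
  pose proof (LambertW_Clog 0 r Hx ltac:(lia)) as E.
  pose proof (LambertW_neq_0 0 r Hx) as Hw. set (w := LambertW 0 r) in *.
  rewrite Clog_RtoC in E by assumption. apply (f_equal Im) in E. autorewrite with reim in E.
  destruct (Im_plus_Carg w Hw) as [K1 K2].
  assert (Ha : Carg w = 0).
  { destruct (Rtotal_order (Carg w) 0) as [Ha|[Ha|Ha]]; [|assumption|].
    - specialize (K1 Ha); lra.
    - specialize (K2 Ha); lra. }
  pose proof (cos_Carg w Hw) as Hc. pose proof (sin_Carg w Hw) as Hsn.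
  rewrite Ha, cos_0 in Hc. rewrite Ha, sin_0 in Hsn.
  exists (Cmod w). split; [apply Cmod_pos; assumption|]. apply C_ext; reim; lra.
Qed.

(** * Entire functions as power series *)

(** Summing componentwise reduces everything to real series; the price is a factor 2 in
    [Cmod_Csum_le], harmless throughout. *)
Definition Csum (u : nat -> C) : C :=
  (Series (fun n => Re (u n)), Series (fun n => Im (u n))).

Definition ex_Csum (u : nat -> C) : Prop := ex_series (fun n => Cmod (u n)).

Lemma ex_series_le_abs (f g : nat -> R) :
  (forall n, Rabs (f n) <= g n) -> ex_series g -> ex_series f.
Proof. exact (ex_series_le (V := R_CompleteNormedModule) f g). Qed.

Lemma ex_series_ext_R (f g : nat -> R) :
  (forall n, f n = g n) -> ex_series f -> ex_series g.
Proof. exact (ex_series_ext f g). Qed.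

Lemma ex_Csum_re (u : nat -> C) : ex_Csum u -> ex_series (fun n => Re (u n)).
Proof. apply ex_series_le_abs. intros n. apply re_le_Cmod. Qed.

Lemma ex_Csum_im (u : nat -> C) : ex_Csum u -> ex_series (fun n => Im (u n)).
Proof. apply ex_series_le_abs. intros n. apply Im_le_Cmod. Qed.

Lemma ex_Csum_le (u : nat -> C) (v : nat -> R) :
  (forall n, Cmod (u n) <= v n) -> ex_series v -> ex_Csum u.
Proof.
  intros H. apply ex_series_le_abs. intros n. rewrite Rabs_pos_eq; [apply H|apply Cmod_ge_0].
Qed.

Lemma Csum_ext (u v : nat -> C) : (forall n, u n = v n) -> Csum u = Csum v.
Proof. intros H. unfold Csum. f_equal; apply Series_ext; intros n; rewrite H; reflexivity. Qed.

Lemma ex_Csum_plus (u v : nat -> C) :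
  ex_Csum u -> ex_Csum v -> ex_Csum (fun n => u n + v n)%C.
Proof.
  intros Hu Hv. apply (ex_Csum_le _ (fun n => Cmod (u n) + Cmod (v n))).
  - intros n; apply Cmod_triangle.
  - exact (ex_series_plus _ _ Hu Hv).
Qed.

Lemma Csum_plus (u v : nat -> C) :
  ex_Csum u -> ex_Csum v -> Csum (fun n => u n + v n)%C = (Csum u + Csum v)%C.
Proof.
  intros Hu Hv. unfold Csum. apply C_ext; reim.
  - rewrite <- Series_plus by (apply ex_Csum_re; assumption).
    apply Series_ext; intros n; reim; reflexivity.
  - rewrite <- Series_plus by (apply ex_Csum_im; assumption).
    apply Series_ext; intros n; reim; reflexivity.
Qed.

Lemma ex_Csum_scal (c : C) (u : nat -> C) : ex_Csum u -> ex_Csum (fun n => c * u n)%C.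
Proof.
  intros Hu. apply (ex_Csum_le _ (fun n => Cmod c * Cmod (u n))).
  - intros n. rewrite Cmod_mult; lra.
  - exact (ex_series_scal_l (Cmod c) _ Hu).
Qed.

Lemma Csum_scal (c : C) (u : nat -> C) :
  ex_Csum u -> Csum (fun n => c * u n)%C = (c * Csum u)%C.
Proof.
  intros Hu. pose proof (ex_Csum_re u Hu). pose proof (ex_Csum_im u Hu).
  unfold Csum. apply C_ext; reim.
  - rewrite <- !Series_scal_l, <- Series_minus.
    + apply Series_ext; intros n; reim; reflexivity.
    + exact (ex_series_scal_l (Re c) _ H).
    + exact (ex_series_scal_l (Im c) _ H0).
  - rewrite <- !Series_scal_l, <- Series_plus.
    + apply Series_ext; intros n; reim; reflexivity.
    + exact (ex_series_scal_l (Re c) _ H0).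
    + exact (ex_series_scal_l (Im c) _ H).
Qed.

Lemma ex_Csum_S (u : nat -> C) : ex_Csum u -> ex_Csum (fun n => u (S n)).
Proof. intros Hu. apply (ex_series_incr_1 (fun n => Cmod (u n))) in Hu. exact Hu. Qed.

Lemma Csum_S (u : nat -> C) : ex_Csum u -> Csum u = (u 0%nat + Csum (fun n => u (S n)))%C.
Proof.
  intros Hu. unfold Csum. apply C_ext; reim.
  - apply Series_incr_1, ex_Csum_re, Hu.
  - apply Series_incr_1, ex_Csum_im, Hu.
Qed.

Lemma Cmod_Csum_le (u : nat -> C) (v : nat -> R) :
  (forall n, Cmod (u n) <= v n) -> ex_series v -> Cmod (Csum u) <= 2 * Series v.
Proof.
  intros H Hv. pose proof (ex_Csum_le u v H Hv) as Hu.
  eapply Rle_trans; [apply Cmod_le_sum|]. unfold Csum; reim.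
  assert (K : forall f : nat -> R, (forall n, Rabs (f n) <= v n) -> Rabs (Series f) <= Series v).
  { intros f Hf.
    assert (Ha : ex_series (fun n => Rabs (f n))).
    { apply (ex_series_le_abs (fun n => Rabs (f n)) v); [|assumption].
      intros n. rewrite Rabs_Rabsolu; apply Hf. }
    eapply Rle_trans; [apply Series_Rabs; assumption|].
    apply Series_le; [|assumption]. intros n; split; [apply Rabs_pos|apply Hf]. }
  assert (Rabs (Series (fun n => Re (u n))) <= Series v).
  { apply K; intros n. eapply Rle_trans; [apply re_le_Cmod|apply H]. }
  assert (Rabs (Series (fun n => Im (u n))) <= Series v).
  { apply K; intros n. eapply Rle_trans; [apply Im_le_Cmod|apply H]. }
  lra.
Qed.

(** * Power series of infinite radius of convergence *)

Definition entire_coef (a : nat -> C) : Prop :=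
  forall r, 0 <= r -> ex_series (fun n => Cmod (a n) * r ^ n).

Definition ev (a : nat -> C) (z : C) : C := Csum (fun n => a n * z ^ n)%C.

Lemma ex_ev (a : nat -> C) (z : C) : entire_coef a -> ex_Csum (fun n => a n * z ^ n)%C.
Proof.
  intros Ha. apply (ex_Csum_le _ (fun n => Cmod (a n) * Cmod z ^ n)).
  - intros n. rewrite Cmod_mult, Cmod_pow; lra.
  - apply Ha, Cmod_ge_0.
Qed.

(** Boundedness of the terms at the radius [2 r + 1] leaves geometric decay with ratio [1 / 2] at
    the radius [r]. *)
Lemma entire_coef_bounded (b : nat -> C) :
  (forall r, 1 <= r -> exists B, forall n, Cmod (b n) * r ^ n <= B) -> entire_coef b.
Proof.
  intros H r Hr. destruct (H (2 * r + 1) ltac:(lra)) as [B HB].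
  apply (ex_series_le_abs _ (fun n => B * (/ 2) ^ n)).
  - intros n. change (Rabs (Cmod (b n) * r ^ n) <= B * (/ 2) ^ n).
    assert (0 <= r ^ n) by (apply pow_le; lra). pose proof (Cmod_ge_0 (b n)).
    rewrite Rabs_pos_eq by (apply Rmult_le_pos; lra).
    specialize (HB n).
    assert (H2 : 0 < 2 ^ n) by (apply pow_lt; lra).
    apply Rmult_le_reg_r with (2 ^ n); [assumption|].
    rewrite Rmult_assoc, <- Rpow_mult_distr, (Rmult_assoc B), <- Rpow_mult_distr.
    replace (/ 2 * 2) with 1 by field. rewrite pow1, Rmult_1_r.
    eapply Rle_trans; [|apply HB]. apply Rmult_le_compat_l; [assumption|].
    apply pow_incr; lra.
  - apply (ex_series_scal_l B (fun n => (/ 2) ^ n)). eexists; apply is_series_geom.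
    rewrite Rabs_pos_eq; lra.
Qed.

Lemma entire_coef_bound (a : nat -> C) (r : R) :
  entire_coef a -> 0 <= r -> exists B, 0 <= B /\ forall n, Cmod (a n) * r ^ n <= B.
Proof.
  intros Ha Hr. pose proof (Ha r Hr) as Hs.
  exists (Series (fun n => Cmod (a n) * r ^ n)).
  assert (Hp : forall n, 0 <= Cmod (a n) * r ^ n).
  { intros n. apply Rmult_le_pos; [apply Cmod_ge_0|apply pow_le; assumption]. }
  assert (K : forall n, Cmod (a n) * r ^ n <= Series (fun n => Cmod (a n) * r ^ n)).
  { intros n.
    assert (Hn : Cmod (a n) * r ^ n <= sum_n (fun n => Cmod (a n) * r ^ n) n).
    { destruct n as [|n]; [rewrite sum_O; lra|].
      rewrite sum_Sn. change plus with Rplus.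
      assert (0 <= sum_n (fun n => Cmod (a n) * r ^ n) n); [|lra].
      clear -Hp. induction n as [|n IH]; [rewrite sum_O; apply Hp|].
      rewrite sum_Sn. change plus with Rplus. pose proof (Hp (S n)). lra. }
    eapply Rle_trans; [exact Hn|].
    apply (is_lim_seq_incr_compare (sum_n (fun n => Cmod (a n) * r ^ n))).
    - apply Series_correct in Hs. exact Hs.
    - intros m. rewrite sum_Sn. change plus with Rplus. pose proof (Hp (S m)). lra. }
  split; [|assumption]. eapply Rle_trans; [apply (Hp 0%nat)|apply K].
Qed.

Definition entire (F : C -> C) : Prop :=
  exists a, entire_coef a /\ forall z, F z = ev a z.

Lemma entire_ext (F G : C -> C) : (forall z, F z = G z) -> entire F -> entire G.
Proof. intros H (a & Ha & E). exists a; split; [assumption|]. intros z; rewrite <- H; apply E. Qed.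

Lemma entire_plus (F G : C -> C) : entire F -> entire G -> entire (fun z => F z + G z)%C.
Proof.
  intros (a & Ha & Ea) (b & Hb & Eb). exists (fun n => a n + b n)%C. split.
  - intros r Hr. apply (ex_series_le_abs _ (fun n => Cmod (a n) * r ^ n + Cmod (b n) * r ^ n)).
    + intros n. 
      assert (0 <= r ^ n) by (apply pow_le; assumption).
      rewrite Rabs_pos_eq by (apply Rmult_le_pos; [apply Cmod_ge_0|assumption]).
      pose proof (Cmod_triangle (a n) (b n)). nra.
    + exact (ex_series_plus _ _ (Ha r Hr) (Hb r Hr)).
  - intros z. rewrite Ea, Eb. unfold ev. rewrite <- Csum_plus by (apply ex_ev; assumption).
    apply Csum_ext; intros n; ring.
Qed.

Lemma entire_scal (c : C) (F : C -> C) : entire F -> entire (fun z => c * F z)%C.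
Proof.
  intros (a & Ha & Ea). exists (fun n => c * a n)%C. split.
  - intros r Hr. apply (ex_series_ext_R (fun n => Cmod c * (Cmod (a n) * r ^ n))).
    + intros n. rewrite Cmod_mult; ring.
    + exact (ex_series_scal_l (Cmod c) _ (Ha r Hr)).
  - intros z. rewrite Ea. unfold ev. rewrite <- Csum_scal by (apply ex_ev; assumption).
    apply Csum_ext; intros n; ring.
Qed.

Lemma entire_mulX (F : C -> C) : entire F -> entire (fun z => z * F z)%C.
Proof.
  intros (a & Ha & Ea).
  set (b := fun n => match n with O => RtoC 0 | S m => a m end).
  assert (Hb : entire_coef b).
  { intros r Hr. apply ex_series_incr_1. simpl.
    apply (ex_series_ext_R (fun n => r * (Cmod (a n) * r ^ n))); [intros n; ring|].
    exact (ex_series_scal_l r _ (Ha r Hr)). }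
  exists b. split; [assumption|].
  intros z. rewrite Ea. unfold ev at 2. rewrite Csum_S by (apply ex_ev; assumption).
  unfold ev. rewrite <- Csum_scal by (apply ex_ev; assumption). simpl.
  rewrite Cmult_0_l, Cplus_0_l. apply Csum_ext. intros n; ring.
Qed.

Lemma entire_comp_scal (c : C) (F : C -> C) : entire F -> entire (fun z => F (c * z)%C).
Proof.
  intros (a & Ha & Ea). exists (fun n => a n * c ^ n)%C. split.
  - intros r Hr. apply (ex_series_ext_R (fun n => Cmod (a n) * (Cmod c * r) ^ n)).
    + intros n. rewrite Cmod_mult, Cmod_pow, Rpow_mult_distr; ring.
    + apply Ha. apply Rmult_le_pos; [apply Cmod_ge_0|assumption].
  - intros z. rewrite Ea. apply Csum_ext. intros n. rewrite Cpow_mult_l; ring.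
Qed.

(* Synthetic division: the coefficients are [b_n = sum_k a_(n+1+k) w^k]. *)
Lemma entire_divide (F : C -> C) (w : C) :
  entire F -> F w = 0 -> exists H, entire H /\ forall z, F z = ((z - w) * H z)%C.
Proof.
  intros (a & Ha & Ea) Hw.
  assert (Hk : forall m, ex_Csum (fun k => a (m + k)%nat * w ^ k)%C).
  { intros m. destruct (entire_coef_bound a (2 * (Cmod w + 1))) as (B & HB0 & HB).
    { assumption. } { pose proof (Cmod_ge_0 w); lra. }
    apply (ex_Csum_le _ (fun k => B * (/ 2) ^ k)).
    - intros k. rewrite Cmod_mult, Cmod_pow. specialize (HB (m + k)%nat).
      pose proof (Cmod_ge_0 w). pose proof (Cmod_ge_0 (a (m + k)%nat)).
      assert (H2 : 0 < 2 ^ k) by (apply pow_lt; lra).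
      apply Rmult_le_reg_r with (2 ^ k); [assumption|].
      rewrite Rmult_assoc, <- Rpow_mult_distr, (Rmult_assoc B), <- Rpow_mult_distr.
      replace (/ 2 * 2) with 1 by field. rewrite pow1, Rmult_1_r.
      eapply Rle_trans; [|apply HB]. apply Rmult_le_compat_l; [assumption|].
      apply Rle_trans with ((2 * (Cmod w + 1)) ^ k).
      + apply pow_incr; lra.
      + apply Rle_pow; [lra|lia].
    - apply (ex_series_scal_l B (fun n => (/ 2) ^ n)). eexists; apply is_series_geom.
      rewrite Rabs_pos_eq; lra. }
  set (b := fun n => Csum (fun k => a (S n + k)%nat * w ^ k)%C).
  assert (Hrec : forall m, Csum (fun k => a (m + k)%nat * w ^ k)%C = (a m + w * b m)%C).
  { intros m. rewrite Csum_S by apply Hk. unfold b.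
    rewrite <- Csum_scal by apply Hk. rewrite Nat.add_0_r. simpl. f_equal; [ring|].
    apply Csum_ext. intros k. rewrite Nat.add_succ_r. simpl. ring. }
  assert (Hb : entire_coef b).
  { apply entire_coef_bounded. intros r Hr. pose proof (Cmod_ge_0 w) as Hw0.
    (* [(2 rho)^(n+1+k)] dominates [r^n (Cmod w)^k 2^k], so the terms of the series for [b_n r^n]
       are at most [B 2^(-k)]; this gives a bound independent of [n]. *)
    set (rho := r + Cmod w).
    destruct (entire_coef_bound a (2 * rho)) as (B & HB0 & HB).
    { assumption. } { unfold rho; lra. }
    exists (2 * (B * 2)). intros n.
    assert (Hs : is_series (fun k => B * (/ 2) ^ k) (B * 2)).
    { replace (B * 2) with (B * / (1 - / 2)) by field.
      apply (is_series_scal_l B (fun k => (/ 2) ^ k) (/ (1 - / 2))), is_series_geom.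
      rewrite Rabs_pos_eq; lra. }
    assert (Hr0 : 0 < r ^ n) by (apply pow_lt; lra).
    replace (b n) with (/ r ^ n * (r ^ n * b n))%C
      by (field; intros E; rewrite <- RtoC_pow in E; apply RtoC_inj in E; lra).
    rewrite Cmod_mult, Cmod_inv, Cmod_pow, Cmod_R, Rabs_pos_eq by
      (try lra; rewrite <- RtoC_pow; intros E; apply RtoC_inj in E; lra).
    replace (/ r ^ n * Cmod (r ^ n * b n) * r ^ n) with (Cmod (r ^ n * b n)) by (field; lra).
    unfold b. rewrite <- Csum_scal by apply Hk.
    rewrite <- (is_series_unique _ _ Hs).
    apply Cmod_Csum_le; [|eexists; apply Hs].
    intros k. rewrite !Cmod_mult, !Cmod_pow, Cmod_R, (Rabs_pos_eq r) by lra.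
    specialize (HB (S n + k)%nat). pose proof (Cmod_ge_0 (a (S n + k)%nat)).
    assert (H2 : 0 < 2 ^ k) by (apply pow_lt; lra).
    apply Rmult_le_reg_r with (2 ^ k); [assumption|].
    rewrite (Rmult_assoc B), <- Rpow_mult_distr.
    replace (/ 2 * 2) with 1 by field. rewrite pow1, Rmult_1_r.
    eapply Rle_trans; [|apply HB].
    replace (r ^ n * (Cmod (a (S n + k)%nat) * Cmod w ^ k) * 2 ^ k)
      with (Cmod (a (S n + k)%nat) * (r ^ n * (Cmod w * 2) ^ k)) by (rewrite Rpow_mult_distr; ring).
    apply Rmult_le_compat_l; [assumption|].
    replace (S n + k)%nat with (n + k + 1)%nat by lia. rewrite !pow_add, pow_1.
    rewrite <- (Rmult_1_r (r ^ n * _)).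
    apply Rmult_le_compat; try (unfold rho; lra).
    - apply Rmult_le_pos; [lra|apply pow_le; lra].
    - apply Rmult_le_compat; try lra; try (apply pow_le; lra).
      + apply pow_incr; unfold rho; lra.
      + apply pow_incr; unfold rho; lra. }
  exists (ev b). split; [exists b; auto|].
  intros z. rewrite Ea in Hw. rewrite Ea. unfold ev in Hw |- *.
  change (Csum (fun k => a (0 + k)%nat * w ^ k)%C = 0) in Hw. rewrite Hrec in Hw.
  rewrite Csum_S by (apply ex_ev; assumption).
  pose proof (ex_ev b z Hb) as Hbz.
  pose proof (ex_Csum_S _ Hbz) as HbS.
  (* Substituting [a_(n+1) = b_n - w b_(n+1)] splits the tail into [z] times the series of [b],
     minus [w] times that series without its first term. *)
  rewrite (Csum_ext _ (fun n => z * (b n * z ^ n) + (- w) * (b (S n) * z ^ S n))%C).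
  - rewrite Csum_plus, !Csum_scal by (try apply ex_Csum_scal; assumption).
    pose proof (Csum_S _ Hbz) as E. simpl in E.
    set (B1 := Csum (fun n => b n * z ^ n)%C) in *.
    change (Csum (fun n => b (S n) * z ^ S n)%C) with (Csum (fun n => b (S n) * (z * z ^ n))%C).
    set (B2 := Csum (fun n => b (S n) * (z * z ^ n))%C) in *.
    replace B2 with (B1 - b 0%nat)%C by (rewrite E; ring). simpl.
    replace (a 0%nat) with (- (w * b 0%nat))%C; [ring|].
    replace (a 0%nat) with (a 0%nat + w * b 0%nat - w * b 0%nat)%C by ring. rewrite Hw; ring.
  - intros n. pose proof (Hrec (S n)) as E. fold (b n) in E.
    replace (a (S n)) with (b n - w * b (S n))%C by (rewrite E; ring). simpl. ring.
Qed.

(** * Derivatives *)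

Ltac eqR := match goal with |- ?a = ?b => change (@eq R a b) end.

Definition pder (g : R -> C) (x : R) (l : C) : Prop :=
  is_derive (fun u => Re (g u)) x (Re l) /\ is_derive (fun u => Im (g u)) x (Im l).

Lemma pder_ext (f g : R -> C) (x : R) (l : C) :
  (forall u, f u = g u) -> pder f x l -> pder g x l.
Proof.
  intros H [H1 H2]. split.
  - apply (is_derive_ext (fun u => Re (f u))); [intros u; rewrite H; reflexivity|assumption].
  - apply (is_derive_ext (fun u => Im (f u))); [intros u; rewrite H; reflexivity|assumption].
Qed.

Lemma pder_eq (f : R -> C) (x : R) (l m : C) : l = m -> pder f x l -> pder f x m.
Proof. intros ->; auto. Qed.

Lemma pder_const (c : C) (x : R) : pder (fun _ => c) x 0.
Proof. split; apply (is_derive_const (V := R_NormedModule)). Qed.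

Lemma pder_id (x : R) : pder (fun u => RtoC u) x 1.
Proof.
  split; reim.
  - exact (is_derive_id (K := R_AbsRing) x).
  - exact (is_derive_const (V := R_NormedModule) 0 x).
Qed.

Lemma pder_plus (f g : R -> C) (x : R) (l m : C) :
  pder f x l -> pder g x m -> pder (fun u => f u + g u)%C x (l + m)%C.
Proof.
  intros [H1 H2] [H3 H4]. split; reim.
  - exact (is_derive_plus (V := R_NormedModule) _ _ x _ _ H1 H3).
  - exact (is_derive_plus (V := R_NormedModule) _ _ x _ _ H2 H4).
Qed.

Lemma pder_opp (f : R -> C) (x : R) (l : C) :
  pder f x l -> pder (fun u => - f u)%C x (- l)%C.
Proof.
  intros [H1 H2]. split; reim.
  - exact (is_derive_opp (V := R_NormedModule) _ x _ H1).
  - exact (is_derive_opp (V := R_NormedModule) _ x _ H2).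
Qed.

Lemma pder_minus (f g : R -> C) (x : R) (l m : C) :
  pder f x l -> pder g x m -> pder (fun u => f u - g u)%C x (l - m)%C.
Proof. intros H1 H2. exact (pder_plus _ _ _ _ _ H1 (pder_opp _ _ _ H2)). Qed.

Lemma is_derive_Rmult (f g : R -> R) (x l m : R) :
  is_derive f x l -> is_derive g x m -> is_derive (fun u => f u * g u) x (l * g x + f x * m).
Proof. intros H1 H2. exact (is_derive_mult f g x l m H1 H2 Rmult_comm). Qed.

Lemma pder_mult (f g : R -> C) (x : R) (l m : C) :
  pder f x l -> pder g x m -> pder (fun u => f u * g u)%C x (l * g x + f x * m)%C.
Proof.
  intros [H1 H2] [H3 H4]. split.
  - apply (is_derive_ext (fun u => Re (f u) * Re (g u) - Im (f u) * Im (g u)));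
      [intros u; reim; reflexivity|].
    replace (Re (l * g x + f x * m)) with
      ((Re l * Re (g x) + Re (f x) * Re m) - (Im l * Im (g x) + Im (f x) * Im m))
      by (reim; ring).
    exact (is_derive_minus (V := R_NormedModule) _ _ x _ _
      (is_derive_Rmult _ _ _ _ _ H1 H3) (is_derive_Rmult _ _ _ _ _ H2 H4)).
  - apply (is_derive_ext (fun u => Re (f u) * Im (g u) + Im (f u) * Re (g u)));
      [intros u; reim; reflexivity|].
    replace (Im (l * g x + f x * m)) with
      ((Re l * Im (g x) + Re (f x) * Im m) + (Im l * Re (g x) + Im (f x) * Re m))
      by (reim; ring).
    exact (is_derive_plus (V := R_NormedModule) _ _ x _ _
      (is_derive_Rmult _ _ _ _ _ H1 H4) (is_derive_Rmult _ _ _ _ _ H2 H3)).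
Qed.

Lemma Cinv_re (z : C) : Re (/ z) = Re z / (Re z * Re z + Im z * Im z).
Proof. unfold Cinv, Re, Im; simpl. f_equal; ring. Qed.

Lemma Cinv_im (z : C) : Im (/ z) = - Im z / (Re z * Re z + Im z * Im z).
Proof. unfold Cinv, Re, Im; simpl. f_equal; ring. Qed.

Lemma Csqr_pos (z : C) : z <> 0 -> 0 < Re z * Re z + Im z * Im z.
Proof. intros H. rewrite <- Cmod_sqr. pose proof (Cmod_pos z H). nra. Qed.

Lemma pder_inv (f : R -> C) (x : R) (l : C) :
  f x <> 0 -> pder f x l -> pder (fun u => / f u)%C x (- l / (f x * f x))%C.
Proof.
  intros Hf [H1 H2]. pose proof (Csqr_pos _ Hf) as Hp.
  set (N := fun u => Re (f u) * Re (f u) + Im (f u) * Im (f u)).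
  assert (HN : is_derive N x (2 * (Re (f x) * Re l + Im (f x) * Im l))).
  { replace (2 * (Re (f x) * Re l + Im (f x) * Im l)) with
      ((Re l * Re (f x) + Re (f x) * Re l) + (Im l * Im (f x) + Im (f x) * Im l)) by ring.
    exact (is_derive_plus (V := R_NormedModule) _ _ x _ _
      (is_derive_Rmult _ _ _ _ _ H1 H1) (is_derive_Rmult _ _ _ _ _ H2 H2)). }
  (* [num] is [- l] times the square of the conjugate of [f x]; over the real denominator [N^2] both
     components become derivatives of real quotients. *)
  pose (num := ((- Re l) * (Re (f x) * Re (f x) - Im (f x) * Im (f x)) - Im l * (2 * Re (f x) * Im (f x)),
     (- Im l) * (Re (f x) * Re (f x) - Im (f x) * Im (f x)) + Re l * (2 * Re (f x) * Im (f x))) : C).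
  assert (E : (- l / (f x * f x))%C = (num / RtoC (N x * N x))%C).
  { assert (Hn : RtoC (N x * N x) <> 0)
      by (intros E; apply RtoC_inj in E; unfold N in E; nra).
    assert (EN : RtoC (N x) = (f x * Cconj (f x))%C) by (apply C_ext; reim; unfold N; ring).
    assert (Hc : Cconj (f x) <> 0) by (apply Cmod_neq; rewrite Cmod_conj; apply Cmod_pos, Hf).
    rewrite RtoC_mult, EN.
    transitivity (- l * (Cconj (f x) * Cconj (f x)) / (f x * Cconj (f x) * (f x * Cconj (f x))))%C.
    - field. auto.
    - f_equal. unfold num. apply C_ext; reim; ring. }
  rewrite E. clear E.
  assert (HNx : N x <> 0) by (unfold N; lra).
  assert (HNN : RtoC (N x * N x) <> 0) by (intros E; apply RtoC_inj in E; nra).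
  assert (Ediv : forall z : C, (z / RtoC (N x * N x))%C = (Re z / (N x * N x), Im z / (N x * N x))).
  { intros z. apply C_ext; unfold Cdiv; rewrite <- RtoC_inv by nra; reim; unfold Rdiv; ring. }
  rewrite Ediv. unfold num. split; reim.
  - apply (is_derive_ext (fun u => Re (f u) / N u)); [intros u; rewrite Cinv_re; reflexivity|].
    refine (eq_ind _ (fun d => is_derive _ x d) (is_derive_div _ N x _ _ H1 HN HNx) _ _).
    eqR. unfold N in HNx |- *. field. exact HNx.
  - apply (is_derive_ext (fun u => - Im (f u) / N u)); [intros u; rewrite Cinv_im; reflexivity|].
    refine (eq_ind _ (fun d => is_derive _ x d)
      (is_derive_div _ N x _ _ (is_derive_opp (V := R_NormedModule) _ x _ H2) HN HNx) _ _).
    change opp with Ropp. eqR. unfold N in HNx |- *. field. exact HNx.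
Qed.

(** Passage from componentwise derivatives to a first-order expansion, where moduli can be estimated
    directly. *)
Lemma pder_eps (g : R -> C) (x : R) (l : C) :
  pder g x l <-> forall eps, 0 < eps -> exists del, 0 < del /\
    forall u, Rabs u < del -> Cmod (g (x + u)%R - g x - u * l) <= eps * Rabs u.
Proof.
  split.
  - intros [H1 H2] eps He.
    apply is_derive_Reals in H1. apply is_derive_Reals in H2.
    destruct (H1 (eps / 2) ltac:(lra)) as [d1 K1]. destruct (H2 (eps / 2) ltac:(lra)) as [d2 K2].
    exists (Rmin d1 d2). split; [apply Rmin_glb_lt; apply cond_pos|].
    intros u Hu. destruct (Req_dec u 0) as [->|Hu0].
    + rewrite Rplus_0_r, Rabs_R0.
      replace (g x - g x - 0 * l)%C with (RtoC 0) by ring. rewrite Cmod_0; lra.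
    + specialize (K1 u Hu0 ltac:(eapply Rlt_le_trans; [exact Hu|apply Rmin_l])).
      specialize (K2 u Hu0 ltac:(eapply Rlt_le_trans; [exact Hu|apply Rmin_r])).
      eapply Rle_trans; [apply Cmod_le_sum|]. reim.
      assert (Hu' : 0 < Rabs u) by (apply Rabs_pos_lt; assumption).
      assert (T : forall a b m, Rabs ((a - b) / u - m) < eps / 2 ->
        Rabs (a - b - u * m) <= eps / 2 * Rabs u).
      { intros a b m Hm. replace (a - b - u * m) with (((a - b) / u - m) * u) by (field; assumption).
        rewrite Rabs_mult. nra. }
      apply T in K1. apply T in K2.
      replace (u * Re l - 0 * Im l) with (u * Re l) by ring.
      replace (u * Im l + 0 * Re l) with (u * Im l) by ring. lra.
  - intros H.
    assert (T : forall (P : C -> R), (forall z w, P (z - w)%C = P z - P w) ->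
      (forall r z, P (RtoC r * z)%C = r * P z) -> (forall z, Rabs (P z) <= Cmod z) ->
      is_derive (fun u => P (g u)) x (P l)).
    { intros P P1 P2 P3. apply is_derive_Reals. intros eps He.
      destruct (H (eps / 2) ltac:(lra)) as (d & Hd & K).
      exists (mkposreal d Hd). intros u Hu0 Hu. simpl in Hu. specialize (K u Hu).
      assert (Hu' : 0 < Rabs u) by (apply Rabs_pos_lt; assumption).
      replace ((P (g (x + u)%R) - P (g x)) / u - P l) with
        (P (g (x + u)%R - g x - u * l)%C / u) by (rewrite !P1, P2; field; assumption).
      rewrite Rabs_div by assumption.
      apply Rmult_lt_reg_r with (Rabs u); [assumption|].
      unfold Rdiv at 1. rewrite Rmult_assoc, Rinv_l, Rmult_1_r by lra.
      eapply Rle_lt_trans; [apply P3|]. nra. }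
    split; apply T; intros.
    + reflexivity. + rewrite re_mult; reim; ring. + apply re_le_Cmod.
    + reflexivity. + rewrite im_mult; reim; ring. + apply Im_le_Cmod.
Qed.

Lemma pder_lipschitz (g : R -> C) (x : R) (l : C) : pder g x l ->
  exists del, 0 < del /\ forall u, Rabs u < del -> Cmod (g (x + u)%R - g x) <= (1 + Cmod l) * Rabs u.
Proof.
  intros H. destruct (proj1 (pder_eps g x l) H 1 Rlt_0_1) as (d & Hd & K).
  exists d. split; [assumption|]. intros u Hu. specialize (K u Hu).
  replace (g (x + u)%R - g x)%C with ((g (x + u)%R - g x - u * l) + u * l)%C by ring.
  eapply Rle_trans; [apply Cmod_triangle|]. rewrite Cmod_mult, Cmod_R. nra.
Qed.

(* Complex derivative, expressed by the chain rule along differentiable paths. *)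
Definition cder (F : C -> C) (z d : C) : Prop :=
  forall g x l, g x = z -> pder g x l -> pder (fun u => F (g u)) x (d * l)%C.

(** A differentiable path is Lipschitz at the point, with constant [Lp], so a remainder quadratic in
    the displacement is negligible against the parameter. *)
Lemma cder_quadratic (F : C -> C) (z d : C) (M r : R) :
  0 < r -> (forall h, Cmod h < r -> Cmod (F (z + h)%C - F z - d * h) <= M * Cmod h * Cmod h) ->
  cder F z d.
Proof.
  intros Hr HM g x l Hg H. apply pder_eps. intros eps He.
  destruct (pder_lipschitz _ _ _ H) as (d1 & Hd1 & K1).
  set (Lp := 1 + Cmod l) in *. assert (HL : 0 < Lp) by (unfold Lp; pose proof (Cmod_ge_0 l); lra).
  set (D := Cmod d + 1). assert (HD : 0 < D) by (unfold D; pose proof (Cmod_ge_0 d); lra).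
  set (M' := Rabs M + 1). pose proof (Rabs_pos M). pose proof (Rle_abs M).
  destruct (proj1 (pder_eps g x l) H (eps / (2 * D))) as (d2 & Hd2 & K2).
  { apply Rdiv_lt_0_compat; lra. }
  (* For a parameter increment [u] below [q] in absolute value, the quadratic remainder
     [M' (Lp |u|)^2] is at most [eps / 2 |u|]. *)
  set (q := eps / (2 * M' * Lp * Lp)).
  assert (HM' : 0 < M') by (unfold M'; lra).
  assert (Hq : 0 < q) by (apply Rdiv_lt_0_compat; [|repeat apply Rmult_lt_0_compat]; lra).
  exists (Rmin (Rmin d1 d2) (Rmin (r / Lp) q)). split.
  { repeat apply Rmin_glb_lt; try assumption. apply Rdiv_lt_0_compat; assumption. }
  intros u Hu.
  assert (Hu1 : Rabs u < d1) by (eapply Rlt_le_trans; [exact Hu|eapply Rle_trans; [apply Rmin_l|apply Rmin_l]]).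
  assert (Hu2 : Rabs u < d2) by (eapply Rlt_le_trans; [exact Hu|eapply Rle_trans; [apply Rmin_l|apply Rmin_r]]).
  assert (Hu3 : Rabs u < r / Lp) by (eapply Rlt_le_trans; [exact Hu|eapply Rle_trans; [apply Rmin_r|apply Rmin_l]]).
  assert (Hu4 : Rabs u < q) by (eapply Rlt_le_trans; [exact Hu|eapply Rle_trans; [apply Rmin_r|apply Rmin_r]]).
  specialize (K1 u Hu1). specialize (K2 u Hu2).
  set (h := (g (x + u)%R - g x)%C) in *. pose proof (Rabs_pos u) as Hau.
  assert (Hh : Cmod h < r).
  { eapply Rle_lt_trans; [exact K1|].
    apply Rmult_lt_compat_l with (r := Lp) in Hu3; [|assumption].
    replace (Lp * (r / Lp)) with r in Hu3 by (field; lra). assumption. }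
  specialize (HM h Hh).
  replace (z + h)%C with (g (x + u)%R) in HM by (unfold h; rewrite Hg; ring).
  rewrite Hg.
  replace (F (g (x + u)%R) - F z - u * (d * l))%C with
    ((F (g (x + u)%R) - F z - d * h) + d * (h - u * l))%C by ring.
  eapply Rle_trans; [apply Cmod_triangle|]. rewrite Cmod_mult.
  assert (A1 : Cmod d * Cmod (h - u * l) <= eps / 2 * Rabs u).
  { apply Rle_trans with (D * (eps / (2 * D) * Rabs u)).
    - apply Rmult_le_compat; try apply Cmod_ge_0; [unfold D; lra|exact K2].
    - right; field; lra. }
  assert (A2 : M * Cmod h * Cmod h <= eps / 2 * Rabs u).
  { pose proof (Cmod_ge_0 h) as Hh0.
    apply Rle_trans with (M' * ((Lp * Rabs u) * (Lp * Rabs u))).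
    - rewrite Rmult_assoc. apply Rle_trans with (M' * (Cmod h * Cmod h)).
      + apply Rmult_le_compat_r; [nra|unfold M'; lra].
      + apply Rmult_le_compat_l; [lra|]. apply Rmult_le_compat; assumption.
    - replace (M' * (Lp * Rabs u * (Lp * Rabs u))) with (M' * Lp * Lp * Rabs u * Rabs u) by ring.
      apply Rmult_le_compat_r; [assumption|].
      apply Rle_trans with (M' * Lp * Lp * q).
      + apply Rmult_le_compat_l; [repeat apply Rmult_le_pos; lra|lra].
      + right; unfold q; field; lra. }
  lra.
Qed.

Lemma cder_ext (F G : C -> C) (z d : C) : (forall v, F v = G v) -> cder F z d -> cder G z d.
Proof.
  intros H K g x l Hg Hp. apply (pder_ext (fun u => F (g u))); [intros; apply H|].
  apply K; assumption.
Qed.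

Lemma cder_mult (F G : C -> C) (z d e : C) :
  cder F z d -> cder G z e -> cder (fun v => F v * G v)%C z (d * G z + F z * e)%C.
Proof.
  intros H K g x l Hg Hp.
  apply (pder_eq _ _ (d * l * G (g x) + F (g x) * (e * l))%C); [rewrite Hg; ring|].
  apply pder_mult; [apply H|apply K]; assumption.
Qed.

Lemma cder_minus (F G : C -> C) (z d e : C) :
  cder F z d -> cder G z e -> cder (fun v => F v - G v)%C z (d - e)%C.
Proof.
  intros H K g x l Hg Hp.
  apply (pder_eq _ _ (d * l - e * l)%C); [ring|].
  apply pder_minus; [apply H|apply K]; assumption.
Qed.

Lemma cder_id (z : C) : cder (fun v => v) z 1.
Proof. intros g x l Hg Hp. apply (pder_eq _ _ l); [ring|assumption]. Qed.

Lemma cder_const (c z : C) : cder (fun _ => c) z 0.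
Proof. intros g x l Hg Hp. apply (pder_eq _ _ 0); [ring|apply pder_const]. Qed.

Lemma cder_inv (F : C -> C) (z d : C) :
  F z <> 0 -> cder F z d -> cder (fun v => / F v)%C z (- d / (F z * F z))%C.
Proof.
  intros Hz H g x l Hg Hp.
  apply (pder_eq _ _ (- (d * l) / (F (g x) * F (g x)))%C); [rewrite Hg; field; assumption|].
  apply (pder_inv (fun u => F (g u))); [rewrite Hg; assumption|]. apply H; assumption.
Qed.

Lemma cder_div (F G : C -> C) (z d e : C) :
  G z <> 0 -> cder F z d -> cder G z e ->
  cder (fun v => F v / G v)%C z ((d * G z - F z * e) / (G z * G z))%C.
Proof.
  intros Hz H K.
  replace ((d * G z - F z * e) / (G z * G z))%C with
    (d * / G z + F z * (- e / (G z * G z)))%C by (field; assumption).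
  apply (cder_mult F (fun v => / G v)%C); [assumption|apply cder_inv; assumption].
Qed.

Lemma cder_pder_segment (F : C -> C) (z v d : C) (x : R) :
  cder F (z + x * v)%C d -> pder (fun u => F (z + RtoC u * v)%C) x (d * v)%C.
Proof.
  intros H. apply (H (fun u => (z + RtoC u * v)%C)); [reflexivity|].
  apply (pder_eq _ _ (0 + (1 * v + x * 0))%C); [ring|].
  apply pder_plus; [apply pder_const|].
  apply (pder_mult (fun u => RtoC u) (fun _ => v)); [apply pder_id|apply pder_const].
Qed.

Lemma pder_unique (f : R -> C) (x : R) (l m : C) : pder f x l -> pder f x m -> l = m.
Proof.
  intros [H1 H2] [H3 H4]. apply C_ext.
  - rewrite <- (is_derive_unique _ _ _ H1). apply is_derive_unique; assumption.
  - rewrite <- (is_derive_unique _ _ _ H2). apply is_derive_unique; assumption.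
Qed.

Lemma cder_unique (F : C -> C) (z d e : C) : cder F z d -> cder F z e -> d = e.
Proof.
  intros H K.
  pose proof (cder_pder_segment F z 1 d 0) as H1. pose proof (cder_pder_segment F z 1 e 0) as K1.
  replace (z + 0 * 1)%C with z in H1, K1 by ring.
  specialize (H1 H). specialize (K1 K).
  pose proof (pder_unique _ _ _ _ H1 K1) as E. rewrite !Cmult_1_r in E. exact E.
Qed.

Lemma pder_zero_const (f : R -> C) (a b : R) :
  a <= b -> (forall u, a <= u <= b -> pder f u 0) -> f a = f b.
Proof.
  intros Hab H.
  assert (T : forall g : R -> R, (forall u, a <= u <= b -> is_derive g u 0) -> g a = g b).
  { intros g Hg. destruct (MVT_gen g a b (fun _ => 0)) as (c & _ & E).
    - intros u Hu. rewrite Rmin_left, Rmax_right in Hu by assumption. apply Hg; lra.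
    - intros u Hu. rewrite Rmin_left, Rmax_right in Hu by assumption.
      apply continuity_pt_filterlim, (ex_derive_continuous g u). eexists; apply Hg; lra.
    - lra. }
  apply C_ext.
  - apply (T (fun u => Re (f u))). intros u Hu. exact (proj1 (H u Hu)).
  - apply (T (fun u => Im (f u))). intros u Hu. exact (proj2 (H u Hu)).
Qed.

(** * Termwise differentiation of power series *)

Lemma pow_n2_bound (n : nat) : INR n * INR n <= 4 * 2 ^ n.
Proof.
  assert (H : forall n, INR n <= 2 ^ n /\ INR n * INR n + INR n * 2 + 2 <= 4 * 2 ^ n \/ (n <= 2)%nat).
  { clear n. induction n as [|n IH]; [right; lia|].
    destruct (Nat.le_gt_cases (S n) 2) as [?|Hn]; [right; assumption|left].
    destruct IH as [[I1 I2]|I].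
    - rewrite S_INR. simpl. assert (1 <= 2 ^ n) by (apply pow_R1_Rle; lra). split; [lra|].
      destruct (Nat.eq_dec n 0) as [->|]; [lia|].
      assert (1 <= INR n) by (apply (le_INR 1); lia). nra.
    - assert (n = 2%nat) by lia. subst n. simpl. lra. }
  destruct (H n) as [[H1 H2]|Hn].
  - pose proof (pos_INR n). lra.
  - destruct n as [|[|[|n]]]; simpl; try lra. lia.
Qed.

Definition ev_deriv (a : nat -> C) (n : nat) : C := (RtoC (INR (S n)) * a (S n))%C.

Lemma entire_coef_weight (a : nat -> C) (r : R) : entire_coef a -> 1 <= r ->
  ex_series (fun n => Cmod (a n) * (INR n * INR n * r ^ n)).
Proof.
  intros Ha Hr. apply (ex_series_le_abs _ (fun n => 4 * (Cmod (a n) * (2 * r) ^ n))).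
  - intros n. rewrite Rpow_mult_distr. pose proof (Cmod_ge_0 (a n)). pose proof (pos_INR n).
    pose proof (pow_n2_bound n). assert (0 <= r ^ n) by (apply pow_le; lra).
    rewrite Rabs_pos_eq by (repeat apply Rmult_le_pos; assumption).
    replace (4 * (Cmod (a n) * (2 ^ n * r ^ n))) with (Cmod (a n) * ((4 * 2 ^ n) * r ^ n)) by ring.
    apply Rmult_le_compat_l; [assumption|]. apply Rmult_le_compat_r; assumption.
  - exact (ex_series_scal_l 4 _ (Ha (2 * r) ltac:(lra))).
Qed.

Lemma entire_coef_deriv (a : nat -> C) : entire_coef a -> entire_coef (ev_deriv a).
Proof.
  intros Ha. apply entire_coef_bounded. intros r Hr.
  destruct (entire_coef_bound a (2 * r) Ha ltac:(lra)) as (B & HB0 & HB).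
  exists (4 * B). intros n. unfold ev_deriv.
  rewrite Cmod_mult, Cmod_R, Rabs_pos_eq by apply pos_INR.
  specialize (HB (S n)). pose proof (Cmod_ge_0 (a (S n))).
  assert (Hn : INR (S n) <= 4 * 2 ^ S n).
  { pose proof (pow_n2_bound (S n)). assert (1 <= INR (S n)) by (apply (le_INR 1); lia). nra. }
  rewrite Rpow_mult_distr in HB.
  apply Rle_trans with (4 * (Cmod (a (S n)) * (2 ^ S n * r ^ S n))); [|lra].
  assert (0 <= r ^ n) by (apply pow_le; lra).
  assert (r ^ n <= r ^ S n) by (simpl; nra).
  replace (4 * (Cmod (a (S n)) * (2 ^ S n * r ^ S n))) with
    (4 * 2 ^ S n * Cmod (a (S n)) * r ^ S n) by ring.
  apply Rmult_le_compat; try assumption.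
  - apply Rmult_le_pos; [apply pos_INR|assumption].
  - apply Rmult_le_compat_r; assumption.
Qed.

(** The Taylor remainders satisfy [E_(n+1) = (z + h) E_n + n z^(n-1) h^2], and
    [n^2 + n <= (n + 1)^2]. The condition [1 <= rho] allows every power of [rho] to be raised to
    [rho^(n+1)]. *)
Lemma Cpow_taylor_bound (z h : C) (rho : R) (n : nat) :
  1 <= rho -> Cmod z <= rho -> Cmod (z + h) <= rho ->
  Cmod ((z + h) ^ n - z ^ n - RtoC (INR n) * z ^ pred n * h) <=
  INR n * INR n * rho ^ n * (Cmod h * Cmod h).
Proof.
  intros Hr Hz Hzh. pose proof (Cmod_ge_0 h) as Hh0.
  induction n as [|n IH].
  - simpl. replace (1 - 1 - 0 * 1 * h)%C with (RtoC 0) by ring. rewrite Cmod_0; lra.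
  - set (E := ((z + h) ^ n - z ^ n - RtoC (INR n) * z ^ pred n * h)%C) in *.
    replace ((z + h) ^ S n - z ^ S n - RtoC (INR (S n)) * z ^ pred (S n) * h)%C with
      ((z + h) * E + RtoC (INR n) * z ^ pred n * (h * h))%C.
    2:{ unfold E. rewrite S_INR, RtoC_plus. simpl pred. destruct n as [|n].
        - simpl. ring.
        - simpl pred. rewrite !(Cpow_S _ (S n)), !(Cpow_S z n). ring. }
    eapply Rle_trans; [apply Cmod_triangle|]. rewrite !Cmod_mult, Cmod_R, Cmod_pow.
    rewrite (Rabs_pos_eq (INR n)) by apply pos_INR. pose proof (pos_INR n) as Hn.
    assert (Hp : Cmod z ^ pred n <= rho ^ n).
    { apply Rle_trans with (rho ^ pred n).
      - apply pow_incr; split; [apply Cmod_ge_0|assumption].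
      - apply Rle_pow; [assumption|lia]. }
    assert (Hrn : 0 <= rho ^ n) by (apply pow_le; lra).
    assert (H1 : Cmod (z + h) * Cmod E <= rho * (INR n * INR n * rho ^ n * (Cmod h * Cmod h))).
    { apply Rmult_le_compat; try apply Cmod_ge_0; assumption. }
    assert (H2 : INR n * Cmod z ^ pred n * (Cmod h * Cmod h) <= INR n * (rho * rho ^ n) * (Cmod h * Cmod h)).
    { apply Rmult_le_compat_r; [nra|]. apply Rmult_le_compat_l; [assumption|]. nra. }
    rewrite S_INR. simpl (rho ^ S n).
    assert (0 <= rho * rho ^ n * (Cmod h * Cmod h)) by (repeat apply Rmult_le_pos; lra).
    nra.
Qed.

Lemma ev_taylor (a : nat -> C) (rho : R) : entire_coef a -> 1 <= rho ->
  exists M, 0 <= M /\ forall z h, Cmod z <= rho -> Cmod (z + h) <= rho ->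
    Cmod (ev a (z + h) - ev a z - ev (ev_deriv a) z * h) <= M * Cmod h * Cmod h.
Proof.
  intros Ha Hr. pose proof (entire_coef_weight a rho Ha Hr) as Hw.
  set (S := Series (fun n => Cmod (a n) * (INR n * INR n * rho ^ n))).
  exists (2 * Rabs S). split; [pose proof (Rabs_pos S); lra|].
  intros z h Hz Hzh.
  assert (Hd : ex_Csum (fun n => a n * (RtoC (INR n) * z ^ pred n))%C).
  { apply (ex_series_incr_1 (fun n => Cmod (a n * (RtoC (INR n) * z ^ pred n))%C)).
    apply (ex_series_ext_R (fun n => Cmod (ev_deriv a n * z ^ n)%C)).
    - intros n. f_equal. unfold ev_deriv. simpl pred. ring.
    - apply (ex_ev _ z (entire_coef_deriv a Ha)). }
  assert (E : ev (ev_deriv a) z = Csum (fun n => a n * (RtoC (INR n) * z ^ pred n))%C).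
  { rewrite (Csum_S _ Hd). simpl (INR 0). rewrite Cmult_0_l, Cmult_0_r, Cplus_0_l.
    apply Csum_ext. intros n. unfold ev_deriv. simpl pred. ring. }
  replace (ev a (z + h) - ev a z - ev (ev_deriv a) z * h)%C with
    (Csum (fun n => a n * ((z + h) ^ n - z ^ n - RtoC (INR n) * z ^ pred n * h))%C).
  - eapply Rle_trans.
    + apply (Cmod_Csum_le _ (fun n => Cmod h * Cmod h * (Cmod (a n) * (INR n * INR n * rho ^ n)))).
      * intros n. rewrite Cmod_mult. pose proof (Cpow_taylor_bound z h rho n Hr Hz Hzh).
        pose proof (Cmod_ge_0 (a n)). nra.
      * exact (ex_series_scal_l (Cmod h * Cmod h) _ Hw).
    + rewrite Series_scal_l. fold S. pose proof (Cmod_ge_0 h). pose proof (Rle_abs S). nra.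
  - rewrite E. unfold ev.
    pose proof (ex_ev a z Ha) as H1. pose proof (ex_ev a (z + h)%C Ha) as H2.
    replace (Csum (fun n => a n * (z + h) ^ n) - Csum (fun n => a n * z ^ n)
       - Csum (fun n => a n * (RtoC (INR n) * z ^ pred n)) * h)%C with
      (Csum (fun n => a n * (z + h) ^ n)%C + (- (1) * Csum (fun n => a n * z ^ n)
       + (- h) * Csum (fun n => a n * (RtoC (INR n) * z ^ pred n))))%C by ring.
    rewrite <- !Csum_scal, <- !Csum_plus by
      (repeat (assumption || apply ex_Csum_plus || apply ex_Csum_scal)).
    apply Csum_ext. intros n. ring.
Qed.

(** The first clause speaks only of differentiable paths; the second, a remainder bound uniform on
    discs, is what yields continuity in the plane. *)
Definition deriv_of (F F' : C -> C) : Prop :=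
  (forall z, cder F z (F' z)) /\
  forall rho, 1 <= rho -> exists M, 0 <= M /\ forall z h, Cmod z <= rho -> Cmod (z + h) <= rho ->
    Cmod (F (z + h)%C - F z - F' z * h) <= M * Cmod h * Cmod h.

Lemma ev_deriv_of (a : nat -> C) : entire_coef a -> deriv_of (ev a) (ev (ev_deriv a)).
Proof.
  intros Ha. split.
  - intros z. pose proof (Cmod_ge_0 z) as Hz.
    destruct (ev_taylor a (Cmod z + 1) Ha ltac:(lra)) as (M & HM & K).
    apply (cder_quadratic _ _ _ M 1); [lra|].
    intros h Hh. apply K; [lra|]. eapply Rle_trans; [apply Cmod_triangle|lra].
  - intros rho Hr. apply ev_taylor; assumption.
Qed.

Lemma entire_deriv (F : C -> C) : entire F -> exists F', entire F' /\ deriv_of F F'.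
Proof.
  intros (a & Ha & E). exists (ev (ev_deriv a)). split.
  - exists (ev_deriv a). split; [apply entire_coef_deriv; assumption|reflexivity].
  - destruct (ev_deriv_of a Ha) as [K1 K2]. split.
    + intros z. apply (cder_ext (ev a)); [intros; symmetry; apply E|apply K1].
    + intros rho Hr. destruct (K2 rho Hr) as (M & HM & K). exists M. split; [assumption|].
      intros z h. rewrite !E. apply K.
Qed.

Lemma cder_Cexp (z : C) : cder Cexp z (Cexp z).
Proof.
  intros g x l Hg [H1 H2]. split; reim.
  - replace (_ - _) with
      ((Re l * exp (Re (g x))) * cos (Im (g x)) + exp (Re (g x)) * (Im l * - sin (Im (g x))))
      by (rewrite Hg; ring).
    apply (is_derive_Rmult (fun u => exp (Re (g u))) (fun u => cos (Im (g u)))).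
    + exact (is_derive_comp exp _ x _ _ (is_derive_exp _) H1).
    + exact (is_derive_comp cos _ x _ _ (is_derive_cos _) H2).
  - replace (_ + _) with
      ((Re l * exp (Re (g x))) * sin (Im (g x)) + exp (Re (g x)) * (Im l * cos (Im (g x))))
      by (rewrite Hg; ring).
    apply (is_derive_Rmult (fun u => exp (Re (g u))) (fun u => sin (Im (g u)))).
    + exact (is_derive_comp exp _ x _ _ (is_derive_exp _) H1).
    + exact (is_derive_comp sin _ x _ _ (is_derive_sin _) H2).
Qed.

Lemma cder_comp (F G : C -> C) (z d e : C) :
  cder G z e -> cder F (G z) d -> cder (fun v => F (G v)) z (d * e)%C.
Proof.
  intros HG HF g x l Hg Hp.
  apply (pder_eq _ _ (d * (e * l))%C); [ring|].
  apply (HF (fun u => G (g u))); [rewrite Hg; reflexivity|]. apply HG; assumption.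
Qed.

(* Both [S(z) = sum z^n / n!] and [Cexp] solve [F' = F], so [S(uz) Cexp(-uz)] is constant in [u]. *)
Lemma entire_Cexp : entire Cexp.
Proof.
  set (a := fun n => RtoC (/ INR (fact n))).
  assert (Hf : forall n, 0 < INR (fact n)) by (intros n; apply INR_fact_lt_0).
  assert (Ha : entire_coef a).
  { intros r Hr. apply (ex_series_ext_R (fun n => / INR (fact n) * r ^ n)).
    - intros n. unfold a. rewrite Cmod_R, Rabs_pos_eq; [reflexivity|].
      left; apply Rinv_0_lt_compat, Hf.
    - exists (exp r). pose proof (is_exp_Reals r) as H.
      apply (is_series_ext (fun n => scal (pow_n r n) (/ INR (fact n)))); [|exact H].
      intros n. rewrite pow_n_pow. change scal with Rmult. apply Rmult_comm. }
  exists a. split; [assumption|].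
  assert (Hd : forall z, ev (ev_deriv a) z = ev a z).
  { intros z. apply Csum_ext. intros n. f_equal. unfold ev_deriv, a.
    rewrite <- RtoC_mult. f_equal. rewrite fact_simpl, mult_INR. field.
    split; [apply Rgt_not_eq, Hf|apply not_0_INR; lia]. }
  destruct (ev_deriv_of a Ha) as [Hder _].
  intros z.
  set (f := fun u : R => (ev a (0 + RtoC u * z) * Cexp (0 + RtoC u * - z))%C).
  assert (Hconst : f 0 = f 1).
  { apply pder_zero_const; [lra|]. intros u _. unfold f.
    apply (pder_eq _ _ (ev a (0 + u * z) * z * Cexp (0 + u * - z)
      + ev a (0 + u * z) * (Cexp (0 + u * - z) * - z))%C); [ring|].
    apply (pder_mult (fun u => ev a (0 + RtoC u * z)%C) (fun u => Cexp (0 + RtoC u * - z)%C)).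
    - apply cder_pder_segment. rewrite <- Hd. apply Hder.
    - apply cder_pder_segment, cder_Cexp. }
  unfold f in Hconst.
  replace (0 + 0 * z)%C with (RtoC 0) in Hconst by ring.
  replace (0 + 0 * - z)%C with (RtoC 0) in Hconst by ring.
  replace (0 + 1 * z)%C with z in Hconst by ring.
  replace (0 + 1 * - z)%C with (- z)%C in Hconst by ring.
  assert (E0 : ev a 0 = 1).
  { unfold ev. rewrite (Csum_S _ (ex_ev a 0 Ha)).
    rewrite (Csum_ext _ (fun n => 0 * (a n * 0 ^ n))%C) by (intros n; simpl; ring).
    rewrite Csum_scal by (apply (ex_ev a 0 Ha)). unfold a. simpl. rewrite Rinv_1. ring. }
  rewrite E0, Cexp_0, Cexp_opp in Hconst.
  pose proof (Cexp_neq_0 z) as Hz.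
  replace (ev a z) with (ev a z * / Cexp z * Cexp z)%C by (field; assumption).
  rewrite <- Hconst. ring.
Qed.

(** * Contour integrals and Cauchy's formula *)

Notation Ccontinuous f x := (@continuous _ C_UniformSpace f x).

Lemma Ccontinuous_pair {U : UniformSpace} (f : U -> C) (x : U) :
  continuous (fun u => Re (f u)) x -> continuous (fun u => Im (f u)) x -> Ccontinuous f x.
Proof.
  intros H1 H2. apply filterlim_locally. intros eps.
  generalize (proj1 (filterlim_locally _ _) H1 eps) (proj1 (filterlim_locally _ _) H2 eps).
  intros K1 K2. generalize (filter_and _ _ K1 K2). apply filter_imp.
  intros u [B1 B2]. split; assumption.
Qed.

Lemma Ccontinuous_re {U : UniformSpace} (f : U -> C) (x : U) :
  Ccontinuous f x -> continuous (fun u => Re (f u)) x.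
Proof.
  intros H. apply (continuous_comp f (fun z : C_UniformSpace => fst z)); [assumption|].
  destruct (f x) as [a b]. apply continuous_fst.
Qed.

Lemma Ccontinuous_im {U : UniformSpace} (f : U -> C) (x : U) :
  Ccontinuous f x -> continuous (fun u => Im (f u)) x.
Proof.
  intros H. apply (continuous_comp f (fun z : C_UniformSpace => snd z)); [assumption|].
  destruct (f x) as [a b]. apply continuous_snd.
Qed.

Lemma continuous_Rmult {U : UniformSpace} (f g : U -> R) (x : U) :
  continuous f x -> continuous g x -> continuous (fun u => f u * g u) x.
Proof. exact (continuous_mult (K := R_AbsRing) f g x). Qed.

Lemma continuous_Rplus {U : UniformSpace} (f g : U -> R) (x : U) :
  continuous f x -> continuous g x -> continuous (fun u => f u + g u) x.
Proof. exact (continuous_plus (V := R_NormedModule) f g x). Qed.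

Lemma continuous_Rminus {U : UniformSpace} (f g : U -> R) (x : U) :
  continuous f x -> continuous g x -> continuous (fun u => f u - g u) x.
Proof. exact (continuous_minus (V := R_NormedModule) f g x). Qed.

Lemma Ccontinuous_plus {U : UniformSpace} (f g : U -> C) (x : U) :
  Ccontinuous f x -> Ccontinuous g x -> Ccontinuous (fun u => f u + g u)%C x.
Proof.
  intros H K. apply Ccontinuous_pair.
  - apply (continuous_Rplus (fun u => Re (f u)) (fun u => Re (g u))); apply Ccontinuous_re; assumption.
  - apply (continuous_Rplus (fun u => Im (f u)) (fun u => Im (g u))); apply Ccontinuous_im; assumption.
Qed.

Lemma Ccontinuous_minus {U : UniformSpace} (f g : U -> C) (x : U) :
  Ccontinuous f x -> Ccontinuous g x -> Ccontinuous (fun u => f u - g u)%C x.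
Proof.
  intros H K. apply Ccontinuous_pair.
  - apply (continuous_Rminus (fun u => Re (f u)) (fun u => Re (g u))); apply Ccontinuous_re; assumption.
  - apply (continuous_Rminus (fun u => Im (f u)) (fun u => Im (g u))); apply Ccontinuous_im; assumption.
Qed.

Lemma Ccontinuous_mult {U : UniformSpace} (f g : U -> C) (x : U) :
  Ccontinuous f x -> Ccontinuous g x -> Ccontinuous (fun u => f u * g u)%C x.
Proof.
  intros H K. apply Ccontinuous_pair.
  - apply (continuous_Rminus (fun u => Re (f u) * Re (g u)) (fun u => Im (f u) * Im (g u)));
      apply continuous_Rmult; auto using Ccontinuous_re, Ccontinuous_im.
  - apply (continuous_Rplus (fun u => Re (f u) * Im (g u)) (fun u => Im (f u) * Re (g u)));
      apply continuous_Rmult; auto using Ccontinuous_re, Ccontinuous_im.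
Qed.

Lemma continuous_Rinv_comp {U : UniformSpace} (f : U -> R) (x : U) :
  f x <> 0 -> continuous f x -> continuous (fun u => / f u) x.
Proof. intros Hf H. apply (continuous_comp f Rinv); [assumption|]. apply continuous_Rinv; assumption. Qed.

Lemma Ccontinuous_inv {U : UniformSpace} (f : U -> C) (x : U) :
  f x <> 0 -> Ccontinuous f x -> Ccontinuous (fun u => / f u)%C x.
Proof.
  intros Hf H. pose proof (Csqr_pos _ Hf) as Hp.
  pose proof (Ccontinuous_re f x H) as H1. pose proof (Ccontinuous_im f x H) as H2.
  assert (HN : continuous (fun u => / (Re (f u) * Re (f u) + Im (f u) * Im (f u))) x).
  { apply continuous_Rinv_comp; [lra|].
    apply continuous_Rplus; apply continuous_Rmult; assumption. }
  apply Ccontinuous_pair.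
  - apply (continuous_ext (fun u => Re (f u) * / (Re (f u) * Re (f u) + Im (f u) * Im (f u)))).
    + intros u. rewrite Cinv_re. reflexivity.
    + apply continuous_Rmult; assumption.
  - apply (continuous_ext (fun u => - Im (f u) * / (Re (f u) * Re (f u) + Im (f u) * Im (f u)))).
    + intros u. rewrite Cinv_im. reflexivity.
    + apply continuous_Rmult; [|assumption]. exact (continuous_opp (V := R_NormedModule) _ x H2).
Qed.

Lemma Ccontinuous_div {U : UniformSpace} (f g : U -> C) (x : U) :
  g x <> 0 -> Ccontinuous f x -> Ccontinuous g x -> Ccontinuous (fun u => f u / g u)%C x.
Proof.
  intros Hg H K. apply (Ccontinuous_mult f (fun u => / g u)%C); [assumption|].
  apply Ccontinuous_inv; assumption.
Qed.

Lemma Ccontinuous_const {U : UniformSpace} (c : C) (x : U) : Ccontinuous (fun _ => c) x.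
Proof. apply (continuous_const (V := C_UniformSpace)). Qed.

Lemma Ccontinuous_RtoC {U : UniformSpace} (f : U -> R) (x : U) :
  continuous f x -> Ccontinuous (fun u => RtoC (f u)) x.
Proof. intros H. apply Ccontinuous_pair; reim; [assumption|apply continuous_const]. Qed.

Lemma Ccontinuous_eps (F : C -> C) (z : C) :
  (forall eps, 0 < eps -> exists del, 0 < del /\
    forall v, Cmod (v - z) < del -> Cmod (F v - F z) < eps) -> Ccontinuous F z.
Proof.
  intros H. apply filterlim_locally. intros eps.
  destruct (H eps (cond_pos eps)) as (d & Hd & K).
  exists (mkposreal (d / 2) ltac:(lra)). intros v [B1 B2].
  change (Rabs (Re (v - z)) < d / 2) in B1. change (Rabs (Im (v - z)) < d / 2) in B2.
  pose proof (Cmod_le_sum (v - z)) as Hle. specialize (K v ltac:(lra)).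
  split.
  - apply Rle_lt_trans with (Cmod (F v - F z)); [exact (re_le_Cmod (F v - F z))|assumption].
  - apply Rle_lt_trans with (Cmod (F v - F z)); [exact (Im_le_Cmod (F v - F z))|assumption].
Qed.

Lemma deriv_of_continuous (F F' : C -> C) (z : C) : deriv_of F F' -> Ccontinuous F z.
Proof.
  intros [_ H]. apply Ccontinuous_eps. intros eps He.
  pose proof (Cmod_ge_0 z) as Hz. pose proof (Cmod_ge_0 (F' z)) as HF'.
  destruct (H (Cmod z + 1) ltac:(lra)) as (M & HM & K).
  set (L := M + Cmod (F' z) + 1). assert (HL : 0 < L) by (unfold L; lra).
  exists (Rmin 1 (eps / L)). split; [apply Rmin_glb_lt; [lra|apply Rdiv_lt_0_compat; lra]|].
  intros v Hv. set (h := (v - z)%C) in *.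
  pose proof (Rmin_l 1 (eps / L)). pose proof (Rmin_r 1 (eps / L)) as Hr.
  assert (Ev : v = (z + h)%C) by (unfold h; ring).
  assert (Hzv : Cmod (z + h) <= Cmod z + 1).
  { eapply Rle_trans; [apply Cmod_triangle|lra]. }
  specialize (K z h ltac:(lra) Hzv). rewrite Ev.
  replace (F (z + h)%C - F z)%C with ((F (z + h)%C - F z - F' z * h) + F' z * h)%C by ring.
  eapply Rle_lt_trans; [apply Cmod_triangle|]. rewrite Cmod_mult.
  pose proof (Cmod_ge_0 h).
  assert (M * Cmod h * Cmod h <= M * Cmod h).
  { rewrite <- (Rmult_1_r (M * Cmod h)) at 2. apply Rmult_le_compat_l; [|lra].
    apply Rmult_le_pos; assumption. }
  apply Rle_lt_trans with (L * Cmod h); [unfold L; lra|].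
  apply Rmult_lt_reg_l with (/ L); [apply Rinv_0_lt_compat; assumption|].
  rewrite <- Rmult_assoc, Rinv_l, Rmult_1_l by lra.
  replace (/ L * eps) with (eps / L) by (field; lra). lra.
Qed.

(** * Integrals of complex-valued functions over real intervals *)

Definition CInt (f : R -> C) (a b : R) : C :=
  (RInt (fun u => Re (f u)) a b, RInt (fun u => Im (f u)) a b).

Lemma CInt_ext (f g : R -> C) (a b : R) : (forall u, f u = g u) -> CInt f a b = CInt g a b.
Proof.
  intros H. unfold CInt. f_equal; apply RInt_ext; intros u _; rewrite H; reflexivity.
Qed.

Definition cont_path (f : R -> C) : Prop := forall u : R, Ccontinuous f u.

Lemma pder_continuous (f : R -> C) (u : R) (l : C) : pder f u l -> Ccontinuous f u.
Proof.
  intros [H1 H2]. apply Ccontinuous_pair.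
  - apply (ex_derive_continuous (fun u => Re (f u)) u). eexists; exact H1.
  - apply (ex_derive_continuous (fun u => Im (f u)) u). eexists; exact H2.
Qed.

Lemma cont_path_ex (f : R -> C) (a b : R) : cont_path f ->
  ex_RInt (fun u => Re (f u)) a b /\ ex_RInt (fun u => Im (f u)) a b.
Proof.
  intros H. split; apply (ex_RInt_continuous (V := R_CompleteNormedModule)); intros u _.
  - apply Ccontinuous_re, H.
  - apply Ccontinuous_im, H.
Qed.

Lemma CInt_plus (f g : R -> C) (a b : R) : cont_path f -> cont_path g ->
  CInt (fun u => f u + g u)%C a b = (CInt f a b + CInt g a b)%C.
Proof.
  intros Hf Hg. destruct (cont_path_ex f a b Hf) as [F1 F2].
  destruct (cont_path_ex g a b Hg) as [G1 G2].
  unfold CInt. apply C_ext; reim.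
  - transitivity (RInt (fun u => Re (f u) + Re (g u)) a b).
    + apply RInt_ext. intros u _. reim. reflexivity.
    + exact (RInt_plus (V := R_CompleteNormedModule) _ _ a b F1 G1).
  - transitivity (RInt (fun u => Im (f u) + Im (g u)) a b).
    + apply RInt_ext. intros u _. reim. reflexivity.
    + exact (RInt_plus (V := R_CompleteNormedModule) _ _ a b F2 G2).
Qed.

Lemma CInt_scal (c : C) (f : R -> C) (a b : R) : cont_path f ->
  CInt (fun u => c * f u)%C a b = (c * CInt f a b)%C.
Proof.
  intros Hf. destruct (cont_path_ex f a b Hf) as [F1 F2].
  assert (S : forall (h : R -> R) (r : R), ex_RInt h a b ->
    ex_RInt (fun u => r * h u) a b /\ RInt (fun u => r * h u) a b = r * RInt h a b).
  { intros h r Hh. split.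
    - exact (ex_RInt_scal (V := R_NormedModule) h a b r Hh).
    - exact (RInt_scal (V := R_CompleteNormedModule) h a b r Hh). }
  destruct (S _ (Re c) F1) as [S1 E1]. destruct (S _ (Re c) F2) as [S2 E2].
  destruct (S _ (Im c) F1) as [S3 E3]. destruct (S _ (Im c) F2) as [S4 E4].
  unfold CInt. apply C_ext; reim.
  - rewrite <- E1, <- E4.
    transitivity (RInt (fun u => Re c * Re (f u) - Im c * Im (f u)) a b).
    + apply RInt_ext. intros u _. reim. reflexivity.
    + exact (RInt_minus (V := R_CompleteNormedModule) _ _ a b S1 S4).
  - rewrite <- E2, <- E3.
    transitivity (RInt (fun u => Re c * Im (f u) + Im c * Re (f u)) a b).
    + apply RInt_ext. intros u _. reim. reflexivity.
    + exact (RInt_plus (V := R_CompleteNormedModule) _ _ a b S2 S3).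
Qed.

Lemma CInt_const (c : C) (a b : R) : CInt (fun _ => c) a b = (RtoC (b - a) * c)%C.
Proof.
  unfold CInt. rewrite !(RInt_const (V := R_CompleteNormedModule)).
  change scal with Rmult. apply C_ext; reim; ring.
Qed.

Lemma CInt_bound (f : R -> C) (a b M : R) : a <= b -> cont_path f ->
  (forall u, a <= u <= b -> Cmod (f u) <= M) -> Cmod (CInt f a b) <= 2 * (M * (b - a)).
Proof.
  intros Hab Hf HM. destruct (cont_path_ex f a b Hf) as [F1 F2].
  eapply Rle_trans; [apply Cmod_le_sum|]. unfold CInt; reim.
  assert (T : forall h : R -> R, ex_RInt h a b -> (forall u, a <= u <= b -> Rabs (h u) <= M) ->
    Rabs (RInt h a b) <= (b - a) * M).
  { intros h Hh Hb. apply abs_RInt_le_const; assumption. }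
  assert (Rabs (RInt (fun u => Re (f u)) a b) <= (b - a) * M).
  { apply T; [assumption|]. intros u Hu. eapply Rle_trans; [apply re_le_Cmod|auto]. }
  assert (Rabs (RInt (fun u => Im (f u)) a b) <= (b - a) * M).
  { apply T; [assumption|]. intros u Hu. eapply Rle_trans; [apply Im_le_Cmod|auto]. }
  lra.
Qed.

Lemma CInt_Chasles (f : R -> C) (a b c : R) : cont_path f ->
  CInt f a c = (CInt f a b + CInt f b c)%C.
Proof.
  intros Hf. destruct (cont_path_ex f a b Hf) as [F1 F2].
  destruct (cont_path_ex f b c Hf) as [F3 F4].
  unfold CInt. apply C_ext; reim.
  - symmetry. exact (RInt_Chasles (V := R_CompleteNormedModule) _ a b c F1 F3).
  - symmetry. exact (RInt_Chasles (V := R_CompleteNormedModule) _ a b c F2 F4).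
Qed.

Lemma CInt_shift (f : R -> C) (a b v : R) : cont_path f ->
  CInt f (a + v) (b + v) = CInt (fun u => f (u + v)) a b.
Proof.
  intros Hf. destruct (cont_path_ex f (a + v) (b + v) Hf) as [F1 F2].
  assert (T : forall h : R -> R, ex_RInt h (a + v) (b + v) ->
    RInt h (a + v) (b + v) = RInt (fun u => h (u + v)) a b).
  { intros h Hh. rewrite <- (Rmult_1_l a), <- (Rmult_1_l b) in Hh.
    pose proof (RInt_comp_lin (V := R_CompleteNormedModule) h 1 v a b Hh) as E.
    rewrite !Rmult_1_l in E. rewrite <- E. apply RInt_ext. intros u _.
    transitivity (h (1 * u + v)); [exact (Rmult_1_l _)|rewrite Rmult_1_l; reflexivity]. }
  unfold CInt. rewrite !T by assumption. reflexivity.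
Qed.

Lemma CInt_pder (f df : R -> C) (a b : R) :
  (forall u, pder f u (df u)) -> cont_path df -> CInt df a b = (f b - f a)%C.
Proof.
  intros H Hc. unfold CInt. apply C_ext; reim.
  - apply is_RInt_unique.
    apply (is_RInt_derive (V := R_CompleteNormedModule) (fun u => Re (f u))); intros u _.
    + apply H.
    + apply Ccontinuous_re, Hc.
  - apply is_RInt_unique.
    apply (is_RInt_derive (V := R_CompleteNormedModule) (fun u => Im (f u))); intros u _.
    + apply H.
    + apply Ccontinuous_im, Hc.
Qed.

(** Intended for circles shrinking to a point: there the derivative is shown to vanish by cancelling
    a factor equal to the shrinking parameter, which is impossible at parameter 0. *)
Lemma pder_interior_zero_const (f f' : R -> C) (a b : R) :
  a <= b -> (forall u, a <= u <= b -> pder f u (f' u)) ->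
  (forall u, a < u < b -> f' u = 0) -> f a = f b.
Proof.
  intros Hab H H0.
  assert (T : forall g g' : R -> R, (forall u, a <= u <= b -> is_derive g u (g' u)) ->
    (forall u, a < u < b -> g' u = 0) -> g a = g b).
  { intros g g' Hg Hg0. destruct (MVT_gen g a b (fun _ => 0)) as (c & _ & E).
    - intros u Hu. rewrite Rmin_left, Rmax_right in Hu by assumption.
      rewrite <- (Hg0 u Hu). apply Hg; lra.
    - intros u Hu. rewrite Rmin_left, Rmax_right in Hu by assumption.
      apply continuity_pt_filterlim, (ex_derive_continuous g u). eexists; apply Hg; lra.
    - lra. }
  apply C_ext.
  - apply (T (fun u => Re (f u)) (fun u => Re (f' u))).
    + intros u Hu. exact (proj1 (H u Hu)).
    + intros u Hu. rewrite H0 by assumption. reflexivity.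
  - apply (T (fun u => Im (f u)) (fun u => Im (f' u))).
    + intros u Hu. exact (proj2 (H u Hu)).
    + intros u Hu. rewrite H0 by assumption. reflexivity.
Qed.

Lemma is_derive_RInt_param_global (f D : R -> R -> R) (a b x d : R) :
  0 < d -> (forall y t, Rabs (y - x) < d -> is_derive (fun u => f u t) y (D y t)) ->
  (forall t, continuous (fun p : R * R => D (fst p) (snd p)) (x, t)) ->
  (forall y, Rabs (y - x) < d -> ex_RInt (f y) a b) ->
  is_derive (fun u => RInt (f u) a b) x (RInt (D x) a b).
Proof.
  intros Hd H Hc Hex.
  rewrite (RInt_ext (D x) (fun t => Derive (fun u => f u t) x)).
  2:{ intros t _. symmetry. apply is_derive_unique, H.
      rewrite Rminus_diag, Rabs_R0; assumption. }
  apply (is_derive_RInt_param f a b x).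
  - exists (mkposreal d Hd). intros y Hy t _. exists (D y t). apply H. exact Hy.
  - intros t _. apply (continuity_2d_pt_ext_loc D).
    + exists (mkposreal d Hd). intros u v Hu _. symmetry. apply is_derive_unique, H. exact Hu.
    + apply continuity_2d_pt_filterlim. apply (Hc t).
  - exists (mkposreal d Hd). intros y Hy. apply Hex. exact Hy.
Qed.

Lemma pder_CInt_param (f D : R -> R -> C) (a b x d : R) :
  0 < d -> (forall y t, Rabs (y - x) < d -> pder (fun u => f u t) y (D y t)) ->
  (forall t, Ccontinuous (fun p : R * R => D (fst p) (snd p)) (x, t)) ->
  (forall y, Rabs (y - x) < d -> cont_path (f y)) ->
  pder (fun u => CInt (f u) a b) x (CInt (D x) a b).
Proof.
  intros Hd H Hc Hex. split; unfold CInt; reim.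
  - apply (is_derive_RInt_param_global (fun y t => Re (f y t)) (fun y t => Re (D y t)) a b x d).
    + assumption.
    + intros y t Hy. exact (proj1 (H y t Hy)).
    + intros t. apply (Ccontinuous_re (fun p : R * R => D (fst p) (snd p))), Hc.
    + intros y Hy. exact (proj1 (cont_path_ex (f y) a b (Hex y Hy))).
  - apply (is_derive_RInt_param_global (fun y t => Im (f y t)) (fun y t => Im (D y t)) a b x d).
    + assumption.
    + intros y t Hy. exact (proj2 (H y t Hy)).
    + intros t. apply (Ccontinuous_im (fun p : R * R => D (fst p) (snd p))), Hc.
    + intros y Hy. exact (proj2 (cont_path_ex (f y) a b (Hex y Hy))).
Qed.

(** The sign [sg] records the orientation; [sg = -1] serves for the reciprocals of the points of a
    positively oriented circle ([circ_inv]). *)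
Definition circ (rho sg alpha : R) : C := (RtoC rho * Cexp (0, (sg * alpha)%R))%C.

Lemma circ_pder (rho sg alpha : R) :
  pder (circ rho sg) alpha ((RtoC sg * Ci) * circ rho sg alpha)%C.
Proof.
  apply (pder_ext (fun u => RtoC rho * Cexp (0 + RtoC u * (RtoC sg * Ci)))%C).
  { intros u. unfold circ. do 2 f_equal. apply C_ext; reim; ring. }
  apply (pder_eq _ _ (0 * Cexp (0 + alpha * (sg * Ci)) +
    rho * (Cexp (0 + alpha * (sg * Ci)) * (sg * Ci)))%C).
  { unfold circ. replace (0 + alpha * (sg * Ci))%C with ((0, (sg * alpha)%R) : C)
      by (apply C_ext; reim; ring). ring. }
  apply (pder_mult (fun _ => RtoC rho) (fun u => Cexp (0 + RtoC u * (RtoC sg * Ci)))).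
  - apply pder_const.
  - apply cder_pder_segment, cder_Cexp.
Qed.

Lemma Cmod_circ (rho sg alpha : R) : 0 <= rho -> Cmod (circ rho sg alpha) = rho.
Proof.
  intros H. unfold circ. rewrite Cmod_mult, Cmod_R, Cmod_Cexp, Rabs_pos_eq by assumption.
  reim. rewrite exp_0; ring.
Qed.

Lemma circ_cont (rho sg : R) : cont_path (circ rho sg).
Proof. intros u. eapply pder_continuous, circ_pder. Qed.

Lemma Cmod_combination (t s : C) (rho u : R) :
  Cmod t <= rho -> Cmod s <= rho -> 0 <= u <= 1 -> Cmod (t + u * (s - t)) <= rho.
Proof.
  intros Ht Hs Hu. replace (t + u * (s - t))%C with (RtoC (1 - u) * t + RtoC u * s)%C
    by (rewrite RtoC_minus; ring).
  eapply Rle_trans; [apply Cmod_triangle|]. rewrite !Cmod_mult, !Cmod_R, !Rabs_pos_eq by lra.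
  nra.
Qed.

(* Shrinking the circle towards [t] leaves the weighted mean of [q] unchanged. *)
Lemma cauchy_weighted (q q' : C -> C) (k : R -> C) (t : C) (rho R1 sg a b : R) :
  0 < rho < R1 -> Cmod t <= rho -> sg <> 0 -> circ rho sg a = circ rho sg b ->
  (forall z, Cmod z < R1 -> cder q z (q' z)) ->
  (forall z, Cmod z < R1 -> Ccontinuous q' z) ->
  cont_path k -> (forall u, (k u * (circ rho sg u - t))%C = circ rho sg u) ->
  CInt (fun u => q (circ rho sg u) * k u)%C a b = (q t * CInt k a b)%C.
Proof.
  intros Hrho Ht Hsg Hper Hq Hq' Hk Hkt.
  set (s := circ rho sg) in *.
  set (p := fun (x u : R) => (t + RtoC x * (s u - t))%C).
  set (f := fun x u => (q (p x u) * k u)%C).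
  set (D := fun x u => (q' (p x u) * s u)%C).
  (* Changing [x] by less than [d] moves [p x u] by at most [(R1 - rho) / 2], so the integral can
     also be differentiated at the end points 0 and 1. *)
  set (d := (R1 - rho) / (4 * rho)).
  assert (Hd : 0 < d) by (apply Rdiv_lt_0_compat; lra).
  assert (Hs : forall u, Cmod (s u) = rho) by (intros u; apply Cmod_circ; lra).
  assert (Hp : forall x y u, 0 <= x <= 1 -> Rabs (y - x) < d -> Cmod (p y u) < R1).
  { intros x y u Hx Hy.
    replace (p y u) with (t + RtoC x * (s u - t) + RtoC (y - x) * (s u - t))%C
      by (unfold p; rewrite RtoC_minus; ring).
    eapply Rle_lt_trans; [apply Cmod_triangle|].
    pose proof (Cmod_combination t (s u) rho x Ht ltac:(rewrite Hs; lra) Hx).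
    rewrite Cmod_mult, Cmod_R.
    pose proof (Cmod_triangle_minus (s u) t) as Hst. rewrite Hs in Hst.
    assert (Rabs (y - x) * Cmod (s u - t) <= d * (2 * rho)).
    { apply Rmult_le_compat; [apply Rabs_pos|apply Cmod_ge_0|lra|lra]. }
    replace (d * (2 * rho)) with ((R1 - rho) / 2) in * by (unfold d; field; lra). lra. }
  assert (Hd0 : forall x : R, Rabs (x - x) < d) by (intros x; rewrite Rminus_diag, Rabs_R0; assumption).
  assert (Hsc : forall u, Ccontinuous s u) by apply circ_cont.
  assert (Hpu : forall x u, pder (p x) u (RtoC x * ((RtoC sg * Ci) * s u))%C).
  { intros x u. unfold p.
    apply (pder_eq _ _ (0 + (0 * (s u - t) + RtoC x * ((RtoC sg * Ci) * s u - 0)))%C); [ring|].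
    apply (pder_plus (fun _ => t)); [apply pder_const|].
    apply (pder_mult (fun _ => RtoC x)); [apply pder_const|].
    apply pder_minus; [apply circ_pder|apply pder_const]. }
  assert (Hqp : forall x u, 0 <= x <= 1 ->
    pder (fun v => q (p x v)) u (q' (p x u) * (RtoC x * ((RtoC sg * Ci) * s u)))%C).
  { intros x u Hx. apply (Hq (p x u)); [apply (Hp x); auto|reflexivity|apply Hpu]. }
  assert (HDc : forall x u, 0 <= x <= 1 -> Ccontinuous (fun v => D x v) u).
  { intros x u Hx. apply (Ccontinuous_mult (fun v => q' (p x v)) s); [|apply Hsc].
    apply (continuous_comp (V := C_UniformSpace) (p x) q').
    - eapply pder_continuous, Hpu.
    - apply Hq', (Hp x); auto. }
  assert (HI : CInt (f 0) a b = CInt (f 1) a b).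
  { apply (pder_interior_zero_const (fun x => CInt (f x) a b) (fun x => CInt (D x) a b)); [lra| |].
    - intros x Hx. apply (pder_CInt_param f D a b x d Hd).
      + intros y u Hy. unfold f, D.
        apply (pder_eq _ _ (q' (p y u) * (s u - t) * k u + q (p y u) * 0)%C).
        { transitivity (q' (p y u) * (k u * (s u - t)))%C; [ring|rewrite Hkt; reflexivity]. }
        apply (pder_mult (fun x => q (p x u)) (fun _ => k u)); [|apply pder_const].
        apply cder_pder_segment, Hq. apply (Hp x y u Hx Hy).
      + intros u. unfold D.
        assert (Hsnd : Ccontinuous (fun w : R * R => s (snd w)) (x, u)).
        { apply (continuous_comp (fun w : R * R => snd w) s); [apply continuous_snd|apply Hsc]. }
        apply (Ccontinuous_mult (fun w : R * R => q' (p (fst w) (snd w)))); [|exact Hsnd].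
        apply (continuous_comp (V := C_UniformSpace) (fun w : R * R => p (fst w) (snd w)) q').
        * unfold p. apply (Ccontinuous_plus (fun _ => t)); [apply Ccontinuous_const|].
          apply (Ccontinuous_mult (fun w : R * R => RtoC (fst w))).
          { apply Ccontinuous_RtoC, continuous_fst. }
          apply Ccontinuous_minus; [exact Hsnd|apply Ccontinuous_const].
        * apply Hq', (Hp x); auto.
      + intros y Hy u. unfold f. apply (Ccontinuous_mult (fun v => q (p y v))); [|apply Hk].
        eapply pder_continuous. apply (Hq (p y u)); [|reflexivity|apply Hpu].
        apply (Hp x y u Hx Hy).
    - intros x Hx.
      assert (Hc : (RtoC x * (RtoC sg * Ci))%C <> 0).
      { apply Cmod_neq. rewrite !Cmod_mult, !Cmod_R, Cmod_Ci.
        pose proof (Rabs_pos_lt x ltac:(lra)). pose proof (Rabs_pos_lt sg Hsg). nra. }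
      (* With this factor, [D x] is the derivative in [u] of [q (p x u)], which takes the same value
         at [a] and at [b]. *)
      assert (E : (RtoC x * (RtoC sg * Ci) * CInt (D x) a b)%C = 0).
      { rewrite <- CInt_scal by (intros u; apply HDc; lra).
        rewrite (CInt_pder (fun v => q (p x v))).
        - unfold p. fold s in Hper. rewrite Hper. ring.
        - intros u. apply (pder_eq _ _ (q' (p x u) * (RtoC x * ((RtoC sg * Ci) * s u)))%C).
          + unfold D. ring.
          + apply Hqp; lra.
        - intros u. apply Ccontinuous_mult; [apply Ccontinuous_const|apply HDc; lra]. }
      replace (CInt (D x) a b) with
        (/ (RtoC x * (RtoC sg * Ci)) * (RtoC x * (RtoC sg * Ci) * CInt (D x) a b))%C
        by (field; repeat split; intros E'; apply Hc; rewrite E'; ring).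
      rewrite E. ring. }
  rewrite (CInt_ext _ (f 1)).
  2:{ intros u. unfold f, p. f_equal. f_equal. ring. }
  rewrite <- HI, <- CInt_scal by assumption. apply CInt_ext.
  intros u. unfold f, p. f_equal. f_equal. ring.
Qed.

(** * Mean values on circles and Cauchy's formula *)

Lemma circ_period (rho sg a : R) : sg = 1 \/ sg = -1 -> circ rho sg a = circ rho sg (a + 2 * PI).
Proof.
  intros Hsg. unfold circ. f_equal.
  destruct Hsg as [-> | ->]; [rewrite <- (Cexp_Zperiod _ 1)|rewrite <- (Cexp_Zperiod _ (-1))];
    f_equal; apply C_ext; reim; ring.
Qed.

Lemma cauchy_center (q q' : C -> C) (rho R1 sg a : R) :
  0 < rho < R1 -> sg = 1 \/ sg = -1 ->
  (forall z, Cmod z < R1 -> cder q z (q' z)) ->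
  (forall z, Cmod z < R1 -> Ccontinuous q' z) ->
  CInt (fun u => q (circ rho sg u)) a (a + 2 * PI) = (2 * PI * q 0)%C.
Proof.
  intros Hrho Hsg Hq Hq'.
  rewrite (CInt_ext _ (fun u => q (circ rho sg u) * 1)%C) by (intros u; ring).
  rewrite (cauchy_weighted q q' (fun _ => RtoC 1) 0 rho R1 sg); try assumption.
  - rewrite CInt_const, <- !RtoC_mult. replace (a + 2 * PI - a) with (2 * PI) by ring.
    rewrite !RtoC_mult; ring.
  - rewrite Cmod_0; lra.
  - destruct Hsg; lra.
  - apply circ_period; assumption.
  - intros u. apply Ccontinuous_const.
  - intros u. ring.
Qed.

Lemma circ_inv (rho alpha : R) : 0 < rho -> (/ circ rho 1 alpha)%C = circ (/ rho) (-1) alpha.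
Proof.
  intros Hr. unfold circ.
  assert (RtoC rho <> 0) by (intros E; apply RtoC_inj in E; lra).
  replace ((0, (-1 * alpha)%R) : C) with (- ((0, (1 * alpha)%R) : C))%C by (apply C_ext; reim; ring).
  rewrite Cexp_opp, RtoC_inv by lra. field. split; [apply Cexp_neq_0|assumption].
Qed.

Lemma circ_neq_0 (rho sg alpha : R) : 0 < rho -> circ rho sg alpha <> 0.
Proof. intros H. apply Cmod_neq. rewrite Cmod_circ; lra. Qed.

Lemma one_minus_neq_0 (w z : C) : Cmod w * Cmod z < 1 -> (1 - w * z)%C <> 0.
Proof.
  intros H E. assert (E' : (w * z)%C = 1) by (replace (w * z)%C with (1 - (1 - w * z))%C by ring; rewrite E; ring).
  rewrite <- Cmod_mult, E', Cmod_1 in H. lra.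
Qed.

Lemma cder_geom (t z : C) : (1 - t * z)%C <> 0 ->
  cder (fun v => / (1 - t * v))%C z (t / ((1 - t * z) * (1 - t * z)))%C.
Proof.
  intros H.
  replace (t / ((1 - t * z) * (1 - t * z)))%C with (- (0 - (0 * z + t * 1)) / ((1 - t * z) * (1 - t * z)))%C
    by (field; assumption).
  apply (cder_inv (fun v => 1 - t * v)%C); [assumption|].
  apply (cder_minus (fun _ => RtoC 1)); [apply cder_const|].
  apply (cder_mult (fun _ => t) (fun v => v)); [apply cder_const|apply cder_id].
Qed.

Lemma Ccontinuous_linear (t z : C) : Ccontinuous (fun v : C_UniformSpace => 1 - t * v)%C z.
Proof.
  apply (Ccontinuous_minus (fun _ => RtoC 1)); [apply Ccontinuous_const|].
  apply (Ccontinuous_mult (fun _ => t)); [apply Ccontinuous_const|apply continuous_id].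
Qed.

(* Mean values of [s / (s - t)] and [1 / (s - w) * s / (s - t)], computed in the variable [1 / s]. *)
Lemma cauchy_kernel_mean (t : C) (rho a : R) : Cmod t < rho ->
  CInt (fun u => circ rho 1 u / (circ rho 1 u - t))%C a (a + 2 * PI) = (2 * PI)%C.
Proof.
  intros Ht. pose proof (Cmod_ge_0 t) as Ht0. assert (Hr : 0 < rho) by lra.
  rewrite (CInt_ext _ (fun u => / (1 - t * circ (/ rho) (-1) u))%C).
  2:{ intros u. rewrite <- circ_inv by assumption.
      pose proof (circ_neq_0 rho 1 u Hr). assert ((circ rho 1 u - t)%C <> 0).
      { apply Cmod_neq. pose proof (Cmod_triangle_sub (circ rho 1 u) t).
        rewrite Cmod_circ in H0; lra. }
      field. auto. }
  (* The reciprocal of the mean of [rho] and [Cmod t]: it exceeds [1 / rho], yet [1 - t z] has no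
     zero for [Cmod z < R1]. *)
  set (R1 := 2 / (rho + Cmod t)).
  assert (HR1 : Cmod t * R1 < 1).
  { apply Rmult_lt_reg_r with (rho + Cmod t); [lra|].
    replace (Cmod t * R1 * (rho + Cmod t)) with (2 * Cmod t) by (unfold R1; field; lra). lra. }
  assert (Hnz : forall z, Cmod z < R1 -> (1 - t * z)%C <> 0).
  { intros z Hz. apply one_minus_neq_0. nra. }
  rewrite (cauchy_center (fun v => / (1 - t * v))%C
    (fun z => t / ((1 - t * z) * (1 - t * z)))%C (/ rho) R1 (-1)).
  - replace (1 - t * 0)%C with (RtoC 1) by ring. field.
  - split; [apply Rinv_0_lt_compat; assumption|].
    apply Rmult_lt_reg_r with (rho * (rho + Cmod t)); [apply Rmult_lt_0_compat; lra|].
    unfold R1. replace (/ rho * (rho * (rho + Cmod t))) with (rho + Cmod t) by (field; lra).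
    replace (2 / (rho + Cmod t) * (rho * (rho + Cmod t))) with (2 * rho) by (field; lra). lra.
  - right; reflexivity.
  - intros z Hz. apply cder_geom, Hnz, Hz.
  - intros z Hz. specialize (Hnz z Hz).
    apply (Ccontinuous_div (fun _ => t)).
    + apply Cmult_neq_0; assumption.
    + apply Ccontinuous_const.
    + apply Ccontinuous_mult; apply Ccontinuous_linear.
Qed.

Lemma cauchy_pole_mean (t w : C) (rho a : R) : Cmod t < rho -> Cmod w < rho ->
  CInt (fun u => / (circ rho 1 u - w) * (circ rho 1 u / (circ rho 1 u - t)))%C a (a + 2 * PI) = 0.
Proof.
  intros Ht Hw. pose proof (Cmod_ge_0 t) as Ht0. pose proof (Cmod_ge_0 w) as Hw0.
  assert (Hr : 0 < rho) by lra.
  rewrite (CInt_ext _ (fun u => circ (/ rho) (-1) u * (/ (1 - w * circ (/ rho) (-1) u)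
    * / (1 - t * circ (/ rho) (-1) u)))%C).
  2:{ intros u. rewrite <- circ_inv by assumption.
      pose proof (circ_neq_0 rho 1 u Hr). 
      assert (K : forall v, Cmod v < rho -> (circ rho 1 u - v)%C <> 0).
      { intros v Hv. apply Cmod_neq. pose proof (Cmod_triangle_sub (circ rho 1 u) v).
        rewrite Cmod_circ in H0; lra. }
      pose proof (K t Ht). pose proof (K w Hw). field. auto. }
  set (m := Rmax (Cmod t) (Cmod w)).
  assert (Hmt : Cmod t <= m) by apply Rmax_l. assert (Hmw : Cmod w <= m) by apply Rmax_r.
  assert (Hm : m < rho) by (apply Rmax_lub_lt; assumption).
  set (R1 := 2 / (rho + m)).
  assert (HR10 : 0 < R1) by (apply Rdiv_lt_0_compat; lra).
  assert (HR1 : m * R1 < 1).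
  { apply Rmult_lt_reg_r with (rho + m); [lra|].
    replace (m * R1 * (rho + m)) with (2 * m) by (unfold R1; field; lra). lra. }
  assert (Hnz : forall v z, Cmod v <= m -> Cmod z < R1 -> (1 - v * z)%C <> 0).
  { intros v z Hv Hz. apply one_minus_neq_0. pose proof (Cmod_ge_0 z). pose proof (Cmod_ge_0 v). nra. }
  rewrite (cauchy_center (fun v => v * (/ (1 - w * v) * / (1 - t * v)))%C
    (fun z => 1 * (/ (1 - w * z) * / (1 - t * z)) + z * (w / ((1 - w * z) * (1 - w * z)) * / (1 - t * z)
       + / (1 - w * z) * (t / ((1 - t * z) * (1 - t * z)))))%C (/ rho) R1 (-1)).
  - ring.
  - split; [apply Rinv_0_lt_compat; assumption|].
    apply Rmult_lt_reg_r with (rho * (rho + m)); [apply Rmult_lt_0_compat; lra|].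
    unfold R1. replace (/ rho * (rho * (rho + m))) with (rho + m) by (field; lra).
    replace (2 / (rho + m) * (rho * (rho + m))) with (2 * rho) by (field; lra). lra.
  - right; reflexivity.
  - intros z Hz. pose proof (Hnz t z Hmt Hz). pose proof (Hnz w z Hmw Hz).
    apply (cder_mult (fun v => v) (fun v => / (1 - w * v) * / (1 - t * v))%C); [apply cder_id|].
    apply (cder_mult (fun v => / (1 - w * v))%C (fun v => / (1 - t * v))%C);
      apply cder_geom; assumption.
  - intros z Hz. pose proof (Hnz t z Hmt Hz) as H1. pose proof (Hnz w z Hmw Hz) as H2.
    assert (K : forall v, (1 - v * z)%C <> 0 -> Ccontinuous (fun z => / (1 - v * z))%C z).
    { intros v Hv. apply Ccontinuous_inv; [assumption|apply Ccontinuous_linear]. }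
    assert (K2 : forall v, (1 - v * z)%C <> 0 ->
      Ccontinuous (fun z => v / ((1 - v * z) * (1 - v * z)))%C z).
    { intros v Hv. apply (Ccontinuous_div (fun _ => v)).
      - apply Cmult_neq_0; assumption.
      - apply Ccontinuous_const.
      - apply Ccontinuous_mult; apply Ccontinuous_linear. }
    apply Ccontinuous_plus.
    + apply (Ccontinuous_mult (fun _ => RtoC 1)); [apply Ccontinuous_const|].
      apply Ccontinuous_mult; auto.
    + apply (Ccontinuous_mult (fun z => z)); [apply continuous_id|].
      apply Ccontinuous_plus; apply Ccontinuous_mult; auto.
Qed.

Lemma cauchy_formula (q q' : C -> C) (t : C) (rho R1 a : R) :
  rho < R1 -> Cmod t < rho ->
  (forall z, Cmod z < R1 -> cder q z (q' z)) ->
  (forall z, Cmod z < R1 -> Ccontinuous q' z) ->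
  CInt (fun u => q (circ rho 1 u) * (circ rho 1 u / (circ rho 1 u - t)))%C a (a + 2 * PI)
  = (2 * PI * q t)%C.
Proof.
  intros HR Ht Hq Hq'. pose proof (Cmod_ge_0 t) as Ht0.
  assert (Hnz : forall u, (circ rho 1 u - t)%C <> 0).
  { intros u. apply Cmod_neq. pose proof (Cmod_triangle_sub (circ rho 1 u) t).
    rewrite Cmod_circ in H; lra. }
  rewrite (cauchy_weighted q q' (fun u => circ rho 1 u / (circ rho 1 u - t))%C t rho R1 1);
    try assumption; try lra.
  - rewrite cauchy_kernel_mean by assumption. ring.
  - apply circ_period; left; reflexivity.
  - intros u. apply Ccontinuous_div; [apply Hnz|apply circ_cont|].
    apply Ccontinuous_minus; [apply circ_cont|apply Ccontinuous_const].
  - intros u. field. apply Hnz.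
Qed.

(** * Products over the zeros of an entire function *)

Definition lprod (l : list C) (s : C) : C :=
  fold_right (fun w acc => ((1 - s / w) * acc)%C) (RtoC 1) l.

Definition lsum (l : list C) (s : C) : C :=
  fold_right (fun w acc => (/ (s - w) + acc)%C) (RtoC 0) l.

Lemma factor_eq_0 (s w : C) : w <> 0 -> (1 - s / w)%C = 0 -> s = w.
Proof.
  intros Hw E. replace s with ((1 - (1 - s / w)) * w)%C by (field; assumption).
  rewrite E; ring.
Qed.

Lemma lprod_neq_0 (l : list C) (s : C) :
  (forall w, In w l -> w <> 0) -> ~ In s l -> lprod l s <> 0.
Proof.
  induction l as [|w l IH]; intros Hl Hs; simpl.
  - exact C1_nz.
  - apply Cmult_neq_0.
    + intros E. apply factor_eq_0 in E; [|apply Hl; left; reflexivity].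
      apply Hs; left; congruence.
    + apply IH; [intros; apply Hl; right; assumption|intros H; apply Hs; right; assumption].
Qed.

Lemma lprod_eq_0 (l : list C) (s : C) : In s l -> s <> 0 -> lprod l s = 0.
Proof.
  induction l as [|w l IH]; intros Hs Hs0; simpl; [destruct Hs|].
  destruct Hs as [->|Hs].
  - replace (1 - s / s)%C with (RtoC 0) by (field; assumption). ring.
  - rewrite IH by assumption. ring.
Qed.

Lemma factor_cder (w z : C) : w <> 0 -> cder (fun s => 1 - s / w)%C z (- / w)%C.
Proof.
  intros Hw. replace (- / w)%C with (0 - (1 * / w + z * 0))%C by ring.
  apply (cder_minus (fun _ => RtoC 1)); [apply cder_const|].
  apply (cder_mult (fun s => s) (fun _ => / w)%C); [apply cder_id|apply cder_const].
Qed.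

(** At a zero of the product only the existence of a derivative matters; the formula through [lsum]
    has a pole there. *)
Lemma lprod_cder (l : list C) (z : C) : (forall w, In w l -> w <> 0) ->
  exists e, cder (lprod l) z e /\ (~ In z l -> e = (lprod l z * lsum l z)%C).
Proof.
  induction l as [|w l IH]; intros Hl.
  - exists (RtoC 0). split; [apply cder_const|]. intros _; simpl; ring.
  - destruct IH as (e & He & E); [intros; apply Hl; right; assumption|].
    assert (Hw : w <> 0) by (apply Hl; left; reflexivity).
    exists (- / w * lprod l z + (1 - z / w) * e)%C. split.
    + apply (cder_mult (fun s => 1 - s / w)%C (lprod l)); [apply factor_cder|]; assumption.
    + intros Hz. rewrite E by (intros H; apply Hz; right; assumption).
      assert ((z - w)%C <> 0).
      { apply Cminus_eq_contra. intros H; apply Hz; left; congruence. }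
      simpl. field. auto.
Qed.

Lemma factor_list (f : C -> C) (l : list C) : entire f -> NoDup l ->
  (forall w, In w l -> w <> 0 /\ f w = 0) ->
  exists h, entire h /\ forall z, f z = (lprod l z * h z)%C.
Proof.
  intros Hf. induction l as [|w l IH]; intros Hnd Hl.
  - exists f. split; [assumption|]. intros z; simpl; ring.
  - inversion Hnd as [|? ? Hin Hnd']; subst.
    destruct IH as (h & Hh & E); [assumption|intros; apply Hl; right; assumption|].
    destruct (Hl w (or_introl eq_refl)) as [Hw Hfw].
    assert (Hhw : h w = 0).
    { assert (Hp : lprod l w <> 0).
      { apply lprod_neq_0; [intros v Hv; apply Hl; right; assumption|assumption]. }
      replace (h w) with (/ lprod l w * (lprod l w * h w))%C by (field; assumption).
      rewrite <- E, Hfw. ring. }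
    destruct (entire_divide h w Hh Hhw) as (k & Hk & Ek).
    (* The constant turns the factor [z - w] into the normalized factor [1 - z / w]. *)
    exists (fun z => (- w) * k z)%C. split; [apply entire_scal; assumption|].
    intros z. rewrite E, Ek. simpl. field. assumption.
Qed.

Lemma lsum_cont (l : list C) (rho : R) : (forall w, In w l -> Cmod w < rho) ->
  cont_path (fun u => lsum l (circ rho 1 u)).
Proof.
  induction l as [|w l IH]; intros Hl u; simpl; [apply Ccontinuous_const|].
  assert (Hw : Cmod w < rho) by (apply Hl; left; reflexivity).
  pose proof (Cmod_ge_0 w).
  apply (Ccontinuous_plus (fun u => / (circ rho 1 u - w))%C).
  - apply (Ccontinuous_inv (fun u => circ rho 1 u - w)%C).
    + apply Cmod_neq. pose proof (Cmod_triangle_sub (circ rho 1 u) w).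
      rewrite Cmod_circ in H0; lra.
    + apply Ccontinuous_minus; [apply circ_cont|apply Ccontinuous_const].
  - apply (IH (fun w H => Hl w (or_intror H))).
Qed.

Lemma kernel_cont (t : C) (rho : R) : Cmod t < rho ->
  cont_path (fun u => circ rho 1 u / (circ rho 1 u - t))%C.
Proof.
  intros Ht u. pose proof (Cmod_ge_0 t). apply Ccontinuous_div; [|apply circ_cont|].
  - apply Cmod_neq. pose proof (Cmod_triangle_sub (circ rho 1 u) t).
    rewrite Cmod_circ in H0; lra.
  - apply Ccontinuous_minus; [apply circ_cont|apply Ccontinuous_const].
Qed.

Lemma lsum_mean (l : list C) (t : C) (rho a : R) :
  Cmod t < rho -> (forall w, In w l -> Cmod w < rho) ->
  CInt (fun u => lsum l (circ rho 1 u) * (circ rho 1 u / (circ rho 1 u - t)))%C a (a + 2 * PI) = 0.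
Proof.
  intros Ht. induction l as [|w l IH]; intros Hl.
  - rewrite (CInt_ext _ (fun _ => RtoC 0)) by (intros u; simpl; ring).
    rewrite CInt_const; ring.
  - assert (Hw : Cmod w < rho) by (apply Hl; left; reflexivity).
    assert (Hl' : forall w, In w l -> Cmod w < rho) by (intros; apply Hl; right; assumption).
    rewrite (CInt_ext _ (fun u => / (circ rho 1 u - w) * (circ rho 1 u / (circ rho 1 u - t))
      + lsum l (circ rho 1 u) * (circ rho 1 u / (circ rho 1 u - t)))%C)
      by (intros u; simpl; ring).
    rewrite CInt_plus.
    + rewrite cauchy_pole_mean, IH by assumption. ring.
    + intros u. apply (Ccontinuous_mult (fun u => / (circ rho 1 u - w))%C); [|apply kernel_cont, Ht].
      assert (Hw1 : forall v, In v (w :: nil) -> Cmod v < rho) by (intros v [<-|[]]; assumption).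
      apply (continuous_ext (U := C_UniformSpace) (fun u => lsum (w :: nil) (circ rho 1 u))).
      * intros v. simpl. ring_simplify. reflexivity.
      * apply (lsum_cont (w :: nil) rho Hw1).
    + intros u. apply Ccontinuous_mult; [apply lsum_cont; assumption|apply kernel_cont, Ht].
Qed.

(** * Means of nearly odd functions on a circle *)

Lemma circ_half_turn (rho u : R) : circ rho 1 (u + PI) = (- circ rho 1 u)%C.
Proof.
  unfold circ. replace ((0, 1 * (u + PI)) : C) with ((0, (1 * u)%R) + (0, PI))%C
    by (apply C_ext; reim; ring).
  rewrite Cexp_plus. replace (Cexp (0, PI)) with (RtoC (-1)); [|apply C_ext; reim;
    rewrite exp_0, ?cos_PI, ?sin_PI; ring].
  ring.
Qed.

Lemma circ_re (rho u : R) : Re (circ rho 1 u) = rho * cos u.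
Proof. unfold circ. reim. rewrite exp_0, !Rmult_1_l. ring. Qed.

(** A half turn folds the integral onto the right half circle, with integrand [G s + G (- s)]. This
    is at most [eps] except on the two end arcs of angle [del], where it is at most [2 M];
    [CInt_bound] doubles each contribution. *)
Lemma mean_bound (G : C -> C) (rho M eps del : R) :
  0 < rho -> 0 < del < PI / 2 -> 0 <= M -> 0 <= eps ->
  cont_path (fun u => G (circ rho 1 u)) ->
  (forall s, Cmod s = rho -> Cmod (G s) <= M) ->
  (forall s, Cmod s = rho -> sin del * rho <= Re s -> Cmod (G s + G (- s)%C) <= eps) ->
  Cmod (CInt (fun u => G (circ rho 1 u)) (- (PI / 2)) (- (PI / 2) + 2 * PI))
  <= 8 * M * del + 2 * eps * PI.
Proof.
  intros Hr Hd HM He Hc HG1 HG2. pose proof PI_RGT_0 as HPI.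
  set (F := fun u => (G (circ rho 1 u) + G (- circ rho 1 u))%C).
  assert (Hsh : cont_path (fun u => G (- circ rho 1 u)%C)).
  { intros u. apply (continuous_ext (U := C_UniformSpace) (fun u => G (circ rho 1 (u + PI)))).
    - intros v. rewrite circ_half_turn. reflexivity.
    - apply (continuous_comp (W := C_UniformSpace) (fun u => u + PI) (fun u => G (circ rho 1 u)));
        [|apply Hc].
      apply continuous_Rplus; [apply continuous_id|apply continuous_const]. }
  assert (HF : cont_path F) by (intros u; apply Ccontinuous_plus; [apply Hc|apply Hsh]).
  assert (E : CInt (fun u => G (circ rho 1 u)) (- (PI / 2)) (- (PI / 2) + 2 * PI)
    = CInt F (- (PI / 2)) (PI / 2)).
  { rewrite (CInt_Chasles _ _ (PI / 2)) by assumption.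
    replace (- (PI / 2) + 2 * PI) with (PI / 2 + PI) by field.
    replace (CInt (fun u => G (circ rho 1 u)) (PI / 2) (PI / 2 + PI)) with
      (CInt (fun u => G (circ rho 1 u)) (- (PI / 2) + PI) (PI / 2 + PI)) by (f_equal; field).
    rewrite CInt_shift by assumption.
    rewrite (CInt_ext (fun u => G (circ rho 1 (u + PI))) (fun u => G (- circ rho 1 u)%C))
      by (intros u; rewrite circ_half_turn; reflexivity).
    rewrite <- CInt_plus by assumption. reflexivity. }
  rewrite E. clear E.
  rewrite (CInt_Chasles F _ (- (PI / 2) + del)), (CInt_Chasles F _ (PI / 2 - del) (PI / 2)) by assumption.
  assert (B : forall u, Cmod (F u) <= 2 * M).
  { intros u. unfold F. eapply Rle_trans; [apply Cmod_triangle|].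
    assert (Cmod (G (circ rho 1 u)) <= M) by (apply HG1, Cmod_circ; lra).
    assert (Cmod (G (- circ rho 1 u)%C) <= M) by (apply HG1; rewrite Cmod_opp; apply Cmod_circ; lra).
    lra. }
  assert (B1 : Cmod (CInt F (- (PI / 2)) (- (PI / 2) + del)) <= 2 * (2 * M * del)).
  { eapply Rle_trans; [apply (CInt_bound F _ _ (2 * M)); [lra|assumption|intros; apply B]|].
    right; ring. }
  assert (B2 : Cmod (CInt F (PI / 2 - del) (PI / 2)) <= 2 * (2 * M * del)).
  { eapply Rle_trans; [apply (CInt_bound F _ _ (2 * M)); [lra|assumption|intros; apply B]|].
    right; ring. }
  assert (B3 : Cmod (CInt F (- (PI / 2) + del) (PI / 2 - del)) <= 2 * (eps * PI)).
  { eapply Rle_trans; [apply (CInt_bound F _ _ eps); [lra|assumption|]|].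
    - intros u Hu. apply HG2; [apply Cmod_circ; lra|].
      rewrite circ_re, Rmult_comm. apply Rmult_le_compat_l; [lra|].
      rewrite <- cos_shift. destruct (Rle_lt_dec 0 u) as [Hu0|Hu0].
      + apply cos_decr_1; lra.
      + rewrite <- (cos_neg u). apply cos_decr_1; lra.
    - apply Rmult_le_compat_l; [lra|]. apply Rmult_le_compat_l; lra. }
  pose proof (Cmod_triangle (CInt F (- (PI / 2)) (- (PI / 2) + del))
    (CInt F (- (PI / 2) + del) (PI / 2 - del) + CInt F (PI / 2 - del) (PI / 2))) as T1.
  pose proof (Cmod_triangle (CInt F (- (PI / 2) + del) (PI / 2 - del)) (CInt F (PI / 2 - del) (PI / 2))) as T2.
  lra.
Qed.

(** Replaces the choice of a logarithm when a small logarithmic derivative is integrated. The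
    quantity [|u|^2 exp (- 2 eta x)] does not increase, hence [|u| <= e <= 3]; the mean value
    theorem then costs [3 eta] for each component. *)
Lemma gronwall_unit (u p : R -> C) (eta : R) : 0 <= eta <= 1 -> u 0 = 1 ->
  (forall x, 0 <= x <= 1 -> pder u x (p x * u x)%C /\ Cmod (p x) <= eta) ->
  Cmod (u 1 - 1) <= 6 * eta.
Proof.
  intros He H0 H.
  set (N := fun x => (Re (u x) * Re (u x) + Im (u x) * Im (u x)) * exp (- (2 * eta) * x)).
  set (N' := fun x => ((Re (p x * u x) * Re (u x) + Re (u x) * Re (p x * u x)) +
     (Im (p x * u x) * Im (u x) + Im (u x) * Im (p x * u x))) * exp (- (2 * eta) * x)
     + (Re (u x) * Re (u x) + Im (u x) * Im (u x)) * (- (2 * eta) * exp (- (2 * eta) * x))).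
  assert (HN : forall x, 0 <= x <= 1 -> is_derive N x (N' x)).
  { intros x Hx. destruct (H x Hx) as [[D1 D2] _].
    apply (is_derive_Rmult (fun x => Re (u x) * Re (u x) + Im (u x) * Im (u x))
      (fun x => exp (- (2 * eta) * x))).
    - exact (is_derive_plus (V := R_NormedModule) _ _ x _ _
        (is_derive_Rmult _ _ _ _ _ D1 D1) (is_derive_Rmult _ _ _ _ _ D2 D2)).
    - auto_derive; [trivial|ring]. }
  assert (HN0 : N 0 = 1).
  { unfold N. rewrite H0. reim. replace (- (2 * eta) * 0) with 0 by ring. rewrite exp_0. ring. }
  assert (Hle : forall x, 0 <= x <= 1 -> N x <= 1).
  { intros x Hx. rewrite <- HN0.
    destruct (MVT_gen N 0 x N') as (c & Hc & E).
    - intros y Hy. rewrite Rmin_left, Rmax_right in Hy by lra. apply HN; lra.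
    - intros y Hy. rewrite Rmin_left, Rmax_right in Hy by lra.
      apply continuity_pt_filterlim, (ex_derive_continuous N y). eexists; apply HN; lra.
    - rewrite Rmin_left, Rmax_right in Hc by lra.
      assert (N' c <= 0); [|nra].
      unfold N'. destruct (H c ltac:(lra)) as [_ Hp].
      pose proof (re_le_Cmod (p c)) as Hre. apply Rabs_le_between in Hre.
      pose proof (exp_pos (- (2 * eta) * c)).
      replace (_ + _) with (2 * (Re (p c) - eta) *
        (Re (u c) * Re (u c) + Im (u c) * Im (u c)) * exp (- (2 * eta) * c)) by (reim; ring).
      assert (0 <= (Re (u c) * Re (u c) + Im (u c) * Im (u c)) * exp (- (2 * eta) * c)).
      { apply Rmult_le_pos; [nra|lra]. }
      nra. }
  assert (Hu : forall x, 0 <= x <= 1 -> Cmod (u x) <= 3).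
  { intros x Hx. specialize (Hle x Hx). unfold N in Hle. rewrite <- Cmod_sqr in Hle.
    assert (He2 : exp (- (2 * eta) * x) * exp (2 * eta * x) = 1)
      by (rewrite <- exp_plus, <- exp_0; f_equal; ring).
    assert (exp (2 * eta * x) <= 9).
    { apply Rle_trans with (exp 2).
      - destruct (Req_dec (2 * eta * x) 2) as [->|]; [lra|left; apply exp_increasing; nra].
      - replace 2 with (1 + 1) by ring. rewrite exp_plus. pose proof exp_le_3. pose proof (exp_pos 1). nra. }
    pose proof (Cmod_ge_0 (u x)). pose proof (exp_pos (2 * eta * x)).
    assert (Cmod (u x) * Cmod (u x) <= 9); [|nra].
    replace (Cmod (u x) * Cmod (u x)) with
      (Cmod (u x) * Cmod (u x) * exp (- (2 * eta) * x) * exp (2 * eta * x))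
      by (rewrite Rmult_assoc, He2; ring). nra. }
  assert (T : forall g g' : R -> R, (forall x, 0 <= x <= 1 -> is_derive g x (g' x)) ->
    (forall x, 0 <= x <= 1 -> Rabs (g' x) <= 3 * eta) -> Rabs (g 1 - g 0) <= 3 * eta).
  { intros g g' Hg Hb. destruct (MVT_gen g 0 1 g') as (c & Hc & E).
    - intros y Hy. rewrite Rmin_left, Rmax_right in Hy by lra. apply Hg; lra.
    - intros y Hy. rewrite Rmin_left, Rmax_right in Hy by lra.
      apply continuity_pt_filterlim, (ex_derive_continuous g y). eexists; apply Hg; lra.
    - rewrite Rmin_left, Rmax_right in Hc by lra. rewrite E.
      replace (g' c * (1 - 0)) with (g' c) by ring. apply Hb; assumption. }
  assert (Hd : forall x, 0 <= x <= 1 -> Cmod (p x * u x) <= 3 * eta).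
  { intros x Hx. rewrite Cmod_mult. destruct (H x Hx) as [_ Hp]. specialize (Hu x Hx).
    pose proof (Cmod_ge_0 (p x)). pose proof (Cmod_ge_0 (u x)). nra. }
  rewrite <- H0. eapply Rle_trans; [apply Cmod_le_sum|]. reim.
  assert (Rabs (Re (u 1) - Re (u 0)) <= 3 * eta).
  { apply (T (fun x => Re (u x)) (fun x => Re (p x * u x))).
    - intros x Hx. exact (proj1 (proj1 (H x Hx))).
    - intros x Hx. eapply Rle_trans; [apply re_le_Cmod|auto]. }
  assert (Rabs (Im (u 1) - Im (u 0)) <= 3 * eta).
  { apply (T (fun x => Im (u x)) (fun x => Im (p x * u x))).
    - intros x Hx. exact (proj2 (proj1 (H x Hx))).
    - intros x Hx. eapply Rle_trans; [apply Im_le_Cmod|auto]. }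
  lra.
Qed.

(* With [h] the entire quotient of [f] by the product over [l], the contour integral of
   [h' / h = f' / f - lsum l] involves only [f' / f], since the poles in [l] average out. *)
Lemma logder_bound (f f' : C -> C) (l : list C) (rho R1 M eps del B : R) :
  entire f -> deriv_of f f' -> (forall z, Ccontinuous f' z) -> f 0 = 1 ->
  0 <= B < rho -> rho < R1 -> 0 < del < PI / 2 -> 0 <= M -> 0 <= eps ->
  NoDup l -> (forall w, In w l -> f w = 0 /\ Cmod w < rho) ->
  (forall z, Cmod z < R1 -> f z = 0 -> In z l) -> (forall z, f z = 0 -> f' z <> 0) ->
  (forall s, Cmod s = rho -> Cmod (f' s / f s) <= M) ->
  (forall s, Cmod s = rho -> sin del * rho <= Re s ->
     Cmod (f' s / f s + f' (- s)%C / f (- s)%C) <= eps) ->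
  exists h h', deriv_of h h' /\ (forall z, f z = (lprod l z * h z)%C) /\ h 0 = 1 /\
    forall t, Cmod t <= B -> h t <> 0 /\
      Cmod (h' t / h t) <= 2 * M * del + eps + 2 * (M * (B / (rho - B))).
Proof.
  intros Hf Hf' Hcf' Hf0 HB HR Hdel HM Heps Hnd Hl Hall Hsimple HG1 HG2.
  pose proof PI_RGT_0 as HPI. pose proof PI2_1 as HPI1.
  assert (Hl0 : forall w, In w l -> w <> 0).
  { intros w Hw ->. destruct (Hl _ Hw) as [E _]. rewrite Hf0 in E. exact (C1_nz E). }
  destruct (factor_list f l Hf Hnd) as (h & Hh & Eh).
  { intros w Hw. split; [apply Hl0; assumption|apply Hl; assumption]. }
  destruct (entire_deriv h Hh) as (h' & Hh' & Dh).
  destruct (entire_deriv h' Hh') as (h'' & Hh'' & Dh').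
  destruct (entire_deriv h'' Hh'') as (h3 & _ & Dh'').
  assert (Hder : forall z e, cder (lprod l) z e -> f' z = (e * h z + lprod l z * h' z)%C).
  { intros z e He. apply (cder_unique f z); [apply Hf'|].
    apply (cder_ext (fun v => lprod l v * h v)%C); [intros; symmetry; apply Eh|].
    apply cder_mult; [assumption|apply Dh]. }
  (* A zero of [h] in the disc would be a zero of [f], hence a member of [l], hence a multiple zero
     of [f]. *)
  assert (Hnz : forall z, Cmod z < R1 -> h z <> 0).
  { intros z Hz Ez.
    assert (Hfz : f z = 0) by (rewrite Eh, Ez; ring).
    pose proof (Hall z Hz Hfz) as Hin.
    destruct (lprod_cder l z Hl0) as (e & He & _).
    apply (Hsimple z Hfz). rewrite (Hder z e He), Ez, (lprod_eq_0 l z Hin (Hl0 z Hin)). ring. }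
  exists h, h'. split; [assumption|]. split; [assumption|]. split.
  { assert (Hp0 : lprod l 0 = 1).
    { clear -Hl0. induction l as [|w l IH]; simpl; [reflexivity|].
      rewrite IH by (intros; apply Hl0; right; assumption).
      field. apply Hl0; left; reflexivity. }
    rewrite Eh, Hp0, Cmult_1_l in Hf0. assumption. }
  intros t Ht. split; [apply Hnz; lra|].
  set (q := fun z => (h' z / h z)%C).
  set (q' := fun z => ((h'' z * h z - h' z * h' z) / (h z * h z))%C).
  pose proof (cauchy_formula q q' t rho R1 (- (PI / 2)) HR ltac:(lra)) as E.
  assert (Hlog : forall s, Cmod s = rho -> f s <> 0 /\ q s = (f' s / f s - lsum l s)%C).
  { intros s Hs.
    assert (Hns : ~ In s l) by (intros Hin; destruct (Hl s Hin); lra).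
    assert (Hfs : f s <> 0) by (intros E0; apply Hns, Hall; [lra|assumption]).
    split; [assumption|].
    destruct (lprod_cder l s Hl0) as (e & He & Ee). specialize (Ee Hns).
    pose proof (Hnz s ltac:(lra)). pose proof (lprod_neq_0 l s Hl0 Hns).
    unfold q. rewrite (Hder s e He), (Eh s), Ee. field. auto. }
  assert (Hkc : cont_path (fun u => circ rho 1 u / (circ rho 1 u - t))%C) by (apply kernel_cont; lra).
  assert (Hcm : forall u, Cmod (circ rho 1 u) = rho) by (intros u; apply Cmod_circ; lra).
  assert (HGc : cont_path (fun u => f' (circ rho 1 u) / f (circ rho 1 u))%C).
  { intros u. apply Ccontinuous_div.
    - apply Hlog, Hcm.
    - apply (continuous_comp (V := C_UniformSpace) (circ rho 1) f'); [apply circ_cont|apply Hcf'].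
    - apply (continuous_comp (V := C_UniformSpace) (circ rho 1) f); [apply circ_cont|].
      exact (deriv_of_continuous f f' _ Hf'). }
  assert (Hlc : cont_path (fun u => lsum l (circ rho 1 u))).
  { apply lsum_cont. intros w Hw. apply Hl; assumption. }
  assert (Htc : cont_path (fun u => t / (circ rho 1 u - t))%C).
  { intros u. apply (continuous_ext (U := C_UniformSpace)
      (fun u => circ rho 1 u / (circ rho 1 u - t) - 1)%C).
    - intros v. assert ((circ rho 1 v - t)%C <> 0).
      { apply Cmod_neq. pose proof (Cmod_triangle_sub (circ rho 1 v) t). rewrite Hcm in H; lra. }
      change (@eq C (circ rho 1 v / (circ rho 1 v - t) - 1)%C (t / (circ rho 1 v - t))%C).
      field. assumption.
    - apply Ccontinuous_minus; [apply Hkc|apply Ccontinuous_const]. }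
  (* The kernel [s / (s - t)] is split as [1 + t / (s - t)]: the constant part gives the plain mean
     of [f' / f], the other part is of order [B / (rho - B)]. *)
  assert (E2 : (2 * PI * q t)%C =
    (CInt (fun u => f' (circ rho 1 u) / f (circ rho 1 u)) (- (PI / 2)) (- (PI / 2) + 2 * PI) +
     CInt (fun u => f' (circ rho 1 u) / f (circ rho 1 u) * (t / (circ rho 1 u - t)))
       (- (PI / 2)) (- (PI / 2) + 2 * PI))%C).
  { rewrite <- E.
    - rewrite <- CInt_plus; [|assumption|intros u; apply Ccontinuous_mult; [apply HGc|apply Htc]].
      rewrite (CInt_ext _ (fun u => (f' (circ rho 1 u) / f (circ rho 1 u)
        + f' (circ rho 1 u) / f (circ rho 1 u) * (t / (circ rho 1 u - t)))
        + - (1) * (lsum l (circ rho 1 u) * (circ rho 1 u / (circ rho 1 u - t))))%C).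
      + rewrite CInt_plus, CInt_scal, lsum_mean.
        * ring.
        * lra.
        * intros w Hw; apply Hl; assumption.
        * intros u. apply Ccontinuous_mult; [apply Hlc|apply Hkc].
        * intros u. apply Ccontinuous_plus; [apply HGc|].
          apply Ccontinuous_mult; [apply HGc|apply Htc].
        * intros u. apply Ccontinuous_mult; [apply Ccontinuous_const|].
          apply Ccontinuous_mult; [apply Hlc|apply Hkc].
      + intros u. destruct (Hlog _ (Hcm u)) as [Hfs Eq]. rewrite Eq.
        assert ((circ rho 1 u - t)%C <> 0).
        { apply Cmod_neq. pose proof (Cmod_triangle_sub (circ rho 1 u) t). rewrite Hcm in H; lra. }
        field. auto.
    - intros z Hz. apply cder_div; [apply Hnz; assumption|apply Dh'|apply Dh].
    - intros z Hz. pose proof (Hnz z Hz).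
      pose proof (deriv_of_continuous _ _ z Dh). pose proof (deriv_of_continuous _ _ z Dh').
      pose proof (deriv_of_continuous _ _ z Dh'').
      apply Ccontinuous_div; [apply Cmult_neq_0; assumption| |].
      + apply Ccontinuous_minus; apply Ccontinuous_mult; assumption.
      + apply Ccontinuous_mult; assumption. }
  pose proof (mean_bound (fun s => f' s / f s)%C rho M eps del ltac:(lra) Hdel HM Heps HGc HG1 HG2) as B1.
  assert (B2 : Cmod (CInt (fun u => f' (circ rho 1 u) / f (circ rho 1 u) * (t / (circ rho 1 u - t)))%C
       (- (PI / 2)) (- (PI / 2) + 2 * PI)) <= 2 * (M * (B / (rho - B)) * (2 * PI))).
  { eapply Rle_trans; [apply (CInt_bound _ _ _ (M * (B / (rho - B)))); [lra| |]|right; ring].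
    - intros u. apply Ccontinuous_mult; [apply HGc|apply Htc].
    - intros u _. rewrite Cmod_mult.
      pose proof (Cmod_triangle_sub (circ rho 1 u) t) as Hst. rewrite Hcm in Hst.
      assert ((circ rho 1 u - t)%C <> 0) by (apply Cmod_neq; lra).
      apply Rmult_le_compat; try apply Cmod_ge_0; [apply HG1, Hcm|].
      rewrite Cmod_div by assumption.
      apply Rmult_le_compat; try apply Cmod_ge_0; [left; apply Rinv_0_lt_compat; lra|lra|].
      apply Rinv_le_contravar; lra. }
  assert (Hq : 2 * PI * Cmod (q t) <= 8 * M * del + 2 * eps * PI + 2 * (M * (B / (rho - B)) * (2 * PI))).
  { replace (2 * PI * Cmod (q t)) with (Cmod (2 * PI * q t)).
    - rewrite E2. eapply Rle_trans; [apply Cmod_triangle|]. apply Rplus_le_compat; assumption.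
    - rewrite !Cmod_mult, !Cmod_R, !Rabs_pos_eq by lra. ring. }
  fold (q t).
  apply Rmult_le_reg_l with (2 * PI); [lra|].
  assert (0 <= M * del) by (apply Rmult_le_pos; lra).
  assert (8 * M * del <= 2 * PI * (2 * M * del)) by nra.
  eapply Rle_trans; [exact Hq|]. nra.
Qed.

(** With [h] as in [logder_bound], the difference is [f T (1 - h T) / h T], and [h T] is near 1
    because [h 0 = 1] and [h' / h] is small along the segment from 0 to [T]. The margin [eta]
    provides the slightly larger disc without further zeros that Cauchy's formula requires. *)
Theorem hadamard_limit (f f' : C -> C) (l : nat -> list C) (rho : nat -> R) (M eta : R) (m0 : nat) :
  entire f -> deriv_of f f' -> (forall z, Ccontinuous f' z) -> f 0 = 1 -> 0 < eta -> 0 <= M ->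
  (forall z, f z = 0 -> f' z <> 0) ->
  (forall B, exists m1, forall m, (m1 <= m)%nat -> B <= rho m) ->
  (forall m, (m0 <= m)%nat -> NoDup (l m)) ->
  (forall m w, (m0 <= m)%nat -> In w (l m) -> f w = 0 /\ Cmod w < rho m) ->
  (forall m z, (m0 <= m)%nat -> Cmod z < rho m + eta -> f z = 0 -> In z (l m)) ->
  (forall m s, (m0 <= m)%nat -> Cmod s = rho m -> Cmod (f' s / f s) <= M) ->
  (forall del eps, 0 < del -> 0 < eps -> exists m1, forall m s, (m1 <= m)%nat ->
     Cmod s = rho m -> del * rho m <= Re s ->
     Cmod (f' s / f s + f' (- s)%C / f (- s)%C) <= eps) ->
  forall T eps, 0 < eps -> exists m1, forall m, (m1 <= m)%nat -> Cmod (lprod (l m) T - f T) < eps.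
Proof.
  intros Hf Hf' Hcf' Hf0 Heta HM Hsimple Hrho Hnd Hl Hall HG1 HG2 T eps He.
  pose proof PI2_1 as HPI1.
  pose proof (Cmod_ge_0 T) as HT. pose proof (Cmod_ge_0 (f T)) as HfT.
  set (K := 12 * (Cmod T + 1) * (Cmod (f T) + 1)).
  assert (HK : 0 < K) by (unfold K; repeat apply Rmult_lt_0_compat; lra).
  (* A bound [e] on [h' / h] gives [|h T - 1| <= 6 |T| e]. The first term of the minimum makes this
     at most [1 / 2], so [|h T| >= 1 / 2]; the second makes the final error [12 |T| |f T| e] smaller
     than [eps]. *)
  set (e := Rmin (/ (12 * (Cmod T + 1))) (eps / (2 * K))).
  assert (He0 : 0 < e).
  { apply Rmin_glb_lt; [apply Rinv_0_lt_compat; lra|apply Rdiv_lt_0_compat; lra]. }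
  set (del := Rmin 1 (e / (6 * (M + 1)))).
  assert (Hdel0 : 0 < del) by (apply Rmin_glb_lt; [lra|apply Rdiv_lt_0_compat; lra]).
  assert (Hdel1 : del <= 1) by apply Rmin_l.
  assert (Hdel : 2 * M * del <= e / 3).
  { assert (del <= e / (6 * (M + 1))) by apply Rmin_r.
    apply Rle_trans with (2 * (M + 1) * (e / (6 * (M + 1)))).
    - apply Rmult_le_compat; lra.
    - right; field; lra. }
  assert (Hsd : 0 < sin del) by (apply sin_gt_0; lra).
  destruct (HG2 (sin del) (e / 3) Hsd ltac:(lra)) as (m2 & Hm2).
  set (B := Cmod T).
  destruct (Hrho (B + 1 + 6 * M * B / e)) as (m3 & Hm3).
  exists (Nat.max m0 (Nat.max m2 m3)). intros m Hm.
  specialize (Hm3 m ltac:(lia)).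
  assert (Hq : 0 <= 6 * M * B / e).
  { apply Rmult_le_pos; [|left; apply Rinv_0_lt_compat; assumption].
    unfold B; repeat apply Rmult_le_pos; lra. }
  destruct (logder_bound f f' (l m) (rho m) (rho m + eta) M (e / 3) del B) as (h & h' & Dh & Eh & Eh0 & Hh);
    try assumption; try (unfold B in *; lra).
  - apply Hnd; lia.
  - intros w Hw. apply Hl; [lia|assumption].
  - intros z. apply Hall; lia.
  - intros s. apply HG1; lia.
  - intros s. apply Hm2; lia.
  - assert (Hlast : 2 * (M * (B / (rho m - B))) <= e / 3).
    { apply Rmult_le_reg_r with (rho m - B); [lra|].
      replace (2 * (M * (B / (rho m - B))) * (rho m - B)) with (2 * M * B) by (field; lra).
      apply Rle_trans with (e / 3 * (6 * M * B / e)); [right; field; lra|].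
      apply Rmult_le_compat_l; lra. }
    assert (HeT : Cmod T * e <= / 12).
    { apply Rle_trans with ((Cmod T + 1) * / (12 * (Cmod T + 1))).
      - apply Rmult_le_compat; try lra. apply Rmin_l.
      - right; field; lra. }
    assert (Hu : Cmod (h T - 1) <= 6 * (Cmod T * e)).
    { pose proof (gronwall_unit (fun x => h (0 + RtoC x * T)%C)
        (fun x => T * (h' (0 + RtoC x * T) / h (0 + RtoC x * T)))%C (Cmod T * e)) as G.
      cbv beta in G. replace (0 + 1 * T)%C with T in G by ring. apply G.
      - split; [apply Rmult_le_pos; lra|lra].
      - replace (0 + 0 * T)%C with (RtoC 0) by ring. assumption.
      - intros x Hx.
        assert (Hxt : Cmod (0 + x * T) <= B).
        { replace (0 + x * T)%C with (x * T)%C by ring.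
          rewrite Cmod_mult, Cmod_R, Rabs_pos_eq by lra. unfold B. nra. }
        destruct (Hh _ Hxt) as [Hnz Hb]. split.
        + apply (pder_eq _ _ (h' (0 + x * T) * T)%C); [field; assumption|].
          apply cder_pder_segment, Dh.
        + rewrite Cmod_mult. apply Rmult_le_compat_l; [assumption|]. lra. }
    assert (Hh1 : / 2 <= Cmod (h T)).
    { pose proof (Cmod_triangle_sub 1 (1 - h T)) as Htr. rewrite Cmod_1 in Htr.
      replace (1 - (1 - h T))%C with (h T) in Htr by ring.
      rewrite (Cmod_minus_sym 1 (h T)) in Htr. lra. }
    assert (Hnz : h T <> 0) by (apply Cmod_neq; lra).
    replace (lprod (l m) T - f T)%C with (f T * (1 - h T) / h T)%C by (rewrite Eh; field; assumption).
    rewrite Cmod_div, Cmod_mult by assumption.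
    rewrite (Cmod_minus_sym 1 (h T)).
    assert (Hinv : / Cmod (h T) <= 2).
    { replace 2 with (/ / 2) by field. apply Rinv_le_contravar; lra. }
    apply Rle_lt_trans with (Cmod (f T) * (6 * (Cmod T * e)) * 2).
    + apply Rmult_le_compat; try assumption.
      * apply Rmult_le_pos; apply Cmod_ge_0.
      * left; apply Rinv_0_lt_compat; lra.
      * apply Rmult_le_compat_l; assumption.
    + apply Rle_lt_trans with (K * e).
      * unfold K. replace (Cmod (f T) * (6 * (Cmod T * e)) * 2) with (12 * Cmod T * Cmod (f T) * e) by ring.
        apply Rmult_le_compat_r; [lra|]. apply Rmult_le_compat; try lra; apply Rmult_le_pos; lra.
      * apply Rle_lt_trans with (K * (eps / (2 * K))).
        -- apply Rmult_le_compat_l; [lra|apply Rmin_r].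
        -- replace (K * (eps / (2 * K))) with (eps / 2) by (field; lra). lra.
Qed.

(** * The entire function whose zeros are the values W_k(x) *)

Lemma RtoC_neq_0 (r : R) : r <> 0 -> RtoC r <> 0.
Proof. intros H E. apply H, RtoC_inj, E. Qed.

Lemma C2_neq_0 : RtoC 2 <> 0.
Proof. apply RtoC_neq_0; lra. Qed.

Lemma entire_deriv_eq (f d : C -> C) : entire f -> (forall z, cder f z (d z)) ->
  deriv_of f d /\ forall z, Ccontinuous d z.
Proof.
  intros Hf Hd. destruct (entire_deriv f Hf) as (f' & Hf' & [D1 D2]).
  assert (E : forall z, f' z = d z) by (intros z; apply (cder_unique f z); auto).
  split.
  - split; [assumption|]. intros rho Hr. destruct (D2 rho Hr) as (M & HM & K).
    exists M. split; [assumption|]. intros z h. rewrite <- E. apply K.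
  - intros z. destruct (entire_deriv f' Hf') as (f'' & _ & D).
    apply (continuous_ext (U := C_UniformSpace) f'); [exact E|].
    exact (deriv_of_continuous _ _ z D).
Qed.

(** The factor [e^(-s/2)] in front of [1 - s e^s / x] balances the logarithmic derivative, whose
    limits without it would be 1 on the right and 0 on the left. The mean [1 / 2] would then appear
    as an exponential factor in the product over the zeros. *)
Definition gW (x s : C) : C := (Cexp (- s / 2) - s / x * Cexp (s / 2))%C.

Definition gW' (x s : C) : C :=
  (- (1 / 2) * Cexp (- s / 2) - (1 / x + s / (2 * x)) * Cexp (s / 2))%C.

Definition EW (x s : C) : C := (s * Cexp s / x)%C.

Lemma gW_entire (x : C) : entire (gW x).
Proof.
  apply (entire_ext (fun s => Cexp (- (1 / 2) * s) + (- (1 / x)) * (s * Cexp (1 / 2 * s)))%C).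
  - intros s. unfold gW, Cdiv.
    replace (- (1 * / 2) * s)%C with (- s * / 2)%C by ring.
    replace (1 * / 2 * s)%C with (s * / 2)%C by ring. ring.
  - apply entire_plus.
    + apply (entire_comp_scal _ Cexp), entire_Cexp.
    + apply entire_scal, entire_mulX, (entire_comp_scal _ Cexp), entire_Cexp.
Qed.

Lemma cder_Cexp_lin (c z : C) : cder (fun s => Cexp (c * s)%C) z (Cexp (c * z) * c)%C.
Proof.
  apply (cder_comp Cexp (fun s => c * s)%C); [|apply cder_Cexp].
  pose proof (cder_mult (fun _ => c) (fun s => s) z 0 1 (cder_const c z) (cder_id z)) as H.
  cbv beta in H. replace (0 * z + c * 1)%C with c in H by ring. exact H.
Qed.

Lemma gW_cder (x z : C) : x <> 0 -> cder (gW x) z (gW' x z).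
Proof.
  intros Hx. pose proof C2_neq_0.
  apply (cder_ext (fun s => Cexp (- (1 / 2) * s) - s / x * Cexp (1 / 2 * s))%C).
  { intros s. unfold gW. f_equal; [f_equal; field; auto|]. do 2 f_equal. field. }
  replace (gW' x z) with (Cexp (- (1 / 2) * z) * (- (1 / 2)) -
    ((1 * / x + z * 0) * Cexp (1 / 2 * z) + z / x * (Cexp (1 / 2 * z) * (1 / 2))))%C.
  - apply (cder_minus (fun s => Cexp (- (1 / 2) * s)%C)); [apply cder_Cexp_lin|].
    apply (cder_mult (fun s => s / x)%C (fun s => Cexp (1 / 2 * s)%C)); [|apply cder_Cexp_lin].
    apply (cder_mult (fun s => s) (fun _ => / x)%C); [apply cder_id|apply cder_const].
  - unfold gW'. replace (- (1 / 2) * z)%C with (- z / 2)%C by (field; auto).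
    replace (1 / 2 * z)%C with (z / 2)%C by (field; auto). field. auto.
Qed.

Lemma gW_factor (x s : C) : x <> 0 -> gW x s = (Cexp (- s / 2) * (1 - EW x s))%C.
Proof.
  intros Hx. unfold gW, EW. pose proof C2_neq_0.
  replace (Cexp s) with (Cexp (s / 2) * Cexp (s / 2))%C
    by (rewrite <- Cexp_plus; f_equal; field; auto).
  replace (- s / 2)%C with (- (s / 2))%C by (field; auto). rewrite Cexp_opp.
  field. split; [assumption|apply Cexp_neq_0].
Qed.

Lemma gW'_factor (x s : C) : x <> 0 -> s <> 0 ->
  gW' x s = (Cexp (- s / 2) * (- (1 / 2) - (1 / s + 1 / 2) * EW x s))%C.
Proof.
  intros Hx Hs. unfold gW', EW. pose proof C2_neq_0.
  replace (Cexp s) with (Cexp (s / 2) * Cexp (s / 2))%C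
    by (rewrite <- Cexp_plus; f_equal; field; auto).
  replace (- s / 2)%C with (- (s / 2))%C by (field; auto). rewrite Cexp_opp.
  field. repeat split; try assumption. apply Cexp_neq_0.
Qed.

Lemma gW_0 (x : C) : gW x 0 = 1.
Proof.
  unfold gW. replace (- 0 / 2)%C with (RtoC 0) by (field; apply C2_neq_0).
  rewrite Cexp_0. unfold Cdiv. ring.
Qed.

Lemma gW_zero_iff (x s : C) : x <> 0 -> gW x s = 0 <-> (s * Cexp s)%C = x.
Proof.
  intros Hx. rewrite gW_factor by assumption. pose proof (Cexp_neq_0 (- s / 2)).
  split.
  - intros E. assert (E1 : (1 - EW x s)%C = 0).
    { replace (1 - EW x s)%C with (/ Cexp (- s / 2) * (Cexp (- s / 2) * (1 - EW x s)))%C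
        by (field; assumption). rewrite E; ring. }
    unfold EW in E1. replace (s * Cexp s)%C with (x * (1 - (1 - s * Cexp s / x)))%C by (field; assumption).
    rewrite E1. ring.
  - intros E. unfold EW. rewrite E. field. assumption.
Qed.

(** At a zero [EW x s = 1], and the derivative becomes [- e^(-s/2) (1 + 1 / s)]. *)
Lemma gW_zero_simple (x s : C) : x <> 0 -> gW x s = 0 -> gW' x s = 0 -> s = RtoC (-1).
Proof.
  intros Hx Hg Hg'. pose proof C2_neq_0.
  apply gW_zero_iff in Hg; [|assumption].
  assert (Hs : s <> 0) by (intros ->; apply Hx; rewrite <- Hg; ring).
  rewrite gW'_factor in Hg' by assumption.
  replace (EW x s) with (RtoC 1) in Hg' by (unfold EW; rewrite Hg; field; assumption).
  pose proof (Cexp_neq_0 (- s / 2)).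
  replace s with (- (1) + (- s) * / Cexp (- s / 2) *
    (Cexp (- s / 2) * (- (1 / 2) - (1 / s + 1 / 2) * 1)))%C by (field; auto).
  rewrite Hg'. replace (RtoC (-1)) with (- (1))%C by (apply C_ext; reim; ring). ring.
Qed.

Lemma gW_logder (x s : C) : x <> 0 -> s <> 0 -> (1 - EW x s)%C <> 0 ->
  (gW' x s / gW x s)%C = ((- (1 / 2) - (1 / s + 1 / 2) * EW x s) / (1 - EW x s))%C.
Proof.
  intros Hx Hs HE. rewrite gW'_factor, gW_factor by assumption.
  pose proof (Cexp_neq_0 (- s / 2)). pose proof C2_neq_0. field. auto.
Qed.

Lemma Cmod_EW (x s : C) : x <> 0 -> Cmod (EW x s) = Cmod s * exp (Re s) / Cmod x.
Proof.
  intros Hx. unfold EW. rewrite Cmod_div, Cmod_mult, Cmod_Cexp by assumption. reflexivity.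
Qed.

(** * Circles that stay away from the zeros *)

Lemma ln_le_root4 (r : R) : 1 <= r -> ln r <= 4 * sqrt (sqrt r).
Proof.
  intros Hr. assert (H1 : 1 <= sqrt r) by (rewrite <- sqrt_1; apply sqrt_le_1; lra).
  assert (H2 : 1 <= sqrt (sqrt r)) by (rewrite <- sqrt_1 at 1; apply sqrt_le_1; lra).
  set (q := sqrt (sqrt r)) in *.
  assert (E : r = (q * q) * (q * q)).
  { unfold q. rewrite sqrt_sqrt by lra. rewrite sqrt_sqrt; lra. }
  rewrite E. rewrite !ln_mult by nra. pose proof (ln_le_sub1 q ltac:(lra)). lra.
Qed.

(** With [q = r^(1/4)] one has [ln r <= 4 q] and [c <= q], so the left side is at most
    [K (25 + 5) q^2], and [30 K <= q^2]. This explains [q0]. *)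
Lemma ln_sqr_small (c K : R) : 0 < c -> 0 < K ->
  exists R0, 1 <= R0 /\ forall r, R0 <= r ->
    K * ((c + ln r) * (c + ln r)) + K * (c + ln r) <= r /\ 0 <= ln r.
Proof.
  intros Hc HK. set (q0 := 1 + c + 30 * K). assert (Hq0 : 1 <= q0) by (unfold q0; lra).
  exists ((q0 * q0) * (q0 * q0)). split; [assert (1 <= q0 * q0) by nra; nra|].
  intros r Hr. assert (Hqq : 1 <= q0 * q0) by nra.
  assert (Hr1 : 1 <= r) by nra.
  pose proof (ln_le_root4 r Hr1) as Hln.
  set (q := sqrt (sqrt r)) in *.
  assert (Hsr : 0 <= sqrt r) by apply sqrt_pos.
  assert (Hq : q0 <= q).
  { unfold q. apply Rsqr_incr_0_var; [|apply sqrt_pos].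
    rewrite Rsqr_sqrt by assumption.
    apply Rsqr_incr_0_var; [|assumption]. rewrite Rsqr_sqrt by lra. unfold Rsqr. lra. }
  assert (E : r = (q * q) * (q * q)).
  { unfold q. rewrite sqrt_sqrt by lra. rewrite sqrt_sqrt; lra. }
  assert (Hln0 : 0 <= ln r).
  { rewrite <- ln_1. destruct (Req_dec 1 r) as [<-|]; [lra|left; apply ln_increasing; lra]. }
  split; [|assumption].
  assert (Hb : c + ln r <= 5 * q) by (unfold q0 in Hq; lra).
  assert (Hb2 : (c + ln r) * (c + ln r) <= (5 * q) * (5 * q)) by (apply Rmult_le_compat; lra).
  assert (K * ((c + ln r) * (c + ln r)) <= K * (25 * (q * q))) by (apply Rmult_le_compat_l; lra).
  assert (Hqq' : q <= q * q) by nra.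
  assert (K * (c + ln r) <= K * (5 * (q * q))) by (apply Rmult_le_compat_l; lra).
  assert (30 * K <= q * q) by (unfold q0 in Hq; lra).
  assert (30 * K * (q * q) <= q * q * (q * q)) by (apply Rmult_le_compat_r; nra). lra.
Qed.

(** Near the points [i r] and [- i r] of the circle of radius [r], [EW x s] is close to
    [kap r e^(Re s) / x] with [kap = - sin r]. The shift by a quarter period has the sign that makes
    [kap Re x <= 0], so that the real part of this value is not positive and [EW] keeps away from
    1. *)
Definition radius (x : C) (m : nat) : R :=
  if Rle_dec 0 (Re x) then 2 * PI * INR m + PI / 2 else 2 * PI * INR m - PI / 2.

Lemma radius_phase (x : C) (m : nat) : exists kap,
  cos (radius x m) = 0 /\ sin (radius x m) = - kap /\ kap * Re x <= 0 /\ (kap = 1 \/ kap = -1).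
Proof.
  assert (H1 : forall y, cos (2 * PI * INR m + y) = cos y).
  { intros y. rewrite <- (cos_period y m). f_equal; ring. }
  assert (H2 : forall y, sin (2 * PI * INR m + y) = sin y).
  { intros y. rewrite <- (sin_period y m). f_equal; ring. }
  unfold radius. destruct (Rle_dec 0 (Re x)) as [Hx|Hx].
  - exists (-1). rewrite H1, H2, cos_PI2, sin_PI2. repeat split; lra.
  - exists 1. unfold Rminus. rewrite H1, H2, cos_neg, sin_neg, cos_PI2, sin_PI2. repeat split; lra.
Qed.

Lemma radius_large (x : C) (B : R) : exists m1, forall m, (m1 <= m)%nat -> B <= radius x m.
Proof.
  destruct (INR_unbounded (Rabs B + 1)) as [m1 Hm1]. exists m1. intros m Hm.
  apply le_INR in Hm. pose proof (Rle_abs B). pose proof (Rabs_pos B). pose proof PI2_1.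
  unfold radius. destruct (Rle_dec 0 (Re x)); nra.
Qed.

Lemma one_minus_cos_le (d : R) : 0 <= d -> 0 <= 1 - cos d <= d.
Proof.
  intros Hd. split; [pose proof (COS_bound d); lra|].
  destruct (Req_dec d 0) as [->|Hd0]; [rewrite cos_0; lra|].
  destruct (MVT_cor2 cos (fun u => - sin u) 0 d) as (c & E & Hc); [lra| |].
  - intros u _. apply is_derive_Reals. auto_derive; [trivial|ring].
  - rewrite cos_0 in E. pose proof (SIN_bound c). nra.
Qed.

Lemma sin_abs_le (d : R) : 0 <= d -> Rabs (sin d) <= d.
Proof.
  intros Hd. destruct (Req_dec d 0) as [->|Hd0]; [rewrite sin_0, Rabs_R0; lra|].
  destruct (MVT_cor2 sin cos 0 d) as (c & E & Hc); [lra| |].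
  - intros u _. apply is_derive_Reals. auto_derive; [trivial|ring].
  - rewrite sin_0 in E. pose proof (COS_bound c). apply Rabs_le. split; nra.
Qed.

(* On the circle of radius [r] with [s] near the imaginary axis, [s e^(i Im s)] is close to [kap r]. *)
Lemma circle_phase (s : C) (r kap : R) : 1 <= r -> Cmod s = r -> cos r = 0 -> sin r = - kap ->
  kap = 1 \/ kap = -1 -> Rabs (Re s) <= r ->
  Cmod (s * Cexp (0, Im s) - RtoC (kap * r)) <= 2 * Rabs (Re s) + 4 * (Re s * Re s).
Proof.
  intros Hr Hs Hcr Hsr Hk Hu.
  set (u := Re s) in *. set (v := Im s).
  assert (Hv2 : v * v = r * r - u * u) by (unfold u, v; rewrite <- Hs; pose proof (Cmod_sqr s); lra).
  set (d := r - Rabs v).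
  pose proof (Rabs_pos v) as Hv0.
  assert (Hva : Rabs v * Rabs v = v * v) by (rewrite <- Rabs_mult; apply Rabs_pos_eq; nra).
  assert (Hd0 : 0 <= d) by (unfold d; nra).
  assert (Hd : r * d <= u * u).
  { replace (u * u) with (d * (r + Rabs v)) by (unfold d; nra). nra. }
  pose proof (one_minus_cos_le d Hd0) as Hcd. pose proof (sin_abs_le d Hd0) as Hsd.
  apply Rabs_le_between in Hsd.
  assert (Hcv : cos v = - kap * sin d).
  { replace (cos v) with (cos (Rabs v)).
    - replace (Rabs v) with (r - d) by (unfold d; ring). rewrite cos_minus, Hsr, Hcr. ring.
    - unfold Rabs. destruct (Rcase_abs v); [apply cos_neg|reflexivity]. }
  assert (Hsv : v * sin v = - kap * ((r - d) * cos d)).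
  { transitivity (Rabs v * sin (Rabs v)).
    - unfold Rabs. destruct (Rcase_abs v); [rewrite sin_neg; ring|reflexivity].
    - replace (Rabs v) with (r - d) by (unfold d; ring). rewrite sin_minus, Hsr, Hcr. ring. }
  assert (HK : Rabs kap = 1) by (destruct Hk as [-> | ->]; [apply Rabs_pos_eq; lra|rewrite Rabs_left; lra]).
  assert (Hau : Rabs u * Rabs u = u * u) by (rewrite <- Rabs_mult; apply Rabs_pos_eq; nra).
  eapply Rle_trans; [apply Cmod_le_sum|]. reim. fold u v. rewrite exp_0.
  assert (H1 : Rabs (u * (1 * cos v) - v * (1 * sin v) - kap * r) <= Rabs u + 2 * (u * u)).
  { replace (u * (1 * cos v) - v * (1 * sin v) - kap * r) with
      (u * cos v + kap * ((r - d) * cos d - r)) by (rewrite !Rmult_1_l; lra).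
    eapply Rle_trans; [apply Rabs_triang|]. rewrite !Rabs_mult, HK, Rmult_1_l.
    apply Rplus_le_compat.
    - pose proof (COS_bound v). assert (Rabs (cos v) <= 1) by (apply Rabs_le; lra).
      pose proof (Rabs_pos u). nra.
    - pose proof (COS_bound d). assert (d <= r) by (unfold d; lra). apply Rabs_le. split; nra. }
  assert (H2 : Rabs (u * (1 * sin v) + v * (1 * cos v) - 0) <= Rabs u + u * u).
  { replace (u * (1 * sin v) + v * (1 * cos v) - 0) with (u * sin v + v * cos v) by ring.
    eapply Rle_trans; [apply Rabs_triang|]. rewrite !Rabs_mult.
    apply Rplus_le_compat.
    - pose proof (SIN_bound v). assert (Rabs (sin v) <= 1) by (apply Rabs_le; lra).
      pose proof (Rabs_pos u). nra.
    - rewrite Hcv, Rabs_mult, Rabs_Ropp, HK, Rmult_1_l.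
      assert (Rabs (sin d) <= d) by (apply Rabs_le; lra).
      assert (Rabs v <= r) by (unfold d in *; lra). pose proof (Rabs_pos (sin d)). nra. }
  assert (0 <= u * u) by nra. lra.
Qed.

Lemma Re_le_Cmod (z : C) : Re z <= Cmod z.
Proof. pose proof (re_le_Cmod z) as H. apply Rabs_le_between in H. lra. Qed.

(** The triangle inequality suffices unless [EW] has modulus between [1 / 2] and 2; in that range
    the phase on the chosen circle gives real part at most [1 / 2]. Having [1 + Cmod EW] on the left
    keeps the quotient in [gW_logder] bounded also where [EW] is huge. *)
Lemma one_minus_EW_lower (x : C) : x <> 0 -> exists m0, forall m s, (m0 <= m)%nat ->
  Cmod s = radius x m -> (1 + Cmod (EW x s)) / 8 <= Cmod (1 - EW x s).
Proof.
  intros Hx. pose proof (Cmod_pos x Hx) as Hx0.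
  set (c := Rabs (ln (Cmod x)) + 2).
  pose proof (Rabs_pos (ln (Cmod x))) as Hlx.
  (* The constant 64 is ample to make the phase error [2 |Re s| + 4 (Re s)^2] of [circle_phase] at
     most [r / 8]. *)
  destruct (ln_sqr_small c 64 ltac:(unfold c; lra) ltac:(lra)) as (R0 & HR0 & Hsm).
  destruct (radius_large x R0) as [m0 Hm0]. exists m0. intros m s Hm Hs.
  specialize (Hm0 m Hm). set (r := radius x m) in *.
  destruct (Hsm r Hm0) as [Hr Hlnr]. clear Hsm.
  pose proof (Cmod_EW x s Hx) as HE. rewrite Hs in HE.
  set (E := EW x s) in *. pose proof (Cmod_ge_0 E) as HE0.
  destruct (Rle_lt_dec 2 (Cmod E)) as [H2|H2].
  { pose proof (Cmod_triangle_sub E 1) as T. rewrite Cmod_1, Cmod_minus_sym in T. lra. }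
  destruct (Rle_lt_dec (Cmod E) (/ 2)) as [H3|H3].
  { pose proof (Cmod_triangle_sub 1 E) as T. rewrite Cmod_1 in T. lra. }
  (* Now [1/2 < |E| < 2], which forces [Re s = O(ln r)]. *)
  assert (Hu : Rabs (Re s) <= c + ln r).
  { assert (Eu : Re s = ln (Cmod E) + ln (Cmod x) - ln r).
    { rewrite HE. unfold Rdiv. rewrite !ln_mult, ln_exp, ln_Rinv; try lra; try apply exp_pos.
      - apply Rmult_lt_0_compat; [lra|apply exp_pos].
      - apply Rinv_0_lt_compat; assumption. }
    assert (L1 : ln (Cmod E) <= 1).
    { pose proof (ln_le_sub1 (Cmod E) ltac:(lra)). lra. }
    assert (L2 : -1 <= ln (Cmod E)).
    { pose proof (ln_le_sub1 (/ Cmod E) ltac:(apply Rinv_0_lt_compat; lra)) as T.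
      rewrite ln_Rinv in T by lra.
      assert (/ Cmod E < / / 2) by (apply Rinv_lt_contravar; [apply Rmult_lt_0_compat|]; lra).
      rewrite Rinv_inv in *. lra. }
    pose proof (Rle_abs (ln (Cmod x))). pose proof (Rle_abs (- ln (Cmod x))). rewrite Rabs_Ropp in *.
    apply Rabs_le. unfold c. lra. }
  assert (Hau : Rabs (Re s) * Rabs (Re s) = Re s * Re s)
    by (rewrite <- Rabs_mult; apply Rabs_pos_eq; nra).
  pose proof (Rabs_pos (Re s)) as Hu0.
  assert (Hsq : Re s * Re s <= (c + ln r) * (c + ln r)) by (rewrite <- Hau; apply Rmult_le_compat; lra).
  destruct (radius_phase x m) as (kap & Hc1 & Hc2 & Hc3 & Hc4). fold r in Hc1, Hc2.
  pose proof (circle_phase s r kap ltac:(lra) Hs Hc1 Hc2 Hc4 ltac:(nra)) as Hph.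
  set (err := (s * Cexp (0, Im s) - RtoC (kap * r))%C) in *.
  (* Main term plus phase error: the first has nonpositive real part by the choice of the radius,
     the second has modulus at most [2 * (1 / 8)]. *)
  assert (EE : E = (RtoC (exp (Re s)) * (RtoC (kap * r) / x) + RtoC (exp (Re s)) * (err / x))%C).
  { unfold E, EW. replace (Cexp s) with (RtoC (exp (Re s)) * Cexp (0, Im s))%C.
    - unfold err. field. assumption.
    - apply C_ext; reim; rewrite exp_0; ring. }
  assert (Hre1 : Re (RtoC (exp (Re s)) * (RtoC (kap * r) / x)) <= 0).
  { unfold Cdiv. rewrite re_scal_l, re_scal_l, Cinv_re. pose proof (Csqr_pos x Hx).
    pose proof (exp_pos (Re s)).
    replace (exp (Re s) * (kap * r * (Re x / (Re x * Re x + Im x * Im x)))) with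
      (exp (Re s) * r / (Re x * Re x + Im x * Im x) * (kap * Re x)) by (field; lra).
    assert (0 < exp (Re s) * r / (Re x * Re x + Im x * Im x)).
    { apply Rdiv_lt_0_compat; [apply Rmult_lt_0_compat|]; lra. }
    nra. }
  assert (Hre2 : Re (RtoC (exp (Re s)) * (err / x)) <= / 2).
  { eapply Rle_trans; [apply Re_le_Cmod|].
    rewrite Cmod_mult, Cmod_div, Cmod_R, Rabs_pos_eq by (assumption || left; apply exp_pos).
    replace (exp (Re s) * (Cmod err / Cmod x)) with (Cmod E * (Cmod err / r)) by (rewrite HE; field; lra).
    assert (Cmod err / r <= / 8).
    { apply Rmult_le_reg_r with r; [lra|].
      replace (Cmod err / r * r) with (Cmod err) by (field; lra). nra. }
    assert (0 <= Cmod err / r).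
    { apply Rmult_le_pos; [apply Cmod_ge_0|left; apply Rinv_0_lt_compat; lra]. }
    nra. }
  assert (HReE : Re E <= / 2) by (rewrite EE, re_plus; lra).
  pose proof (Re_le_Cmod (1 - E)) as T. autorewrite with reim in T. lra.
Qed.

(** The numerator of [gW_logder] is at most [3 / 2 (1 + Cmod EW)] and the denominator at least
    [(1 + Cmod EW) / 8], whence 12. *)
Lemma gW_logder_bound (x : C) : x <> 0 -> exists m0, forall m s, (m0 <= m)%nat ->
  Cmod s = radius x m -> Cmod (gW' x s / gW x s) <= 12.
Proof.
  intros Hx. destruct (one_minus_EW_lower x Hx) as [m1 Hm1].
  destruct (radius_large x 1) as [m2 Hm2]. exists (Nat.max m1 m2).
  intros m s Hm Hs. specialize (Hm1 m s ltac:(lia) Hs). specialize (Hm2 m ltac:(lia)).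
  pose proof (Cmod_ge_0 (EW x s)).
  assert (Hs0 : s <> 0) by (apply Cmod_neq; lra).
  assert (HE : (1 - EW x s)%C <> 0) by (apply Cmod_neq; lra).
  rewrite gW_logder, Cmod_div by assumption.
  apply Rmult_le_reg_r with (Cmod (1 - EW x s)); [lra|].
  unfold Rdiv. rewrite Rmult_assoc, Rinv_l, Rmult_1_r by lra.
  assert (H12 : Cmod (1 / 2) = / 2).
  { rewrite Cmod_div by apply C2_neq_0. rewrite !Cmod_R, !Rabs_pos_eq by lra. lra. }
  assert (H1s : Cmod (1 / s) <= 1).
  { rewrite Cmod_div, Cmod_1 by assumption. rewrite Hs.
    apply Rmult_le_reg_r with (radius x m); [lra|]. unfold Rdiv. rewrite Rmult_assoc, Rinv_l; lra. }
  eapply Rle_trans; [apply Cmod_triangle_minus|]. rewrite Cmod_opp, H12, Cmod_mult.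
  pose proof (Cmod_triangle (1 / s) (1 / 2)) as T. rewrite H12 in T.
  assert (Cmod (1 / s + 1 / 2) * Cmod (EW x s) <= 3 / 2 * Cmod (EW x s)) by (apply Rmult_le_compat_r; lra).
  lra.
Qed.

Lemma exp_ge_sqr (y : R) : 0 <= y -> y * y / 4 <= exp y.
Proof.
  intros Hy. replace (exp y) with (exp (y / 2) * exp (y / 2)) by (rewrite <- exp_plus; f_equal; field).
  pose proof (exp_ineq1_le (y / 2)). nra.
Qed.

(** In the sector [Re s >= del r], [EW x s] is at least [r / Cmod x] in modulus, whereas
    [EW x (- s)] is exponentially small; the bound [exp y >= y^2 / 4] is all that is needed of
    this. *)
Lemma gW_logder_sym (x : C) (del eps : R) : x <> 0 -> 0 < del -> 0 < eps ->
  exists m1, forall m s, (m1 <= m)%nat -> Cmod s = radius x m -> del * radius x m <= Re s ->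
  Cmod (gW' x s / gW x s + gW' x (- s) / gW x (- s)) <= eps.
Proof.
  intros Hx Hd He. pose proof (Cmod_pos x Hx) as Hx0.
  set (a := Cmod x) in *.
  (* The summands ensure, in order, [r >= 1], [Cmod E >= 2], [Cmod E' <= 1 / 2], and the estimates
     [eps / 2] for the two terms of the sum. *)
  destruct (radius_large x (1 + 2 * a + 8 / (del * del * a) + 4 * (a + 1) / eps
    + 32 / (del * del * a * eps))) as [m1 Hm1].
  exists m1. intros m s Hm Hs Hre. specialize (Hm1 m Hm). set (r := radius x m) in *.
  assert (Hdda : 0 < del * del * a) by (repeat apply Rmult_lt_0_compat; assumption).
  assert (P1 : 0 < 8 / (del * del * a)) by (apply Rdiv_lt_0_compat; lra).
  assert (P2 : 0 < 4 * (a + 1) / eps) by (apply Rdiv_lt_0_compat; lra).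
  assert (P3 : 0 < 32 / (del * del * a * eps)).
  { apply Rdiv_lt_0_compat; [lra|apply Rmult_lt_0_compat; assumption]. }
  assert (Hr : 0 < r) by lra.
  assert (Hs0 : s <> 0) by (apply Cmod_neq; lra).
  assert (Hs0' : (- s)%C <> 0) by (apply Cmod_neq; rewrite Cmod_opp; lra).
  pose proof (Cmod_EW x s Hx) as HE. pose proof (Cmod_EW x (- s) Hx) as HE'.
  rewrite Cmod_opp in HE'. autorewrite with reim in HE'. rewrite Hs in HE, HE'. fold a in HE, HE'.
  set (E := EW x s) in *. set (E' := EW x (- s)) in *.
  assert (Hdr : 0 < del * r) by (apply Rmult_lt_0_compat; assumption).
  assert (HEbig : r / a <= Cmod E).
  { rewrite HE. apply Rmult_le_compat_r; [left; apply Rinv_0_lt_compat; assumption|].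
    pose proof (exp_ineq1_le (Re s)). nra. }
  assert (Hra : 2 <= r / a).
  { apply Rmult_le_reg_r with a; [assumption|]. replace (r / a * a) with r by (field; lra). lra. }
  assert (HEsmall : Cmod E' <= 4 / (del * del * a * r)).
  { rewrite HE', exp_Ropp. pose proof (exp_ge_sqr (del * r) ltac:(lra)) as Hq.
    assert (exp (del * r) <= exp (Re s)).
    { destruct (Req_dec (del * r) (Re s)) as [->|]; [lra|left; apply exp_increasing; lra]. }
    assert (Hq0 : 0 < del * r * (del * r) / 4) by (assert (0 < del * r * (del * r)) by nra; lra).
    assert (/ exp (Re s) <= / (del * r * (del * r) / 4)) by (apply Rinv_le_contravar; lra).
    apply Rle_trans with (r * / (del * r * (del * r) / 4) / a).
    - apply Rmult_le_compat_r; [left; apply Rinv_0_lt_compat; assumption|].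
      apply Rmult_le_compat_l; lra.
    - right. field. repeat split; lra. }
  assert (HE'half : Cmod E' <= / 2).
  { eapply Rle_trans; [exact HEsmall|].
    apply Rmult_le_reg_r with (del * del * a * r); [apply Rmult_lt_0_compat; assumption|].
    replace (4 / (del * del * a * r) * (del * del * a * r)) with 4 by (field; repeat split; lra).
    apply Rle_trans with (/ 2 * (del * del * a * (8 / (del * del * a)))); [right; field; repeat split; lra|].
    apply Rmult_le_compat_l; [lra|]. apply Rmult_le_compat_l; lra. }
  assert (T1 : Cmod E - 1 <= Cmod (1 - E)).
  { pose proof (Cmod_triangle_sub E 1) as T. rewrite Cmod_1, Cmod_minus_sym in T. lra. }
  assert (T2 : 1 - Cmod E' <= Cmod (1 - E')).
  { pose proof (Cmod_triangle_sub 1 E') as T. rewrite Cmod_1 in T. lra. }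
  assert (N1 : (1 - E)%C <> 0) by (apply Cmod_neq; lra).
  assert (N2 : (1 - E')%C <> 0) by (apply Cmod_neq; lra).
  rewrite !gW_logder by assumption. fold E E'.
  pose proof C2_neq_0 as H2.
  (* The two quotients are [1 / 2 - (1 + E / s) / (1 - E)] and
     [- 1 / 2 + (1 / s - 1) E' / (1 - E')]; the halves cancel. *)
  replace (_ + _)%C with (- ((1 + E / s) / (1 - E)) + (1 / s - 1) * E' / (1 - E'))%C
    by (field; repeat split; assumption).
  pose proof (Cmod_ge_0 E') as HE'0.
  assert (B1 : Cmod ((1 + E / s) / (1 - E)) <= eps / 2).
  { rewrite Cmod_div by assumption.
    assert (Hn : Cmod (1 + E / s) <= 1 + Cmod E / r).
    { eapply Rle_trans; [apply Cmod_triangle|]. rewrite Cmod_1, Cmod_div, Hs by assumption. lra. }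
    apply Rmult_le_reg_r with (Cmod (1 - E)); [lra|].
    unfold Rdiv at 1. rewrite Rmult_assoc, Rinv_l, Rmult_1_r by lra.
    eapply Rle_trans; [exact Hn|].
    apply Rle_trans with (eps / 2 * (Cmod E / 2)).
    - assert (Hr2 : 4 * (a + 1) <= eps * r).
      { apply Rle_trans with (eps * (4 * (a + 1) / eps)); [right; field; lra|].
        apply Rmult_le_compat_l; lra. }
      assert (Hr3 : Cmod E / r * (4 * (a + 1)) <= eps * Cmod E).
      { apply Rle_trans with (Cmod E / r * (eps * r)).
        - apply Rmult_le_compat_l; [|assumption].
          apply Rmult_le_pos; [lra|left; apply Rinv_0_lt_compat; lra].
        - right; field; lra. }
      assert (1 <= Cmod E / r * a).
      { apply Rmult_le_reg_r with (r / a); [lra|].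
        replace (Cmod E / r * a * (r / a)) with (Cmod E) by (field; lra). lra. }
      nra.
    - apply Rmult_le_compat_l; lra. }
  assert (B2 : Cmod ((1 / s - 1) * E' / (1 - E')) <= eps / 2).
  { rewrite Cmod_div, Cmod_mult by assumption.
    assert (Hn : Cmod (1 / s - 1) <= 2).
    { eapply Rle_trans; [apply Cmod_triangle_minus|]. rewrite Cmod_1, Cmod_div, Cmod_1, Hs by assumption.
      assert (1 / r <= 1); [|lra].
      apply Rmult_le_reg_r with r; [lra|]. unfold Rdiv. rewrite Rmult_assoc, Rinv_l; lra. }
    apply Rmult_le_reg_r with (Cmod (1 - E')); [lra|].
    unfold Rdiv at 1. rewrite Rmult_assoc, Rinv_l, Rmult_1_r by lra.
    apply Rle_trans with (2 * Cmod E'); [apply Rmult_le_compat_r; assumption|].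
    assert (Cmod E' <= eps / 8).
    { eapply Rle_trans; [exact HEsmall|].
      apply Rmult_le_reg_r with (del * del * a * r); [apply Rmult_lt_0_compat; assumption|].
      replace (4 / (del * del * a * r) * (del * del * a * r)) with 4 by (field; repeat split; lra).
      apply Rle_trans with (eps / 8 * (del * del * a * (32 / (del * del * a * eps))));
        [right; field; repeat split; lra|].
      apply Rmult_le_compat_l; [lra|]. apply Rmult_le_compat_l; lra. }
    apply Rle_trans with (eps / 2 * / 2); [lra|]. apply Rmult_le_compat_l; lra. }
  eapply Rle_trans; [apply Cmod_triangle|]. rewrite Cmod_opp. lra.
Qed.

(** * Asymptotics of the branches *)

(** A stand-in for the logarithm. The power [1 / 4] is small enough: a product of two such terms is
    [sqrt n], and [sqrt n / n^2] is still summable. *)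
Definition root4 (r : R) : R := sqrt (sqrt r).

Lemma root4_ge_1 (r : R) : 1 <= r -> 1 <= root4 r.
Proof.
  intros Hr. unfold root4. rewrite <- sqrt_1. apply sqrt_le_1; try lra; try apply sqrt_pos.
  rewrite <- sqrt_1. apply sqrt_le_1; lra.
Qed.

Lemma root4_pow (r : R) : 0 <= r -> root4 r * root4 r * (root4 r * root4 r) = r.
Proof.
  intros Hr. unfold root4. rewrite sqrt_sqrt by apply sqrt_pos. apply sqrt_sqrt; assumption.
Qed.

Lemma third_le_sin (a : R) : 0 <= a <= PI / 2 -> a / 3 <= sin a.
Proof.
  intros Ha. pose proof PI_4.
  destruct (pre_sin_bound a 0 ltac:(lra) ltac:(lra)) as [Hb _].
  unfold sin_approx, sin_term in Hb. simpl in Hb.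
  assert (Hb' : a - a * a * a / 6 <= sin a) by lra.
  assert (a * a <= 4) by nra.
  destruct (Req_dec a 0) as [->|]; [rewrite sin_0; lra|]. nra.
Qed.

Lemma abs_le_sin (a : R) : - (PI / 2) <= a <= PI / 2 -> Rabs a <= 3 * Rabs (sin a).
Proof.
  intros Ha. destruct (Rle_lt_dec 0 a) as [H|H].
  - pose proof (third_le_sin a ltac:(lra)). rewrite !Rabs_pos_eq; lra.
  - pose proof (third_le_sin (- a) ltac:(lra)) as K. rewrite sin_neg in K.
    rewrite !Rabs_left; lra.
Qed.

Lemma ln_diff_le (a b m : R) : 0 < m -> m <= a -> m <= b -> Rabs (ln a - ln b) <= Rabs (a - b) / m.
Proof.
  intros Hm Ha Hb.
  assert (K : forall a b, m <= a -> m <= b -> ln a - ln b <= Rabs (a - b) / m).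
  { clear a b Ha Hb. intros a b Ha Hb.
    replace (ln a - ln b) with (ln (a / b)).
    - pose proof (ln_le_sub1 (a / b) ltac:(apply Rdiv_lt_0_compat; lra)) as H.
      replace (a / b - 1) with ((a - b) / b) in H by (field; lra).
      eapply Rle_trans; [exact H|]. unfold Rdiv.
      apply Rle_trans with (Rabs (a - b) * / b).
      + apply Rmult_le_compat_r; [left; apply Rinv_0_lt_compat; lra|apply Rle_abs].
      + apply Rmult_le_compat_l; [apply Rabs_pos|]. apply Rinv_le_contravar; lra.
    - unfold Rdiv. rewrite ln_mult, ln_Rinv; try lra. apply Rinv_0_lt_compat; lra. }
  apply Rabs_le. split.
  - pose proof (K b a Hb Ha) as H. rewrite Rabs_minus_sym in H. lra.
  - apply K; assumption.
Qed.

(* Case [k = sg * n] with [sg = 1] or [-1]; [b] is the centre of the asymptotic expansion. *)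
Lemma wright_asymp (L0 theta : R) : - PI < theta <= PI -> exists C0, 0 < C0 /\
  forall (n : nat) (sg : R) (w : C), (2 <= n)%nat -> sg = 1 \/ sg = -1 -> w <> 0 ->
  (w + Clog w)%C = (L0, theta + sg * (2 * PI * INR n)) ->
  Cmod (w - (L0 - ln (2 * PI * INR n), sg * (2 * PI * INR n - PI / 2) + theta)) <=
  C0 * root4 (INR n) / INR n.
Proof.
  intros Hth. pose proof PI_RGT_0 as HPI. pose proof PI2_1 as HPI1. pose proof PI_4 as HPI4.
  pose proof (Rabs_pos L0) as HL0.
  set (C1 := 2 * (Rabs L0 + 4 * PI)).
  set (C2 := Rabs L0 + Rabs (ln C1) + 4).
  assert (HC1 : 0 < C1) by (unfold C1; lra).
  assert (HC2 : 0 < C2) by (unfold C2; pose proof (Rabs_pos (ln C1)); lra).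
  exists (4 * (C2 + 2 * PI)). split; [lra|].
  intros n sg w Hn Hsg Hw E.
  assert (Hn2 : 2 <= INR n) by (apply (le_INR 2); lia).
  set (N := INR n) in *.
  pose proof (root4_ge_1 N ltac:(lra)) as Hq1. set (q := root4 N) in *.
  pose proof (f_equal Re E) as E1. pose proof (f_equal Im E) as E2.
  autorewrite with reim in E1, E2.
  pose proof (Carg_bound w Hw) as Ha. pose proof (Cmod_pos w Hw) as Hr0.
  set (r := Cmod w) in *. set (y := Im w) in *. set (u := Re w) in *. set (al := Carg w) in *.
  (* A bootstrap starts here. The imaginary part makes [Cmod w] comparable to [n] (from below this
     uses [2 <= n]); hence [Re w = L0 - ln (Cmod w)] is of logarithmic size, the argument differs
     from [sg PI / 2] by [O(Re w / Cmod w)], and both [Im w] and [ln (Cmod w)] are thereby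
     refined. *)
  assert (Hyabs : 2 * PI * N - 2 * PI <= sg * y <= 2 * PI * N + 2 * PI).
  { destruct Hsg as [-> | ->]; lra. }
  assert (Hyr : sg * y <= r).
  { pose proof (Im_le_Cmod w) as T. apply Rabs_le_between in T. fold y r in T.
    destruct Hsg as [-> | ->]; lra. }
  assert (HPN : 2 * PI <= PI * N) by nra.
  assert (HrN : PI * N <= r) by lra.
  assert (Hr1 : 1 <= r) by nra.
  assert (Hrup : r <= C1 * N).
  { pose proof (Cmod_le_sum w) as T. fold r u y in T.
    assert (Rabs y <= 2 * PI * N + 2 * PI).
    { apply Rabs_le. destruct Hsg as [-> | ->]; lra. }
    assert (Rabs u <= Rabs L0 + r / 2).
    { replace u with (L0 - ln r) by lra.
      assert (0 <= ln r).
      { rewrite <- ln_1. destruct (Req_dec 1 r) as [<-|]; [lra|left; apply ln_increasing; lra]. }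
      assert (ln r <= r / 2).
      { pose proof (ln_le_sub1 (r / 2) ltac:(lra)) as K.
        unfold Rdiv in K. rewrite ln_mult, ln_Rinv in K by lra.
        assert (ln 2 <= 1) by (pose proof (ln_le_sub1 2 ltac:(lra)); lra). lra. }
      eapply Rle_trans; [apply Rabs_triang|]. rewrite Rabs_Ropp, (Rabs_pos_eq (ln r)) by assumption. lra. }
    assert (Rabs L0 <= Rabs L0 * N) by nra. unfold C1. nra. }
  assert (Hu : Rabs u <= C2 * q).
  { replace u with (L0 - ln r) by lra.
    assert (0 <= ln r).
    { rewrite <- ln_1. destruct (Req_dec 1 r) as [<-|]; [lra|left; apply ln_increasing; lra]. }
    assert (ln r <= Rabs (ln C1) + 4 * q).
    { apply Rle_trans with (ln (C1 * N)).
      - destruct (Req_dec r (C1 * N)) as [->|]; [lra|left; apply ln_increasing; lra].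
      - rewrite ln_mult by lra. pose proof (Rle_abs (ln C1)).
        pose proof (ln_le_root4 N ltac:(lra)) as K. fold (root4 N) q in K. lra. }
    eapply Rle_trans; [apply Rabs_triang|]. rewrite Rabs_Ropp, (Rabs_pos_eq (ln r)) by assumption.
    pose proof (Rabs_pos (ln C1)).
    assert (Rabs L0 <= Rabs L0 * q) by nra. assert (Rabs (ln C1) <= Rabs (ln C1) * q) by nra.
    unfold C2. lra. }
  assert (Hal : Rabs (al - sg * (PI / 2)) <= 3 * (C2 * q) / (PI * N)).
  { pose proof (cos_Carg w Hw) as Hc. pose proof (sin_Carg w Hw) as Hs. fold r u y al in Hc, Hs.
    assert (Hsal : 0 < sg * al < PI \/ sg * al = PI).
    { destruct Hsg as [-> | ->].
      - assert (0 < al); [|lra]. apply Rnot_le_lt. intros Hle.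
        assert (sin al <= 0).
        { destruct (Req_dec al 0) as [->|]; [rewrite sin_0; lra|].
          pose proof (sin_gt_0 (- al) ltac:(lra) ltac:(lra)) as K. rewrite sin_neg in K. lra. }
        nra.
      - assert (al < 0); [|lra]. apply Rnot_le_lt. intros Hle.
        pose proof (sin_ge_0 al Hle ltac:(lra)). nra. }
    assert (Hsin : r * sin (PI / 2 - sg * al) = u).
    { rewrite sin_shift. rewrite <- Hc. f_equal.
      destruct Hsg as [-> | ->]; [f_equal; ring|]. rewrite <- cos_neg. f_equal; ring. }
    replace (Rabs (al - sg * (PI / 2))) with (Rabs (PI / 2 - sg * al)).
    2:{ destruct Hsg as [-> | ->]; [rewrite Rabs_minus_sym; f_equal; ring|f_equal; ring]. }
    eapply Rle_trans; [apply abs_le_sin; lra|].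
    assert (Hsabs : Rabs (sin (PI / 2 - sg * al)) <= C2 * q / (PI * N)).
    { replace (sin (PI / 2 - sg * al)) with (u / r) by (rewrite <- Hsin; field; lra).
      rewrite Rabs_div, (Rabs_pos_eq r) by lra.
      apply Rmult_le_compat; try apply Rabs_pos; try assumption.
      - left; apply Rinv_0_lt_compat; lra.
      - apply Rinv_le_contravar; [apply Rmult_lt_0_compat|]; lra. }
    unfold Rdiv in *. rewrite Rmult_assoc. apply Rmult_le_compat_l; lra. }
  assert (Hln : Rabs (ln r - ln (2 * PI * N)) <= (2 * PI + C2 * q) / (PI * N)).
  { eapply Rle_trans; [apply (ln_diff_le _ _ (PI * N)); nra|].
    apply Rmult_le_compat_r; [left; apply Rinv_0_lt_compat, Rmult_lt_0_compat; lra|].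
    apply Rabs_le. pose proof (Cmod_le_sum w) as T. fold r u y in T.
    assert (Rabs y = sg * y).
    { destruct Hsg as [-> | ->]; [rewrite Rabs_pos_eq; lra|rewrite Rabs_left; lra]. }
    lra. }
  eapply Rle_trans; [apply Cmod_le_sum|]. reim. fold u y.
  replace (u - (L0 - ln (2 * PI * N))) with (- (ln r - ln (2 * PI * N))) by lra.
  replace (y - (sg * (2 * PI * N - PI / 2) + theta)) with (- (al - sg * (PI / 2))) by lra.
  rewrite !Rabs_Ropp.
  assert (HNpos : 0 < PI * N) by (apply Rmult_lt_0_compat; lra).
  apply Rle_trans with ((2 * PI + C2 * q) / (PI * N) + 3 * (C2 * q) / (PI * N)); [lra|].
  apply Rmult_le_reg_r with (PI * N); [assumption|].
  replace (((2 * PI + C2 * q) / (PI * N) + 3 * (C2 * q) / (PI * N)) * (PI * N)) with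
    (2 * PI + 4 * (C2 * q)) by (field; lra).
  replace (4 * (C2 + 2 * PI) * q / N * (PI * N)) with (PI * (4 * (C2 + 2 * PI) * q)) by (field; lra).
  assert (2 * PI <= 2 * PI * q) by nra. assert (0 <= C2 * q) by nra. nra.
Qed.

(* [lambert_b x k] and [lambert_b' x k] approximate [W_k] and [W_(-k)] for [k >= 1]. *)
Definition lambert_b (x : C) (n : nat) : C :=
  (2 * PI * INR n * Ci - PI / 2 * Ci + Clog x - ln (2 * PI * INR n))%C.

Definition lambert_b' (x : C) (n : nat) : C :=
  (- (2 * PI * INR n * Ci) + PI / 2 * Ci + Clog x - ln (2 * PI * INR n))%C.

Lemma PI2_RtoC : (PI / 2)%C = RtoC (PI / 2).
Proof. rewrite RtoC_div by lra. reflexivity. Qed.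

Lemma LambertW_asymp (x : C) : x <> 0 -> exists C0, 0 < C0 /\
  forall n : nat, (1 <= n)%nat ->
  Cmod (LambertW (Z.of_nat n) x - lambert_b x n) <= C0 * root4 (INR n) / INR n /\
  Cmod (LambertW (- Z.of_nat n) x - lambert_b' x n) <= C0 * root4 (INR n) / INR n.
Proof.
  intros Hx.
  destruct (wright_asymp (ln (Cmod x)) (Carg x) (Carg_bound x Hx)) as (C0 & HC0 & H).
  set (A := Cmod (LambertW 1 x - lambert_b x 1)).
  set (B := Cmod (LambertW (-1) x - lambert_b' x 1)).
  exists (C0 + A + B).
  assert (HA : 0 <= A) by apply Cmod_ge_0. assert (HB : 0 <= B) by apply Cmod_ge_0.
  split; [lra|]. intros n Hn.
  (* The case [n = 1] is absorbed in the constant: [W_(-1)] on the cut does not satisfy the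
     logarithmic equation with index -1. *)
  destruct (Nat.eq_dec n 1) as [->|Hn1].
  - change (Z.of_nat 1) with 1%Z. change (- (1))%Z with (-1)%Z. fold A B.
    simpl INR. unfold root4. rewrite !sqrt_1. split; lra.
  - assert (HN : 2 <= INR n) by (apply (le_INR 2); lia).
    pose proof (root4_ge_1 (INR n) ltac:(lra)) as Hq.
    assert (Hup : C0 * root4 (INR n) / INR n <= (C0 + A + B) * root4 (INR n) / INR n).
    { apply Rmult_le_compat_r; [left; apply Rinv_0_lt_compat; lra|]. nra. }
    pose proof (IZR_INR_comm := INR_IZR_INZ n).
    split; (eapply Rle_trans; [|exact Hup]).
    + replace (lambert_b x n) with ((ln (Cmod x) - ln (2 * PI * INR n),
        1 * (2 * PI * INR n - PI / 2) + Carg x) : C).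
      2:{ unfold lambert_b. rewrite PI2_RtoC. apply C_ext; reim; ring. }
      apply H; [lia|left; reflexivity|apply LambertW_neq_0; assumption|].
      rewrite LambertW_Clog by (assumption || lia).
      apply C_ext; reim; rewrite <- ?INR_IZR_INZ; ring.
    + replace (lambert_b' x n) with ((ln (Cmod x) - ln (2 * PI * INR n),
        -1 * (2 * PI * INR n - PI / 2) + Carg x) : C).
      2:{ unfold lambert_b'. rewrite PI2_RtoC. apply C_ext; reim; ring. }
      apply H; [lia|right; reflexivity|apply LambertW_neq_0; assumption|].
      rewrite LambertW_Clog by (assumption || lia).
      apply C_ext; reim; rewrite ?opp_IZR, <- ?INR_IZR_INZ; ring.
Qed.

(** * The product of the factors 1 - T / W_k(x) *)

Definition zrange (a b : Z) : list Z :=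
  map (fun i => (a + Z.of_nat i)%Z) (seq 0 (Z.to_nat (b - a + 1))).

Definition zprod (f : Z -> C) (l : list Z) : C :=
  fold_right (fun k acc => (f k * acc)%C) (RtoC 1) l.

Lemma in_zrange (a b k : Z) : In k (zrange a b) <-> (a <= k <= b)%Z.
Proof.
  unfold zrange. rewrite in_map_iff. split.
  - intros (i & <- & Hi). apply in_seq in Hi. lia.
  - intros H. exists (Z.to_nat (k - a)). split; [lia|]. apply in_seq. lia.
Qed.

Lemma NoDup_zrange (a b : Z) : NoDup (zrange a b).
Proof.
  unfold zrange. apply NoDup_map_NoDup_ForallPairs; [|apply seq_NoDup].
  intros i j _ _ H. lia.
Qed.

Lemma zrange_cons (a b : Z) : (a <= b)%Z -> zrange a b = a :: zrange (a + 1) b.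
Proof.
  intros H. unfold zrange.
  replace (Z.to_nat (b - a + 1)) with (S (Z.to_nat (b - (a + 1) + 1))) by lia.
  simpl. f_equal; [lia|]. rewrite <- seq_shift, map_map. apply map_ext. intros i. lia.
Qed.

Lemma zrange_snoc (a b : Z) : (a <= b)%Z -> zrange a b = zrange a (b - 1) ++ b :: nil.
Proof.
  intros H. unfold zrange.
  replace (Z.to_nat (b - a + 1)) with (Z.to_nat (b - 1 - a + 1) + 1)%nat by lia.
  rewrite seq_app, map_app. f_equal. simpl. f_equal. lia.
Qed.

Lemma zprod_cons (f : Z -> C) (k : Z) (l : list Z) : zprod f (k :: l) = (f k * zprod f l)%C.
Proof. reflexivity. Qed.

Lemma zprod_app (f : Z -> C) (l l' : list Z) : zprod f (l ++ l') = (zprod f l * zprod f l')%C.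
Proof. induction l as [|k l IH]; simpl; [ring|rewrite IH; ring]. Qed.

Lemma zprod_mult (f g : Z -> C) (l : list Z) :
  zprod (fun k => f k * g k)%C l = (zprod f l * zprod g l)%C.
Proof. induction l as [|k l IH]; simpl; [ring|rewrite IH; ring]. Qed.

Lemma zprod_ext (f g : Z -> C) (l : list Z) : (forall k, In k l -> f k = g k) -> zprod f l = zprod g l.
Proof.
  induction l as [|k l IH]; intros H; simpl; [reflexivity|].
  rewrite H, IH; [reflexivity| |left; reflexivity]. intros j Hj. apply H; right; assumption.
Qed.

Lemma prod_sym_zprod (K : nat) (f : Z -> C) :
  prod_sym K f = zprod f (zrange (- Z.of_nat K) (Z.of_nat K)).
Proof.
  assert (H : forall n j, Iter.iter Cmult (RtoC 1) (seq.iota j n)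
      (fun i => f (Z.of_nat i - Z.of_nat K)%Z) =
    zprod f (map (fun i => (- Z.of_nat K + Z.of_nat i)%Z) (List.seq j n))).
  { intros n. induction n as [|n IH]; intros j; simpl; [reflexivity|].
    rewrite IH. do 2 f_equal. lia. }
  unfold prod_sym, Iter.iter_nat, zrange. rewrite H. do 3 f_equal. lia.
Qed.

Lemma lprod_map (g : Z -> C) (l : list Z) (T : C) :
  lprod (map g l) T = zprod (fun k => 1 - T / g k)%C l.
Proof. induction l as [|k l IH]; simpl; [reflexivity|rewrite IH; reflexivity]. Qed.

(** * Which branches lie inside a given circle *)

Lemma root4_small (K eps : R) : 0 < K -> 0 < eps ->
  exists n0, (1 <= n0)%nat /\ forall n, (n0 <= n)%nat -> K * root4 (INR n) / INR n <= eps.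
Proof.
  intros HK He. set (A := K / eps). assert (HA : 0 < A) by (apply Rdiv_lt_0_compat; assumption).
  destruct (INR_unbounded (A * A + 1)) as [n0 Hn0]. exists (Nat.max 1 n0). split; [lia|].
  intros n Hn. assert (Hn1 : A * A + 1 < INR n).
  { eapply Rlt_le_trans; [exact Hn0|]. apply le_INR; lia. }
  assert (H1 : 1 <= INR n) by nra.
  set (N := INR n) in *. pose proof (root4_ge_1 N H1) as Hq. pose proof (root4_pow N ltac:(lra)) as E.
  set (q := root4 N) in *.
  assert (Hqq : A <= q * q).
  { apply Rsqr_incr_0_var; [|nra]. unfold Rsqr. lra. }
  assert (HAe : A * eps = K) by (unfold A; field; lra).
  apply Rmult_le_reg_r with N; [lra|].
  replace (K * q / N * N) with (K * q) by (field; lra).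
  assert (q * q <= N) by nra.
  assert (A * q <= N) by nra. nra.
Qed.

Lemma Cmod_pair_approx (X Y d : R) : 0 < Y -> X * X <= 2 * Y * d -> Y <= Cmod (X, Y) <= Y + d /\
  Y <= Cmod (X, - Y) <= Y + d.
Proof.
  intros HY HX. assert (Hd : 0 <= d) by nra.
  assert (K : forall z : C, Re z * Re z + Im z * Im z = X * X + Y * Y -> Y <= Cmod z <= Y + d).
  { intros z Hz. rewrite <- Cmod_sqr in Hz. pose proof (Cmod_ge_0 z). split; nra. }
  split; apply K; reim; ring.
Qed.

(** The real part is logarithmic and adds only [O(ln^2 n / n)] to the modulus, which is therefore
    governed by the imaginary part. *)
Lemma Cmod_LambertW_asymp (x : C) : x <> 0 -> exists n0, forall n, (n0 <= n)%nat ->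
  Rabs (Cmod (LambertW (Z.of_nat n) x) - (2 * PI * INR n - PI / 2 + Carg x)) <= / 8 /\
  Rabs (Cmod (LambertW (- Z.of_nat n) x) - (2 * PI * INR n - PI / 2 - Carg x)) <= / 8.
Proof.
  intros Hx. destruct (LambertW_asymp x Hx) as (C0 & HC0 & H).
  pose proof (Carg_bound x Hx) as Hth. pose proof PI2_1. pose proof PI_4.
  set (L0 := ln (Cmod x)). set (c := Rabs L0 + 3).
  pose proof (Rabs_pos L0) as HL0. pose proof (Rle_abs L0) as HL1. pose proof (Rle_abs (- L0)) as HL2.
  rewrite Rabs_Ropp in HL2.
  destruct (root4_small C0 (/ 16) HC0 ltac:(lra)) as (n1 & Hn1 & Hrt).
  destruct (ln_sqr_small c 16 ltac:(unfold c; lra) ltac:(lra)) as (R0 & HR0 & Hsm).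
  destruct (INR_unbounded (R0 + 2)) as [n2 Hn2].
  exists (Nat.max n1 n2). intros n Hn.
  specialize (H n ltac:(lia)). specialize (Hrt n ltac:(lia)).
  assert (HN : R0 + 2 < INR n) by (eapply Rlt_le_trans; [exact Hn2|apply le_INR; lia]).
  set (N := INR n) in *. destruct (Hsm N ltac:(lra)) as [Hs Hln0].
  set (X := L0 - ln (2 * PI * N)).
  assert (Hln : ln (2 * PI * N) = ln (2 * PI) + ln N) by (apply ln_mult; lra).
  assert (Hl2 : 0 <= ln (2 * PI) <= 3).
  { split.
    - rewrite <- ln_1. left; apply ln_increasing; lra.
    - rewrite ln_mult by lra. pose proof (ln_le_sub1 2 ltac:(lra)).
      pose proof (ln_le_sub1 (PI / 2) ltac:(lra)) as K. unfold Rdiv in K. rewrite ln_mult, ln_Rinv in K by lra.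
      lra. }
  assert (HX : - (c + ln N) <= X <= c + ln N) by (unfold X, c; lra).
  assert (HXX : 16 * (X * X) <= N).
  { assert (X * X <= (c + ln N) * (c + ln N)) by nra. unfold c in *; nra. }
  assert (E1 : lambert_b x n = (X, 2 * PI * N - PI / 2 + Carg x)).
  { unfold lambert_b. rewrite PI2_RtoC. unfold X, L0, N. apply C_ext; reim; ring. }
  assert (E2 : lambert_b' x n = (X, - (2 * PI * N - PI / 2 - Carg x))).
  { unfold lambert_b'. rewrite PI2_RtoC. unfold X, L0, N. apply C_ext; reim; ring. }
  assert (HY1 : N <= 2 * PI * N - PI / 2 + Carg x) by nra.
  assert (HY2 : N <= 2 * PI * N - PI / 2 - Carg x) by nra.
  destruct (Cmod_pair_approx X (2 * PI * N - PI / 2 + Carg x) (/ 16)) as [P1 _]; [lra|lra|].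
  destruct (Cmod_pair_approx X (2 * PI * N - PI / 2 - Carg x) (/ 16)) as [_ P2]; [lra|lra|].
  rewrite E1, E2 in H. destruct H as [D1 D2].
  assert (T : forall z w : C, Rabs (Cmod z - Cmod w) <= Cmod (z - w)).
  { intros z w. pose proof (Cmod_triangle_sub z w). pose proof (Cmod_triangle_sub w z) as K.
    rewrite Cmod_minus_sym in K. apply Rabs_le. lra. }
  pose proof (T (LambertW (Z.of_nat n) x) (X, 2 * PI * N - PI / 2 + Carg x)) as T1.
  pose proof (T (LambertW (- Z.of_nat n) x) (X, - (2 * PI * N - PI / 2 - Carg x))) as T2.
  apply Rabs_le_between in T1. apply Rabs_le_between in T2.
  split; apply Rabs_le; lra.
Qed.

(** Range of the indices of the branches inside the circle [radius x m]. When [Re x < 0], one of the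
    branches of index [m] and [- m] has modulus about [2 PI m] or more and is left out: index [m] if
    [Im x >= 0], index [- m] otherwise. *)
Definition lower_index (x : C) (m : nat) : Z :=
  if Rle_dec 0 (Re x) then (- Z.of_nat m)%Z else
  if Rle_dec 0 (Im x) then (- Z.of_nat m)%Z else (1 - Z.of_nat m)%Z.

Definition upper_index (x : C) (m : nat) : Z :=
  if Rle_dec 0 (Re x) then Z.of_nat m else
  if Rle_dec 0 (Im x) then (Z.of_nat m - 1)%Z else Z.of_nat m.

Lemma LambertW_locally_bounded (x : C) (n : nat) :
  exists B, forall k, (- Z.of_nat n <= k <= Z.of_nat n)%Z -> Cmod (LambertW k x) <= B.
Proof.
  induction n as [|n [B HB]].
  - exists (Cmod (LambertW 0 x)). intros k Hk. replace k with 0%Z by lia. lra.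
  - exists (Rmax B (Rmax (Cmod (LambertW (Z.of_nat (S n)) x)) (Cmod (LambertW (- Z.of_nat (S n)) x)))).
    intros k Hk.
    destruct (Z.eq_dec k (Z.of_nat (S n))) as [->|H1].
    { eapply Rle_trans; [|apply Rmax_r]. apply Rmax_l. }
    destruct (Z.eq_dec k (- Z.of_nat (S n))) as [->|H2].
    { eapply Rle_trans; [|apply Rmax_r]. apply Rmax_r. }
    eapply Rle_trans; [|apply Rmax_l]. apply HB. lia.
Qed.

Lemma Carg_quadrant (x : C) : x <> 0 ->
  (0 <= Re x -> - (PI / 2) <= Carg x <= PI / 2) /\
  (Re x < 0 -> 0 <= Im x -> PI / 2 <= Carg x <= PI) /\
  (Re x < 0 -> Im x < 0 -> - PI <= Carg x <= - (PI / 2)).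
Proof.
  intros Hx. pose proof (Cmod_pos x Hx) as H0. pose proof (Carg_bound x Hx) as Hb.
  pose proof (cos_Carg x Hx) as Hc. pose proof PI_RGT_0.
  assert (K1 : 0 <= Re x -> - (PI / 2) <= Carg x <= PI / 2).
  { intros Hr. split.
    - apply Rnot_lt_le. intros Hlt.
      pose proof (cos_lt_0 (- Carg x) ltac:(lra) ltac:(lra)) as K. rewrite cos_neg in K. nra.
    - apply Rnot_lt_le. intros Hlt. pose proof (cos_lt_0 (Carg x) ltac:(lra) ltac:(lra)). nra. }
  assert (K2 : Re x < 0 -> ~ (- (PI / 2) < Carg x < PI / 2)).
  { intros Hr Hlt. pose proof (cos_gt_0 (Carg x) ltac:(lra) ltac:(lra)). nra. }
  assert (K3 : (0 <= Im x -> 0 <= Carg x) /\ (Im x < 0 -> Carg x <= 0)).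
  { unfold Carg. pose proof (acos_bound (Re x / Cmod x)).
    destruct (Rle_dec 0 (Im x)); split; intros; lra. }
  split; [assumption|]. split; intros Hr Hi; specialize (K2 Hr).
  - pose proof (proj1 K3 Hi). split; [|lra]. apply Rnot_lt_le. intros Hlt. apply K2; lra.
  - pose proof (proj2 K3 Hi). split; [lra|]. apply Rnot_lt_le. intros Hlt. apply K2; lra.
Qed.

(** In each case of the quadrant of [x] the approximate moduli [2 PI n - PI / 2 + Carg x] and
    [2 PI n - PI / 2 - Carg x] are at distance at least [PI / 2] from the radius, so an error of
    [1 / 8] leaves the margin [1 / 4]. The finitely many small indices only require [m] to be
    large. *)
Lemma LambertW_inside (x : C) : x <> 0 -> exists m0, (1 <= m0)%nat /\ forall m, (m0 <= m)%nat ->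
  (forall k, (lower_index x m <= k <= upper_index x m)%Z -> Cmod (LambertW k x) < radius x m) /\
  (forall k, ~ (lower_index x m <= k <= upper_index x m)%Z ->
     radius x m + / 4 <= Cmod (LambertW k x)).
Proof.
  intros Hx. destruct (Cmod_LambertW_asymp x Hx) as [n0 Hn0].
  destruct (LambertW_locally_bounded x n0) as [B HB].
  destruct (radius_large x (B + 1)) as [m1 Hm1].
  destruct (Carg_quadrant x Hx) as (Q1 & Q2 & Q3).
  pose proof PI2_1 as HPI1. pose proof PI_4 as HPI4.
  exists (Nat.max (n0 + 1) m1). split; [lia|]. intros m Hm. specialize (Hm1 m ltac:(lia)).
  assert (U : forall n p : nat, (n + p <= m)%nat -> 2 * PI * INR n + 2 * PI * INR p <= 2 * PI * INR m).
  { intros n p Hnm. apply le_INR in Hnm. rewrite plus_INR in Hnm. nra. }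
  assert (V : forall n p : nat, (m + p <= n)%nat -> 2 * PI * INR m + 2 * PI * INR p <= 2 * PI * INR n).
  { intros n p Hnm. apply le_INR in Hnm. rewrite plus_INR in Hnm. nra. }
  assert (Hcase : forall k : Z, (- Z.of_nat n0 <= k <= Z.of_nat n0)%Z \/
    (exists n, (n0 <= n)%nat /\ (k = Z.of_nat n \/ k = (- Z.of_nat n)%Z))).
  { intros k. destruct (Z_le_gt_dec (Z.abs k) (Z.of_nat n0)); [left; lia|right].
    exists (Z.abs_nat k). lia. }
  unfold lower_index, upper_index. unfold radius in *.
  destruct (Rle_dec 0 (Re x)) as [Hr|Hr]; [|destruct (Rle_dec 0 (Im x)) as [Hi|Hi]].
  - specialize (Q1 Hr). split; intros k Hk.
    + destruct (Hcase k) as [Hs|(n & Hn & [-> | ->])].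
      * specialize (HB k Hs); lra.
      * destruct (Hn0 n Hn) as [T _]. apply Rabs_le_between in T. pose proof (U n 0%nat ltac:(lia)).
        simpl in *; lra.
      * destruct (Hn0 n Hn) as [_ T]. apply Rabs_le_between in T. pose proof (U n 0%nat ltac:(lia)).
        simpl in *; lra.
    + destruct (Hcase k) as [Hs|(n & Hn & [-> | ->])]; [exfalso; lia| |].
      * destruct (Hn0 n Hn) as [T _]. apply Rabs_le_between in T. pose proof (V n 1%nat ltac:(lia)).
        simpl in *; lra.
      * destruct (Hn0 n Hn) as [_ T]. apply Rabs_le_between in T. pose proof (V n 1%nat ltac:(lia)).
        simpl in *; lra.
  - specialize (Q2 ltac:(lra) Hi). split; intros k Hk.
    + destruct (Hcase k) as [Hs|(n & Hn & [-> | ->])].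
      * specialize (HB k Hs); lra.
      * destruct (Hn0 n Hn) as [T _]. apply Rabs_le_between in T. pose proof (U n 1%nat ltac:(lia)).
        simpl in *; lra.
      * destruct (Hn0 n Hn) as [_ T]. apply Rabs_le_between in T. pose proof (U n 0%nat ltac:(lia)).
        simpl in *; lra.
    + destruct (Hcase k) as [Hs|(n & Hn & [-> | ->])]; [exfalso; lia| |].
      * destruct (Hn0 n Hn) as [T _]. apply Rabs_le_between in T. pose proof (V n 0%nat ltac:(lia)).
        simpl in *; lra.
      * destruct (Hn0 n Hn) as [_ T]. apply Rabs_le_between in T. pose proof (V n 1%nat ltac:(lia)).
        simpl in *; lra.
  - specialize (Q3 ltac:(lra) ltac:(lra)). split; intros k Hk.
    + destruct (Hcase k) as [Hs|(n & Hn & [-> | ->])].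
      * specialize (HB k Hs); lra.
      * destruct (Hn0 n Hn) as [T _]. apply Rabs_le_between in T. pose proof (U n 0%nat ltac:(lia)).
        simpl in *; lra.
      * destruct (Hn0 n Hn) as [_ T]. apply Rabs_le_between in T. pose proof (U n 1%nat ltac:(lia)).
        simpl in *; lra.
    + destruct (Hcase k) as [Hs|(n & Hn & [-> | ->])]; [exfalso; lia| |].
      * destruct (Hn0 n Hn) as [T _]. apply Rabs_le_between in T. pose proof (V n 1%nat ltac:(lia)).
        simpl in *; lra.
      * destruct (Hn0 n Hn) as [_ T]. apply Rabs_le_between in T. pose proof (V n 0%nat ltac:(lia)).
        simpl in *; lra.
Qed.

Lemma cder_eq (F : C -> C) (z d e : C) : d = e -> cder F z d -> cder F z e.
Proof. intros ->; auto. Qed.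

Lemma gW_LambertW (x : C) (k : Z) : x <> 0 -> gW x (LambertW k x) = 0.
Proof. intros Hx. apply gW_zero_iff; [assumption|]. apply LambertW_exp; assumption. Qed.

Lemma gW_deriv_of (x : C) : x <> 0 -> deriv_of (gW x) (gW' x) /\ forall z, Ccontinuous (gW' x) z.
Proof.
  intros Hx. apply entire_deriv_eq; [apply gW_entire|]. intros z; apply gW_cder; assumption.
Qed.

(** If -1 is not a zero, all zeros are simple and the [W_k(x)] are pairwise distinct, as
    [hadamard_limit] requires. *)
Lemma product_regular (x : C) : x <> 0 -> gW x (RtoC (-1)) <> 0 -> forall T eps, 0 < eps ->
  exists m1, forall m, (m1 <= m)%nat ->
  Cmod (lprod (map (fun k => LambertW k x) (zrange (lower_index x m) (upper_index x m))) T - gW x T) < eps.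
Proof.
  intros Hx Hreg.
  destruct (gW_deriv_of x Hx) as [D1 D2].
  destruct (LambertW_inside x Hx) as (m0 & Hm0 & Hin).
  destruct (gW_logder_bound x Hx) as [m1 Hlog].
  apply (hadamard_limit (gW x) (gW' x)
    (fun m => map (fun k => LambertW k x) (zrange (lower_index x m) (upper_index x m)))
    (radius x) 12 (/ 4) (Nat.max m0 m1)); try assumption; try lra.
  - apply gW_entire.
  - apply gW_0.
  - intros z Hz Hz'. apply Hreg. rewrite <- (gW_zero_simple x z); assumption.
  - apply radius_large.
  - intros m _. apply NoDup_map_NoDup_ForallPairs; [|apply NoDup_zrange].
    intros j k _ _ E. destruct (LambertW_inj x j k Hx E) as [H|[H _]]; [assumption|].
    exfalso. apply Hreg. rewrite <- H. apply gW_LambertW; assumption.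
  - intros m w Hm Hw. apply in_map_iff in Hw. destruct Hw as (k & <- & Hk).
    apply in_zrange in Hk. split; [apply gW_LambertW; assumption|].
    apply (Hin m ltac:(lia)); assumption.
  - intros m z Hm Hz Hg. apply gW_zero_iff in Hg; [|assumption].
    destruct (LambertW_surj x z Hx Hg) as [k ->].
    apply (in_map (fun k => LambertW k x)). apply in_zrange.
    destruct (classic (lower_index x m <= k <= upper_index x m)%Z) as [H|H]; [assumption|].
    exfalso. pose proof (proj2 (Hin m ltac:(lia)) k H). lra.
  - intros m s Hm. apply Hlog; lia.
  - intros del eps Hd He. apply (gW_logder_sym x del eps Hx Hd He).
Qed.

(* If [-1] is a zero of [gW x] (that is, [x = -1/e]) it is a double one, [W_0 = W_(-1) = -1];
   the factor belonging to [W_0] is then divided out first. *)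
Lemma product_degenerate (x : C) : x <> 0 -> gW x (RtoC (-1)) = 0 -> forall T eps, 0 < eps ->
  exists m1, forall m, (m1 <= m)%nat ->
  Cmod (lprod (map (fun k => LambertW k x) (zrange (lower_index x m) (upper_index x m))) T - gW x T) < eps.
Proof.
  intros Hx Hdeg T eps He. pose proof C2_neq_0 as H2.
  destruct (gW_deriv_of x Hx) as [D1 D2].
  destruct (LambertW_inside x Hx) as (m0 & Hm0 & Hin).
  destruct (gW_logder_bound x Hx) as [m1 Hlog].
  assert (Ex : x = (- Cexp (- (1)))%C).
  { apply gW_zero_iff in Hdeg; [|assumption]. rewrite <- Hdeg.
    replace (RtoC (-1)) with (- (1))%C by (apply C_ext; reim; ring). ring. }
  assert (ExR : x = RtoC (- exp (-1))).
  { rewrite Ex. rewrite <- RtoC_opp, Cexp_RtoC, <- RtoC_opp. reflexivity. }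
  pose proof (exp_pos (-1)) as Hexp.
  assert (Hlow : forall m, lower_index x m = (- Z.of_nat m)%Z).
  { intros m. unfold lower_index. rewrite ExR. reim.
    destruct (Rle_dec 0 (- exp (-1))) as [?|_]; [lra|].
    destruct (Rle_dec 0 0) as [_|?]; [reflexivity|lra]. }
  assert (Hupp : forall m, upper_index x m = (Z.of_nat m - 1)%Z).
  { intros m. unfold upper_index. rewrite ExR. reim.
    destruct (Rle_dec 0 (- exp (-1))) as [?|_]; [lra|].
    destruct (Rle_dec 0 0) as [_|?]; [reflexivity|lra]. }
  assert (Hcut : on_cut x).
  { rewrite ExR. split; reim; [reflexivity|].
    replace (-1) with (- (1)) by ring. rewrite exp_Ropp. 
    pose proof (Rinv_0_lt_compat _ (exp_pos 1)). lra. }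
  assert (HW : LambertW 0 x = RtoC (-1) /\ LambertW (-1) x = RtoC (-1)).
  { assert (K : forall b, b * exp b = - exp (-1) -> b = -1).
    { intros b Hb. replace (- exp (-1)) with (-1 * exp (-1)) in Hb by ring.
      destruct (Rtotal_order b (-1)) as [Hab|[Hab|Hab]]; [|assumption|].
      - destruct (xexp_eq b (-1) Hab Hb); lra.
      - destruct (xexp_eq (-1) b Hab (eq_sym Hb)); lra. }
    assert (K2 : forall v : C, Im v = 0 -> (v * Cexp v)%C = x -> v = RtoC (-1)).
    { intros v Hi Ev. assert (Ev' : v = RtoC (Re v)) by (apply C_ext; reim; auto).
      rewrite Ev', RtoC_mult_Cexp, ExR in Ev. apply RtoC_inj in Ev.
      rewrite Ev', (K _ Ev). reflexivity. }
    split.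
    - destruct (LambertW_spec 0 x Hx) as [(_ & _ & Hi & _ & E)|[(_ & ? & _)|([?|?] & _)]];
        [apply K2; assumption|lia|tauto|tauto].
    - destruct (LambertW_spec (-1) x Hx) as [(_ & ? & _)|[(_ & _ & Hi & _ & E)|([?|?] & _)]];
        [lia|apply K2; assumption|tauto|tauto]. }
  destruct HW as [HW0 HW1].
  destruct (entire_divide (gW x) (RtoC (-1)) (gW_entire x) Hdeg) as (h & Hh & Eh).
  destruct (entire_deriv h Hh) as (h' & Hh' & Dh).
  destruct (entire_deriv h' Hh') as (h'' & Hh'' & Dh').
  assert (Lin : forall z, cder (fun s => s - RtoC (-1))%C z 1).
  { intros z. replace (RtoC 1) with (1 - 0)%C by ring.
    apply (cder_minus (fun s => s)); [apply cder_id|apply cder_const]. }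
  assert (E' : forall z, gW' x z = (h z + (z - RtoC (-1)) * h' z)%C).
  { intros z. apply (cder_unique (gW x) z); [apply D1|].
    apply (cder_ext (fun s => (s - RtoC (-1)) * h s)%C); [intros; symmetry; apply Eh|].
    replace (h z + (z - RtoC (-1)) * h' z)%C with (1 * h z + (z - RtoC (-1)) * h' z)%C by ring.
    apply (cder_mult (fun s => s - RtoC (-1))%C h); [apply Lin|apply Dh]. }
  assert (Em1 : RtoC (-1) = (- (1))%C) by (apply C_ext; reim; ring).
  assert (E1 : EW x (RtoC (-1)) = 1).
  { unfold EW. rewrite Ex, Em1. pose proof (Cexp_neq_0 (- (1))). field. assumption. }
  assert (Hm1 : RtoC (-1) <> 0) by (apply RtoC_neq_0; lra).
  assert (Hh1 : h (RtoC (-1)) = 0).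
  { replace (h (RtoC (-1))) with (gW' x (RtoC (-1))).
    - rewrite gW'_factor, E1 by assumption. rewrite Em1. field. auto.
    - rewrite E'. ring. }
  (* The second derivative of [gW x] at -1 is computed twice: from the factorization it is
     [2 h'(-1)], explicitly it is [e^(1/2)]. Hence -1 is a simple zero of [h]. *)
  assert (Hh1' : h' (RtoC (-1)) <> 0).
  { set (v := RtoC (-1)) in *.
    assert (C1 : cder (gW' x) v (2 * h' v)%C).
    { apply (cder_ext (fun z => h z - (RtoC (-1) - z) * h' z)%C);
        [intros z; rewrite E'; unfold v; ring|].
      replace (2 * h' v)%C with (h' v - ((0 - 1) * h' v + (RtoC (-1) - v) * h'' v))%C
        by (unfold v; ring).
      apply (cder_minus h); [apply Dh|].
      apply (cder_mult (fun z => RtoC (-1) - z)%C h'); [|apply Dh'].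
      apply (cder_minus (fun _ => RtoC (-1))); [apply cder_const|apply cder_id]. }
    assert (C2 : cder (gW' x) v (- (1 / 2) * (Cexp (- (1 / 2) * v) * (- (1 / 2))) -
      ((1 / (2 * x)) * Cexp (1 / 2 * v) + (1 / x + v / (2 * x)) * (Cexp (1 / 2 * v) * (1 / 2))))%C).
    { apply (cder_ext (fun s => - (1 / 2) * Cexp (- (1 / 2) * s) -
        (1 / x + s / (2 * x)) * Cexp (1 / 2 * s))%C).
      { intros s. unfold gW'. f_equal; [do 2 f_equal; field|]. f_equal. f_equal. field. }
      apply (cder_minus (fun s => - (1 / 2) * Cexp (- (1 / 2) * s))%C).
      - replace (- (1 / 2) * (Cexp (- (1 / 2) * v) * - (1 / 2)))%C with
          (0 * Cexp (- (1 / 2) * v) + - (1 / 2) * (Cexp (- (1 / 2) * v) * - (1 / 2)))%C by ring.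
        apply (cder_mult (fun _ => - (1 / 2))%C (fun s => Cexp (- (1 / 2) * s)%C));
          [apply cder_const|apply cder_Cexp_lin].
      - apply (cder_mult (fun s => 1 / x + s / (2 * x))%C (fun s => Cexp (1 / 2 * s)%C));
          [|apply cder_Cexp_lin].
        apply (cder_ext (fun s => s * (1 / (2 * x)) - - (1 / x))%C); [intros; field; auto|].
        apply (cder_eq _ _ ((1 * (1 / (2 * x)) + v * 0) - 0)%C); [field; auto|].
        apply (cder_minus (fun s => s * (1 / (2 * x)))%C); [|apply cder_const].
        apply (cder_mult (fun s => s) (fun _ => 1 / (2 * x))%C); [apply cder_id|apply cder_const]. }
    pose proof (cder_unique _ _ _ _ C1 C2) as Eq. intros H0. rewrite H0 in Eq.
    apply (Cexp_neq_0 (1 / 2)).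
    assert (Hv : v = (- (1))%C) by exact Em1. rewrite Hv in Eq.
    replace (- (1 / 2) * - (1))%C with (1 / 2)%C in Eq by field.
    replace (1 / 2 * - (1))%C with (- (1 / 2))%C in Eq by field.
    assert (Hx2 : x = (- (/ (Cexp (1 / 2) * Cexp (1 / 2))))%C).
    { rewrite Ex, <- Cexp_plus, <- Cexp_opp. do 2 f_equal. field. }
    rewrite Cexp_opp in Eq. pose proof (Cexp_neq_0 (1 / 2)) as Hne.
    rewrite Hx2 in Eq.
    replace (Cexp (1 / 2)) with (2 * 0)%C; [ring|].
    rewrite Eq. set (q := Cexp (1 / 2)) in *. field. auto. }
  set (l := fun m => map (fun k => LambertW k x) (zrange (lower_index x m) (-1) ++ zrange 1 (upper_index x m))).
  assert (Hfull : forall m, (1 <= m)%nat ->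
    lprod (map (fun k => LambertW k x) (zrange (lower_index x m) (upper_index x m))) T =
    ((1 + T) * lprod (l m) T)%C).
  { intros m Hm. unfold l. rewrite !lprod_map, zprod_app.
    replace (zrange (lower_index x m) (upper_index x m)) with
      (zrange (lower_index x m) (-1) ++ 0%Z :: zrange 1 (upper_index x m)).
    - rewrite zprod_app. simpl. rewrite HW0, Em1. field.
    - rewrite Hlow, Hupp. replace (0%Z :: zrange 1 (Z.of_nat m - 1)) with (zrange 0 (Z.of_nat m - 1)).
      + unfold zrange.
        replace (Z.to_nat (Z.of_nat m - 1 - - Z.of_nat m + 1)) with (m + m)%nat by lia.
        replace (Z.to_nat (-1 - - Z.of_nat m + 1)) with m by lia.
        replace (Z.to_nat (Z.of_nat m - 1 - 0 + 1)) with m by lia.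
        rewrite seq_app, map_app. f_equal.
        change (0 + m)%nat with m.
        assert (S : forall n j, map (fun i => (0 + Z.of_nat i)%Z) (seq j n) =
          map (fun i => (- Z.of_nat m + Z.of_nat i)%Z) (seq (j + m) n)).
        { induction n as [|n IH]; intros j; simpl; [reflexivity|]. f_equal; [lia|]. apply IH. }
        apply (S m 0%nat).
      + rewrite zrange_cons by lia. reflexivity. }
  assert (Hh0 : forall z, z <> RtoC (-1) -> (z - RtoC (-1))%C <> 0 /\ h z = (gW x z / (z - RtoC (-1)))%C).
  { intros z Hz. assert ((z - RtoC (-1))%C <> 0) by (apply Cminus_eq_contra; assumption).
    split; [assumption|]. rewrite Eh. field. assumption. }
  assert (Hquot : forall z, z <> RtoC (-1) -> gW x z <> 0 ->
    (h' z / h z)%C = (gW' x z / gW x z - 1 / (z - RtoC (-1)))%C).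
  { intros z Hz Hg. destruct (Hh0 z Hz) as [Hzz Ehz].
    assert (h z <> 0).
    { intros E0. apply Hg. rewrite Eh, E0. ring. }
    rewrite E', Eh. field. repeat split; assumption. }
  destruct (radius_large x (3 + 4)) as [m2 Hm2].
  assert (Hcirc : forall m s, (Nat.max m0 (Nat.max m1 m2) <= m)%nat -> Cmod s = radius x m ->
    s <> RtoC (-1) /\ gW x s <> 0 /\ Cmod (1 / (s - RtoC (-1))) <= 2 / radius x m).
  { intros m s Hm Hs. specialize (Hm2 m ltac:(lia)).
    assert (C1 : Cmod (RtoC (-1)) = 1) by (rewrite Em1, Cmod_opp, Cmod_1; reflexivity).
    assert (Hs1 : s <> RtoC (-1)) by (intros ->; lra).
    split; [assumption|]. split.
    - intros Hg. apply gW_zero_iff in Hg; [|assumption].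
      destruct (LambertW_surj x s Hx Hg) as [k ->].
      destruct (classic (lower_index x m <= k <= upper_index x m)%Z) as [H|H].
      + pose proof (proj1 (Hin m ltac:(lia)) k H). lra.
      + pose proof (proj2 (Hin m ltac:(lia)) k H). lra.
    - destruct (Hh0 s Hs1) as [Hn _]. rewrite Cmod_div, Cmod_1 by assumption.
      pose proof (Cmod_triangle_sub s (RtoC (-1))) as Tr. rewrite C1, Hs in Tr.
      apply Rmult_le_reg_r with (Cmod (s - RtoC (-1))); [lra|].
      unfold Rdiv at 1. rewrite Rmult_assoc, Rinv_l, Rmult_1_l by lra.
      apply Rle_trans with (2 / radius x m * (radius x m - 1)).
      + apply Rmult_le_reg_r with (radius x m); [lra|].
        replace (2 / radius x m * (radius x m - 1) * radius x m) with (2 * (radius x m - 1)) by (field; lra).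
        lra.
      + apply Rmult_le_compat_l; [|lra]. apply Rmult_le_pos; [lra|]. left; apply Rinv_0_lt_compat; lra. }
  (* Dividing by [z + 1] changes the logarithmic derivative by [1 / (s + 1)], of order [1 / radius]:
     the bound 12 becomes 13 and the near oddness persists. *)
  assert (Hlim : forall e, 0 < e -> exists m3, forall m, (m3 <= m)%nat -> Cmod (lprod (l m) T - h T) < e).
  { apply (hadamard_limit h h' l (radius x) 13 (/ 4) (Nat.max m0 (Nat.max m1 m2)));
      try assumption; try lra.
    - intros z. exact (deriv_of_continuous _ _ z Dh').
    - destruct (Hh0 0) as [H3 ->]; [intros H; apply Hm1; congruence|].
      rewrite gW_0, Em1. field.
    - intros z Hz Hz'. destruct (Ceq_dec z (RtoC (-1))) as [->|Hn]; [exact (Hh1' Hz')|].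
      apply Hn. apply (gW_zero_simple x z Hx).
      + rewrite Eh, Hz; ring.
      + rewrite E', Hz, Hz'; ring.
    - apply radius_large.
    - intros m Hm. apply NoDup_map_NoDup_ForallPairs.
      + intros j k Hj Hk E. apply in_app_iff in Hj. apply in_app_iff in Hk.
        rewrite !in_zrange in Hj, Hk.
        destruct (LambertW_inj x j k Hx E) as [H|[_ H]]; [assumption|lia].
      + apply NoDup_app; try apply NoDup_zrange.
        intros k Hk Hk'. rewrite in_zrange in Hk, Hk'. lia.
    - intros m w Hm Hw. apply in_map_iff in Hw. destruct Hw as (k & <- & Hk).
      assert (Hk2 : (lower_index x m <= k <= upper_index x m)%Z).
      { apply in_app_iff in Hk. rewrite !in_zrange in Hk. rewrite Hlow, Hupp in *. lia. }
      split; [|apply (Hin m ltac:(lia)); assumption].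
      destruct (Ceq_dec (LambertW k x) (RtoC (-1))) as [->|Hn]; [assumption|].
      destruct (Hh0 _ Hn) as [Hn' ->]. rewrite gW_LambertW by assumption. field. assumption.
    - intros m z Hm Hz Hhz.
      assert (Hg : gW x z = 0) by (rewrite Eh, Hhz; ring).
      apply gW_zero_iff in Hg; [|assumption].
      destruct (LambertW_surj x z Hx Hg) as [k Ek].
      assert (Hk : exists j, z = LambertW j x /\ j <> 0%Z).
      { destruct (Z.eq_dec k 0) as [->|Hk0]; [exists (-1)%Z|exists k; auto].
        split; [rewrite Ek, HW0, HW1; reflexivity|lia]. }
      clear k Ek. destruct Hk as (k & -> & Hk0).
      unfold l. apply (in_map (fun k => LambertW k x)). apply in_app_iff. rewrite !in_zrange.
      destruct (classic (lower_index x m <= k <= upper_index x m)%Z) as [H|H]; [lia|].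
      exfalso. pose proof (proj2 (Hin m ltac:(lia)) k H). lra.
    - intros m s Hm Hs. destruct (Hcirc m s Hm Hs) as (H3 & H4 & H5).
      rewrite Hquot by assumption.
      eapply Rle_trans; [apply Cmod_triangle_minus|].
      pose proof (Hlog m s ltac:(lia) Hs). specialize (Hm2 m ltac:(lia)).
      assert (2 / radius x m <= 1); [|lra].
      apply Rmult_le_reg_r with (radius x m); [lra|].
      unfold Rdiv. rewrite Rmult_assoc, Rinv_l; lra.
    - intros del e Hd Hee. destruct (gW_logder_sym x del (e / 2) Hx Hd ltac:(lra)) as [m3 Hm3].
      destruct (radius_large x (8 / e)) as [m4 Hm4].
      exists (Nat.max m0 (Nat.max m1 (Nat.max m2 (Nat.max m3 m4)))). intros m s Hm Hs Hre.
      destruct (Hcirc m s ltac:(lia) Hs) as (H3 & H4 & H5).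
      destruct (Hcirc m (- s)%C ltac:(lia) ltac:(rewrite Cmod_opp; assumption)) as (H6 & H7 & H8).
      rewrite !Hquot by assumption.
      specialize (Hm3 m s ltac:(lia) Hs Hre). specialize (Hm4 m ltac:(lia)). specialize (Hm2 m ltac:(lia)).
      replace (_ + _)%C with ((gW' x s / gW x s + gW' x (- s) / gW x (- s)) -
        (1 / (s - RtoC (-1)) + 1 / (- s - RtoC (-1))))%C by ring.
      eapply Rle_trans; [apply Cmod_triangle_minus|].
      pose proof (Cmod_triangle (1 / (s - RtoC (-1))) (1 / (- s - RtoC (-1)))) as Tr.
      assert (2 / radius x m <= e / 4); [|lra].
      apply Rmult_le_reg_r with (radius x m); [lra|].
      unfold Rdiv at 1. rewrite Rmult_assoc, Rinv_l, Rmult_1_r by lra.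
      apply Rle_trans with (e / 4 * (8 / e)); [right; field; lra|]. apply Rmult_le_compat_l; lra. }
  pose proof (Cmod_ge_0 (1 + T)) as HT.
  destruct (Hlim (eps / (Cmod (1 + T) + 1))) as [m3 Hm3]; [apply Rdiv_lt_0_compat; lra|].
  exists (Nat.max 1 m3). intros m Hm. rewrite Hfull by lia. specialize (Hm3 m ltac:(lia)).
  replace ((1 + T) * lprod (l m) T - gW x T)%C with ((1 + T) * (lprod (l m) T - h T))%C
    by (rewrite Eh, Em1; ring).
  rewrite Cmod_mult.
  apply Rle_lt_trans with (Cmod (1 + T) * (eps / (Cmod (1 + T) + 1))).
  - apply Rmult_le_compat_l; lra.
  - apply Rmult_lt_reg_r with (Cmod (1 + T) + 1); [lra|].
    replace (Cmod (1 + T) * (eps / (Cmod (1 + T) + 1)) * (Cmod (1 + T) + 1)) with (Cmod (1 + T) * eps)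
      by (field; lra). nra.
Qed.

Lemma LambertW_factor_lim (x T : C) (eps : R) : x <> 0 -> 0 < eps ->
  exists n0, forall n, (n0 <= n)%nat ->
  Cmod (T / LambertW (Z.of_nat n) x) < eps /\ Cmod (T / LambertW (- Z.of_nat n) x) < eps.
Proof.
  intros Hx He. destruct (Cmod_LambertW_asymp x Hx) as [n0 Hn0].
  pose proof (Carg_bound x Hx). pose proof PI2_1. pose proof PI_4. pose proof (Cmod_ge_0 T).
  assert (HTe : 0 <= Cmod T / eps) by (apply Rmult_le_pos; [lra|left; apply Rinv_0_lt_compat; lra]).
  destruct (INR_unbounded (Cmod T / eps + 10)) as [n1 Hn1].
  exists (Nat.max n0 n1). intros n Hn. specialize (Hn0 n ltac:(lia)).
  assert (HN : Cmod T / eps + 10 < INR n) by (eapply Rlt_le_trans; [exact Hn1|apply le_INR; lia]).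
  assert (K : forall w : C, Cmod T / eps < Cmod w -> Cmod (T / w) < eps).
  { intros w Hw. rewrite Cmod_div by (apply Cmod_neq; lra).
    apply Rmult_lt_reg_r with (Cmod w); [lra|].
    replace (Cmod T / Cmod w * Cmod w) with (Cmod T) by (field; lra).
    apply Rle_lt_trans with (eps * (Cmod T / eps)); [right; field; lra|].
    apply Rmult_lt_compat_l; lra. }
  destruct Hn0 as [A B]. apply Rabs_le_between in A. apply Rabs_le_between in B.
  split; apply K; nra.
Qed.

(** The symmetric range of indices differs from the range inside the circle by at most one factor,
    [1 - T / W_m] or [1 - T / W_(-m)], and this tends to 1. *)
Theorem lambert_product (x T : C) (eps : R) : x <> 0 -> 0 < eps ->
  exists m1, forall m, (m1 <= m)%nat ->
  Cmod (prod_sym m (fun k => 1 - T / LambertW k x)%C - gW x T) < eps.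
Proof.
  intros Hx He.
  assert (Hmain : forall e, 0 < e -> exists m1, forall m, (m1 <= m)%nat ->
    Cmod (lprod (map (fun k => LambertW k x) (zrange (lower_index x m) (upper_index x m))) T - gW x T) < e).
  { intros e Hee. destruct (Ceq_dec (gW x (RtoC (-1))) 0) as [E|E].
    - apply product_degenerate; assumption.
    - apply product_regular; assumption. }
  set (G := Cmod (gW x T)). assert (HG : 0 <= G) by apply Cmod_ge_0.
  destruct (Hmain (Rmin 1 (eps / 2)) ltac:(apply Rmin_glb_lt; lra)) as [m1 Hm1].
  destruct (LambertW_factor_lim x T (eps / (2 * (G + 1))) Hx) as [n0 Hn0];
    [apply Rdiv_lt_0_compat; lra|].
  exists (Nat.max 1 (Nat.max m1 n0)). intros m Hm.
  specialize (Hm1 m ltac:(lia)). specialize (Hn0 m ltac:(lia)).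
  set (P := lprod (map (fun k => LambertW k x) (zrange (lower_index x m) (upper_index x m))) T) in *.
  pose proof (Rmin_l 1 (eps / 2)). pose proof (Rmin_r 1 (eps / 2)).
  assert (Hc : exists d : C, prod_sym m (fun k => 1 - T / LambertW k x)%C = (P * (1 - d))%C /\
    Cmod d <= eps / (2 * (G + 1))).
  { rewrite prod_sym_zprod. unfold P. rewrite lprod_map. unfold lower_index, upper_index.
    assert (He0 : 0 <= eps / (2 * (G + 1))) by (left; apply Rdiv_lt_0_compat; lra).
    destruct (Rle_dec 0 (Re x)) as [Hr|Hr]; [|destruct (Rle_dec 0 (Im x)) as [Hi|Hi]].
    - exists (RtoC 0). rewrite Cmod_0. split; [ring|assumption].
    - exists (T / LambertW (Z.of_nat m) x)%C. split; [|lra].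
      rewrite (zrange_snoc (- Z.of_nat m) (Z.of_nat m)) by lia. rewrite zprod_app, zprod_cons. simpl. ring.
    - exists (T / LambertW (- Z.of_nat m) x)%C. split; [|lra].
      rewrite (zrange_cons (- Z.of_nat m) (Z.of_nat m)) by lia.
      replace (- Z.of_nat m + 1)%Z with (1 - Z.of_nat m)%Z by lia.
      rewrite zprod_cons. ring. }
  destruct Hc as (d & -> & Hd).
  assert (HP : Cmod P <= G + 1).
  { replace P with ((P - gW x T) + gW x T)%C by ring.
    eapply Rle_trans; [apply Cmod_triangle|]. fold G. lra. }
  replace (P * (1 - d) - gW x T)%C with ((P - gW x T) - P * d)%C by ring.
  eapply Rle_lt_trans; [apply Cmod_triangle_minus|]. rewrite Cmod_mult.
  assert (Cmod P * Cmod d <= (G + 1) * (eps / (2 * (G + 1)))).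
  { apply Rmult_le_compat; try apply Cmod_ge_0; assumption. }
  replace ((G + 1) * (eps / (2 * (G + 1)))) with (eps / 2) in * by (field; lra). lra.
Qed.

(** * The product for sinh *)

Definition csinh (s : C) : C := ((Cexp s - Cexp (- s)) / 2)%C.
Definition ccosh (s : C) : C := ((Cexp s + Cexp (- s)) / 2)%C.

Lemma Cexp_opp_lin_cder (z : C) : cder (fun s => Cexp (- s)%C) z (- Cexp (- z))%C.
Proof.
  apply (cder_ext (fun s => Cexp (- (1) * s)%C)); [intros; f_equal; ring|].
  apply (cder_eq _ _ (Cexp (- (1) * z) * - (1))%C); [|apply cder_Cexp_lin].
  replace (- (1) * z)%C with (- z)%C by ring. ring.
Qed.

Lemma csinh_cder (z : C) : cder csinh z (ccosh z).
Proof.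
  apply (cder_eq _ _ ((Cexp z - - Cexp (- z)) * / 2 + (Cexp z - Cexp (- z)) * 0)%C).
  { unfold ccosh, Cdiv. ring. }
  apply (cder_mult (fun s => Cexp s - Cexp (- s))%C (fun _ => / 2)%C); [|apply cder_const].
  apply (cder_minus Cexp); [apply cder_Cexp|apply Cexp_opp_lin_cder].
Qed.

Lemma csinh_entire : entire csinh.
Proof.
  apply (entire_ext (fun s => / 2 * Cexp s + - / 2 * Cexp (- (1) * s))%C).
  - intros s. unfold csinh, Cdiv. replace (- (1) * s)%C with (- s)%C by ring. ring.
  - apply entire_plus; apply entire_scal.
    + apply entire_Cexp.
    + apply (entire_comp_scal _ Cexp), entire_Cexp.
Qed.

Lemma csinh_logform (s : C) : csinh s = (- (Cexp (- s) * (1 - Cexp (2 * s))) / 2)%C.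
Proof.
  unfold csinh. replace (2 * s)%C with (s + s)%C by ring. rewrite Cexp_plus, Cexp_opp.
  field. apply Cexp_neq_0.
Qed.

Lemma ccosh_logform (s : C) : ccosh s = (Cexp (- s) * (1 + Cexp (2 * s)) / 2)%C.
Proof.
  unfold ccosh. replace (2 * s)%C with (s + s)%C by ring. rewrite Cexp_plus, Cexp_opp.
  field. apply Cexp_neq_0.
Qed.

Lemma csinh_zero (s : C) : csinh s = 0 -> exists k : Z, s = (IZR k * PI * Ci)%C.
Proof.
  intros H. pose proof C2_neq_0 as H2.
  destruct (Cexp_eq_1 (2 * s)) as [k Hk].
  - replace (Cexp (2 * s)) with (1 + 2 * (Cexp s * csinh s))%C; [rewrite H; ring|].
    rewrite csinh_logform, Cexp_opp. field. apply Cexp_neq_0.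
  - exists k. replace s with (2 * s / 2)%C by (field; assumption). rewrite Hk. field.
Qed.

Lemma Cexp_2Zpi (k : Z) : Cexp (2 * (IZR k * PI * Ci)) = 1.
Proof.
  rewrite <- Cexp_0, <- (Cexp_Zperiod 0 k). f_equal. ring.
Qed.

Lemma csinh_Zpi (k : Z) : csinh (IZR k * PI * Ci) = 0.
Proof.
  rewrite csinh_logform. rewrite Cexp_2Zpi. field.
Qed.

Definition half_radius (m : nat) : R := PI * INR m + PI / 2.

(** If [Cexp (2 s)] has modulus between [1 / 2] and 2, then [|Re s| <= 1 / 2], so [|Im s|] is within
    [1 / 4] of [PI m + PI / 2] and [cos (2 Im s) <= 0]. No threshold on [m] is needed. *)
Lemma one_minus_Cexp_lower (m : nat) (s : C) : Cmod s = half_radius m ->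
  (1 + Cmod (Cexp (2 * s))) / 8 <= Cmod (1 - Cexp (2 * s)).
Proof.
  intros Hs. pose proof PI2_1 as HP1. pose proof PI_4 as HP4. pose proof (pos_INR m) as Hm.
  set (r := half_radius m) in *. assert (Hr : 1 <= r) by (unfold r, half_radius; nra).
  pose proof (Cmod_Cexp (2 * s)) as HE. rewrite re_scal_l in HE.
  set (E := Cexp (2 * s)) in *. pose proof (Cmod_ge_0 E) as HE0.
  destruct (Rle_lt_dec 2 (Cmod E)) as [H2|H2].
  { pose proof (Cmod_triangle_sub E 1) as T. rewrite Cmod_1, Cmod_minus_sym in T. lra. }
  destruct (Rle_lt_dec (Cmod E) (/ 2)) as [H3|H3].
  { pose proof (Cmod_triangle_sub 1 E) as T. rewrite Cmod_1 in T. lra. }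
  set (u := Re s) in *. set (v := Im s).
  assert (Hu : -1 <= 2 * u <= 1).
  { rewrite HE in H2, H3. split; apply Rnot_lt_le; intros Hlt.
    - assert (exp (2 * u) < exp (-1)) by (apply exp_increasing; assumption).
      assert (exp (-1) <= / 2); [|lra].
      replace (-1) with (- (1)) by ring. rewrite exp_Ropp.
      apply Rinv_le_contravar; [lra|]. pose proof (exp_ineq1_le 1); lra.
    - assert (exp 1 < exp (2 * u)) by (apply exp_increasing; assumption).
      pose proof (exp_ineq1_le 1); lra. }
  assert (Hv2 : v * v = r * r - u * u) by (unfold u, v; rewrite <- Hs; pose proof (Cmod_sqr s); lra).
  pose proof (Rabs_pos v) as Hv0.
  assert (Hva : Rabs v * Rabs v = v * v) by (rewrite <- Rabs_mult; apply Rabs_pos_eq; nra).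
  set (d := r - Rabs v).
  assert (Hd0 : 0 <= d) by (unfold d; nra).
  assert (Hd : d <= / 4).
  { assert (d * (r + Rabs v) = u * u) by (unfold d; nra).
    assert (u * u <= / 4) by nra. nra. }
  assert (Hcos : cos (2 * v) <= 0).
  { replace (cos (2 * v)) with (cos (2 * Rabs v)).
    - replace (2 * Rabs v) with ((PI - 2 * d) + 2 * INR m * PI)
        by (unfold d, r, half_radius; field).
      rewrite cos_period, cos_minus, cos_PI, sin_PI.
      pose proof (cos_ge_0 (2 * d) ltac:(lra) ltac:(lra)). lra.
    - unfold Rabs. destruct (Rcase_abs v); [|reflexivity].
      rewrite <- (cos_neg (2 * v)). f_equal; ring. }
  pose proof (Re_le_Cmod (1 - E)) as T. autorewrite with reim in T.
  assert (Re E <= 0).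
  { unfold E. rewrite re_Cexp, re_scal_l, im_scal_l. fold u v. pose proof (exp_pos (2 * u)). nra. }
  lra.
Qed.

Definition sinhc_zeros (m : nat) : list C :=
  map (fun k => (IZR k * PI * Ci)%C) (zrange (- Z.of_nat m) (-1) ++ zrange 1 (Z.of_nat m)).

Lemma Cmod_Zpi (k : Z) : Cmod (IZR k * PI * Ci) = PI * Rabs (IZR k).
Proof.
  rewrite !Cmod_mult, !Cmod_R, Cmod_Ci, (Rabs_pos_eq PI) by (pose proof PI_RGT_0; lra). ring.
Qed.

(** The function [sinh s / s] is even, so its logarithmic derivative is exactly odd and the symmetry
    condition of [hadamard_limit] holds with error 0. *)
Lemma sinhc_product : exists f : C -> C, (forall s, csinh s = (s * f s)%C) /\
  forall T eps, 0 < eps -> exists m1, forall m, (m1 <= m)%nat ->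
  Cmod (lprod (sinhc_zeros m) T - f T) < eps.
Proof.
  pose proof C2_neq_0 as H2. pose proof PI_RGT_0 as HPI. pose proof PI2_1 as HP1.
  destruct (entire_divide csinh 0 csinh_entire) as (f & Hf & Ef0).
  { unfold csinh. replace (- 0)%C with (RtoC 0) by ring. rewrite Cexp_0. field. }
  assert (Ef : forall s, csinh s = (s * f s)%C) by (intros s; rewrite Ef0; ring).
  exists f. split; [assumption|].
  destruct (entire_deriv f Hf) as (f' & Hf' & Df).
  destruct (entire_deriv f' Hf') as (f'' & _ & Df').
  assert (E' : forall z, ccosh z = (f z + z * f' z)%C).
  { intros z. apply (cder_unique csinh z); [apply csinh_cder|].
    apply (cder_ext (fun s => s * f s)%C); [intros; symmetry; apply Ef|].
    apply (cder_eq _ _ (1 * f z + z * f' z)%C); [ring|].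
    apply (cder_mult (fun s => s)); [apply cder_id|apply Df]. }
  assert (Hf0 : f 0 = 1).
  { pose proof (E' 0) as K. unfold ccosh in K. replace (- 0)%C with (RtoC 0) in K by ring.
    rewrite Cexp_0 in K. replace (f 0) with (f 0 + 0 * f' 0)%C by ring. rewrite <- K. field. }
  assert (Hodd : forall s, csinh (- s) = (- csinh s)%C /\ ccosh (- s) = ccosh s).
  { intros s. unfold csinh, ccosh. replace (- - s)%C with s by ring.
    split; field; assumption. }
  assert (Heven : forall s : C, s <> 0 -> f (- s)%C = f s /\ f' (- s)%C = (- f' s)%C).
  { intros s Hs. destruct (Hodd s) as [O1 O2]. rewrite !Ef in O1. rewrite !E' in O2.
    assert (K : f (- s)%C = f s).
    { replace (f (- s)%C) with ((- / s) * (- s * f (- s)%C))%C by (field; assumption).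
      rewrite O1. field. assumption. }
    split; [assumption|]. rewrite K in O2.
    replace (f' (- s)%C) with ((- / s) * ((f s + - s * f' (- s)%C) - f s))%C by (field; assumption).
    rewrite O2. field. assumption. }
  assert (Hzero : forall z, f z = 0 -> exists k, k <> 0%Z /\ z = (IZR k * PI * Ci)%C).
  { intros z Hz. destruct (csinh_zero z) as [k Hk]; [rewrite Ef, Hz; ring|].
    exists k. split; [|assumption]. intros ->. apply C1_nz.
    replace (IZR 0 * PI * Ci)%C with (RtoC 0) in Hk by ring. rewrite Hk, Hf0 in Hz. exact Hz. }
  assert (Hin : forall m k, (k <> 0 /\ - Z.of_nat m <= k <= Z.of_nat m)%Z <->
    In k (zrange (- Z.of_nat m) (-1) ++ zrange 1 (Z.of_nat m))).
  { intros m k. rewrite in_app_iff, !in_zrange. lia. }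
  assert (Hquot : forall m s, Cmod s = half_radius m ->
    s <> 0 /\ f s <> 0 /\ (f' s / f s)%C = (- ((1 + Cexp (2 * s)) / (1 - Cexp (2 * s))) - 1 / s)%C
    /\ (1 - Cexp (2 * s))%C <> 0).
  { intros m s Hs. pose proof (one_minus_Cexp_lower m s Hs) as K.
    pose proof (Cmod_ge_0 (Cexp (2 * s))). pose proof (pos_INR m).
    assert (Hs0 : s <> 0) by (apply Cmod_neq; rewrite Hs; unfold half_radius; nra).
    assert (Hn : (1 - Cexp (2 * s))%C <> 0) by (apply Cmod_neq; lra).
    assert (Hsh : csinh s <> 0).
    { rewrite csinh_logform. intros E. apply Hn.
      pose proof (Cexp_neq_0 (- s)).
      replace (1 - Cexp (2 * s))%C with
        (- (2 / Cexp (- s)) * (- (Cexp (- s) * (1 - Cexp (2 * s))) / 2))%C by (field; auto).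
      rewrite E. ring. }
    assert (Hfs : f s <> 0) by (intros E; apply Hsh; rewrite Ef, E; ring).
    split; [assumption|split; [assumption|split; [|assumption]]].
    replace (f' s / f s)%C with (ccosh s / csinh s - 1 / s)%C
      by (rewrite E', Ef; field; auto).
    rewrite ccosh_logform, csinh_logform.
    pose proof (Cexp_neq_0 (- s)). field; repeat split; assumption. }
  (* The hyperbolic cotangent is at most 8 on these circles and [1 / s] at most 1, so 10 is safe.
     The margin 1 is below [PI / 2], the distance to the next zeros. *)
  apply (hadamard_limit f f' sinhc_zeros half_radius 10 1 1); try assumption; try lra.
  - intros z. exact (deriv_of_continuous _ _ z Df').
  - intros z Hz Hz'. pose proof (E' z) as K. rewrite Hz, Hz' in K.
    assert (Hs : csinh z = 0) by (rewrite Ef, Hz; ring).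
    apply (Cexp_neq_0 z). replace (Cexp z) with (ccosh z + csinh z)%C.
    + rewrite K, Hs. ring.
    + unfold ccosh, csinh. field.
  - intros B. destruct (INR_unbounded (Rabs B)) as [m1 Hm1]. exists m1. intros m Hm.
    apply le_INR in Hm. pose proof (Rle_abs B). pose proof (Rabs_pos B). unfold half_radius. nra.
  - intros m _. apply NoDup_map_NoDup_ForallPairs.
    + intros j k _ _ E. apply (f_equal Im) in E. autorewrite with reim in E. apply eq_IZR. nra.
    + apply NoDup_app; try apply NoDup_zrange.
      intros k Hk Hk'. rewrite in_zrange in Hk, Hk'. lia.
  - intros m w Hm Hw. apply in_map_iff in Hw. destruct Hw as (k & <- & Hk).
    apply Hin in Hk. destruct Hk as [Hk0 Hk]. split.
    + assert (Hkn : (IZR k * PI * Ci)%C <> 0).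
      { apply Cmod_neq. rewrite Cmod_Zpi. apply Rmult_lt_0_compat; [assumption|].
        apply Rabs_pos_lt. intros E. apply Hk0, eq_IZR, E. }
      replace (f (IZR k * PI * Ci)%C) with (csinh (IZR k * PI * Ci) / (IZR k * PI * Ci))%C
        by (rewrite Ef; field; repeat split; intros E; apply Hkn; rewrite E; ring).
      rewrite csinh_Zpi. unfold Cdiv. ring.
    + rewrite Cmod_Zpi. unfold half_radius.
      assert (Rabs (IZR k) <= INR m).
      { rewrite INR_IZR_INZ. apply Rabs_le. rewrite <- opp_IZR. split; apply IZR_le; lia. }
      nra.
  - intros m z Hm Hz Hfz. destruct (Hzero z Hfz) as (k & Hk0 & ->).
    apply (in_map (fun k => (IZR k * PI * Ci)%C)). apply Hin. split; [assumption|].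
    rewrite Cmod_Zpi in Hz. unfold half_radius in Hz.
    assert (Rabs (IZR k) < INR m + 1) by nra.
    rewrite INR_IZR_INZ, <- plus_IZR in H. apply Rabs_lt_between in H. rewrite <- opp_IZR in H.
    destruct H as [A B]. apply lt_IZR in A. apply lt_IZR in B. lia.
  - intros m s Hm Hs. destruct (Hquot m s Hs) as (Hs0 & Hfs & -> & Hn).
    pose proof (one_minus_Cexp_lower m s Hs) as K.
    eapply Rle_trans; [apply Cmod_triangle_minus|]. rewrite Cmod_opp, !Cmod_div by assumption.
    rewrite Cmod_1, Hs.
    assert (Cmod (1 + Cexp (2 * s)) / Cmod (1 - Cexp (2 * s)) <= 8).
    { pose proof (Cmod_ge_0 (Cexp (2 * s))).
      apply Rmult_le_reg_r with (Cmod (1 - Cexp (2 * s))); [lra|].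
      unfold Rdiv. rewrite Rmult_assoc, Rinv_l, Rmult_1_r by lra.
      eapply Rle_trans; [apply Cmod_triangle|]. rewrite Cmod_1. lra. }
    assert (1 / half_radius m <= 1).
    { pose proof (pos_INR m). assert (1 <= half_radius m) by (unfold half_radius; nra).
      apply Rmult_le_reg_r with (half_radius m); [lra|]. unfold Rdiv. rewrite Rmult_assoc, Rinv_l; lra. }
    lra.
  - intros del e Hd He. exists 1%nat. intros m s Hm Hs _.
    destruct (Hquot m s Hs) as (Hs0 & Hfs & _ & _). destruct (Heven s Hs0) as [-> ->].
    replace (f' s / f s + - f' s / f s)%C with (RtoC 0) by (field; assumption).
    rewrite Cmod_0. lra.
Qed.

Fixpoint sinh_prod (m : nat) (t : R) : R :=
  match m with
  | O => 1
  | S m' => sinh_prod m' t * (1 + (t / (PI * INR (S m'))) ^ 2)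
  end.

Lemma lprod_sinhc_zeros (m : nat) (t : R) : lprod (sinhc_zeros m) t = RtoC (sinh_prod m t).
Proof.
  pose proof PI_RGT_0 as HPI.
  unfold sinhc_zeros. rewrite lprod_map, zprod_app.
  induction m as [|m IH]; [simpl; ring|].
  rewrite (zrange_cons (- Z.of_nat (S m)) (-1)), (zrange_snoc 1 (Z.of_nat (S m))) by lia.
  replace (- Z.of_nat (S m) + 1)%Z with (- Z.of_nat m)%Z by lia.
  replace (Z.of_nat (S m) - 1)%Z with (Z.of_nat m) by lia.
  rewrite zprod_app, !zprod_cons. cbn [zprod fold_right sinh_prod].
  rewrite RtoC_mult, <- IH. unfold zprod.
  set (A := fold_right _ _ (zrange (- Z.of_nat m) (-1))).
  set (B := fold_right _ _ (zrange 1 (Z.of_nat m))).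
  rewrite opp_IZR, <- INR_IZR_INZ. set (N := INR (S m)).
  assert (HN : 0 < N) by (apply lt_0_INR; lia).
  assert (HN' : RtoC N <> 0) by (apply RtoC_neq_0; lra).
  assert (HP' : RtoC PI <> 0) by (apply RtoC_neq_0; lra).
  assert (Hi : Ci <> 0) by apply Ci_nz.
  assert (E : RtoC (1 + (t / (PI * N)) ^ 2) = ((1 - t / (- N * PI * Ci)) * (1 - t / (N * PI * Ci)))%C).
  { rewrite RtoC_plus, RtoC_pow, RtoC_div, RtoC_mult by nra.
    assert (Hii : (Ci * Ci)%C = (- (1))%C) by (apply C_ext; reim; ring).
    transitivity (1 - (t / (N * PI)) * (t / (N * PI)) / (Ci * Ci))%C.
    - rewrite Hii. field. auto.
    - field. auto. }
  rewrite RtoC_opp, E. ring.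
Qed.

Lemma sinh_prod_lim (t eps : R) : t <> 0 -> 0 < eps -> exists m1, forall m, (m1 <= m)%nat ->
  Rabs (sinh_prod m t - (exp t - exp (- t)) / (2 * t)) < eps.
Proof.
  intros Ht He. destruct sinhc_product as (f & Ef & H).
  destruct (H t eps He) as [m1 Hm1]. exists m1. intros m Hm. specialize (Hm1 m Hm).
  assert (Ht' : RtoC t <> 0) by (apply RtoC_neq_0; assumption).
  assert (Hft : f t = RtoC ((exp t - exp (- t)) / (2 * t))).
  { replace (f t) with (csinh t / t)%C by (rewrite Ef; field; assumption).
    unfold csinh. rewrite RtoC_div by lra. rewrite RtoC_minus, RtoC_mult, <- RtoC_opp, !Cexp_RtoC.
    field. assumption. }
  rewrite lprod_sinhc_zeros, Hft, <- RtoC_minus, Cmod_R in Hm1. exact Hm1.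
Qed.

(** * Comparison of the Lambert and sinh products *)

(** Leading part of [W_n(x) - t], with the logarithms omitted; its opposite is the leading part of
    [W_(-n)(y) + t], and [Zk] is the square of its modulus. *)
Definition zk (t : R) (n : nat) : C := (- t, 2 * PI * INR n - PI / 2).

Definition Zk (t : R) (n : nat) : R := t * t + (2 * PI * INR n - PI / 2) * (2 * PI * INR n - PI / 2).

(* Telescoping approximation of [1 / zk + 1 / conj zk = - 2 t / Zk]. *)
Definition tau (t : R) (n : nat) : R :=
  - / PI * (atan (2 * PI * INR n / t) - atan (2 * PI * (INR n - 1) / t)).

(** The two factors [(PI j)^2 + t^2] with [j = 2 n] and [j = 2 n - 1], against which four Lambert
    factors are matched. *)
Definition Dk (t : R) (n : nat) : R :=
  ((2 * PI * INR n) ^ 2 + t ^ 2) * ((2 * PI * INR n - PI) ^ 2 + t ^ 2).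

(** A single quantity dominating all errors of one quadruple. It is at most [1 / t], and at most
    [n^(-3/2)] independently of [t]; hence its sum over [n] is small for large [t]. *)
Definition pair_err (t : R) (n : nat) : R := sqrt (INR n) / (INR n * sqrt (Zk t n)).

Lemma tau_mvt (t : R) (n : nat) : 0 < t -> exists xi,
  2 * PI * (INR n - 1) <= xi <= 2 * PI * INR n /\ tau t n = - (2 * t / (t * t + xi * xi)).
Proof.
  intros Ht. pose proof PI_RGT_0 as HPI.
  destruct (MVT_cor2 (fun u => atan (u / t)) (fun u => t / (t * t + u * u))
    (2 * PI * (INR n - 1)) (2 * PI * INR n)) as (xi & E & Hxi).
  - lra.
  - intros u _. apply is_derive_Reals. auto_derive; [lra|].
    assert (0 < t * t + u * u) by nra.
    field. split; lra.
  - exists xi. split; [lra|]. unfold tau. rewrite E.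
    assert (0 < t * t + xi * xi) by nra. field. split; lra.
Qed.

Lemma Zk_bounds (t : R) (n : nat) : 1 <= t -> (1 <= n)%nat ->
  let v := sqrt (Zk t n) in
  0 < v /\ v * v = Zk t n /\ INR n <= v /\ t <= v /\ 1 <= v.
Proof.
  intros Ht Hn v. apply le_INR in Hn. change (INR 1) with 1 in Hn.
  pose proof PI2_1 as HP1.
  assert (Hw : INR n <= 2 * PI * INR n - PI / 2) by nra.
  assert (HZ : 0 <= Zk t n) by (unfold Zk; nra).
  assert (Hv : v * v = Zk t n) by (apply sqrt_sqrt; assumption).
  assert (Hv0 : 0 <= v) by apply sqrt_pos.
  unfold Zk in Hv.
  assert (t <= v) by nra. repeat split; try assumption; try lra. nra.
Qed.

Lemma tau_bounds (t : R) (n : nat) : 1 <= t -> (1 <= n)%nat ->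
  Rabs (tau t n) <= 80 / sqrt (Zk t n) /\
  Rabs (tau t n + 2 * t / Zk t n) <= 10240 / Zk t n.
Proof.
  intros Ht Hn. destruct (Zk_bounds t n Ht Hn) as (Hv0 & Hvv & Hnv & Htv & Hv1).
  set (v := sqrt (Zk t n)) in *.
  destruct (tau_mvt t n ltac:(lra)) as (xi & Hxi & ->).
  pose proof PI2_1 as HP1. pose proof PI_4 as HP4.
  assert (HN : 1 <= INR n) by (apply (le_INR 1); assumption).
  set (N := INR n) in *. set (om := 2 * PI * N - PI / 2).
  assert (HZe : Zk t n = t * t + om * om) by reflexivity.
  set (Z := Zk t n) in *.
  assert (Hom : N <= om) by (unfold om; nra).
  assert (Hxi0 : 0 <= xi) by nra.
  assert (HZ0 : 0 < Z) by nra.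
  (* The constant is dictated by [n = 1], where [xi] may be near 0: then [om <= 6] and [t >= 1] give
     a ratio of at most 37. It leads to [80 = 2 * 40] and [10240 = 2 * 8 * 16 * 40] in the
     conclusion. *)
  assert (HX : Z <= 40 * (t * t + xi * xi)).
  { destruct (Nat.eq_dec n 1) as [E|E].
    - assert (HN1 : N = 1) by (unfold N; rewrite E; reflexivity).
      assert (om <= 6) by (unfold om; rewrite HN1; lra). rewrite HZe. nra.
    - assert (2 <= N) by (apply (le_INR 2); lia).
      assert (om <= 2 * xi) by (unfold om; nra). rewrite HZe. nra. }
  set (X := t * t + xi * xi) in *. assert (HX0 : 0 < X) by (unfold X; nra).
  assert (HXi : / X <= 40 * / Z).
  { apply Rmult_le_reg_r with (X * Z); [apply Rmult_lt_0_compat; assumption|].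
    replace (/ X * (X * Z)) with Z by (field; lra).
    replace (40 * / Z * (X * Z)) with (40 * X) by (field; lra). assumption. }
  assert (HZv : / Z = / v * / v) by (rewrite <- Hvv; field; lra).
  split.
  - rewrite Rabs_Ropp, Rabs_pos_eq.
    + apply Rle_trans with (2 * v * (40 * / Z)).
      * apply Rmult_le_compat; try lra. left; apply Rinv_0_lt_compat; assumption.
      * rewrite HZv. right. field. lra.
    + apply Rmult_le_pos; [lra|left; apply Rinv_0_lt_compat; assumption].
  - replace (- (2 * t / X) + 2 * t / Z) with (2 * t * ((xi - om) * (xi + om)) * (/ X * / Z)).
    2:{ replace ((xi - om) * (xi + om)) with (X - Z) by (unfold X; rewrite HZe; ring).
        field. split; lra. }
    assert (H1 : Rabs (xi - om) <= 8) by (apply Rabs_le; unfold om; split; lra).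
    assert (H2 : xi + om <= 16 * v).
    { apply Rle_trans with (16 * N); [unfold om; nra|lra]. }
    rewrite !Rabs_mult, (Rabs_pos_eq (xi + om)), (Rabs_pos_eq 2), (Rabs_pos_eq t) by lra.
    rewrite (Rabs_pos_eq (/ X)), (Rabs_pos_eq (/ Z)) by (left; apply Rinv_0_lt_compat; assumption).
    assert (P1 : 0 < / X) by (apply Rinv_0_lt_compat; assumption).
    assert (P2 : 0 < / Z) by (apply Rinv_0_lt_compat; assumption).
    pose proof (Rabs_pos (xi - om)).
    apply Rle_trans with (2 * v * (8 * (16 * v)) * (40 * / Z * / Z)).
    + apply Rmult_le_compat.
      * repeat apply Rmult_le_pos; lra.
      * left; apply Rmult_lt_0_compat; assumption.
      * apply Rmult_le_compat; try lra; [apply Rmult_le_pos; lra|].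
        apply Rmult_le_compat; lra.
      * apply Rmult_le_compat_r; lra.
    + right. rewrite <- Hvv. field. lra.
Qed.

(** Centering at [om = 2 PI n - PI / 2] gives [Dk = (Zk + PI^2 / 4)^2 - PI^2 om^2], which differs
    from [Zk^2] by [O(Zk)]. *)
Lemma Dk_bounds (t : R) (n : nat) : 1 <= t -> (1 <= n)%nat ->
  Zk t n * Zk t n / 4 <= Dk t n /\
  Rabs (Dk t n / (Zk t n * Zk t n) - 1) <= 24 / Zk t n.
Proof.
  intros Ht Hn. destruct (Zk_bounds t n Ht Hn) as (Hv0 & Hvv & Hnv & Htv & Hv1).
  pose proof PI2_1 as HP1. pose proof PI_4 as HP4.
  assert (HN : 1 <= INR n) by (apply (le_INR 1); assumption).
  unfold Dk. set (N := INR n) in *. set (om := 2 * PI * N - PI / 2).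
  assert (HZe : Zk t n = t * t + om * om) by reflexivity.
  set (Z := Zk t n) in *.
  assert (Hom : PI <= om) by (unfold om; nra).
  assert (HZ1 : 1 <= Z) by nra.
  replace (2 * PI * N - PI) with (om - PI / 2) by (unfold om; field).
  replace (2 * PI * N) with (om + PI / 2) by (unfold om; field).
  split.
  - assert (A1 : Z <= (om + PI / 2) ^ 2 + t ^ 2) by (rewrite HZe; nra).
    assert (A2 : Z / 4 <= (om - PI / 2) ^ 2 + t ^ 2).
    { rewrite HZe. assert (om / 2 <= om - PI / 2) by lra.
      assert (om / 2 * (om / 2) <= (om - PI / 2) * (om - PI / 2)) by (apply Rmult_le_compat; lra). nra. }
    replace (Z * Z / 4) with (Z * (Z / 4)) by field.
    apply Rmult_le_compat; lra.
  - replace (((om + PI / 2) ^ 2 + t ^ 2) * ((om - PI / 2) ^ 2 + t ^ 2)) with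
      ((Z + PI * PI / 4) * (Z + PI * PI / 4) - PI * PI * (om * om)) by (rewrite HZe; field).
    set (P := PI * PI). assert (HP : 0 <= P <= 16) by (unfold P; nra).
    replace (((Z + P / 4) * (Z + P / 4) - P * (om * om)) / (Z * Z) - 1) with
      ((P / 2 - P * (om * om / Z) + P * P / 16 / Z) / Z) by (field; lra).
    assert (Hq : 0 <= om * om / Z <= 1).
    { split.
      - apply Rmult_le_pos; [nra|left; apply Rinv_0_lt_compat; lra].
      - apply Rmult_le_reg_r with Z; [lra|]. unfold Rdiv. rewrite Rmult_assoc, Rinv_l by lra. nra. }
    assert (Hq2 : 0 <= P * P / 16 / Z <= 16).
    { assert (0 <= P * P / 16 <= 16) by nra. split.
      - apply Rmult_le_pos; [lra|left; apply Rinv_0_lt_compat; lra].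
      - apply Rmult_le_reg_r with Z; [lra|]. unfold Rdiv at 1.
        rewrite Rmult_assoc, Rinv_l by lra. nra. }
    rewrite Rabs_div, (Rabs_pos_eq Z) by lra.
    apply Rmult_le_compat_r; [left; apply Rinv_0_lt_compat; lra|].
    set (Q := om * om / Z) in *. apply Rabs_le. split; nra.
Qed.

Lemma pair_err_bounds (t : R) (n : nat) : 1 <= t -> (1 <= n)%nat ->
  let v := sqrt (Zk t n) in let s := pair_err t n in
  0 < s <= 1 /\ / Zk t n <= s /\ s <= / t /\ s <= / (INR n * sqrt (INR n)) /\
  root4 (INR n) / INR n * / v <= s /\ root4 (INR n) * root4 (INR n) * / Zk t n <= s.
Proof.
  intros Ht Hn v s. destruct (Zk_bounds t n Ht Hn) as (Hv0 & Hvv & Hnv & Htv & Hv1).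
  fold v in Hv0, Hvv, Hnv, Htv, Hv1.
  assert (HN : 1 <= INR n) by (apply (le_INR 1); assumption).
  pose proof (root4_ge_1 (INR n) HN) as Hq.
  assert (Hqq : root4 (INR n) * root4 (INR n) = sqrt (INR n)).
  { unfold root4. apply sqrt_sqrt, sqrt_pos. }
  assert (Hw : sqrt (INR n) * sqrt (INR n) = INR n) by (apply sqrt_sqrt; lra).
  unfold s, pair_err. fold v.
  set (N := INR n) in *. set (w := sqrt N) in *. set (q := root4 N) in *.
  assert (Hw1 : 1 <= w) by nra.
  assert (HwN : w <= N) by nra.
  assert (HNv : 0 < N * v) by (apply Rmult_lt_0_compat; lra).
  assert (Hnn : forall a b, a * (N * v) <= b -> a <= b / (N * v)).
  { intros a b Hab. apply Rmult_le_reg_r with (N * v); [assumption|].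
    unfold Rdiv. rewrite Rmult_assoc, Rinv_l by lra. lra. }
  assert (Hsmall : forall c, 0 < c -> w * c <= N * v -> w / (N * v) <= / c).
  { intros c Hc Hwc. apply Rmult_le_reg_r with (N * v * c); [apply Rmult_lt_0_compat; assumption|].
    replace (w / (N * v) * (N * v * c)) with (w * c) by (field; lra).
    replace (/ c * (N * v * c)) with (N * v) by (field; lra). assumption. }
  split; [split|split; [|split; [|split; [|split]]]].
  - apply Rdiv_lt_0_compat; lra.
  - rewrite <- Rinv_1. apply Hsmall; [lra|]. nra.
  - apply Hnn. rewrite <- Hvv. replace (/ (v * v) * (N * v)) with (N / v) by (field; lra).
    apply Rmult_le_reg_r with v; [assumption|]. unfold Rdiv. rewrite Rmult_assoc, Rinv_l by lra. nra.
  - apply Hsmall; [lra|]. nra.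
  - apply Hsmall; [nra|]. replace (w * (N * w)) with (N * (w * w)) by ring. rewrite Hw. nra.
  - apply Hnn. replace (q / N * / v * (N * v)) with q by (field; lra). nra.
  - rewrite Hqq. apply Hnn. rewrite <- Hvv.
    replace (w * / (v * v) * (N * v)) with (w * (N / v)) by (field; lra).
    assert (N / v <= 1).
    { apply Rmult_le_reg_r with v; [assumption|]. unfold Rdiv. rewrite Rmult_assoc, Rinv_l by lra. lra. }
    nra.
Qed.

Lemma Cexp_quadratic (B : R) : 1 <= B -> exists M, 0 <= M /\
  forall w : C, Cmod w <= B -> Cmod (Cexp w - 1 - w) <= M * Cmod w * Cmod w.
Proof.
  intros HB. destruct (entire_deriv_eq Cexp Cexp entire_Cexp cder_Cexp) as [[_ D] _].
  destruct (D B HB) as (M & HM & K). exists M. split; [assumption|].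
  intros w Hw. specialize (K 0 w).
  rewrite Cexp_0 in K. replace (0 + w)%C with w in K by ring.
  replace (Cexp w - 1 - w)%C with (Cexp w - 1 - 1 * w)%C by ring.
  apply K; [rewrite Cmod_0; lra|assumption].
Qed.

Definition ek (mu : C) (t : R) (n : nat) : C := Cexp (mu * RtoC (tau t n)).

(** The pair [(z + a) (- z + b)] is [- z^2 (1 + mu / z + r)] with a small [r], and likewise at the
    conjugate of [z]; the product of both is [Zk^2 (1 - 2 t mu / Zk)] up to [pair_err]. Writing the
    first-order factor as [ek], an exponential of [mu tau], makes the product over [n] telescope. *)
Lemma pair_ratio (mu : C) (C0 : R) : 0 < C0 -> exists A, 0 < A /\
  forall (t : R) (n : nat) (a b a' b' : C), 1 <= t -> (1 <= n)%nat ->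
  let q := root4 (INR n) in
  Cmod (a - b - mu) <= C0 * (q / INR n) -> Cmod (a' - b' - mu) <= C0 * (q / INR n) ->
  Cmod a <= C0 * q -> Cmod b <= C0 * q -> Cmod a' <= C0 * q -> Cmod b' <= C0 * q ->
  exists eta : C, Cmod eta <= A * pair_err t n /\
    ((zk t n + a) * (- zk t n + b) * ((Cconj (zk t n) + a') * (- Cconj (zk t n) + b')))%C =
    (RtoC (Dk t n) * ek mu t n * (1 + eta))%C.
Proof.
  intros HC0. set (u := Cmod mu). assert (Hu : 0 <= u) by apply Cmod_ge_0.
  destruct (Cexp_quadratic (80 * u + 1) ltac:(lra)) as (M & HM & Hexp).
  set (c := C0 + C0 * C0). assert (Hc : 0 < c) by (unfold c; nra).
  set (A1 := u * u + 2 * (u * c) + c * c + 2 * c).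
  set (A2 := M * (80 * u) * (80 * u) + 10240 * u).
  set (A3 := A1 + A2 + 24 * exp (80 * u)).
  pose proof (exp_pos (80 * u)) as He0.
  assert (HA1 : 0 <= A1) by (unfold A1; nra).
  assert (HA2 : 0 <= A2).
  { unfold A2. assert (0 <= M * (80 * u) * (80 * u)) by (repeat apply Rmult_le_pos; lra). lra. }
  (* [A1] bounds the remainder of the algebraic expansion, [A2] that of the exponential, and [A3]
     adds the deviation of [Dk] from [Zk^2]. The front factor comes from dividing by
     [Dk >= Zk^2 / 4] and by [ek], whose modulus is at least [exp (- 80 u)]. *)
  exists (4 * exp (80 * u) * A3). split; [unfold A3; apply Rmult_lt_0_compat; lra|].
  intros t n a b a' b' Ht Hn q Hab Hab' Ha Hb Ha' Hb'.
  destruct (Zk_bounds t n Ht Hn) as (Hv0 & Hvv & Hnv & Htv & Hv1).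
  destruct (pair_err_bounds t n Ht Hn) as ((Hs0 & Hs1) & HsZ & _ & _ & Hs3 & Hs4).
  destruct (tau_bounds t n Ht Hn) as [Ht1 Ht2].
  destruct (Dk_bounds t n Ht Hn) as [HD1 HD2].
  fold q in Hs3, Hs4.
  set (s := pair_err t n) in *. set (v := sqrt (Zk t n)) in *. set (Z := Zk t n) in *.
  set (D := Dk t n) in *.
  assert (HN : 1 <= INR n) by (apply (le_INR 1); assumption).
  pose proof (root4_ge_1 (INR n) HN) as Hq. fold q in Hq.
  assert (HZ0 : 0 < Z) by nra.
  set (z := zk t n) in *. set (zb := Cconj z).
  assert (Hzz : (z * zb)%C = RtoC Z).
  { unfold zb. apply C_ext; unfold z, zk, Z, Zk; reim; ring. }
  assert (Hzm : Cmod z = v).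
  { apply Rsqr_inj; [apply Cmod_ge_0|lra|]. unfold Rsqr. rewrite Hvv, Cmod_sqr.
    unfold z, zk, Z, Zk. reim. ring. }
  assert (Hzbm : Cmod zb = v) by (unfold zb; rewrite Cmod_conj; assumption).
  assert (Hz : z <> 0) by (apply Cmod_neq; lra).
  assert (Hzb : zb <> 0) by (apply Cmod_neq; lra).
  assert (HZc : RtoC Z <> 0) by (apply RtoC_neq_0; lra).
  assert (Hsum : (mu * (/ z + / zb))%C = (- (RtoC (2 * t / Z) * mu))%C).
  { replace (/ z + / zb)%C with ((z + zb) / (z * zb))%C by (field; auto).
    rewrite Hzz. replace (z + zb)%C with (RtoC (- (2 * t))) by
      (unfold zb, z, zk; apply C_ext; reim; ring).
    unfold Rdiv. rewrite RtoC_mult, RtoC_inv, RtoC_opp by lra. field. assumption. }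
  set (iv := / v). assert (Hiv : 0 < iv <= 1).
  { unfold iv. split; [apply Rinv_0_lt_compat; assumption|]. rewrite <- Rinv_1. apply Rinv_le_contravar; lra. }
  assert (HiZ : / Z = iv * iv) by (unfold iv; rewrite <- Hvv; field; lra).
  (* [rem] is what remains of a normalized factor after removing [1 + mu / w]. *)
  assert (Hrem : forall (w a b : C), w <> 0 -> Cmod w = v -> Cmod (a - b - mu) <= C0 * (q / INR n) ->
    Cmod a <= C0 * q -> Cmod b <= C0 * q ->
    Cmod ((a - b - mu) * / w - a * b * (/ w * / w)) <= c * s).
  { clear a b a' b' Hab Hab' Ha Hb Ha' Hb'. intros w a b Hw Hwm Hab Ha Hb.
    eapply Rle_trans; [apply Cmod_triangle_minus|].
    rewrite !Cmod_mult, !Cmod_inv, Hwm by assumption. fold iv.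
    assert (H1 : Cmod (a - b - mu) * iv <= C0 * s).
    { apply Rle_trans with (C0 * (q / INR n) * iv); [apply Rmult_le_compat_r; lra|].
      rewrite Rmult_assoc. apply Rmult_le_compat_l; [lra|]. exact Hs3. }
    assert (H2 : Cmod a * Cmod b * (iv * iv) <= C0 * C0 * s).
    { apply Rle_trans with ((C0 * q) * (C0 * q) * (iv * iv)).
      - apply Rmult_le_compat_r; [nra|]. apply Rmult_le_compat; try apply Cmod_ge_0; assumption.
      - replace (C0 * q * (C0 * q) * (iv * iv)) with (C0 * C0 * (q * q * (iv * iv))) by ring.
        apply Rmult_le_compat_l; [nra|]. rewrite <- HiZ. exact Hs4. }
    unfold c. lra. }
  set (r := ((a - b - mu) * / z - a * b * (/ z * / z))%C).
  set (r' := ((a' - b' - mu) * / zb - a' * b' * (/ zb * / zb))%C).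
  assert (Hr : Cmod r <= c * s) by (apply Hrem; assumption).
  assert (Hr' : Cmod r' <= c * s) by (apply Hrem; assumption).
  (* All terms of [(1 + mu / z + r) (1 + mu / zb + r')] except 1 and the first-order part
     [mu (1 / z + 1 / zb) = - 2 t mu / Z]. *)
  set (X := (mu * mu * / RtoC Z + mu * / z * r' + r * (mu * / zb) + r * r' + (r + r'))%C).
  assert (HNe : ((z + a) * (- z + b) * ((zb + a') * (- zb + b')))%C =
    (RtoC (Z * Z) * (1 - RtoC (2 * t / Z) * mu + X))%C).
  { replace (1 - RtoC (2 * t / Z) * mu)%C with (1 + - (RtoC (2 * t / Z) * mu))%C by ring.
    rewrite <- Hsum. rewrite RtoC_mult. unfold X. rewrite <- Hzz. unfold r, r'.
    field. auto. }
  assert (HX : Cmod X <= A1 * s).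
  { unfold X.
    assert (M1 : Cmod (mu * mu * / RtoC Z) <= u * u * s).
    { rewrite !Cmod_mult, Cmod_inv, Cmod_R, Rabs_pos_eq by (assumption || lra). fold u.
      apply Rmult_le_compat_l; [nra|assumption]. }
    assert (M2 : Cmod (mu * / z * r') <= u * c * s).
    { rewrite !Cmod_mult, Cmod_inv, Hzm by assumption. fold u iv. pose proof (Cmod_ge_0 r').
      apply Rle_trans with (u * 1 * (c * s)); [|lra].
      apply Rmult_le_compat; try assumption; [nra|]. apply Rmult_le_compat_l; lra. }
    assert (M3 : Cmod (r * (mu * / zb)) <= u * c * s).
    { rewrite !Cmod_mult, Cmod_inv, Hzbm by assumption. fold u iv. pose proof (Cmod_ge_0 r).
      apply Rle_trans with (c * s * (u * 1)); [|lra].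
      apply Rmult_le_compat; try assumption; [nra|]. apply Rmult_le_compat_l; lra. }
    assert (M4 : Cmod (r * r') <= c * c * s).
    { rewrite Cmod_mult. apply Rle_trans with (c * s * (c * s)).
      - apply Rmult_le_compat; try apply Cmod_ge_0; assumption.
      - assert (c * c * s * s <= c * c * s * 1) by (apply Rmult_le_compat_l; [nra|lra]). lra. }
    assert (M5 : Cmod (r + r') <= 2 * c * s) by (eapply Rle_trans; [apply Cmod_triangle|lra]).
    eapply Rle_trans; [apply Cmod_triangle|].
    eapply Rle_trans; [apply Rplus_le_compat_r, Cmod_triangle|].
    eapply Rle_trans; [apply Rplus_le_compat_r, Rplus_le_compat_r, Cmod_triangle|].
    eapply Rle_trans; [apply Rplus_le_compat_r, Rplus_le_compat_r, Rplus_le_compat_r, Cmod_triangle|].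
    unfold A1. lra. }
  set (e := ek mu t n). set (e1 := (e - (1 - RtoC (2 * t / Z) * mu))%C).
  assert (Htau : Cmod (mu * RtoC (tau t n)) <= 80 * u * iv).
  { rewrite Cmod_mult, Cmod_R. fold u. apply Rle_trans with (u * (80 / v)).
    - apply Rmult_le_compat_l; assumption.
    - right. unfold iv. field. lra. }
  assert (He1 : Cmod e1 <= A2 * s).
  { replace e1 with ((Cexp (mu * RtoC (tau t n)) - 1 - mu * RtoC (tau t n))
      + mu * RtoC (tau t n + 2 * t / Z))%C by (unfold e1, e, ek; rewrite RtoC_plus; ring).
    eapply Rle_trans; [apply Cmod_triangle|].
    assert (M1 : Cmod (Cexp (mu * RtoC (tau t n)) - 1 - mu * RtoC (tau t n)) <= M * (80 * u) * (80 * u) * s).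
    { eapply Rle_trans; [apply Hexp; nra|]. set (w := Cmod (mu * RtoC (tau t n))) in *.
      assert (0 <= w) by apply Cmod_ge_0.
      apply Rle_trans with (M * (80 * u * iv) * (80 * u * iv)).
      - apply Rmult_le_compat; try assumption; [nra|]. apply Rmult_le_compat_l; assumption.
      - replace (M * (80 * u * iv) * (80 * u * iv)) with (M * (80 * u) * (80 * u) * (iv * iv)) by ring.
        apply Rmult_le_compat_l; [repeat apply Rmult_le_pos; lra|]. rewrite <- HiZ. assumption. }
    assert (M2 : Cmod (mu * RtoC (tau t n + 2 * t / Z)) <= 10240 * u * s).
    { rewrite Cmod_mult, Cmod_R. fold u. apply Rle_trans with (u * (10240 / Z)).
      - apply Rmult_le_compat_l; assumption.
      - unfold Rdiv. replace (10240 * u * s) with (u * (10240 * s)) by ring.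
        apply Rmult_le_compat_l; [assumption|]. lra. }
    unfold A2. lra. }
  assert (He : exp (- (80 * u)) <= Cmod e <= exp (80 * u)).
  { unfold e, ek. rewrite Cmod_Cexp.
    pose proof (re_le_Cmod (mu * RtoC (tau t n))) as T. apply Rabs_le_between in T.
    assert (80 * u * iv <= 80 * u) by nra.
    assert (Hmono : forall p p', p <= p' -> exp p <= exp p').
    { intros p p' [Hp| ->]; [left; apply exp_increasing; assumption|lra]. }
    split; apply Hmono; lra. }
  set (y := D / (Z * Z) - 1) in *.
  assert (HDy : RtoC D = (RtoC (Z * Z) * (1 + RtoC y))%C).
  { rewrite <- RtoC_plus, <- RtoC_mult. f_equal. unfold y. field. lra. }
  assert (HZZ : 0 < Z * Z) by (apply Rmult_lt_0_compat; assumption).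
  assert (HD0 : 0 < D) by lra.
  assert (Hee : e <> 0) by (apply Cexp_neq_0).
  assert (HDc : RtoC D <> 0) by (apply RtoC_neq_0; lra).
  set (W := (X - e1 - RtoC y * e)%C).
  assert (HW : Cmod W <= A3 * s).
  { unfold W. eapply Rle_trans; [apply Cmod_triangle_minus|].
    eapply Rle_trans; [apply Rplus_le_compat_r, Cmod_triangle_minus|].
    rewrite Cmod_mult, Cmod_R.
    assert (Rabs y * Cmod e <= 24 * s * exp (80 * u)).
    { apply Rmult_le_compat; try apply Rabs_pos; try apply Cmod_ge_0; [|lra].
      eapply Rle_trans; [exact HD2|]. unfold Rdiv. apply Rmult_le_compat_l; lra. }
    unfold A3. lra. }
  exists (RtoC (Z * Z) * W / (RtoC D * e))%C. split.
  - rewrite Cmod_div, !Cmod_mult, !Cmod_R by (apply Cmult_neq_0; assumption).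
    rewrite (Rabs_pos_eq (Z * Z)), (Rabs_pos_eq D) by lra.
    assert (HE2 : exp (80 * u) * exp (- (80 * u)) = 1) by (rewrite <- exp_plus, <- exp_0; f_equal; ring).
    assert (Hlow : Z * Z / 4 * exp (- (80 * u)) <= D * Cmod e).
    { apply Rmult_le_compat; try lra. left; apply exp_pos. }
    pose proof (exp_pos (- (80 * u))) as He0'.
    assert (HDe : 0 < D * Cmod e) by (apply Rmult_lt_0_compat; lra).
    apply Rmult_le_reg_r with (D * Cmod e); [assumption|].
    unfold Rdiv. rewrite Rmult_assoc, Rinv_l, Rmult_1_r by lra.
    apply Rle_trans with (4 * exp (80 * u) * A3 * s * (Z * Z / 4 * exp (- (80 * u)))).
    + replace (4 * exp (80 * u) * A3 * s * (Z * Z / 4 * exp (- (80 * u)))) with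
        (Z * Z * (A3 * s) * (exp (80 * u) * exp (- (80 * u)))) by field.
      rewrite HE2, Rmult_1_r. apply Rmult_le_compat_l; [lra|assumption].
    + apply Rmult_le_compat_l; [|assumption].
      apply Rmult_le_pos; [apply Rmult_le_pos; [lra|unfold A3; lra]|lra].
  - fold zb. rewrite HNe.
    transitivity (RtoC D * e + RtoC (Z * Z) * W)%C; [|fold e; field; auto].
    rewrite HDy. unfold W, e1. ring.
Qed.

(** * Multiplying the comparison over all indices *)

Lemma prod_sym_0 (f : Z -> C) : prod_sym 0 f = f 0%Z.
Proof. rewrite prod_sym_zprod. unfold zrange, zprod. simpl. ring. Qed.

Lemma prod_sym_S (K : nat) (f : Z -> C) :
  prod_sym (S K) f = (f (- Z.of_nat (S K))%Z * prod_sym K f * f (Z.of_nat (S K)))%C.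
Proof.
  rewrite !prod_sym_zprod.
  rewrite (zrange_cons (- Z.of_nat (S K))), (zrange_snoc _ (Z.of_nat (S K))) by lia.
  replace (- Z.of_nat (S K) + 1)%Z with (- Z.of_nat K)%Z by lia.
  replace (Z.of_nat (S K) - 1)%Z with (Z.of_nat K) by lia.
  rewrite zprod_cons, zprod_app, zprod_cons. cbn [zprod fold_right]. ring.
Qed.

Lemma prod_sym_mult (K : nat) (f g : Z -> C) :
  prod_sym K (fun k => f k * g k)%C = (prod_sym K f * prod_sym K g)%C.
Proof. rewrite !prod_sym_zprod. apply zprod_mult. Qed.

Lemma prod_sym_ext (K : nat) (f g : Z -> C) : (forall k, f k = g k) -> prod_sym K f = prod_sym K g.
Proof. intros H. rewrite !prod_sym_zprod. apply zprod_ext. intros; apply H. Qed.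

(** The product of the [PI j] for [1 <= j <= 2 K]; hence [cK^2] times [sinh_prod (2 K) t] is the
    product of the [(PI j)^2 + t^2]. *)
Definition cK (K : nat) : R := PI ^ (2 * K) * INR (fact (2 * K)).

Lemma cK_pos (K : nat) : 0 < cK K.
Proof.
  apply Rmult_lt_0_compat; [apply pow_lt, PI_RGT_0|apply INR_fact_lt_0].
Qed.

Lemma cK_S (K : nat) : cK (S K) = PI * PI * INR (2 * K + 1) * INR (2 * K + 2) * cK K.
Proof.
  unfold cK. replace (2 * S K)%nat with (S (S (2 * K))) by lia.
  rewrite !fact_simpl, !mult_INR. simpl pow.
  replace (S (2 * K)) with (2 * K + 1)%nat by lia.
  replace (S (2 * K + 1)) with (2 * K + 2)%nat by lia. ring.
Qed.

Lemma log_term_bound (n : nat) (L : C) : (1 <= n)%nat ->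
  Cmod (L - ln (2 * PI * INR n)) <= (Cmod L + 7) * root4 (INR n).
Proof.
  intros Hn. assert (HN : 1 <= INR n) by (apply (le_INR 1); assumption).
  pose proof (root4_ge_1 _ HN) as Hq. pose proof (ln_le_root4 _ HN) as Hln. fold (root4 (INR n)) in Hln.
  pose proof PI2_1. pose proof PI_4. pose proof (Cmod_ge_0 L).
  eapply Rle_trans; [apply Cmod_triangle_minus|]. rewrite Cmod_R.
  assert (0 <= ln (2 * PI * INR n)).
  { rewrite <- ln_1. left; apply ln_increasing; nra. }
  rewrite Rabs_pos_eq by assumption.
  rewrite ln_mult by lra.
  assert (ln (2 * PI) <= 3).
  { rewrite ln_mult by lra. pose proof (ln_le_sub1 2 ltac:(lra)).
    pose proof (ln_le_sub1 (PI / 2) ltac:(lra)) as K. unfold Rdiv in K. rewrite ln_mult, ln_Rinv in K by lra.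
    lra. }
  nra.
Qed.

Lemma lambert_quadruple (x y : C) : x <> 0 -> y <> 0 -> exists A, 0 < A /\
  forall t n, 1 <= t -> (1 <= n)%nat -> exists eta : C, Cmod eta <= A * pair_err t n /\
  ((LambertW (Z.of_nat n) x - t) * (LambertW (- Z.of_nat n) y + t) *
   ((LambertW (- Z.of_nat n) x - t) * (LambertW (Z.of_nat n) y + t)))%C =
  (RtoC (Dk t n) * ek (Clog x - Clog y) t n * (1 + eta))%C.
Proof.
  intros Hx Hy.
  destruct (LambertW_asymp x Hx) as (Cx & HCx & Hax). destruct (LambertW_asymp y Hy) as (Cy & HCy & Hay).
  set (C0 := Cx + Cy + Cmod (Clog x) + Cmod (Clog y) + 7).
  pose proof (Cmod_ge_0 (Clog x)). pose proof (Cmod_ge_0 (Clog y)).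
  destruct (pair_ratio (Clog x - Clog y) C0 ltac:(unfold C0; lra)) as (A & HA & HP).
  exists A. split; [assumption|]. intros t n Ht Hn.
  destruct (Hax n Hn) as [X1 X2]. destruct (Hay n Hn) as [Y1 Y2].
  assert (HN : 1 <= INR n) by (apply (le_INR 1); assumption).
  pose proof (root4_ge_1 _ HN) as Hq.
  pose proof (log_term_bound n (Clog x) Hn) as Lx. pose proof (log_term_bound n (Clog y) Hn) as Ly.
  set (q := root4 (INR n)) in *. set (ell := RtoC (ln (2 * PI * INR n))) in *.
  set (om := RtoC (2 * PI * INR n - PI / 2)).
  assert (Hqn : 0 <= q / INR n <= q).
  { split.
    - apply Rmult_le_pos; [lra|left; apply Rinv_0_lt_compat; lra].
    - apply Rmult_le_reg_r with (INR n); [lra|]. unfold Rdiv. rewrite Rmult_assoc, Rinv_l by lra. nra. }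
  assert (Ez : zk t n = (- t + om * Ci)%C) by (unfold zk, om; apply C_ext; reim; ring).
  assert (Ezc : Cconj (zk t n) = (- t - om * Ci)%C) by (unfold zk, om; apply C_ext; reim; ring).
  assert (Bx : lambert_b x n = (om * Ci + (Clog x - ell))%C).
  { unfold lambert_b, om, ell. rewrite PI2_RtoC. rewrite RtoC_minus, !RtoC_mult. ring. }
  assert (By : lambert_b y n = (om * Ci + (Clog y - ell))%C).
  { unfold lambert_b, om, ell. rewrite PI2_RtoC. rewrite RtoC_minus, !RtoC_mult. ring. }
  assert (Bx' : lambert_b' x n = (- (om * Ci) + (Clog x - ell))%C).
  { unfold lambert_b', om, ell. rewrite PI2_RtoC. rewrite RtoC_minus, !RtoC_mult. ring. }
  assert (By' : lambert_b' y n = (- (om * Ci) + (Clog y - ell))%C).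
  { unfold lambert_b', om, ell. rewrite PI2_RtoC. rewrite RtoC_minus, !RtoC_mult. ring. }
  set (wx := LambertW (Z.of_nat n) x) in *. set (wx' := LambertW (- Z.of_nat n) x) in *.
  set (wy := LambertW (Z.of_nat n) y) in *. set (wy' := LambertW (- Z.of_nat n) y) in *.
  rewrite Bx in X1. rewrite Bx' in X2. rewrite By in Y1. rewrite By' in Y2.
  assert (Hdiff : forall u v : C, Cmod u <= Cx * q / INR n -> Cmod v <= Cy * q / INR n ->
    Cmod (u - v) <= C0 * (q / INR n)).
  { intros u v Hu Hv. eapply Rle_trans; [apply Cmod_triangle_minus|].
    unfold Rdiv in *. rewrite Rmult_assoc in Hu, Hv. unfold C0.
    assert (Cx * (q * / INR n) + Cy * (q * / INR n) <= (Cx + Cy + Cmod (Clog x) + Cmod (Clog y) + 7) * (q * / INR n));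
      [|lra].
    rewrite <- Rmult_plus_distr_r. apply Rmult_le_compat_r; lra. }
  assert (Hsize : forall (u L : C) c, 0 < c -> c + Cmod L + 7 <= C0 -> Cmod u <= c * q / INR n ->
    Cmod (L - ell) <= (Cmod L + 7) * q -> Cmod (u + (L - ell)) <= C0 * q).
  { intros u L c Hc HcL Hu HL. eapply Rle_trans; [apply Cmod_triangle|].
    assert (c * q / INR n <= c * q).
    { unfold Rdiv in *. rewrite Rmult_assoc. apply Rmult_le_compat_l; lra. }
    assert ((c + Cmod L + 7) * q <= C0 * q) by (apply Rmult_le_compat_r; lra). lra. }
  (* Each deviation is [Clog - ell] plus an error of order [q / n]. The terms [ell = ln (2 PI n)]
     cancel in the differences; individually they are only [O(q)]. *)
  destruct (HP t n (wx - om * Ci) (wy' + om * Ci) (wx' + om * Ci) (wy - om * Ci))%C as (eta & He & E);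
    try assumption; fold q.
  - replace (wx - om * Ci - (wy' + om * Ci) - (Clog x - Clog y))%C with
      ((wx - (om * Ci + (Clog x - ell))) - (wy' - (- (om * Ci) + (Clog y - ell))))%C by ring.
    apply Hdiff; assumption.
  - replace (wx' + om * Ci - (wy - om * Ci) - (Clog x - Clog y))%C with
      ((wx' - (- (om * Ci) + (Clog x - ell))) - (wy - (om * Ci + (Clog y - ell))))%C by ring.
    apply Hdiff; assumption.
  - replace (wx - om * Ci)%C with ((wx - (om * Ci + (Clog x - ell))) + (Clog x - ell))%C by ring.
    apply (Hsize _ _ Cx); try assumption; unfold C0; lra.
  - replace (wy' + om * Ci)%C with ((wy' - (- (om * Ci) + (Clog y - ell))) + (Clog y - ell))%C by ring.
    apply (Hsize _ _ Cy); try assumption; unfold C0; lra.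
  - replace (wx' + om * Ci)%C with ((wx' - (- (om * Ci) + (Clog x - ell))) + (Clog x - ell))%C by ring.
    apply (Hsize _ _ Cx); try assumption; unfold C0; lra.
  - replace (wy - om * Ci)%C with ((wy - (om * Ci + (Clog y - ell))) + (Clog y - ell))%C by ring.
    apply (Hsize _ _ Cy); try assumption; unfold C0; lra.
  - exists eta. split; [assumption|]. rewrite <- E, Ezc, Ez. ring.
Qed.

Fixpoint pair_err_sum (t : R) (K : nat) : R :=
  match K with O => 0 | S K' => pair_err_sum t K' + pair_err t (S K') end.

(** With [a = sqrt n] and [b = sqrt (n + 1)], the difference [1 / a - 1 / b] equals
    [1 / (a b (a + b))], and [a b (a + b) <= 2 b^3]: a telescoping majorant. *)
Lemma inv_pow32_le (n : nat) : (1 <= n)%nat ->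
  / (INR (S n) * sqrt (INR (S n))) <= 2 * (/ sqrt (INR n) - / sqrt (INR (S n))).
Proof.
  intros Hn. assert (HN : 1 <= INR n) by (apply (le_INR 1); assumption). rewrite S_INR.
  set (N := INR n) in *.
  assert (Ha : 0 < sqrt N) by (apply sqrt_lt_R0; lra).
  assert (Hb : 0 < sqrt (N + 1)) by (apply sqrt_lt_R0; lra).
  assert (Haa : sqrt N * sqrt N = N) by (apply sqrt_sqrt; lra).
  assert (Hbb : sqrt (N + 1) * sqrt (N + 1) = N + 1) by (apply sqrt_sqrt; lra).
  set (a := sqrt N) in *. set (b := sqrt (N + 1)) in *.
  assert (Hab : a <= b) by nra.
  replace (2 * (/ a - / b)) with (2 / (a * b * (a + b))).
  2:{ replace (/ a - / b) with ((b * b - a * a) / (a * b * (a + b))) by (field; repeat split; lra).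
      rewrite Hbb, Haa. field. repeat split; lra. }
  rewrite <- Hbb.
  assert (P : 0 < a * b * (a + b)) by (repeat apply Rmult_lt_0_compat; lra).
  assert (P2 : 0 < b * b * b) by (repeat apply Rmult_lt_0_compat; lra).
  apply Rmult_le_reg_r with (b * b * b * (a * b * (a + b))); [apply Rmult_lt_0_compat; assumption|].
  replace (/ (b * b * b) * (b * b * b * (a * b * (a + b)))) with (a * b * (a + b)) by (field; lra).
  replace (2 / (a * b * (a + b)) * (b * b * b * (a * b * (a + b)))) with (2 * (b * b * b))
    by (field; repeat split; lra).
  assert (a * b * (a + b) <= b * b * (b + b)); [|lra].
  apply Rmult_le_compat; nra.
Qed.

(** The first [m] terms are bounded by [1 / t] each, the others by [n^(-3/2)]. As the bound does not
    involve [K], one may fix [m] first, then [t], and let [K] run freely. *)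
Lemma pair_err_sum_bound (t : R) (m K : nat) : 1 <= t -> (1 <= m)%nat ->
  pair_err_sum t K <= INR m / t + 2 / sqrt (INR m).
Proof.
  intros Ht Hm.
  assert (Hit : 0 < / t) by (apply Rinv_0_lt_compat; lra).
  assert (H : ((K <= m)%nat /\ pair_err_sum t K <= INR K / t) \/
    ((m <= K)%nat /\ pair_err_sum t K <= INR m / t + 2 * (/ sqrt (INR m) - / sqrt (INR K)))).
  { induction K as [|K IH].
    - left. split; [lia|]. simpl. unfold Rdiv. lra.
    - destruct (pair_err_bounds t (S K) Ht ltac:(lia)) as (_ & _ & S1 & S2 & _).
      simpl pair_err_sum.
      destruct (Nat.le_gt_cases (S K) m) as [Hle|Hgt].
      + left. split; [assumption|]. destruct IH as [[_ I]|[I1 I2]]; [|exfalso; lia].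
        rewrite S_INR. unfold Rdiv in *. lra.
      + right. split; [lia|].
        pose proof (inv_pow32_le K ltac:(lia)) as Hp.
        destruct IH as [[I1 I2]|[I1 I2]]; [assert (K = m) by lia; subst K|]; lra. }
  assert (Hs : 0 < sqrt (INR m)) by (apply sqrt_lt_R0, lt_0_INR; lia).
  assert (0 < / sqrt (INR m)) by (apply Rinv_0_lt_compat; assumption).
  destruct H as [[H1 H2]|[H1 H2]].
  - apply le_INR in H1. assert (INR K / t <= INR m / t) by (apply Rmult_le_compat_r; lra).
    unfold Rdiv at 2. lra.
  - assert (0 < / sqrt (INR K)) by (apply Rinv_0_lt_compat, sqrt_lt_R0, lt_0_INR; lia).
    unfold Rdiv at 2. lra.
Qed.

(** Induction on [K], each step contributing the quadruple of indices [K + 1] and [- (K + 1)] for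
    both points. The [tau] telescope to the arctangent, and the relative errors combine by
    [1 + |eta| <= exp |eta|]. *)
Lemma lambert_double_product (x y : C) : x <> 0 -> y <> 0 -> exists A, 0 < A /\
  forall t K, 1 <= t -> exists H : C, Cmod H <= exp (A * pair_err_sum t K) - 1 /\
  (prod_sym K (fun k => LambertW k x - t) * prod_sym K (fun k => LambertW k y + t))%C =
  ((LambertW 0 x - t) * (LambertW 0 y + t) * RtoC (cK K * cK K * sinh_prod (2 * K) t) *
   Cexp ((Clog x - Clog y) * RtoC (- / PI * atan (2 * PI * INR K / t))) * (1 + H))%C.
Proof.
  intros Hx Hy. destruct (lambert_quadruple x y Hx Hy) as (A & HA & HQ).
  exists A. split; [assumption|]. intros t K Ht. pose proof PI_RGT_0 as HPI.
  induction K as [|K (H & HH & E)].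
  - exists (RtoC 0). split.
    + simpl. rewrite Rmult_0_r, exp_0, Cmod_0. lra.
    + rewrite !prod_sym_0. unfold cK. simpl.
      replace (2 * PI * 0 / t) with 0 by (field; lra). rewrite atan_0.
      replace (- / PI * 0) with 0 by ring. rewrite Cmult_0_r, Cexp_0.
      rewrite !Rmult_1_r. ring.
  - destruct (HQ t (S K) Ht ltac:(lia)) as (eta & Heta & E2).
    exists (H + eta + H * eta)%C. split.
    + simpl pair_err_sum. rewrite Rmult_plus_distr_l, exp_plus.
      pose proof (exp_ineq1_le (A * pair_err t (S K))) as K1.
      set (s := A * pair_err t (S K)) in *. set (e := exp (A * pair_err_sum t K)) in *.
      eapply Rle_trans; [apply Cmod_triangle|]. eapply Rle_trans; [apply Rplus_le_compat_r, Cmod_triangle|].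
      rewrite Cmod_mult. pose proof (Cmod_ge_0 H). pose proof (Cmod_ge_0 eta).
      assert ((1 + Cmod H) * (1 + Cmod eta) <= e * exp s) by (apply Rmult_le_compat; lra). lra.
    + rewrite !prod_sym_S.
      transitivity ((prod_sym K (fun k => LambertW k x - t) * prod_sym K (fun k => LambertW k y + t)) *
        ((LambertW (Z.of_nat (S K)) x - t) * (LambertW (- Z.of_nat (S K)) y + t) *
        ((LambertW (- Z.of_nat (S K)) x - t) * (LambertW (Z.of_nat (S K)) y + t))))%C; [ring|].
      rewrite E, E2. unfold ek.
      set (mu := (Clog x - Clog y)%C).
      assert (Htau : (- / PI * atan (2 * PI * INR (S K) / t)) =
        - / PI * atan (2 * PI * INR K / t) + tau t (S K)).
      { unfold tau. rewrite S_INR. replace (INR K + 1 - 1) with (INR K) by ring. ring. }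
      rewrite Htau, RtoC_plus.
      replace (mu * (RtoC (- / PI * atan (2 * PI * INR K / t)) + RtoC (tau t (S K))))%C with
        (mu * RtoC (- / PI * atan (2 * PI * INR K / t)) + mu * RtoC (tau t (S K)))%C by ring.
      rewrite Cexp_plus.
      (* Passing from [K] to [K + 1] adds the factors [(PI j)^2 + t^2] with [j = 2 K + 1] and
         [j = 2 K + 2], which make up [Dk t (S K)]. *)
      assert (HD : cK (S K) * cK (S K) * sinh_prod (2 * S K) t =
        cK K * cK K * sinh_prod (2 * K) t * Dk t (S K)).
      { replace (2 * S K)%nat with (S (S (2 * K))) by lia. cbn [sinh_prod]. rewrite cK_S.
        unfold Dk.
        replace (S (2 * K)) with (2 * K + 1)%nat by lia.
        replace (S (2 * K + 1)) with (2 * K + 2)%nat by lia.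
        replace (INR (S K)) with (INR (2 * K + 2) / 2).
        2:{ rewrite S_INR, plus_INR, mult_INR. simpl. field. }
        assert (P1 : INR (2 * K + 1) = INR (2 * K + 2) - 1).
        { rewrite !plus_INR. simpl. ring. }
        assert (P3 : 0 < INR (2 * K + 1)) by (apply lt_0_INR; lia).
        assert (P4 : 0 < INR (2 * K + 2)) by (apply lt_0_INR; lia).
        replace (2 * PI * (INR (2 * K + 2) / 2)) with (PI * INR (2 * K + 2)) by field.
        replace (PI * INR (2 * K + 2) - PI) with (PI * INR (2 * K + 1)) by (rewrite P1; ring).
        set (p := INR (2 * K + 1)) in *. set (p' := INR (2 * K + 2)) in *.
        field. repeat split; lra. }
      rewrite HD, (RtoC_mult _ (Dk t (S K))). ring.
Qed.

(** * The limit of the product of the branches *)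

Definition Clim (u : nat -> C) (l : C) : Prop :=
  forall eps, 0 < eps -> exists N, forall n, (N <= n)%nat -> Cmod (u n - l) < eps.

Lemma Clim_ext (u v : nat -> C) (l : C) (N0 : nat) :
  (forall n, (N0 <= n)%nat -> u n = v n) -> Clim u l -> Clim v l.
Proof.
  intros E H eps He. destruct (H eps He) as [N HN]. exists (Nat.max N0 N). intros n Hn.
  rewrite <- E by lia. apply HN; lia.
Qed.

Lemma Clim_eq (u : nat -> C) (l m : C) : Clim u l -> l = m -> Clim u m.
Proof. intros H <-; exact H. Qed.

Lemma Clim_const (c : C) : Clim (fun _ => c) c.
Proof.
  intros eps He. exists 0%nat. intros n _. replace (c - c)%C with (RtoC 0) by ring.
  rewrite Cmod_0; assumption.
Qed.

Lemma Clim_plus (u v : nat -> C) (l m : C) :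
  Clim u l -> Clim v m -> Clim (fun n => u n + v n)%C (l + m)%C.
Proof.
  intros Hu Hv eps He. destruct (Hu (eps / 2) ltac:(lra)) as [N1 H1].
  destruct (Hv (eps / 2) ltac:(lra)) as [N2 H2]. exists (Nat.max N1 N2). intros n Hn.
  specialize (H1 n ltac:(lia)). specialize (H2 n ltac:(lia)).
  replace (u n + v n - (l + m))%C with ((u n - l) + (v n - m))%C by ring.
  eapply Rle_lt_trans; [apply Cmod_triangle|lra].
Qed.

Lemma Clim_mult (u v : nat -> C) (l m : C) :
  Clim u l -> Clim v m -> Clim (fun n => u n * v n)%C (l * m)%C.
Proof.
  intros Hu Hv eps He.
  pose proof (Cmod_ge_0 l) as Hl. pose proof (Cmod_ge_0 m) as Hm.
  set (B := Cmod l + Cmod m + 1). assert (HB : 0 < B) by (unfold B; lra).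
  assert (Hd : 0 < Rmin 1 (eps / (2 * B))).
  { apply Rmin_glb_lt; [lra|apply Rdiv_lt_0_compat; lra]. }
  destruct (Hu _ Hd) as [N1 H1]. destruct (Hv _ Hd) as [N2 H2].
  exists (Nat.max N1 N2). intros n Hn. specialize (H1 n ltac:(lia)). specialize (H2 n ltac:(lia)).
  pose proof (Rmin_l 1 (eps / (2 * B))). pose proof (Rmin_r 1 (eps / (2 * B))).
  set (d := Rmin 1 (eps / (2 * B))) in *.
  replace (u n * v n - l * m)%C with ((u n - l) * (v n - m) + ((u n - l) * m + l * (v n - m)))%C by ring.
  eapply Rle_lt_trans; [apply Cmod_triangle|].
  eapply Rle_lt_trans; [apply Rplus_le_compat_l, Cmod_triangle|].
  rewrite !Cmod_mult.
  pose proof (Cmod_ge_0 (u n - l)). pose proof (Cmod_ge_0 (v n - m)).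
  assert (A1 : Cmod (u n - l) * Cmod (v n - m) <= d * 1) by (apply Rmult_le_compat; lra).
  assert (A2 : Cmod (u n - l) * Cmod m <= d * Cmod m) by (apply Rmult_le_compat_r; lra).
  assert (A3 : Cmod l * Cmod (v n - m) <= Cmod l * d) by (apply Rmult_le_compat_l; lra).
  assert (A4 : d * B <= eps / (2 * B) * B) by (apply Rmult_le_compat_r; lra).
  replace (eps / (2 * B) * B) with (eps / 2) in A4 by (field; lra).
  unfold B in A4. lra.
Qed.

Lemma Clim_inv (u : nat -> C) (l : C) : l <> 0 -> Clim u l -> Clim (fun n => / u n)%C (/ l)%C.
Proof.
  intros Hl0 Hu eps He. pose proof (Cmod_pos l Hl0) as Hl. set (a := Cmod l) in *.
  assert (Hd : 0 < Rmin (a / 2) (eps * (a * a / 2))).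
  { apply Rmin_glb_lt; [lra|]. apply Rmult_lt_0_compat; [assumption|nra]. }
  destruct (Hu _ Hd) as [N HN]. exists N. intros n Hn. specialize (HN n Hn).
  pose proof (Rmin_l (a / 2) (eps * (a * a / 2))). pose proof (Rmin_r (a / 2) (eps * (a * a / 2))).
  pose proof (Cmod_triangle_sub l (l - u n)) as T. fold a in T.
  replace (l - (l - u n))%C with (u n) in T by ring. rewrite (Cmod_minus_sym l (u n)) in T.
  assert (Hun : a / 2 < Cmod (u n)) by lra.
  assert (Hn0 : u n <> 0) by (apply Cmod_neq; lra).
  replace (/ u n - / l)%C with (- (u n - l) / (u n * l))%C by (field; auto).
  rewrite Cmod_div, Cmod_opp, Cmod_mult by (apply Cmult_neq_0; assumption). fold a.
  apply Rmult_lt_reg_r with (Cmod (u n) * a); [apply Rmult_lt_0_compat; lra|].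
  replace (Cmod (u n - l) / (Cmod (u n) * a) * (Cmod (u n) * a)) with (Cmod (u n - l)) by (field; lra).
  assert (eps * (a * a / 2) <= eps * (Cmod (u n) * a)); [|lra].
  apply Rmult_le_compat_l; [lra|]. nra.
Qed.

Lemma Clim_div (u v : nat -> C) (l m : C) : m <> 0 ->
  Clim u l -> Clim v m -> Clim (fun n => u n / v n)%C (l / m)%C.
Proof. intros Hm Hu Hv. apply Clim_mult; [assumption|apply Clim_inv; assumption]. Qed.

Lemma Clim_filterlim (u : nat -> C) (l : C) :
  Clim u l -> filterlim u eventually (@locally C_UniformSpace l).
Proof.
  intros H. apply filterlim_locally. intros eps.
  destruct (H eps (cond_pos eps)) as [N HN]. exists N. intros n Hn. specialize (HN n Hn).
  split.
  - apply Rle_lt_trans with (Cmod (u n - l)); [exact (re_le_Cmod (u n - l))|assumption].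
  - apply Rle_lt_trans with (Cmod (u n - l)); [exact (Im_le_Cmod (u n - l))|assumption].
Qed.

Lemma Clim_small (f : nat -> R) (c : R) :
  (forall n, (1 <= n)%nat -> Rabs (f n) <= c / INR n) -> Clim (fun n => RtoC (f n)) 0.
Proof.
  intros H eps He. destruct (INR_unbounded (Rabs c / eps + 1)) as [N HN].
  assert (Hc : 0 <= Rabs c / eps).
  { apply Rmult_le_pos; [apply Rabs_pos|left; apply Rinv_0_lt_compat; lra]. }
  exists (Nat.max 1 N). intros n Hn.
  assert (Hn1 : Rabs c / eps + 1 < INR n) by (eapply Rlt_le_trans; [exact HN|apply le_INR; lia]).
  replace (RtoC (f n) - 0)%C with (RtoC (f n)) by ring. rewrite Cmod_R.
  eapply Rle_lt_trans; [apply H; lia|].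
  apply Rmult_lt_reg_r with (INR n); [lra|].
  replace (c / INR n * INR n) with c by (field; lra).
  pose proof (Rle_abs c).
  assert (Rabs c = eps * (Rabs c / eps)) by (field; lra). nra.
Qed.

(** * The value at fixed t and its limit for large t *)

Lemma exp_neg_small (n : nat) : (1 <= n)%nat ->
  INR n * exp (- INR n) <= 4 / INR n /\ exp (- INR n) <= 4 / INR n.
Proof.
  intros Hn. assert (HN : 1 <= INR n) by (apply (le_INR 1); assumption).
  set (N := INR n) in *. pose proof (exp_ge_sqr N ltac:(lra)) as H.
  rewrite exp_Ropp. pose proof (exp_pos N) as Hp.
  assert (Hi : / exp N <= 4 / (N * N)).
  { replace (4 / (N * N)) with (/ (N * N / 4)) by (field; lra). apply Rinv_le_contravar; nra. }
  assert (Hi0 : 0 < / exp N) by (apply Rinv_0_lt_compat; assumption).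
  assert (A : N * / exp N <= 4 / N).
  { apply Rle_trans with (N * (4 / (N * N))); [apply Rmult_le_compat_l; lra|right; field; lra]. }
  split; [assumption|]. nra.
Qed.

Definition Acst (x : C) (K : nat) : C := (prod_sym K (fun k => LambertW k x) / RtoC (cK K))%C.

(** Since [x = exp (log x)], this is [exp ((log x + log y) / 2) / 2], symmetric in the two
    points. *)
Definition limval (x y : C) : C := (x / 2 * Cexp ((Clog x - Clog y) * RtoC (- / 2)))%C.

(** Obtained from [lambert_double_product] by dropping [1 + H], dividing by the products over
    [1 - t / W_k(x)] and [1 + t / W_k(y)], and letting [K] tend to infinity. *)
Definition fixed_t_value (x y : C) (t : R) : C :=
  ((LambertW 0 x - t) * (LambertW 0 y + t) * RtoC ((exp t - exp (- t)) / (2 * t)) *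
   Cexp ((Clog x - Clog y) * RtoC (- / 2)) / (gW x t * gW y (- t)))%C.

Lemma gW_large (x : C) (t : R) : x <> 0 -> 0 < t ->
  gW x t = (- (t / x) * RtoC (exp (t / 2)) * (1 - x * RtoC (/ t * exp (- t))))%C.
Proof.
  intros Hx Ht. unfold gW. assert (RtoC t <> 0) by (apply RtoC_neq_0; lra).
  assert (E : (t / 2)%C = RtoC (t / 2)) by (rewrite RtoC_div by lra; reflexivity).
  replace (- t / 2)%C with (- (t / 2))%C by field.
  rewrite E, <- RtoC_opp, !Cexp_RtoC.
  rewrite  RtoC_mult, RtoC_inv by lra.
  replace (exp (- (t / 2))) with (exp (t / 2) * exp (- t)) by (rewrite <- exp_plus; f_equal; field).
  rewrite RtoC_mult. field. auto.
Qed.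

Lemma gW_large_neg (y : C) (t : R) : y <> 0 -> 0 < t ->
  gW y (- t) = (RtoC (exp (t / 2)) * (1 + / y * RtoC (t * exp (- t))))%C.
Proof.
  intros Hy Ht. unfold gW.
  assert (E : (t / 2)%C = RtoC (t / 2)) by (rewrite RtoC_div by lra; reflexivity).
  replace (- - t / 2)%C with (t / 2)%C by field.
  replace (- t / 2)%C with (- (t / 2))%C by field.
  rewrite E, <- !RtoC_opp, !Cexp_RtoC, RtoC_mult.
  replace (exp (- (t / 2))) with (exp (t / 2) * exp (- t)) by (rewrite <- exp_plus; f_equal; field).
  rewrite RtoC_mult, RtoC_opp. field. auto.
Qed.

(** The linear factors behave like [- t^2], the quotient of [sinh t] by [t] like [e^t / (2 t)], and
    the denominator like [- (t / x) e^t]; this leaves [x / 2] times the constant exponential. *)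
Lemma fixed_t_value_lim (x y : C) : x <> 0 -> y <> 0 ->
  Clim (fun n => fixed_t_value x y (INR n)) (limval x y) /\
  exists n0, forall n, (n0 <= n)%nat -> (gW x (INR n) * gW y (- INR n))%C <> 0.
Proof.
  intros Hx Hy.
  assert (HN : forall n, (1 <= n)%nat -> 1 <= INR n) by (intros n Hn; apply (le_INR 1); assumption).
  assert (L1 : Clim (fun n => RtoC (/ INR n)) 0).
  { apply (Clim_small _ 1). intros n Hn. specialize (HN n Hn).
    rewrite Rabs_pos_eq; [lra|left; apply Rinv_0_lt_compat; lra]. }
  assert (L2 : Clim (fun n => RtoC (INR n * exp (- INR n))) 0).
  { apply (Clim_small _ 4). intros n Hn. specialize (HN n Hn). pose proof (exp_pos (- INR n)).
    rewrite Rabs_pos_eq by nra. apply exp_neg_small; assumption. }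
  assert (L3 : Clim (fun n => RtoC (/ INR n * exp (- INR n))) 0).
  { apply (Clim_small _ 4). intros n Hn. specialize (HN n Hn). pose proof (exp_pos (- INR n)).
    assert (0 < / INR n <= 1).
    { split; [apply Rinv_0_lt_compat; lra|]. rewrite <- Rinv_1. apply Rinv_le_contravar; lra. }
    rewrite Rabs_pos_eq by nra. pose proof (proj2 (exp_neg_small n Hn)). nra. }
  assert (L4 : Clim (fun n => RtoC (exp (- INR n) * exp (- INR n))) 0).
  { apply (Clim_small _ 4). intros n Hn. specialize (HN n Hn). pose proof (exp_pos (- INR n)).
    assert (exp (- INR n) < 1) by (rewrite <- exp_0; apply exp_increasing; lra).
    rewrite Rabs_pos_eq by nra. pose proof (proj2 (exp_neg_small n Hn)). nra. }
  assert (M : forall (c d : C) (u : nat -> C), Clim u 0 -> Clim (fun n => c + d * u n)%C c).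
  { intros c d u Hu. apply (Clim_eq _ (c + d * 0)%C); [|ring].
    apply Clim_plus; [apply Clim_const|]. apply Clim_mult; [apply Clim_const|assumption]. }
  set (X := fun n => (1 + - x * RtoC (/ INR n * exp (- INR n)))%C).
  set (Y := fun n => (1 + / y * RtoC (INR n * exp (- INR n)))%C).
  assert (HX : Clim X 1) by (apply M; assumption).
  assert (HY : Clim Y 1) by (apply M; assumption).
  assert (Hnz : exists n0, forall n, (n0 <= n)%nat -> X n <> 0 /\ Y n <> 0).
  { destruct (HX 1 Rlt_0_1) as [N1 H1]. destruct (HY 1 Rlt_0_1) as [N2 H2].
    exists (Nat.max N1 N2). intros n Hn. specialize (H1 n ltac:(lia)). specialize (H2 n ltac:(lia)).
    assert (K : forall z : C, Cmod (z - 1) < 1 -> z <> 0).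
    { intros z Hz ->. replace (0 - 1)%C with (- (1))%C in Hz by ring. rewrite Cmod_opp, Cmod_1 in Hz. lra. }
    split; apply K; assumption. }
  destruct Hnz as [n0 Hnz].
  set (mu := (Clog x - Clog y)%C).
  assert (EX : forall n, (1 <= n)%nat -> gW x (INR n) =
    (- (INR n / x) * RtoC (exp (INR n / 2)) * X n)%C).
  { intros n Hn. specialize (HN n Hn). rewrite gW_large by (assumption || lra). unfold X. ring. }
  assert (EY : forall n, (1 <= n)%nat -> gW y (- INR n) = (RtoC (exp (INR n / 2)) * Y n)%C).
  { intros n Hn. specialize (HN n Hn). rewrite gW_large_neg by (assumption || lra). unfold Y. ring. }
  assert (Hexp : forall r, RtoC (exp r) <> 0).
  { intros r. apply RtoC_neq_0. pose proof (exp_pos r). lra. }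
  assert (HNc : forall n, (1 <= n)%nat -> RtoC (INR n) <> 0).
  { intros n Hn. apply RtoC_neq_0. specialize (HN n Hn). lra. }
  split.
  - apply (Clim_ext (fun n => x / 2 * Cexp (mu * RtoC (- / 2)) *
      ((1 + - LambertW 0 x * RtoC (/ INR n)) * (1 + LambertW 0 y * RtoC (/ INR n)) *
       (1 + - (1) * RtoC (exp (- INR n) * exp (- INR n))) / (X n * Y n)))%C _ _ (Nat.max 1 n0)).
    + intros n Hn. destruct (Hnz n ltac:(lia)) as [HXn HYn].
      specialize (HN n ltac:(lia)). specialize (HNc n ltac:(lia)).
      unfold fixed_t_value. rewrite EX, EY by lia. fold mu.
      assert (E3 : exp (INR n) - exp (- INR n) =
        exp (INR n / 2) * exp (INR n / 2) * (1 - exp (- INR n) * exp (- INR n))).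
      { replace (exp (INR n / 2) * exp (INR n / 2)) with (exp (INR n)) by (rewrite <- exp_plus; f_equal; field).
        assert (exp (INR n) * exp (- INR n) = 1) by (rewrite <- exp_plus, <- exp_0; f_equal; ring).
        replace (exp (INR n) * (1 - exp (- INR n) * exp (- INR n)))
          with (exp (INR n) - exp (INR n) * exp (- INR n) * exp (- INR n)) by ring.
        rewrite H. ring. }
      rewrite E3. rewrite RtoC_div by lra.
      rewrite !RtoC_mult, RtoC_minus, !RtoC_mult, RtoC_inv by lra.
      field. repeat split; auto.
    + unfold limval. fold mu.
      apply (Clim_eq _ (x / 2 * Cexp (mu * RtoC (- / 2)) * (1 * 1 * 1 / (1 * 1)))%C); [|field].
      apply Clim_mult; [apply Clim_const|].
      apply Clim_div; [rewrite Cmult_1_l; exact C1_nz| |apply Clim_mult; assumption].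
      apply Clim_mult; [apply Clim_mult|]; apply M; assumption.
  - exists (Nat.max 1 n0). intros n Hn. destruct (Hnz n ltac:(lia)) as [HXn HYn].
    specialize (HNc n ltac:(lia)).
    rewrite EX, EY by lia. repeat apply Cmult_neq_0; try assumption; try apply Hexp.
    intros E. apply HNc. replace (RtoC (INR n)) with (- x * - (INR n / x))%C by (field; assumption).
    rewrite E. ring.
Qed.

Lemma atan_ratio_lim (t eps : R) : 0 < t -> 0 < eps -> exists N, forall K, (N <= K)%nat ->
  Rabs (- / PI * atan (2 * PI * INR K / t) - - / 2) < eps.
Proof.
  intros Ht He. pose proof PI_RGT_0 as HPI. pose proof PI2_1 as HP1.
  set (d := Rmin 1 eps). assert (Hd : 0 < d) by (apply Rmin_glb_lt; lra).
  assert (Hd1 : d <= 1) by apply Rmin_l. assert (Hde : d <= eps) by apply Rmin_r.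
  set (b := tan (PI / 2 - d)).
  destruct (INR_unbounded (Rabs b * t)) as [N HN]. exists N. intros K HK.
  assert (HKr : Rabs b * t < INR K) by (eapply Rlt_le_trans; [exact HN|apply le_INR; assumption]).
  assert (Hlt : b < 2 * PI * INR K / t).
  { apply Rmult_lt_reg_r with t; [assumption|].
    replace (2 * PI * INR K / t * t) with (2 * PI * INR K) by (field; lra).
    pose proof (Rle_abs b). pose proof (pos_INR K). nra. }
  apply atan_increasing in Hlt. unfold b in Hlt. rewrite atan_tan in Hlt by lra.
  pose proof (atan_bound (2 * PI * INR K / t)) as Hb.
  set (a := atan (2 * PI * INR K / t)) in *.
  replace (- / PI * a - - / 2) with ((PI / 2 - a) / PI) by (field; lra).
  rewrite Rabs_pos_eq.
  - apply Rmult_lt_reg_r with PI; [assumption|].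
    replace ((PI / 2 - a) / PI * PI) with (PI / 2 - a) by (field; lra). nra.
  - apply Rmult_le_pos; [lra|left; apply Rinv_0_lt_compat; assumption].
Qed.

Lemma Clim_Cexp (u : nat -> C) (l : C) : Clim u l -> Clim (fun n => Cexp (u n)) (Cexp l).
Proof.
  intros H. apply (Clim_ext (fun n => Cexp l * Cexp (u n - l))%C _ _ 0%nat).
  - intros n _. rewrite <- Cexp_plus. f_equal. ring.
  - apply (Clim_eq _ (Cexp l * 1)%C); [|ring].
    apply Clim_mult; [apply Clim_const|].
    destruct (Cexp_quadratic 1 (Rle_refl 1)) as (M & HM & K).
    intros eps He.
    assert (Hd : 0 < Rmin 1 (eps / (M + 2))) by (apply Rmin_glb_lt; [lra|apply Rdiv_lt_0_compat; lra]).
    destruct (H _ Hd) as [N HN]. exists N. intros n Hn. specialize (HN n Hn).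
    pose proof (Rmin_l 1 (eps / (M + 2))). pose proof (Rmin_r 1 (eps / (M + 2))) as Hr.
    set (w := (u n - l)%C) in *. pose proof (Cmod_ge_0 w) as Hw.
    replace (Cexp w - 1)%C with ((Cexp w - 1 - w) + w)%C by ring.
    eapply Rle_lt_trans; [apply Cmod_triangle|].
    specialize (K w ltac:(lra)).
    assert (M * Cmod w * Cmod w <= M * Cmod w * 1) by (apply Rmult_le_compat_l; [apply Rmult_le_pos|]; lra).
    apply Rle_lt_trans with ((M + 1) * Cmod w); [lra|].
    apply Rle_lt_trans with ((M + 1) * (eps / (M + 2))); [apply Rmult_le_compat_l; lra|].
    apply Rmult_lt_reg_r with (M + 2); [lra|].
    replace ((M + 1) * (eps / (M + 2)) * (M + 2)) with ((M + 1) * eps) by (field; lra). nra.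
Qed.

Lemma prod_sym_shift (K : nat) (x T : C) : x <> 0 ->
  prod_sym K (fun k => LambertW k x - T)%C =
  (prod_sym K (fun k => LambertW k x) * prod_sym K (fun k => 1 - T / LambertW k x))%C.
Proof.
  intros Hx. rewrite <- prod_sym_mult. apply prod_sym_ext. intros k.
  field. apply LambertW_neq_0; assumption.
Qed.

Lemma lambert_product_lim (x T : C) : x <> 0 ->
  Clim (fun K => prod_sym K (fun k => 1 - T / LambertW k x)%C) (gW x T).
Proof. intros Hx eps He. apply lambert_product; assumption. Qed.

(* For fixed [t], all factors but [1 + H] converge as [K] grows, and [H] is small uniformly in [K]
   once [t] is large. *)
Lemma Acst_mult_lim (x y : C) : x <> 0 -> y <> 0 ->
  Clim (fun K => Acst x K * Acst y K)%C (limval x y).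
Proof.
  intros Hx Hy eps He. set (V := limval x y).
  destruct (lambert_double_product x y Hx Hy) as (A & HA & HP).
  destruct (fixed_t_value_lim x y Hx Hy) as [HV [n0 Hn0]].
  pose proof (Cmod_ge_0 V) as HV0.
  set (e1 := Rmin 1 (eps / 4)). assert (He1 : 0 < e1) by (apply Rmin_glb_lt; lra).
  assert (He11 : e1 <= 1) by apply Rmin_l. assert (He14 : e1 <= eps / 4) by apply Rmin_r.
  destruct (HV e1 He1) as [n1 Hn1].
  set (del := Rmin 1 (eps / (4 * (Cmod V + 3)))).
  assert (Hdel : 0 < del) by (apply Rmin_glb_lt; [lra|apply Rdiv_lt_0_compat; lra]).
  (* Choose [t = n] so that the accumulated error [exp (A * sum) - 1] is at most [del]. *)
  set (ls := ln (1 + del) / A).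
  assert (Hls : 0 < ls).
  { apply Rdiv_lt_0_compat; [|assumption]. rewrite <- ln_1. apply ln_increasing; lra. }
  (* This choice makes the tail [2 / sqrt m] at most [ls / 2]; the later choice of [t] does the same
     for [m / t]. *)
  destruct (INR_unbounded (16 / (ls * ls) + 1)) as [m Hm].
  assert (Hq : 0 < 16 / (ls * ls)) by (apply Rdiv_lt_0_compat; [lra|apply Rmult_lt_0_compat; assumption]).
  assert (Hm1 : (1 <= m)%nat).
  { apply INR_le. change (INR 1) with 1. lra. }
  assert (Hsm : 2 / sqrt (INR m) <= ls / 2).
  { assert (Hs : 4 / ls <= sqrt (INR m)).
    { apply Rsqr_incr_0_var; [|apply sqrt_pos]. rewrite Rsqr_sqrt by lra. unfold Rsqr.
      replace (4 / ls * (4 / ls)) with (16 / (ls * ls)) by (field; lra). lra. }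
    assert (H4 : 0 < 4 / ls) by (apply Rdiv_lt_0_compat; lra).
    apply Rmult_le_reg_r with (sqrt (INR m)); [lra|].
    replace (2 / sqrt (INR m) * sqrt (INR m)) with 2 by (field; lra).
    apply Rle_trans with (ls / 2 * (4 / ls)); [right; field; lra|]. apply Rmult_le_compat_l; lra. }
  destruct (INR_unbounded (2 * INR m / ls)) as [n2 Hn2].
  set (n := Nat.max 1 (Nat.max n0 (Nat.max n1 n2))).
  set (t := INR n).
  assert (Ht : 1 <= t) by (apply (le_INR 1); lia).
  assert (Hmt : INR m / t <= ls / 2).
  { assert (2 * INR m / ls < t) by (eapply Rlt_le_trans; [exact Hn2|apply le_INR; lia]).
    apply Rmult_le_reg_r with t; [lra|].
    replace (INR m / t * t) with (INR m) by (field; lra).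
    apply Rle_trans with (ls / 2 * (2 * INR m / ls)); [right; field; lra|]. apply Rmult_le_compat_l; lra. }
  specialize (Hn1 n ltac:(lia)). specialize (Hn0 n ltac:(lia)). fold t in Hn1, Hn0. fold V in Hn1.
  set (G := (gW x t * gW y (- t))%C) in *.
  set (mu := (Clog x - Clog y)%C).
  set (P := fun K => (prod_sym K (fun k => 1 - t / LambertW k x) *
    prod_sym K (fun k => 1 - (- t) / LambertW k y))%C).
  assert (HPlim : Clim P G) by (apply Clim_mult; apply lambert_product_lim; assumption).
  set (B := fun K => ((LambertW 0 x - t) * (LambertW 0 y + t) * RtoC (sinh_prod (2 * K) t) *
    Cexp (mu * RtoC (- / PI * atan (2 * PI * INR K / t))))%C).
  assert (HBlim : Clim (fun K => B K / P K)%C (fixed_t_value x y t)).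
  { apply Clim_div; try assumption. fold mu. apply Clim_mult; [apply Clim_mult; [apply Clim_const|]|].
    - intros e Hee. destruct (sinh_prod_lim t e ltac:(lra) Hee) as [N HN]. exists N.
      intros K HK. rewrite <- RtoC_minus, Cmod_R. apply HN. lia.
    - apply Clim_Cexp. apply Clim_mult; [apply Clim_const|].
      intros e Hee. destruct (atan_ratio_lim t e ltac:(lra) Hee) as [N HN]. exists N.
      intros K HK. rewrite <- RtoC_minus, Cmod_R. apply HN. assumption. }
  destruct (HBlim e1 He1) as [N1 HN1].
  pose proof (Cmod_pos G Hn0) as HG.
  destruct (HPlim (Cmod G) HG) as [N2 HN2].
  exists (Nat.max N1 N2). intros K HK. specialize (HN1 K ltac:(lia)). specialize (HN2 K ltac:(lia)).
  assert (HPK : P K <> 0).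
  { intros E. rewrite E in HN2. replace (0 - G)%C with (- G)%C in HN2 by ring.
    rewrite Cmod_opp in HN2. lra. }
  destruct (HP t K Ht) as (H & HH & E).
  assert (HHd : Cmod H <= del).
  { eapply Rle_trans; [exact HH|].
    assert (A * pair_err_sum t K <= ln (1 + del)).
    { pose proof (pair_err_sum_bound t m K Ht Hm1).
      apply Rle_trans with (A * ls); [apply Rmult_le_compat_l; lra|]. right. unfold ls. field. lra. }
    assert (exp (A * pair_err_sum t K) <= 1 + del); [|lra].
    rewrite <- (exp_ln (1 + del)) by lra.
    destruct H0 as [H0|H0]; [left; apply exp_increasing; assumption|rewrite H0; lra]. }
  pose proof (cK_pos K) as HcK. assert (HcKc : RtoC (cK K) <> 0) by (apply RtoC_neq_0; lra).
  assert (EQ : (Acst x K * Acst y K)%C = (B K / P K * (1 + H))%C).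
  { assert (E2 : (prod_sym K (fun k => LambertW k x) * prod_sym K (fun k => LambertW k y) * P K)%C =
      (RtoC (cK K) * RtoC (cK K) * B K * (1 + H))%C).
    { transitivity (prod_sym K (fun k => LambertW k x - t) * prod_sym K (fun k => LambertW k y + t))%C.
      - rewrite (prod_sym_ext K (fun k => LambertW k y + t)%C (fun k => LambertW k y - - t)%C)
          by (intros k; ring).
        rewrite !prod_sym_shift by assumption. unfold P. ring.
      - rewrite E. unfold B, mu. rewrite !RtoC_mult. ring. }
    unfold Acst.
    transitivity (prod_sym K (fun k => LambertW k x) * prod_sym K (fun k => LambertW k y) * P K
      / (RtoC (cK K) * RtoC (cK K) * P K))%C; [field; auto|].
    rewrite E2. field. auto. }
  rewrite EQ. set (Q := (B K / P K)%C) in *.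
  replace (Q * (1 + H) - V)%C with ((Q - fixed_t_value x y t) + (fixed_t_value x y t - V) + Q * H)%C by ring.
  eapply Rle_lt_trans; [apply Cmod_triangle|].
  eapply Rle_lt_trans; [apply Rplus_le_compat_r, Cmod_triangle|].
  rewrite Cmod_mult.
  assert (HQ : Cmod Q <= Cmod V + 2).
  { replace Q with ((Q - fixed_t_value x y t) + (fixed_t_value x y t - V) + V)%C by ring.
    eapply Rle_trans; [apply Cmod_triangle|]. eapply Rle_trans; [apply Rplus_le_compat_r, Cmod_triangle|]. lra. }
  assert (HQH : Cmod Q * Cmod H <= (Cmod V + 3) * (eps / (4 * (Cmod V + 3)))).
  { apply Rmult_le_compat; try apply Cmod_ge_0; [lra|].
    eapply Rle_trans; [exact HHd|apply Rmin_r]. }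
  replace ((Cmod V + 3) * (eps / (4 * (Cmod V + 3)))) with (eps / 4) in HQH by (field; lra).
  lra.
Qed.

(** At the positive point 2, [W_0] is positive and the factors of index [k] and [- k] are
    conjugate. *)
Lemma prod_sym_2_pos (K : nat) : exists a, 0 < a /\ prod_sym K (fun k => LambertW k (RtoC 2)) = RtoC a.
Proof.
  induction K as [|K (a & Ha & E)].
  - destruct (LambertW_0_pos 2 ltac:(lra)) as (a & Ha & E). exists a. rewrite prod_sym_0. auto.
  - set (w := LambertW (Z.of_nat (S K)) (RtoC 2)).
    assert (Hw : w <> 0) by (apply LambertW_neq_0, C2_neq_0).
    exists (Cmod w * Cmod w * a). split.
    + pose proof (Cmod_pos w Hw). repeat apply Rmult_lt_0_compat; assumption.
    + rewrite prod_sym_S, E, LambertW_conj by lra. fold w.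
      rewrite RtoC_mult, Cmod_sqr. apply C_ext; reim; ring.
Qed.

(** The squares tend to 1, and [|p - 1| <= |p^2 - 1|] for [p > 0], so positivity fixes the sign of
    the limit. *)
Lemma Acst_2_lim : Clim (Acst (RtoC 2)) 1.
Proof.
  intros eps He. destruct (Acst_mult_lim (RtoC 2) (RtoC 2) C2_neq_0 C2_neq_0 eps He) as [N HN].
  exists N. intros K HK. specialize (HN K HK).
  destruct (prod_sym_2_pos K) as (a & Ha & E). pose proof (cK_pos K) as Hc.
  assert (EA : Acst (RtoC 2) K = RtoC (a / cK K)).
  { unfold Acst. rewrite E, RtoC_div by lra. reflexivity. }
  assert (EV : limval (RtoC 2) (RtoC 2) = 1).
  { unfold limval. replace ((Clog (RtoC 2) - Clog (RtoC 2)) * RtoC (- / 2))%C with (RtoC 0) by ring.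
    rewrite Cexp_0. field. }
  rewrite EA, EV, <- RtoC_mult, <- RtoC_minus, Cmod_R in HN.
  rewrite EA, <- RtoC_minus, Cmod_R.
  set (p := a / cK K) in *. assert (Hp : 0 < p) by (apply Rdiv_lt_0_compat; assumption).
  eapply Rle_lt_trans; [|exact HN].
  replace (p * p - 1) with ((p - 1) * (p + 1)) by ring.
  rewrite Rabs_mult, (Rabs_pos_eq (p + 1)) by lra. pose proof (Rabs_pos (p - 1)). nra.
Qed.

(** Division by the positive number 2 does not change the argument, so
    [Clog (x / 2) = Clog x - Clog 2] without correction; then [x / 2], the exponential of this
    logarithm, loses half of the exponent. *)
Lemma limval_2 (x : C) : x <> 0 -> limval x (RtoC 2) = Csqrt (x / 2).
Proof.
  intros Hx. unfold limval, Csqrt.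
  assert (Hlog : Clog (x / 2) = (Clog x - Clog (RtoC 2))%C).
  { rewrite <- (Clog_Cexp (Clog x - Clog (RtoC 2))).
    - f_equal. replace (Clog x - Clog (RtoC 2))%C with (Clog x + - Clog (RtoC 2))%C by ring.
      rewrite Cexp_plus, Cexp_opp, !Cexp_Clog by (assumption || apply C2_neq_0). reflexivity.
    - rewrite Clog_RtoC by lra. reim. rewrite Rminus_0_r. apply Carg_bound; assumption. }
  set (lam := (Clog x - Clog (RtoC 2))%C) in *.
  assert (Hx2 : (x / 2)%C <> 0).
  { intros E. apply Hx. replace x with (x / 2 * 2)%C by field. rewrite E. ring. }
  rewrite <- (Cexp_Clog (x / 2)) at 1 by assumption.
  rewrite Hlog, <- Cexp_plus. f_equal.
  rewrite RtoC_opp, RtoC_inv by lra. field.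
Qed.

Lemma Acst_lim (x : C) : x <> 0 -> Clim (Acst x) (Csqrt (x / 2)).
Proof.
  intros Hx. pose proof (Acst_mult_lim x (RtoC 2) Hx C2_neq_0) as H.
  rewrite limval_2 in H by assumption.
  apply (Clim_eq _ (Csqrt (x / 2) / 1)%C); [|field].
  apply (Clim_ext (fun K => Acst x K * Acst (RtoC 2) K / Acst (RtoC 2) K)%C _ _ 0%nat).
  - intros K _. field. unfold Acst. destruct (prod_sym_2_pos K) as (a & Ha & ->).
    pose proof (cK_pos K). rewrite <- RtoC_div by lra. apply RtoC_neq_0.
    assert (0 < a / cK K) by (apply Rdiv_lt_0_compat; assumption). lra.
  - apply Clim_div; [exact C1_nz|exact H|exact Acst_2_lim].
Qed.

Theorem corollary3p4 (x : C) (hx : x <> 0) :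
  filterlim
    (fun K : nat =>
       (prod_sym K (fun k => LambertW k x)
          / (PI ^ (2 * K) * INR (fact (2 * K)))%R)%C)
    eventually
    (@locally C_UniformSpace (Csqrt (x / 2)%C))
  /\
  forall t : C,
    filterlim
      (fun K : nat =>
         (prod_sym K (fun k => LambertW k x - t)
            / (PI ^ (2 * K) * INR (fact (2 * K)))%R)%C)
      eventually
      (@locally C_UniformSpace
         (Csqrt (x / 2) * (Cexp (- t / 2) - t / x * Cexp (t / 2)))%C).
Proof.
  split.
  - apply Clim_filterlim. exact (Acst_lim x hx).
  - intros t. apply Clim_filterlim. fold (gW x t).
    apply (Clim_ext (fun K => Acst x K * prod_sym K (fun k => 1 - t / LambertW k x))%C _ _ 0%nat).
    + intros K _. rewrite prod_sym_shift by assumption. unfold Acst, cK, Cdiv. ring.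
    + apply Clim_mult; [apply Acst_lim|apply lambert_product_lim]; assumption.
Qed.
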